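(* Let $\phi$ and $\psi$ be Ramanujan's mock theta functions (defined in the context), and let $E_n$ denote the Euler numbers. Then the following hold. 1. Let $k,l\in\mathbb{N}$. If $\gcd(l,2k+1)=1$, then $\phi\!\left(e^{-t}\zeta_{2k+1}^{\,l}\right)$ has an asymptotic expansion in nonnegative integer powers of $t$ as $t\to 0^+$; if $\gcd(l,4k)=1$, then $\psi\!\left(e^{-t}\zeta_{4k}^{\,l}\right)$ has an asymptotic expansion in nonnegative integer powers of $t$ as $t\to 0^+$. In particular, $$\phi\left(e^{-t}\right)\sim\sum_{n=0}^\infty \frac{a_n}{n!}t^n\qquad (t\to 0^+),$$ where $$a_n=\sum_{a+2b+c=n}\frac{n!}{a!\,(2b)!\,c!}\left(\tfrac32\right)^a\left(\tfrac52\right)^{2b}E_{2a+2b}+\sum_{a+2b=n}\frac{n!}{a!\,(2b)!}\left(\tfrac32\right)^a\left(\tfrac12\right)^{2b}E_{2a+2b},$$ the sums being over $a,b,c\in\mathbb{N}_0$. 2. For $k,l\in\mathbb{N}$, put $q=e^{-\alpha}$, $q_1=e^{-\pi^2/\alpha}$, $q^{-1/24}:=e^{\alpha/24}$, $q_1^{-1/24}:=e^{\pi^2/(24\alpha)}$. If $\gcd(l,2k+1)=1$ and $\alpha=-\frac{2\pi i l}{2k+1}$, then $$q^{-\frac1{24}}\phi(q)=\sqrt{\frac{4\pi}{\alpha}}\,q_1^{-\frac1{24}}\psi(q_1)+\sqrt{\frac{2\pi}{3\alpha}}\int_0^\infty e^{-\frac{\pi^2u^2}{6\alpha}}\,\frac{\cosh\frac{5\pi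 u}{6}+\cosh\frac{\pi u}{6}}{\cosh \pi u}\,du .$$ If $\gcd(l,4k)=1$ and $\alpha=-\frac{2\pi i l}{4k}$, then $$q^{-\frac1{24}}\psi(q)=\sqrt{\frac{\pi}{4\alpha}}\,q_1^{-\frac1{24}}\phi(q_1)-\sqrt{\frac{\pi}{6\alpha}}\int_0^\infty e^{-\frac{\pi^2u^2}{6\alpha}}\,\frac{\cosh\frac{5\pi u}{6}+\cosh\frac{\pi u}{6}}{\cosh \pi u}\,du .$$ 3. As $\mathbb{N}\ni k\to\infty$, $$\zeta_{24(2k+1)}^{-1}\,\phi\left(\zeta_{2k+1}\right)\sim\sqrt{2(2k+1)i}\;\zeta_{96}^{-23(2k+1)}+\sum_{n=0}^\infty\frac{\zeta_{24(2k+1)}^{-1}b_n+\zeta_{24(2k+1)}^{-25}c_n}{(2k+1)^n},$$ $$\zeta_{96k}^{-1}\,\psi\left(\zeta_{4k}\right)\sim\sqrt{2ki}\;\zeta_{24}^{k}-\frac12\sum_{n=0}^\infty\frac{\zeta_{96k}^{-1}b_n+\zeta_{96k}^{-25}c_n}{(4k)^n},$$ where $$b_n=\pi^n\sum_{a+2b=n}\frac{(-1)^{a+b}(3i)^a}{a!\,(2b)!}E_{2a+2b},\qquad c_n=\pi^n\sum_{a+2b=n}\frac{(-1)^{a+b}(3i)^a5^{2b}}{a!\,(2b)!}E_{2a+2b},$$ the sums being over $a,b\in\mathbb{N}_0$.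
   Context: For $n\in\mathbb{N}_0$, $(a;b)_n=(1-a)(1-ab)\cdots(1-ab^{n-1})$ (empty product $=1$). For $m\in\mathbb{N}$, $\zeta_m=e^{2\pi i/m}$ and $\zeta_m^{x}:=e^{2\pi i x/m}$ for any real $x$. Ramanujan's mock theta functions are, for $|q|<1$, $$\phi(q)=\sum_{n\ge0}\frac{q^{n^2}}{(-q^2;q^2)_n}=1+\sum_{n\ge0}(-1)^nq^{2n+1}(q;q^2)_n,\qquad \psi(q)=\sum_{n\ge1}\frac{q^{n^2}}{(q;q^2)_n}=\sum_{n\ge0}q^{n+1}(-q^2;q^2)_n .$$ At roots of unity they are defined by the second expressions, which become finite sums: $\phi(q)=1+\sum_{n\ge0}(-1)^nq^{2n+1}(q;q^2)_n$ for $q$ a root of unity of odd order (including $q=1$), and $\psi(q)=\sum_{n\ge0}q^{n+1}(-q^2;q^2)_n$ for roots of unity $q$ with $q^{2j}=-1$ for some $j\ge1$ (e.g. primitive $4m$-th roots of unity). The Euler numbers $E_n$ are defined by $\frac{1}{\cosh x}=\sum_{n\ge0}E_n\frac{x^n}{n!}$. Square roots denote the principal branch. An asymptotic expansion $f(k)\sim A(k)+\sum_{n\ge0}d_n m^{-n}$ (with $m=2k+1$ or $4k$) means $f(k)-A(k)-\sum_{n<N}d_nm^{-n}=O(m^{-N})$ for every $N$; similarly for expansions in powers of $t$ as $t\to0^+$. *)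

(* Defs.v *)
From Stdlib Require Import Reals Lra Lia Psatz Factorial List Wf_nat.
From Coquelicot Require Import Coquelicot.
Open Scope R_scope.

Definition Cexp (z : C) : C :=
  (exp (Re z) * cos (Im z), exp (Re z) * sin (Im z)).

(* Principal branch, with cut along the negative reals, where the value is
   taken on the positive imaginary axis; see [Csqrt_sqr] and [Csqrt_principal]. *)
Definition Csqrt (z : C) : C :=
  (sqrt ((Cmod z + Re z) / 2),
   if Rle_dec 0 (Im z) then sqrt ((Cmod z - Re z) / 2)
   else - sqrt ((Cmod z - Re z) / 2)).

(* [zeta m x] is $e^{2 \pi i x / m}$. *)
Definition zeta (m : nat) (x : R) : C := Cexp (2 * PI * Ci * x / INR m)%C.

Fixpoint qpoch (a b : C) (n : nat) : C :=
  match n with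
  | O => 1%C
  | S n' => (qpoch a b n' * (1 - a * b ^ n'))%C
  end.

Definition CSeries (a : nat -> C) : C :=
  (Series (fun n => Re (a n)), Series (fun n => Im (a n))).

(* At a root of unity of odd order the terms of the second series are
   eventually zero, since [qpoch q (q ^ 2) n] is. *)
Definition phi (q : C) : C :=
  if Rlt_dec (Cmod q) 1 then
    CSeries (fun n => q ^ (n ^ 2) / qpoch (- q ^ 2) (q ^ 2) n)%C
  else
    (1 + CSeries (fun n => (-(1)) ^ n * q ^ (2 * n + 1) * qpoch q (q ^ 2) n))%C.

(* The first series is indexed from n + 1 = 1.  At a root of unity with
   q ^ (2 * j) = -1 for some j >= 1 the terms of the second one are
   eventually zero. *)
Definition psi (q : C) : C :=
  if Rlt_dec (Cmod q) 1 then
    CSeries (fun n => q ^ ((n + 1) ^ 2) / qpoch q (q ^ 2) (n + 1))%C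
  else
    CSeries (fun n => q ^ (n + 1) * qpoch (- q ^ 2) (q ^ 2) n)%C.

(* The Taylor coefficients of 1 / cosh; the generating function identity is
   [euler_number_egf]. *)
Definition euler_number (n : nat) : R := Derive_n (fun x => / cosh x) n 0.

Definition coef_a (n : nat) : R :=
  sum_n (fun a => sum_n (fun b => sum_n (fun c =>
    if Nat.eqb (a + 2 * b + c) n then
      INR (fact n) / (INR (fact a) * INR (fact (2 * b)) * INR (fact c))
      * (3 / 2) ^ a * (5 / 2) ^ (2 * b) * euler_number (2 * a + 2 * b)
    else 0) n) n) n
  + sum_n (fun a => sum_n (fun b =>
    if Nat.eqb (a + 2 * b) n then
      INR (fact n) / (INR (fact a) * INR (fact (2 * b)))
      * (3 / 2) ^ a * (1 / 2) ^ (2 * b) * euler_number (2 * a + 2 * b)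
    else 0) n) n.

Definition coef_b (n : nat) : C :=
  (PI ^ n *
   sum_n (fun a => sum_n (fun b =>
    (if Nat.eqb (a + 2 * b) n then
      (-(1)) ^ (a + b) * (3 * Ci) ^ a
      / (INR (fact a) * INR (fact (2 * b))) * euler_number (2 * a + 2 * b)
    else RtoC 0)%C) n) n)%C.

Definition coef_c (n : nat) : C :=
  (PI ^ n *
   sum_n (fun a => sum_n (fun b =>
    (if Nat.eqb (a + 2 * b) n then
      (-(1)) ^ (a + b) * (3 * Ci) ^ a * 5 ^ (2 * b)
      / (INR (fact a) * INR (fact (2 * b))) * euler_number (2 * a + 2 * b)
    else RtoC 0)%C) n) n)%C.

Definition mordell_integrand (alpha : C) (u : R) : C :=
  (Cexp (- (PI ^ 2 * u ^ 2 / (6 * alpha)))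
   * RtoC ((cosh (5 * PI * u / 6) + cosh (PI * u / 6)) / cosh (PI * u)))%C.

Definition is_mordell_integral (alpha J : C) : Prop :=
  is_RInt_gen (V := C_R_CompleteNormedModule) (mordell_integrand alpha)
    (at_point 0) (Rbar_locally p_infty) J.

(* The sum of a n over n < N. *)
Fixpoint Csum (a : nat -> C) (N : nat) : C :=
  match N with
  | O => 0%C
  | S n => (Csum a n + a n)%C
  end.

(* f(t) ~ sum of d n * t ^ n as t -> 0+. *)
Definition asymp_at_0 (f : R -> C) (d : nat -> C) : Prop :=
  forall N : nat, exists M : R,
    at_right 0 (fun t =>
      Cmod (f t - Csum (fun n => d n * t ^ n) N)%C <= M * t ^ N).

(* f(k) ~ A(k) + sum of d n k / (m k) ^ n as k -> infinity; the coefficients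
   may depend on k. *)
Definition asymp_at_infty
    (f A : nat -> C) (m : nat -> nat) (d : nat -> nat -> C) : Prop :=
  forall N : nat, exists M : R,
    eventually (fun k =>
      Cmod (f k - A k - Csum (fun n => d n k / INR (m k) ^ n) N)%C
      <= M / INR (m k) ^ N).

Lemma Csqrt_sqr (z : C) : (Csqrt z ^ 2 = z)%C.
Proof.
destruct z as [x y]; unfold Csqrt.
assert (Hm : Cmod (x, y) * Cmod (x, y) = x * x + y * y).
{ unfold Cmod; simpl; rewrite sqrt_sqrt; nra. }
pose proof (Cmod_ge_0 (x, y)) as H0.
assert (Hx : Rabs x <= Cmod (x, y)).
{ apply Rsqr_incr_0; [|apply Rabs_pos|exact H0].
  rewrite <- Rsqr_abs; unfold Rsqr; nra. }
apply Rabs_le_between in Hx.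
simpl Re; simpl Im; set (r := Cmod (x, y)) in *.
assert (A1 := sqrt_sqrt ((r + x) / 2) ltac:(lra)).
assert (A2 := sqrt_sqrt ((r - x) / 2) ltac:(lra)).
assert (A3 : sqrt ((r + x) / 2) * sqrt ((r - x) / 2) = Rabs y / 2).
{ rewrite <- sqrt_mult by lra.
  replace ((r + x) / 2 * ((r - x) / 2)) with (Rsqr (y / 2)) by (unfold Rsqr; lra).
  rewrite sqrt_Rsqr_abs; unfold Rdiv; rewrite Rabs_mult, (Rabs_pos_eq (/ 2)); lra. }
destruct (Rle_dec 0 y) as [Hy|Hy].
- rewrite Rabs_pos_eq in A3 by lra.
  unfold Cpow, Cmult; simpl; f_equal; nra.
- rewrite Rabs_left in A3 by lra.
  unfold Cpow, Cmult; simpl; f_equal; nra.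
Qed.

Lemma Csqrt_principal (z : C) :
  0 < Re (Csqrt z) \/ (Re (Csqrt z) = 0 /\ 0 <= Im (Csqrt z)).
Proof.
destruct (Rle_lt_or_eq_dec 0 (Re (Csqrt z))) as [H|H];
  [apply sqrt_pos|now left|right; split; [easy|]].
pose proof (f_equal Im (Csqrt_sqr z)) as E.
destruct (Csqrt z) as [x y] eqn:Hs; simpl in *; subst x.
unfold Csqrt in Hs; injection Hs as Hx Hy; subst y.
destruct z as [u v]; simpl in *.
destruct (Rle_dec 0 v); [apply sqrt_pos|].
exfalso; nra.
Qed.

Section EulerNumbers.

Let c (n : nat) : R := if Nat.even n then / INR (fact n) else 0.

Let c_bound (n : nat) : 0 <= c n <= / INR (fact n).
Proof.
pose proof (Rinv_0_lt_compat _ (INR_fact_lt_0 n)).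
unfold c; destruct (Nat.even n); lra.
Qed.

Let cosh_series (x : R) : is_pseries c x (cosh x).
Proof.
assert (E := is_exp_Reals x).
assert (E' := is_exp_Reals (- x)).
unfold is_pseries in *.
assert (P := is_series_scal (/ 2) _ _ (is_series_plus _ _ _ _ E E')).
unfold cosh.
replace ((exp x + exp (- x)) / 2) with (scal (/ 2) (plus (exp x) (exp (- x))))
  by (unfold scal, plus; simpl; unfold mult; simpl; field).
refine (is_series_ext _ _ _ _ P).
intros n.
rewrite !pow_n_pow; unfold scal, plus; simpl; unfold mult; simpl.
replace (- x) with (- 1 * x) by ring; rewrite Rpow_mult_distr.
unfold c; destruct (Nat.even n) eqn:En.
- apply Nat.even_spec in En; destruct En as [m ->].
  rewrite pow_1_even; field; apply INR_fact_neq_0.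
- assert (On : Nat.odd n = true) by (unfold Nat.odd; now rewrite En).
  apply Nat.odd_spec in On; destruct On as [m ->].
  replace (2 * m + 1)%nat with (S (2 * m)) by lia.
  rewrite pow_1_odd; field; apply INR_fact_neq_0.
Qed.

Let tail_bound (n : nat) : sum_f_R0 (fun j => c (S j)) n <= 1.
Proof.
assert (H : forall m, sum_f_R0 (fun j => c (S j)) m <= 1 - / 2 ^ m).
{ induction m as [|m IH].
  - simpl; unfold c; simpl; lra.
  - rewrite tech5.
    assert (F : / INR (fact (S (S m))) <= / 2 ^ S m).
    { assert (G : forall j, 2 ^ j <= INR (fact (S j))).
      { induction j as [|j IHj]; [simpl; lra|].
        change (fact (S (S j))) with (S (S j) * fact (S j))%nat.
        rewrite mult_INR, <- tech_pow_Rmult.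
        assert (2 <= INR (S (S j))) by (rewrite !S_INR; pose proof (pos_INR j); lra).
        pose proof (pow_lt 2 j ltac:(lra)); nra. }
      apply Rinv_le_contravar; [apply pow_lt; lra|apply G]. }
    destruct (c_bound (S (S m))) as [_ B].
    replace (/ 2 ^ m) with (/ 2 ^ S m * 2) in IH
      by (simpl; field; apply pow_nonzero; lra).
    lra. }
pose proof (Rinv_0_lt_compat _ (pow_lt 2 n ltac:(lra))).
specialize (H n); lra.
Qed.

(* [hist n] lists the first n + 1 coefficients of 1 / cosh, latest first. *)
Let hist : nat -> list R := fix hist n :=
  match n with
  | O => 1 :: nil
  | S n' => - sum_f_R0 (fun j => c (S j) * nth j (hist n') 0) n' :: hist n'
  end.

Let a (n : nat) : R := nth 0 (hist n) 0.

Let nth_hist (n j : nat) : (j <= n)%nat -> nth j (hist n) 0 = a (n - j).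
Proof.
revert j; induction n as [|n IH]; intros [|j] Hj; try reflexivity; [lia|].
exact (IH j ltac:(lia)).
Qed.

Let a_S (n : nat) : a (S n) = - sum_f_R0 (fun j => c (S j) * a (n - j)) n.
Proof.
unfold a at 1; simpl; f_equal; apply sum_eq.
intros j Hj; now rewrite nth_hist.
Qed.

Let a_bound (n : nat) : Rabs (a n) <= 1.
Proof.
induction n as [n IH] using (well_founded_induction lt_wf).
destruct n as [|n]; [unfold a; simpl; rewrite Rabs_R1; lra|].
rewrite a_S, Rabs_Ropp.
eapply Rle_trans; [apply Rsum_abs|].
eapply Rle_trans; [|apply (tail_bound n)].
apply sum_Rle; intros j Hj.
destruct (c_bound (S j)) as [C0 _].
rewrite Rabs_mult, (Rabs_pos_eq _ C0).
pose proof (IH (n - j)%nat ltac:(lia)); nra.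
Qed.

Let radius (b : nat -> R) :
  (forall n, Rabs (b n) <= 1) -> Rbar_le 1 (CV_radius b).
Proof.
intros H; apply (proj1 (CV_radius_bounded b)).
exists 1; intros n; rewrite pow1, Rmult_1_r; apply H.
Qed.

Let c_abs (n : nat) : Rabs (c n) <= 1.
Proof.
destruct (c_bound n) as [C0 C1]; rewrite Rabs_pos_eq by assumption.
apply (Rle_trans _ _ _ C1); rewrite <- Rinv_1; apply Rinv_le_contravar; [lra|].
apply (le_INR 1), lt_O_fact.
Qed.

Let mult_ca (n : nat) : PS_mult c a n = if Nat.eqb n 0 then 1 else 0.
Proof.
unfold PS_mult; destruct n as [|n].
- unfold c, a; simpl; lra.
- rewrite decomp_sum by lia; simpl pred; rewrite Nat.sub_0_r, a_S.
  replace (c 0) with 1 by (unfold c; simpl; lra); simpl; ring.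
Qed.

Let a_series (x : R) : Rabs x < 1 -> is_pseries a x (/ cosh x).
Proof.
intros Hx.
assert (Ra := radius a a_bound); assert (Rc := radius c c_abs).
assert (Ha : Rbar_lt (Rabs x) (CV_radius a))
  by (apply Rbar_lt_le_trans with 1; [exact Hx|exact Ra]).
assert (Hc : Rbar_lt (Rabs x) (CV_radius c))
  by (apply Rbar_lt_le_trans with 1; [exact Hx|exact Rc]).
assert (Sa : is_pseries a x (PSeries a x))
  by (apply PSeries_correct, CV_radius_inside, Ha).
assert (P := is_pseries_mult _ _ _ _ _ (cosh_series x) Sa Hc Ha).
assert (Q : is_pseries (PS_mult c a) x 1).
{ apply is_pseries_R.
  apply (filterlim_ext (fun _ => 1)); [|apply filterlim_const].
  induction x0 as [|n IH].
  - rewrite sum_O, mult_ca; simpl; ring.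
  - rewrite sum_Sn, <- IH, mult_ca; unfold plus; simpl; ring. }
assert (E : cosh x * PSeries a x = 1).
{ rewrite <- (is_pseries_unique _ _ _ P); exact (is_pseries_unique _ _ _ Q). }
replace (/ cosh x) with (PSeries a x); [exact Sa|].
assert (cosh x <> 0) by (intros Z; rewrite Z in E; lra).
apply Rmult_eq_reg_l with (cosh x); [|assumption].
rewrite E; field; assumption.
Qed.

Let ball_1 (x : R) : ball (0 : R) 1 x -> Rabs x < 1.
Proof.
intros H; unfold ball in H; simpl in H; unfold AbsRing_ball, abs, minus, plus, opp in H.
simpl in H; now rewrite Ropp_0, Rplus_0_r in H.
Qed.

Lemma euler_number_egf :
  locally 0 (fun x =>
    is_pseries (fun n => euler_number n / INR (fact n)) x (/ cosh x)).
Proof.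
exists (mkposreal 1 Rlt_0_1); intros x Hx; apply ball_1 in Hx.
apply is_pseries_ext with a; [|now apply a_series].
intros n; unfold euler_number.
rewrite (Derive_n_ext_loc _ (PSeries a)).
- rewrite Derive_n_coef.
  + change (a n = a n * INR (fact n) / INR (fact n) :> R).
    field; apply INR_fact_neq_0.
  + apply Rbar_lt_le_trans with 1; [exact Rlt_0_1|apply (radius a a_bound)].
- exists (mkposreal 1 Rlt_0_1); intros y Hy; apply ball_1 in Hy.
  symmetry; now apply is_pseries_unique, a_series.
Qed.

End EulerNumbers.

(* Main.v *)
(* The series Y(z) = sum_n q^(n^2) / ((z; q)_(n+1) (q/z; q)_n) satisfies
   Y(q z) + q z^3 Y(z) = 1 - q z^2 and combines, at z = i and z = -i, into phi(q).
   At a root of unity the corresponding finite sums close up under iteration, which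
   expresses phi and psi as finite theta sums with exponents - (12 p + a)^2 / 24,
   a = 1, 5, 7, 11.  The Mordell integral at a rational parameter is a combination
   of the same theta sum and its conjugate at the transformed parameter, whence the
   transformation formulas; expanding 1 / cosh under the oscillating Gaussian gives
   the expansions as k -> infinity.

   As t -> 0+ at a nontrivial root of unity, each term of the series is smooth on
   [0, t0], with derivatives bounded by a fixed polynomial in n times rho^n, so
   that the series may be expanded term by term.  At q = e^(-t) this fails.
   Instead phi(q) and the Gaussian Mordell integral are the values at j = 0 of two
   sequences U_j, M_j that satisfy the same first order recurrence and are smooth
   functions of j t.  The differences U_j - M_j alternate in sign, so their K-th
   finite difference dominates U_0 - M_0, while smoothness makes it O(t^K). *)
Require Import Defs.
From Stdlib Require Import Reals Lra Lia Psatz Factorial ZArith FunctionalExtensionality ClassicalEpsilon.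
From Coquelicot Require Import Coquelicot.
Open Scope R_scope.

(** A recurrence iterated over a period could close up trivially. It does not, because the
    integrating factor [nrm] is -1 after a period: the two ends of the iteration add up to twice the
    unknown instead of cancelling. The sign [eta] = -(-1)^n does the same for the Mordell integral.
    The analytic obstacle is that alpha is purely imaginary: the Gaussian has modulus 1 and gives no
    decay. In place of contour shifts, the integrals of exp (- i mu x^2 - c x) are continued to all
    real c by a closed form with an incomplete Fresnel integral. The defect of a shift is an
    integral over a finite segment, and the defects of all terms of the series add up to a Dirichlet
    kernel concentrated at the half integers. The Euler numbers enter as derivatives of 1 / cosh at
    0: normalised averages against a Gaussian of width tau obey a heat equation in tau, and a factor
    cosh (kap x) is removed by a similar equation in kap. Both equations hold for Gaussian and for
    Fresnel weights, so that one expansion serves t -> 0 and k -> infinity. *)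

Section Algebra.
Local Open Scope C_scope.

Lemma Csum_ext (a b : nat -> C) (N : nat) :
  (forall n, (n < N)%nat -> a n = b n) -> Csum a N = Csum b N.
Proof.
induction N as [|N IH]; intros H; [easy|]; simpl.
rewrite IH, (H N) by (intros; try apply H; lia); easy.
Qed.

Lemma Csum_plus (a b : nat -> C) (N : nat) :
  Csum (fun n => a n + b n) N = Csum a N + Csum b N.
Proof. induction N as [|N IH]; simpl; [ring|rewrite IH; ring]. Qed.

Lemma Csum_scal (c : C) (a : nat -> C) (N : nat) :
  Csum (fun n => c * a n) N = c * Csum a N.
Proof. induction N as [|N IH]; simpl; [ring|rewrite IH; ring]. Qed.

Lemma Csum_S_l (a : nat -> C) (N : nat) :
  Csum a (S N) = a 0%nat + Csum (fun n => a (S n)) N.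
Proof. induction N as [|N IH]; [simpl; ring|]. simpl in *; rewrite IH; ring. Qed.

Lemma Csum_0 (a : nat -> C) (N : nat) :
  (forall n, (n < N)%nat -> a n = 0) -> Csum a N = 0.
Proof.
intros H; induction N as [|N IH]; [easy|]; simpl.
rewrite IH, H by (intros; try apply H; lia); ring.
Qed.

Lemma Csum_add (a : nat -> C) (N M : nat) :
  Csum a (N + M) = Csum a N + Csum (fun n => a (N + n)%nat) M.
Proof.
induction M as [|M IH]; [rewrite Nat.add_0_r; simpl; ring|].
rewrite Nat.add_succ_r; simpl; rewrite IH; ring.
Qed.

Lemma Csum_rev (a : nat -> C) (N : nat) :
  Csum (fun n => a (N - 1 - n)%nat) N = Csum a N.
Proof.
induction N as [|N IH]; [easy|].
rewrite Csum_S_l; simpl; rewrite Nat.sub_0_r, Nat.sub_0_r, <- IH, Cplus_comm.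
f_equal; apply Csum_ext; intros n Hn; f_equal; lia.
Qed.

(** The summand [Rabs (b 0)] pays for N = 0, where [pred N] still leaves one term, of unknown sign,
    in the real sum. *)
Lemma Cmod_Csum (a : nat -> C) (b : nat -> R) (N : nat) :
  (forall n, (n < N)%nat -> (Cmod (a n) <= b n)%R) ->
  (Cmod (Csum a N) <= sum_f_R0 b (pred N) + Rabs (b 0%nat))%R.
Proof.
intros H; destruct N as [|N]; [simpl; rewrite Cmod_0; pose proof (Rabs_pos (b 0%nat));
  assert (- Rabs (b 0%nat) <= b 0%nat)%R by (pose proof (Rle_abs (- b 0%nat)); rewrite Rabs_Ropp in *; lra); lra|].
simpl pred; apply Rle_trans with (sum_f_R0 b N); [|pose proof (Rabs_pos (b 0%nat)); lra].
induction N as [|N IH].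
- simpl; rewrite Cplus_0_l; apply H; lia.
- change (Csum a (S (S N))) with (Csum a (S N) + a (S N)).
  eapply Rle_trans; [apply Cmod_triangle|]; simpl sum_f_R0.
  apply Rplus_le_compat; [apply IH; intros; apply H; lia|apply H; lia].
Qed.

Lemma Ci2 : Ci * Ci = -1.
Proof. unfold Ci, Cmult, Copp, RtoC; simpl; f_equal; ring. Qed.

Lemma Ci_neq0 : Ci <> 0.
Proof. intros E; injection E; lra. Qed.

(** Letting t tend to 0 kills the constant coefficient, and division by t repeats the argument. It
    serves twice: with M = 0 for polynomial identities, and for the uniqueness of asymptotic
    coefficients. *)
Lemma poly_small_0 (N : nat) (c : nat -> C) (M t0 : R) :
  (0 < t0)%R ->
  (forall t : R, (0 < t < t0)%R -> (Cmod (Csum (fun n => c n * t ^ n)%C N) <= M * t ^ N)%R) ->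
  forall n, (n < N)%nat -> c n = 0.
Proof.
revert c; induction N as [|N IH]; intros c Ht H; [lia|].
assert (H' : forall t : R, Csum (fun n => c n * t ^ n) (S N)
               = c 0%nat + t * Csum (fun n => c (S n) * t ^ n) N).
{ intros t; rewrite Csum_S_l, <- Csum_scal; simpl; f_equal; [ring|].
  apply Csum_ext; intros; simpl; ring. }
set (B := (sum_f_R0 (fun n => Cmod (c (S n))) (pred N) + Rabs (Cmod (c 1%nat)) + Rabs M)%R).
assert (HB : forall t : R, (0 < t < Rmin t0 1)%R -> (Cmod (c 0%nat) <= t * B)%R).
{ intros t [T0 T1].
  assert (t < t0)%R by (eapply Rlt_le_trans; [apply T1|apply Rmin_l]).
  assert (t < 1)%R by (eapply Rlt_le_trans; [apply T1|apply Rmin_r]).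
  specialize (H t ltac:(lra)); rewrite H' in H.
  assert (P : forall k, (0 <= t ^ k <= 1)%R).
  { intros k; split; [apply pow_le; lra|rewrite <- (pow1 k); apply pow_incr; lra]. }
  assert (G : (Cmod (Csum (fun n => c (S n) * t ^ n)%C N)
    <= sum_f_R0 (fun n => Cmod (c (S n))) (pred N) + Rabs (Cmod (c 1%nat)))%R).
  { apply Cmod_Csum; intros n Hn; rewrite Cmod_mult, <- RtoC_pow, Cmod_R.
    rewrite Rabs_pos_eq by apply P.
    pose proof (Cmod_ge_0 (c (S n))); specialize (P n); nra. }
  replace (c 0%nat) with ((c 0%nat + t * Csum (fun n => c (S n) * t ^ n) N)
     + - (t * Csum (fun n => c (S n) * t ^ n) N)) by ring.
  eapply Rle_trans; [apply Cmod_triangle|].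
  rewrite Cmod_opp, Cmod_mult, Cmod_R, Rabs_pos_eq by lra.
  simpl pow in H; unfold B.
  pose proof (Rle_abs M); specialize (P N); pose proof (Rabs_pos M).
  assert (M * (t * t ^ N) <= Rabs M * (t * 1))%R.
  { apply Rle_trans with (Rabs M * (t * t ^ N))%R.
    - apply Rmult_le_compat_r; [apply Rmult_le_pos|]; lra.
    - apply Rmult_le_compat_l; [lra|]; apply Rmult_le_compat_l; lra. }
  apply (Rmult_le_compat_l t) in G; [lra|lra]. }
assert (C0 : c 0%nat = 0).
{ apply Cmod_eq_0; apply Rle_antisym; [|apply Cmod_ge_0].
  apply le_epsilon; intros e He; rewrite Rplus_0_l.
  assert (0 <= B)%R.
  { assert (0 < Rmin t0 1)%R by (apply Rmin_glb_lt; lra).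
    specialize (HB (Rmin t0 1 / 2)%R ltac:(lra)); pose proof (Cmod_ge_0 (c 0%nat)); nra. }
  set (t := Rmin (Rmin t0 1 / 2) (e / (B + 1))).
  assert (0 < Rmin t0 1)%R by (apply Rmin_glb_lt; lra).
  assert (0 < e / (B + 1))%R by (apply Rdiv_lt_0_compat; lra).
  assert (0 < t)%R by (apply Rmin_glb_lt; lra).
  assert (t <= Rmin t0 1 / 2)%R by apply Rmin_l.
  assert (t <= e / (B + 1))%R by apply Rmin_r.
  specialize (HB t ltac:(lra)).
  apply (Rle_trans _ _ _ HB).
  apply Rle_trans with (e / (B + 1) * (B + 1))%R; [nra|right; field; lra]. }
intros [|n] Hn; [exact C0|].
apply (IH (fun n => c (S n)) Ht); [|lia].
intros t T; specialize (H t T); rewrite H', C0, Cplus_0_l, Cmod_mult, Cmod_R,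
  Rabs_pos_eq in H by lra.
simpl pow in H; apply Rmult_le_reg_l with t; [lra|]; lra.
Qed.

Lemma qpoch_S_l (a b : C) (n : nat) :
  qpoch a b (S n) = (1 - a) * qpoch (a * b) b n.
Proof.
induction n as [|n IH]; [simpl; ring|].
change (qpoch a b (S (S n))) with (qpoch a b (S n) * (1 - a * b ^ S n)).
rewrite IH; simpl; ring.
Qed.

Lemma qpoch_zero (a b : C) (k n : nat) :
  (k < n)%nat -> a * b ^ k = 1 -> qpoch a b n = 0.
Proof.
intros Hk E; induction n as [|n IH]; [lia|]; simpl.
destruct (Nat.eq_dec k n) as [->|]; [rewrite E; ring|rewrite IH by lia; ring].
Qed.

Lemma qpoch_nz (a b : C) (n : nat) :
  (forall k, (k < n)%nat -> a * b ^ k <> 1) -> qpoch a b n <> 0.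
Proof.
intros H; induction n as [|n IH]; simpl.
- intros E; injection E; lra.
- apply Cmult_neq_0; [apply IH; intros; apply H; lia|].
  intros E; apply (H n ltac:(lia)); rewrite <- (Cplus_0_l (a * b ^ n)), <- E; ring.
Qed.

Definition prim (w : C) (n : nat) : Prop :=
  w ^ n = 1 /\ forall j, (0 < j < n)%nat -> w ^ j <> 1.

(* Invariance under y -> w y kills all the coefficients but two. *)
Lemma qpoch_prim (w y : C) (n : nat) :
  (0 < n)%nat -> prim w n -> qpoch y w n = 1 - y ^ n.
Proof.
intros Hn [W1 W2].
assert (Pol : forall m, exists a : nat -> C, a 0%nat = 1 /\
          forall y, qpoch y w m = Csum (fun k => a k * y ^ k) (S m)).
{ induction m as [|m [a [A0 A]]].
  - exists (fun _ => RtoC 1); split; [easy|]; intros; simpl; ring.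
  - exists (fun k => match k with O => RtoC 1 | S j =>
              (if Nat.ltb j m then a (S j) else RtoC 0) - w ^ m * a j end).
    split; [easy|]; intros x; rewrite Csum_S_l.
    simpl qpoch; rewrite A, (Csum_S_l (fun k => a k * x ^ k)), A0.
    rewrite (Csum_ext (fun n => ((if Nat.ltb n m then a (S n) else RtoC 0) - w ^ m * a n) * x ^ S n) (fun j => 
       (if Nat.ltb j m then a (S j) else RtoC 0) * x ^ S j + (- (w ^ m * x)) * (a j * x ^ j)))
      by (intros; simpl; ring).
    rewrite Csum_plus, Csum_scal, (Csum_S_l (fun j => a j * x ^ j)), A0.
    assert (E : Csum (fun n => (if Nat.ltb n m then a (S n) else RtoC 0) * x ^ S n) (S m)
              = Csum (fun n => a (S n) * x ^ S n) m).
    { simpl; rewrite Nat.ltb_irrefl.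
      rewrite (Csum_ext _ (fun n => a (S n) * (x * x ^ n))); [ring|].
      intros k Hk; apply Nat.ltb_lt in Hk; rewrite Hk; ring. }
    rewrite E; simpl; ring. }
destruct (Pol n) as [a [A0 A]].
assert (Z : forall k, (k < S n)%nat -> a k * (w ^ k - 1) = 0).
{ apply (poly_small_0 (S n) (fun k => a k * (w ^ k - 1)) 0 1 Rlt_0_1).
  intros t T; rewrite Rmult_0_l; right.
  rewrite (Csum_ext _ (fun k => a k * (t * w) ^ k + (-1) * (a k * t ^ k)))
    by (intros; rewrite Cpow_mult_l; ring).
  rewrite Csum_plus, Csum_scal, <- !A.
  (* Replacing t by w t drops the first factor 1 - t and appends 1 - t w^n, which is again 1 - t.
     Cancelling it is legitimate because t < 1. *)
  assert (E : (1 - t) * qpoch (t * w) w n = (1 - t) * qpoch t w n).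
  { rewrite <- qpoch_S_l; simpl; rewrite W1; ring. }
  assert (D : 1 - t <> 0).
  { intros D; apply (f_equal Re) in D; simpl in D; lra. }
  apply (f_equal (Cmult (/ (1 - t)))) in E.
  rewrite !Cmult_assoc, Cinv_l, !Cmult_1_l in E by exact D.
  rewrite E, <- Cmod_0; f_equal; ring. }
assert (F : forall x, qpoch x w n = 1 + a n * x ^ n).
{ intros x; rewrite A; destruct n as [|n]; [lia|].
  rewrite Csum_S_l; simpl; rewrite A0.
  rewrite (Csum_0 (fun k => a (S k) * (x * x ^ k))); [ring|].
  intros k Hk; specialize (Z (S k) ltac:(lia)).
  assert (w ^ S k - 1 <> 0).
  { intros D; apply (W2 (S k) ltac:(lia)); rewrite <- (Cplus_0_l 1), <- D; ring. }
  apply (f_equal (fun u => u * / (w ^ S k - 1))) in Z.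
  rewrite <- Cmult_assoc, Cinv_r in Z by assumption.
  replace (a (S k)) with (a (S k) * 1) by ring; rewrite Z; ring. }
(* At x = 1 the product vanishes, which forces the last coefficient to be -1. *)
assert (E := F 1); rewrite (qpoch_zero 1 w 0 n Hn ltac:(simpl; ring)), Cpow_1_l in E.
rewrite F; replace (a n) with ((1 + a n * 1) - 1) by ring; rewrite <- E; ring.
Qed.

(** * The functional equation *)

Definition posterm (q z : C) (n : nat) : C :=
  q ^ (n ^ 2) / (qpoch z q (S n) * qpoch (q / z) q n).

(* The analytic continuation of [posterm] to the index - n - 1. *)
Definition negterm (q z : C) (n : nat) : C :=
  q ^ S n * qpoch (z * q) q n * qpoch (/ z) q (S n).

Lemma sub_neq_0 (a b : C) : a <> b -> b - a <> 0.
Proof. intros H E; apply H; rewrite <- (Cplus_0_l a), <- E; ring. Qed.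

(** A telescoping certificate: once both sides are divided by the common products and by q^(n^2),
    what remains is a rational identity in q, z and X = q^n. Summation over n gives the functional
    equation of Y with explicit boundary terms. *)
Lemma posterm_telescope (q z : C) (n : nat) :
  q <> 0 -> z <> 0 -> (forall j, z * q ^ j <> 1) -> (forall j, / z * q ^ j <> 1) ->
  posterm q (q * z) n + q * z ^ 3 * posterm q z n
  = (z - q ^ S n) * (1 - q * z ^ 2) * posterm q z (S n)
    - (z - q ^ n) * (1 - q * z ^ 2) * posterm q z n.
Proof.
intros Hq Hz H1 H2.
assert (H2' : forall j, q ^ j <> z).
{ intros j E; apply (H2 j); rewrite E; field; exact Hz. }
assert (E1 : qpoch (q * z) q (S n) = qpoch z q (S n) * (1 - z * q ^ S n) / (1 - z)).
{ assert (E := qpoch_S_l z q (S n)); simpl qpoch in E.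
  rewrite (Cmult_comm q z); simpl qpoch.
  assert (1 - z <> 0) by (apply sub_neq_0; specialize (H1 0%nat); simpl in H1; intros F; apply H1; rewrite F; ring).
  simpl Cpow; rewrite E; field; assumption. }
assert (E2 : qpoch (q / (q * z)) q n = qpoch (q / z) q n * (1 - / z) / (1 - / z * q ^ n)).
{ replace (q / (q * z)) with (/ z) by (field; split; assumption).
  assert (E := qpoch_S_l (/ z) q n); simpl qpoch in E.
  replace (q / z) with (/ z * q) by (field; assumption).
  assert (1 - / z * q ^ n <> 0) by (apply sub_neq_0, H2).
  replace (qpoch (/ z * q) q n * (1 - / z)) with (qpoch (/ z) q n * (1 - / z * q ^ n)) by (rewrite E; ring).
  field; split; [assumption|]; apply sub_neq_0; intros F; apply (H2 n); rewrite F; field; assumption. }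
unfold posterm; rewrite E1, E2.
replace (qpoch z q (S (S n))) with (qpoch z q (S n) * (1 - z * (q * q ^ n))) by easy.
replace (qpoch (q / z) q (S n)) with (qpoch (q / z) q n * (1 - q / z * q ^ n)) by easy.
replace (q ^ (S n ^ 2)) with (q ^ (n ^ 2) * (q ^ n * q ^ n * q)).
2: { replace (S n ^ 2)%nat with (n ^ 2 + (n + n + 1))%nat by (simpl; lia).
     rewrite !Cpow_add_r, Cpow_1_r; ring. }
assert (P : qpoch z q (S n) <> 0) by (apply qpoch_nz; intros; apply H1).
assert (Q : qpoch (q / z) q n <> 0).
{ apply qpoch_nz; intros k _; replace (q / z * q ^ k) with (/ z * q ^ S k) by (simpl; field; assumption); apply H2. }
generalize dependent (qpoch z q (S n)); intros P _ HP.
generalize dependent (qpoch (q / z) q n); intros Q _ HQ.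
simpl (q ^ S n).
assert (D1 : 1 - z <> 0) by (apply sub_neq_0; specialize (H1 0%nat); simpl in H1; intros F; apply H1; rewrite F; ring).
assert (D2 : z - 1 <> 0) by (intros F; apply D1; replace (1 - z) with (- (z - 1)) by ring; rewrite F; ring).
assert (D3 := sub_neq_0 _ _ (H1 (S n))).
assert (D4 := sub_neq_0 _ _ (H2' (S n))).
assert (D5 := sub_neq_0 _ _ (H2' n)).
simpl Cpow in D3, D4.
generalize dependent (q ^ n); intros X; intros.
generalize (q ^ (n ^ 2)); intros S0.
field; repeat split; try assumption; try (intros F; apply D3; rewrite <- F; ring);
  intros F; apply D4; rewrite <- F; ring.
Qed.

(** The right side is the difference of consecutive values of (1 - q z^2) (z q; q)_n (1/z; q)_n.
    Here the end n = 0 enters with a minus sign, which is why the recurrence for psi has s = -1. *)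
Lemma negterm_telescope (q z : C) (n : nat) :
  q <> 0 -> z <> 0 ->
  negterm q (q * z) n + q * z ^ 3 * negterm q z n
  = - (1 - q * z ^ 2) * qpoch (z * q) q n * qpoch (/ z) q n
    + (1 - q * z ^ 2) * qpoch (z * q) q (S n) * qpoch (/ z) q (S n).
Proof.
intros Hq Hz; unfold negterm.
assert (E2 : qpoch (/ (q * z)) q (S n) = (1 - / (q * z)) * qpoch (/ z) q n).
{ rewrite qpoch_S_l; f_equal; f_equal; field; split; assumption. }
assert (E1 : (1 - z * q) * qpoch (q * z * q) q n = qpoch (z * q) q n * (1 - z * q * q ^ n)).
{ rewrite (Cmult_comm q z), <- qpoch_S_l; easy. }
rewrite E2.
replace (q ^ S n * qpoch (q * z * q) q n * ((1 - / (q * z)) * qpoch (/ z) q n))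
  with (- q ^ n / z * ((1 - z * q) * qpoch (q * z * q) q n) * qpoch (/ z) q n)
  by (simpl; field; split; assumption).
rewrite E1; simpl qpoch; simpl Cpow; field; assumption.
Qed.

Lemma Csum_telescope (a c : nat -> C) (N : nat) :
  (forall n, a n = c (S n) - c n) -> Csum a N = c N - c 0%nat.
Proof. intros H; induction N as [|N IH]; simpl; [ring|rewrite IH, H; ring]. Qed.

(** The end at index 0 contributes the 1. The term at N tends to 0 when |q| < 1, and can be computed
    from q^N = 1 at a root of unity, so the same finite identity serves both situations. *)
Lemma possum_shift (q z : C) (N : nat) :
  q <> 0 -> z <> 0 -> (forall j, z * q ^ j <> 1) -> (forall j, / z * q ^ j <> 1) ->
  Csum (posterm q (q * z)) N + q * z ^ 3 * Csum (posterm q z) N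
  = (1 - q * z ^ 2) * (1 + (z - q ^ N) * posterm q z N).
Proof.
intros Hq Hz H1 H2.
rewrite <- Csum_scal, <- Csum_plus.
rewrite (Csum_telescope _ (fun n => (z - q ^ n) * (1 - q * z ^ 2) * posterm q z n)).
2: { intros n; rewrite posterm_telescope by assumption; easy. }
replace (posterm q z 0) with (/ (1 - z)).
- simpl; field; apply sub_neq_0; intros E; apply (H1 0%nat); rewrite E; simpl; ring.
- unfold posterm; simpl; field; apply sub_neq_0; intros E; apply (H1 0%nat); rewrite E; simpl; ring.
Qed.

(* The combination of the even and odd parts of Y that eliminates i. *)
Definition mix (Y : C -> C) (q : C) (j : nat) : C :=
  / 2 * ((1 - Ci) * Y (Ci * q ^ (2 * j)) + (1 + Ci) * Y (- Ci * q ^ (2 * j))).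

Lemma two_neq0 : RtoC 2 <> 0.
Proof. intros E; apply (f_equal Re) in E; simpl in E; lra. Qed.

(** Two steps z -> q z lead from i q^(2 j) to i q^(2 j + 2). Since e^2 = -1 for e = i and e = -i,
    the inhomogeneous term takes the form A + e B with A and B free of i, and the weights 1 - i and
    1 + i turn this into A + B. The sign s is 1 for phi and -1 for psi. *)
Lemma mix_rec (Y : C -> C) (q s : C) (j : nat) :
  (forall (e : C) (j : nat), e = Ci \/ e = - Ci ->
     Y (q * (e * q ^ j)) = s * (1 - q * (e * q ^ j) ^ 2) - q * (e * q ^ j) ^ 3 * Y (e * q ^ j)) ->
  mix Y q (S j) = s * (1 + q ^ (4 * j + 3) + q ^ (6 * j + 4) + q ^ (10 * j + 5))
                  - q ^ (12 * j + 5) * mix Y q j.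
Proof.
intros H.
assert (G : forall e, e = Ci \/ e = - Ci -> Y (e * q ^ (2 * S j)) =
   s * (1 + q ^ (4 * j + 3) + e * q ^ (6 * j + 4) + e * q ^ (10 * j + 5))
   - q ^ (12 * j + 5) * Y (e * q ^ (2 * j))).
{ intros e He.
  assert (E2 : e * e = -1) by (destruct He as [->| ->]; rewrite <- Ci2; ring).
  replace (e * q ^ (2 * S j)) with (q * (e * q ^ S (2 * j))).
  2: { replace (2 * S j)%nat with (S (S (2 * j))) by lia; simpl; ring. }
  rewrite (H e (S (2 * j)) He).
  replace (e * q ^ S (2 * j)) with (q * (e * q ^ (2 * j))) by (simpl; ring).
  rewrite (H e (2 * j)%nat He).
  set (x := q ^ j).
  replace (q ^ (2 * j)) with (x ^ 2) by (unfold x; rewrite <- Cpow_mult_r; f_equal; lia).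
  replace (q ^ (4 * j + 3)) with (x ^ 4 * q ^ 3) by (unfold x; rewrite <- Cpow_mult_r, <- Cpow_add_r; f_equal; lia).
  replace (q ^ (6 * j + 4)) with (x ^ 6 * q ^ 4) by (unfold x; rewrite <- Cpow_mult_r, <- Cpow_add_r; f_equal; lia).
  replace (q ^ (10 * j + 5)) with (x ^ 10 * q ^ 5) by (unfold x; rewrite <- Cpow_mult_r, <- Cpow_add_r; f_equal; lia).
  replace (q ^ (12 * j + 5)) with (x ^ 12 * q ^ 5) by (unfold x; rewrite <- Cpow_mult_r, <- Cpow_add_r; f_equal; lia).
  clearbody x; generalize (Y (e * x ^ 2)); intros y.
  replace ((q * (e * x ^ 2)) ^ 3) with (e * e * e * q ^ 3 * x ^ 6) by ring.
  replace ((q * (e * x ^ 2)) ^ 2) with (e * e * q ^ 2 * x ^ 4) by ring.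
  replace ((e * x ^ 2) ^ 3) with (e * e * e * x ^ 6) by ring.
  replace ((e * x ^ 2) ^ 2) with (e * e * x ^ 4) by ring.
  rewrite E2.
  replace (s * (1 - q * (-1 * q ^ 2 * x ^ 4)) - q * (-1 * e * q ^ 3 * x ^ 6) *
    (s * (1 - q * (-1 * x ^ 4)) - q * (-1 * e * x ^ 6) * y))
   with (s * (1 + q ^ 3 * x ^ 4 + e * q ^ 4 * x ^ 6 + e * q ^ 5 * x ^ 10)
     + (e * e) * q ^ 5 * x ^ 12 * y) by ring.
  rewrite E2; ring. }
unfold mix; rewrite (G Ci), (G (- Ci)) by tauto.
assert (F := Ci2).
replace (/ 2 * ((1 - Ci) * (s * (1 + q ^ (4 * j + 3) + Ci * q ^ (6 * j + 4) + Ci * q ^ (10 * j + 5))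
     - q ^ (12 * j + 5) * Y (Ci * q ^ (2 * j))) +
   (1 + Ci) * (s * (1 + q ^ (4 * j + 3) + - Ci * q ^ (6 * j + 4) + - Ci * q ^ (10 * j + 5)) -
    q ^ (12 * j + 5) * Y (- Ci * q ^ (2 * j)))))
 with (s * (1 + q ^ (4 * j + 3) - (Ci * Ci) * q ^ (6 * j + 4) - (Ci * Ci) * q ^ (10 * j + 5))
   - q ^ (12 * j + 5) * (/ 2 * ((1 - Ci) * Y (Ci * q ^ (2 * j)) + (1 + Ci) * Y (- Ci * q ^ (2 * j)))))
 by (field; apply two_neq0).
rewrite F; ring.
Qed.

(* q^{1/24} times the theta term with exponents - (12 p + a)^2 / 24, a = 1, 5, 7, 11. *)
Definition theta_term (q : C) (p : nat) : C :=
  (- (1)) ^ p * (/ q) ^ (6 * p ^ 2) *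
  ((/ q) ^ p + (/ q) ^ (5 * p + 1) + (/ q) ^ (7 * p + 2) + (/ q) ^ (11 * p + 5)).

(** The integrating factor of the recurrence of [mix_rec]: consecutive quotients are - q^(- 12 j -
    5), so that [nrm q j] times the solution telescopes into theta terms. *)
Definition nrm (q : C) (j : nat) : C := (- (1)) ^ j * (/ q) ^ (6 * j ^ 2) * q ^ j.

Lemma mix_theta (q s : C) (U : nat -> C) (n : nat) :
  q <> 0 ->
  (forall j, U (S j) = s * (1 + q ^ (4 * j + 3) + q ^ (6 * j + 4) + q ^ (10 * j + 5))
                  - q ^ (12 * j + 5) * U j) ->
  nrm q n * U n = U 0%nat - s * Csum (theta_term q) n.
Proof.
intros Hq H; induction n as [|n IH]; [unfold nrm; simpl; ring|].
simpl Csum; rewrite H.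
replace (U 0%nat - s * (Csum (theta_term q) n + theta_term q n))
  with (U 0%nat - s * Csum (theta_term q) n - s * theta_term q n) by ring.
rewrite <- IH; unfold nrm, theta_term.
replace (6 * S n ^ 2)%nat with (6 * n ^ 2 + 12 * n + 6)%nat by (simpl; lia).
rewrite !(Cpow_inv q) by assumption.
rewrite !Cpow_add_r; simpl (_ ^ S n).
set (x := q ^ n).
replace (q ^ (6 * n ^ 2)) with ((q ^ (n ^ 2)) ^ 6) by (rewrite <- Cpow_mult_r; f_equal; lia).
replace (q ^ (12 * n)) with (x ^ 12) by (unfold x; rewrite <- Cpow_mult_r; f_equal; lia).
replace (q ^ (11 * n)) with (x ^ 11) by (unfold x; rewrite <- Cpow_mult_r; f_equal; lia).
replace (q ^ (10 * n)) with (x ^ 10) by (unfold x; rewrite <- Cpow_mult_r; f_equal; lia).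
replace (q ^ (7 * n)) with (x ^ 7) by (unfold x; rewrite <- Cpow_mult_r; f_equal; lia).
replace (q ^ (6 * n)) with (x ^ 6) by (unfold x; rewrite <- Cpow_mult_r; f_equal; lia).
replace (q ^ (5 * n)) with (x ^ 5) by (unfold x; rewrite <- Cpow_mult_r; f_equal; lia).
replace (q ^ (4 * n)) with (x ^ 4) by (unfold x; rewrite <- Cpow_mult_r; f_equal; lia).
assert (x <> 0) by (apply Cpow_nz, Hq).
assert (q ^ (n ^ 2) <> 0) by (apply Cpow_nz, Hq).
clearbody x; generalize dependent (q ^ (n ^ 2)); intros w Hw.
generalize ((- (1)) ^ n) (U n); intros e u.
field; repeat split; assumption.
Qed.

End Algebra.

(** * The values of phi and psi at roots of unity as finite theta sums *)

Section RootsOfUnity.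
Local Open Scope C_scope.

Lemma qpoch_S (a b : C) (n : nat) : qpoch a b (S n) = qpoch a b n * (1 - a * b ^ n).
Proof. easy. Qed.

Lemma Csum_S (a : nat -> C) (n : nat) : Csum a (S n) = Csum a n + a n.
Proof. easy. Qed.

Lemma sum_n_Re_Csum (a : nat -> C) (n : nat) :
  sum_n (fun n => Re (a n)) n = Re (Csum a (S n)).
Proof.
induction n as [|n IH]; [rewrite sum_O; symmetry; apply Rplus_0_l|].
rewrite sum_Sn, IH; easy.
Qed.

Lemma sum_n_Im_Csum (a : nat -> C) (n : nat) :
  sum_n (fun n => Im (a n)) n = Im (Csum a (S n)).
Proof.
induction n as [|n IH]; [rewrite sum_O; symmetry; apply Rplus_0_l|].
rewrite sum_Sn, IH; easy.
Qed.

Lemma CSeries_finite (a : nat -> C) (N : nat) :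
  (forall n, (N <= n)%nat -> a n = 0) -> CSeries a = Csum a N.
Proof.
intros H.
assert (E : forall n, (N <= n)%nat -> Csum a (S n) = Csum a N).
{ intros n Hn; replace (S n) with (N + (S n - N))%nat by lia.
  rewrite Csum_add, (Csum_0 (fun k => a (N + k)%nat)); [ring|].
  intros; apply H; lia. }
unfold CSeries; rewrite (surjective_pairing (Csum a N)); f_equal; apply is_series_unique.
- apply filterlim_ext_loc with (fun _ => Re (Csum a N)); [|apply filterlim_const].
  exists N; intros n Hn; rewrite sum_n_Re_Csum, E by exact Hn; easy.
- apply filterlim_ext_loc with (fun _ => Im (Csum a N)); [|apply filterlim_const].
  exists N; intros n Hn; rewrite sum_n_Im_Csum, E by exact Hn; easy.
Qed.

Lemma RtoC_m1 : RtoC (-1) = - (1).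
Proof. unfold RtoC, Copp; simpl; f_equal; ring. Qed.

Lemma Cm1_neq_1 : - (1) <> RtoC 1.
Proof. intros E; injection E; lra. Qed.

Lemma Cm1_pow_even (n : nat) : (- (1)) ^ (2 * n) = 1.
Proof. rewrite Cpow_mult_r; replace ((- (1)) ^ 2) with (RtoC 1) by ring; apply Cpow_1_l. Qed.

Lemma Cm1_pow_odd (n : nat) : (- (1)) ^ (2 * n + 1) = - (1).
Proof. rewrite Cpow_add_r, Cm1_pow_even; ring. Qed.

Lemma qpoch_i (q : C) (n : nat) :
  qpoch (Ci * q) q n * qpoch (- Ci * q) q n = qpoch (- q ^ 2) (q ^ 2) n.
Proof.
induction n as [|n IH]; [simpl; ring|]; rewrite !qpoch_S; rewrite <- IH.
replace ((q ^ 2) ^ n) with ((q ^ n) ^ 2) by (rewrite <- !Cpow_mult_r; f_equal; lia).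
replace (1 - - q ^ 2 * (q ^ n) ^ 2) with ((1 - Ci * q * q ^ n) * (1 - - Ci * q * q ^ n)); [ring|].
replace ((1 - Ci * q * q ^ n) * (1 - - Ci * q * q ^ n)) with (1 - (Ci * Ci) * q ^ 2 * (q ^ n) ^ 2) by ring.
rewrite Ci2; ring.
Qed.

Lemma pm_i_sq (e : C) : e = Ci \/ e = - Ci -> e * e = -1.
Proof. intros [->| ->]; rewrite <- Ci2; ring. Qed.

Lemma pm_i_neq0 (e : C) : e = Ci \/ e = - Ci -> e <> 0.
Proof. intros H E; apply pm_i_sq in H; rewrite E in H; apply (f_equal Re) in H; simpl in H; lra. Qed.

Lemma pow_one (q : C) (N j : nat) : q ^ N = 1 -> q ^ (N * j) = 1.
Proof. intros H; rewrite Cpow_mult_r, H; apply Cpow_1_l. Qed.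

Lemma root_neq0 (q w : C) (N : nat) : (0 < N)%nat -> w <> 0 -> q ^ N = w -> q <> 0.
Proof. intros HN Hw H E; apply Hw; rewrite <- H, E; destruct N; [lia|]; simpl; ring. Qed.

Lemma C1_neq0 : RtoC 1 <> 0.
Proof. intros E; injection E; lra. Qed.

Lemma pm_i_root (q e : C) (N j : nat) :
  Nat.Odd N -> q ^ N = 1 -> e = Ci \/ e = - Ci -> e * q ^ j <> 1.
Proof.
intros [m ->] H He E.
apply (f_equal (fun x => x ^ (2 * (2 * m + 1)))) in E.
rewrite Cpow_1_l, Cpow_mult_l, (Cpow_mult_r e 2), <- (Cpow_mult_r q) in E.
replace (j * (2 * (2 * m + 1)))%nat with ((2 * m + 1) * (2 * j))%nat in E by lia.
rewrite (pow_one _ _ _ H) in E.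
replace (e ^ 2) with (- (1)) in E by (rewrite <- RtoC_m1, <- (pm_i_sq e He); ring).
rewrite Cm1_pow_odd in E; apply Cm1_neq_1; transitivity (- (1) * 1); [ring|exact E].
Qed.

(** Iterating t -> t q^2 from t = 1 multiplies up the factors q^(2 k + 1) - 1, that is (-1)^k (q;
    q^2)_k. This is the passage from the first series of phi to the second, carried out on finite
    sums. *)
Lemma first_second (q t : C) (M : nat) :
  (forall k, - q ^ 2 * (q ^ 2) ^ k <> 1) ->
  let f t n := q ^ (n ^ 2) * t ^ n / qpoch (- q ^ 2) (q ^ 2) n in
  Csum (f t) M = 2 - (1 + (q ^ 2) ^ M) * f t M + (t * q - 1) * Csum (f (t * q ^ 2)) M.
Proof.
intros H f; induction M as [|M IH].
- unfold f; simpl; field.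
- rewrite !Csum_S, IH.
  assert (E1 : f (t * q ^ 2) M = (q ^ 2) ^ M * f t M).
  { unfold f; rewrite Cpow_mult_l; field; apply qpoch_nz; intros; apply H. }
  assert (E2 : (1 + (q ^ 2) ^ S M) * f t (S M) = t * q * (q ^ 2) ^ M * f t M).
  { clear E1 IH; unfold f; clear f; replace (S M ^ 2)%nat with (M ^ 2 + 2 * M + 1)%nat by (simpl; lia).
    rewrite !Cpow_add_r, (Cpow_mult_r q 2 M), qpoch_S, (Cpow_S (q ^ 2) M), (Cpow_S t M), Cpow_1_r.
    assert (D := sub_neq_0 _ _ (H M)).
    assert (P : qpoch (- q ^ 2) (q ^ 2) M <> 0) by (apply qpoch_nz; intros; apply H).
    generalize dependent (qpoch (- q ^ 2) (q ^ 2) M); intros P HP.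
    generalize dependent ((q ^ 2) ^ M); intros X HX.
    field; repeat split; try assumption; intros F; apply HX; rewrite <- F; ring. }
  rewrite E1, E2; ring.
Qed.

(** Over a period the denominator (- q^2; q^2)_N is 1 - (-1)^N = 2, so the boundary term of
    [first_second] is 2 - 2 / 2 = 1 at every step. After N steps the remainder carries (q; q^2)_N,
    which contains the factor 1 - q^N = 0. *)
Lemma phi_root_sum (q : C) (N : nat) :
  Nat.Odd N -> prim q N ->
  Csum (fun n => q ^ (n ^ 2) / qpoch (- q ^ 2) (q ^ 2) n) N
  = Csum (fun n => (- (1)) ^ n * qpoch q (q ^ 2) n) N.
Proof.
intros HN Hp.
assert (N0 : (0 < N)%nat) by (destruct HN; lia).
assert (Hq : q ^ N = 1) by apply Hp.
assert (q0 : q <> 0) by (apply (root_neq0 q 1 N N0 C1_neq0 Hq)).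
assert (H : forall k, - q ^ 2 * (q ^ 2) ^ k <> 1).
{ intros k E; apply (f_equal (fun x => x ^ N)) in E.
  replace (- q ^ 2 * (q ^ 2) ^ k) with (- (1) * (q ^ (2 * S k))) in E
    by (rewrite Cpow_mult_r; simpl; ring).
  rewrite Cpow_1_l, Cpow_mult_l, <- Cpow_mult_r, (Nat.mul_comm (2 * S k)), (pow_one _ _ _ Hq) in E.
  destruct HN as [m ->]; rewrite Cm1_pow_odd in E; apply Cm1_neq_1; transitivity (- (1) * 1); [ring|exact E]. }
assert (Hp2 : prim (q ^ 2) N).
{ split; [rewrite <- Cpow_mult_r, Nat.mul_comm; apply (pow_one _ _ _ Hq)|].
  intros j Hj E; rewrite <- Cpow_mult_r in E; destruct HN as [m Hm].
  destruct (Nat.le_gt_cases N (2 * j)) as [L|L].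
  - apply (proj2 Hp (2 * j - N)%nat); [lia|].
    replace (2 * j)%nat with (N + (2 * j - N))%nat in E by lia.
    rewrite Cpow_add_r, Hq, Cmult_1_l in E; exact E.
  - apply (proj2 Hp (2 * j)%nat); [lia|exact E]. }
set (f := fun t n => q ^ (n ^ 2) * t ^ n / qpoch (- q ^ 2) (q ^ 2) n).
assert (G : forall k, Csum (f 1) N = Csum (fun n => (- (1)) ^ n * qpoch q (q ^ 2) n) k
                + (- (1)) ^ k * qpoch q (q ^ 2) k * Csum (f (q ^ (2 * k))) N).
{ induction k as [|k IH]; [simpl; ring|].
  rewrite IH at 1; rewrite Csum_S.
  pose proof (first_second q (q ^ (2 * k)) N H) as FS.
  change (Csum (f (q ^ (2 * k))) N = 2 - (1 + (q ^ 2) ^ N) * f (q ^ (2 * k)) N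
     + (q ^ (2 * k) * q - 1) * Csum (f (q ^ (2 * k) * q ^ 2)) N) in FS.
  assert (FN : f (q ^ (2 * k)) N = / 2).
  { unfold f; rewrite (qpoch_prim _ _ _ N0 Hp2), <- !Cpow_mult_r.
    replace (2 * k * N)%nat with (N * (2 * k))%nat by lia; rewrite (pow_one _ _ _ Hq).
    replace (N ^ 2)%nat with (N * N)%nat by (simpl; lia); rewrite (pow_one _ _ _ Hq).
    replace ((- q ^ 2) ^ N) with (- (1)).
    2: { replace (- q ^ 2) with (- (1) * q ^ 2) by ring; rewrite Cpow_mult_l, <- Cpow_mult_r.
         replace (2 * N)%nat with (N * 2)%nat by lia; rewrite (pow_one _ _ _ Hq).
         destruct HN as [m ->]; rewrite Cm1_pow_odd; ring. }
    replace (1 - - (1)) with (RtoC 2) by ring; field; apply two_neq0. }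
  rewrite FS, FN, qpoch_S, <- !Cpow_mult_r, (Cpow_S _ k).
  replace (q ^ (2 * k) * q ^ 2) with (q ^ (2 * S k)) by (rewrite <- Cpow_add_r; f_equal; lia).
  rewrite (Nat.mul_comm 2 N), (pow_one _ _ _ Hq).
  field; apply two_neq0. }
assert (Z : qpoch q (q ^ 2) N = 0).
{ destruct HN as [m Hm]; apply (qpoch_zero _ _ m); [lia|].
  rewrite <- Cpow_mult_r; rewrite <- Hq, Hm, Cpow_add_r; ring. }
rewrite <- (Cplus_0_r (Csum (fun n => (- (1)) ^ n * qpoch q (q ^ 2) n) N)).
replace (RtoC 0) with ((- (1)) ^ N * qpoch q (q ^ 2) N * Csum (f (q ^ (2 * N))) N) by (rewrite Z; ring).
rewrite <- G; apply Csum_ext; intros n _; unfold f; rewrite Cpow_1_l, Cmult_1_r; easy.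
Qed.

(** The term q^(2 n + 1) (q; q^2)_n is a difference of consecutive products, and summation by parts
    doubles the alternating sum. The factor 2 is also 1 + 1/2 + 1/4 + ...: the terms of the first
    series are halved after each period. *)
Lemma phi_root (q : C) (N : nat) :
  Nat.Odd N -> prim q N -> ~ (Cmod q < 1)%R ->
  phi q = 2 * Csum (fun n => q ^ (n ^ 2) / qpoch (- q ^ 2) (q ^ 2) n) N.
Proof.
intros HN Hp H1; rewrite (phi_root_sum q N HN Hp).
unfold phi; destruct (Rlt_dec (Cmod q) 1) as [L|_]; [easy|].
assert (Z : forall n, (N <= n)%nat -> qpoch q (q ^ 2) n = 0).
{ intros n Hn; destruct HN as [m Hm]; apply (qpoch_zero _ _ m); [lia|].
  rewrite <- Cpow_mult_r; rewrite <- (proj1 Hp), Hm, Cpow_add_r; ring. }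
rewrite (CSeries_finite _ N) by (intros n Hn; rewrite Z by exact Hn; ring).
assert (G : forall M, 1 + Csum (fun n => (- (1)) ^ n * q ^ (2 * n + 1) * qpoch q (q ^ 2) n) M
   = 2 * Csum (fun n => (- (1)) ^ n * qpoch q (q ^ 2) n) M + (- (1)) ^ M * qpoch q (q ^ 2) M).
{ induction M as [|M IH]; [simpl; ring|]; rewrite !Csum_S.
  rewrite Cplus_assoc, IH; rewrite !qpoch_S.
  rewrite Cpow_add_r, Cpow_mult_r; simpl Cpow; ring. }
rewrite G, Z by lia; ring.
Qed.

Lemma phi_theta (q : C) (N : nat) :
  Nat.Odd N -> prim q N -> ~ (Cmod q < 1)%R -> 2 * phi q = Csum (theta_term q) N.
Proof.
intros HN Hp H1; rewrite (phi_root q N HN Hp H1).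
assert (N0 : (0 < N)%nat) by (destruct HN; lia).
assert (Hq : q ^ N = 1) by apply Hp.
assert (q0 : q <> 0) by (apply (root_neq0 q 1 N N0 C1_neq0 Hq)).
(* At q^N = 1 the boundary factor of [possum_shift] is 1/2, because (z; q)_(N+1) (q/z; q)_N reduces
   to 2 (1 - z). Doubling the sum makes the recurrence the one with s = 1. *)
set (Y := fun z => 2 * Csum (posterm q z) N).
assert (Inv : forall e, e = Ci \/ e = - Ci -> / e = Ci \/ / e = - Ci).
{ intros e He; assert (E := pm_i_sq e He); assert (E0 := pm_i_neq0 e He).
  assert (F : / e = - e).
  { replace (- e) with (- (e * e) * / e) by (field; exact E0); rewrite E, RtoC_m1; field; exact E0. }
  rewrite F; destruct He as [->| ->]; [right; easy|left; ring]. }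
assert (Hne : forall e i j, e = Ci \/ e = - Ci -> / (e * q ^ i) * q ^ j <> 1).
{ intros e i j He E; apply (pm_i_root q e N i HN Hq He).
  assert (E0 := pm_i_neq0 e He); assert (Qi := Cpow_nz q i q0).
  assert (E' : e * q ^ i = q ^ j) by (rewrite <- (Cmult_1_r (e * q ^ i)), <- E; field; split; assumption).
  exfalso; apply (pm_i_root q e N (i + (N * j - j)) HN Hq He).
  rewrite Cpow_add_r, Cmult_assoc, E', <- Cpow_add_r.
  replace (j + (N * j - j))%nat with (N * j)%nat by nia; apply (pow_one _ _ _ Hq). }
assert (R := mix_theta q 1 (mix Y q) N q0).
assert (HY : forall (e : C) (j : nat), e = Ci \/ e = - Ci ->
     Y (q * (e * q ^ j)) = 1 * (1 - q * (e * q ^ j) ^ 2) - q * (e * q ^ j) ^ 3 * Y (e * q ^ j)).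
{ intros e j He; unfold Y.
  assert (E0 := pm_i_neq0 e He); assert (Qi := Cpow_nz q j q0).
  assert (z0 : e * q ^ j <> 0) by (apply Cmult_neq_0; assumption).
  assert (S := possum_shift q (e * q ^ j) N q0 z0).
  rewrite Hq in S.
  assert (P : posterm q (e * q ^ j) N = / 2 * / (1 - e * q ^ j)).
  { unfold posterm; rewrite !qpoch_S; rewrite !(qpoch_prim q _ N N0 Hp), Hq.
    replace (N ^ 2)%nat with (N * N)%nat by (simpl; lia); rewrite (pow_one _ _ _ Hq).
    replace (q / (e * q ^ j)) with (/ e * (q * / q ^ j)) by (field; repeat split; assumption).
    rewrite !Cpow_mult_l, !Cpow_inv, Hq, <- Cpow_mult_r, (Nat.mul_comm j), (pow_one _ _ _ Hq) by assumption.
    assert (D : 1 - e * q ^ j <> 0) by (apply sub_neq_0, (pm_i_root q e N j HN Hq He)).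
    assert (W : e ^ N * e ^ N = - (1)).
    { rewrite <- Cpow_mult_l, (pm_i_sq e He); destruct HN as [m ->].
      rewrite RtoC_m1.
      apply Cm1_pow_odd. }
    assert (W0 : e ^ N <> 0) by (apply Cpow_nz, E0).
    set (w := e ^ N) in *.
    replace ((1 - w * 1) * (1 - e * q ^ j * 1) * (1 - / w * (1 * / 1))) with (2 * (1 - e * q ^ j)).
    - field; repeat split; try assumption; apply two_neq0.
    - replace ((1 - w * 1) * (1 - e * q ^ j * 1) * (1 - / w * (1 * / 1)))
        with ((1 - e * q ^ j) * (2 - / w * (1 + w * w))) by (field; repeat split; try assumption; apply C1_neq0).
      rewrite W; ring. }
  rewrite P in S.
  assert (D : 1 - e * q ^ j <> 0) by (apply sub_neq_0, (pm_i_root q e N j HN Hq He)).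
  replace (1 + (e * q ^ j - 1) * (/ 2 * / (1 - e * q ^ j))) with (/ 2) in S
    by (field; repeat split; try assumption; apply two_neq0).
  specialize (S ltac:(intros k; rewrite <- Cmult_assoc, <- Cpow_add_r; apply (pm_i_root q e N _ HN Hq He))
                ltac:(intros k; apply Hne, He)).
  apply (f_equal (fun x => 2 * x)) in S.
  replace (2 * ((1 - q * (e * q ^ j) ^ 2) * / 2)) with (1 - q * (e * q ^ j) ^ 2) in S by (field; apply two_neq0).
  rewrite Cmult_1_l, <- S; ring. }
specialize (R (fun j => mix_rec Y q 1 j HY)).
assert (PN : mix Y q N = mix Y q 0).
{ unfold mix; rewrite Nat.mul_comm, (pow_one _ _ _ Hq); easy. }
(* N odd is what produces the minus sign; with + 1 the value at 0 would drop out of the relation. *)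
assert (NN : nrm q N = - (1)).
{ unfold nrm; rewrite Hq; replace (6 * N ^ 2)%nat with (N * (6 * N))%nat by (simpl; lia).
  rewrite Cpow_inv, (pow_one _ _ _ Hq) by exact q0.
  destruct HN as [m ->]; rewrite Cm1_pow_odd; field; apply C1_neq0. }
rewrite PN, NN in R.
replace (Csum (theta_term q) N) with (2 * mix Y q 0).
2: { replace (2 * mix Y q 0) with (mix Y q 0 - (- (1) * mix Y q 0)) by ring; rewrite R; ring. }
f_equal; unfold mix, Y; simpl (q ^ (2 * 0)).
rewrite !Cmult_1_r.
rewrite <- !Csum_scal, <- Csum_plus, <- Csum_scal; apply Csum_ext; intros n Hn.
unfold posterm.
assert (K := Ci_neq0).
replace (q / Ci) with (- Ci * q).
2: { replace (- Ci * q) with (- (Ci * Ci) * q * / Ci) by (field; exact K); rewrite Ci2; field; exact K. }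
replace (q / - Ci) with (Ci * q).
2: { replace (Ci * q) with ((Ci * Ci) * q * / Ci) by (field; exact K); rewrite Ci2; field; exact K. }
rewrite !qpoch_S_l, <- !qpoch_i.
assert (A : forall e k, e = Ci \/ e = - Ci -> qpoch (e * q) q k <> 0).
{ intros e k He; apply qpoch_nz; intros j _; rewrite <- Cmult_assoc.
  apply (pm_i_root q e N (S j) HN Hq He). }
assert (A1 := A Ci n ltac:(tauto)); assert (A2 := A (- Ci) n ltac:(tauto)).
assert (B1 : 1 - Ci <> 0) by (intros E; apply (f_equal Re) in E; simpl in E; lra).
assert (B2 : 1 - - Ci <> 0) by (intros E; apply (f_equal Re) in E; simpl in E; lra).
assert (B3 : 1 + Ci <> 0) by (intros E; apply (f_equal Re) in E; simpl in E; lra).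
generalize dependent (qpoch (Ci * q) q n); intros P1 HP1.
generalize dependent (qpoch (- Ci * q) q n); intros P2 HP2.
field; repeat split; try assumption; try apply two_neq0.
Qed.

Lemma psi_root (q : C) (m : nat) :
  (0 < m)%nat -> q ^ (2 * m) = - (1) -> ~ (Cmod q < 1)%R ->
  psi q = Csum (fun n => q ^ S n * qpoch (- q ^ 2) (q ^ 2) n) (4 * m).
Proof.
intros Hm Hq H1; unfold psi; destruct (Rlt_dec (Cmod q) 1) as [L|_]; [easy|].
rewrite (CSeries_finite _ (4 * m)).
- apply Csum_ext; intros; rewrite Nat.add_1_r; easy.
- intros n Hn; rewrite (qpoch_zero _ _ (m - 1)); [ring|lia|].
  replace (- q ^ 2 * (q ^ 2) ^ (m - 1)) with (- (q ^ (2 * m))); [rewrite Hq; ring|].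
  rewrite Cpow_mult_r; destruct m as [|m]; [lia|].
  simpl (S m - 1)%nat; rewrite Nat.sub_0_r; simpl; ring.
Qed.

(** The terms at negative indices replace those of Y: at z = i and z = -i they are multiples of the
    terms of the second series of psi, and [mix] at 0 is 2 psi. After 2 m steps [nrm] is -1 again,
    this time because q^(2 m) = -1. *)
Lemma psi_theta (q : C) (m : nat) :
  (0 < m)%nat -> q ^ (2 * m) = - (1) -> ~ (Cmod q < 1)%R ->
  - (4) * psi q = Csum (theta_term q) (2 * m).
Proof.
intros Hm Hq H1; rewrite (psi_root q m Hm Hq H1).
assert (Hq4 : q ^ (4 * m) = 1).
{ replace (4 * m)%nat with (2 * m * 2)%nat by lia; rewrite Cpow_mult_r, Hq; ring. }
assert (q0 : q <> 0) by (apply (root_neq0 q 1 (4 * m) ltac:(lia) C1_neq0 Hq4)).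
set (Y := fun z => Csum (negterm q z) (4 * m)).
assert (HY : forall (e : C) (j : nat), e = Ci \/ e = - Ci ->
     Y (q * (e * q ^ j)) = -1 * (1 - q * (e * q ^ j) ^ 2) - q * (e * q ^ j) ^ 3 * Y (e * q ^ j)).
{ intros e j He; unfold Y.
  assert (E0 := pm_i_neq0 e He); assert (Qi := Cpow_nz q j q0).
  assert (z0 : e * q ^ j <> 0) by (apply Cmult_neq_0; assumption).
  set (z := e * q ^ j) in *.
  assert (T := Csum_telescope (fun n => negterm q (q * z) n + q * z ^ 3 * negterm q z n)
      (fun n => (1 - q * z ^ 2) * qpoch (z * q) q n * qpoch (/ z) q n) (4 * m)).
  rewrite Csum_plus, Csum_scal in T.
  assert (Z : qpoch (z * q) q (4 * m) = 0).
  (* Since (q^m)^2 = -1 = e^2, e is q^m or - q^m = q^(3 m). So z q is a power of q, and a product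
     over the whole period 4 m must contain a zero factor. *)
  { assert (exists r, e = q ^ r) as [r Hr].
    { assert (F : (e - q ^ m) * (e + q ^ m) = 0).
      { replace ((e - q ^ m) * (e + q ^ m)) with (e * e - q ^ m * q ^ m) by ring.
        rewrite (pm_i_sq e He), <- Cpow_add_r; replace (m + m)%nat with (2 * m)%nat by lia; rewrite Hq.
        unfold RtoC, Cminus, Cplus, Copp; simpl; f_equal; ring. }
      destruct (Ceq_dec (e - q ^ m) 0) as [A|A].
      - exists m; rewrite <- (Cplus_0_l (q ^ m)), <- A; ring.
      - destruct (Ceq_dec (e + q ^ m) 0) as [B|B].
        + exists (2 * m + m)%nat; rewrite Cpow_add_r, Hq.
          replace e with (e + q ^ m - q ^ m) by ring; rewrite B; ring.
        + exfalso; apply (Cmult_neq_0 _ _ A B F). }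
    (* The index of the vanishing factor is - k modulo 4 m, written without subtraction as (4 m - 1)
       k modulo 4 m. *)
    set (k := (r + j + 1)%nat).
    apply (qpoch_zero _ _ ((4 * m - 1) * k mod (4 * m))); [apply Nat.mod_upper_bound; lia|].
    unfold z; rewrite Hr.
    replace (q ^ r * q ^ j * q) with (q ^ k) by (unfold k; rewrite !Cpow_add_r; simpl; ring).
    assert (D := Nat.div_mod ((4 * m - 1) * k) (4 * m) ltac:(lia)).
    set (d := ((4 * m - 1) * k / (4 * m))%nat) in *.
    set (x := ((4 * m - 1) * k mod (4 * m))%nat) in *.
    rewrite <- Cpow_add_r; transitivity (q ^ (4 * m * d + (k + x))).
    { rewrite (Cpow_add_r q (4 * m * d)), (pow_one _ _ d Hq4); ring. }
    replace (4 * m * d + (k + x))%nat with (4 * m * k)%nat by nia.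
    apply (pow_one _ _ _ Hq4). }
  rewrite Z in T; simpl (qpoch _ _ 0) in T.
  rewrite <- (Cplus_0_r (Csum (negterm q (q * z)) (4 * m))).
  replace (RtoC 0) with (q * z ^ 3 * Csum (negterm q z) (4 * m) - q * z ^ 3 * Csum (negterm q z) (4 * m)) by ring.
  unfold Cminus at 1; rewrite Cplus_assoc, T; [|intros; rewrite negterm_telescope by assumption; ring].
  rewrite RtoC_m1.
  ring. }
assert (R := mix_theta q (-1) (mix Y q) (2 * m) q0 (fun j => mix_rec Y q (-1) j HY)).
assert (PN : mix Y q (2 * m) = mix Y q 0).
{ unfold mix; replace (2 * (2 * m))%nat with (4 * m)%nat by lia; rewrite Hq4; easy. }
assert (NN : nrm q (2 * m) = - (1)).
{ unfold nrm; rewrite Hq, Cm1_pow_even.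
  replace (6 * (2 * m) ^ 2)%nat with (4 * m * (6 * m))%nat by (simpl; lia).
  rewrite Cpow_inv, (pow_one _ _ _ Hq4) by exact q0; field; apply C1_neq0. }
rewrite PN, NN in R.
replace (Csum (theta_term q) (2 * m)) with (- (2) * mix Y q 0).
2: { rewrite RtoC_m1 in R.
     replace (- (2) * mix Y q 0) with (- (1) * mix Y q 0 - mix Y q 0) by ring; rewrite R; ring. }
replace (- (4)) with (- (2) * 2) by ring; rewrite <- Cmult_assoc; f_equal.
unfold mix, Y; simpl (q ^ (2 * 0)); rewrite !Cmult_1_r.
rewrite <- !Csum_scal, <- Csum_plus, <- Csum_scal; apply Csum_ext; intros n Hn.
unfold negterm.
replace (/ Ci) with (- Ci).
2: { replace (- Ci) with (- (Ci * Ci) * / Ci) by (field; apply Ci_neq0); rewrite Ci2; field; apply Ci_neq0. }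
replace (/ - Ci) with Ci.
2: { replace Ci with ((Ci * Ci) * / Ci) at 1 by (field; apply Ci_neq0); rewrite Ci2; field; apply Ci_neq0. }
rewrite !qpoch_S_l, <- !qpoch_i.
generalize (qpoch (Ci * q) q n) (qpoch (- Ci * q) q n); intros P1 P2.
replace (/ 2 * ((1 - Ci) * (q ^ S n * P1 * ((1 - - Ci) * P2)) + (1 + Ci) * (q ^ S n * P2 * ((1 - Ci) * P1))))
  with ((1 - Ci * Ci) * q ^ S n * P1 * P2) by (field; apply two_neq0).
rewrite Ci2, RtoC_m1; ring.
Qed.

End RootsOfUnity.

(** * Complex-valued functions of a real variable *)

Lemma im_le_Cmod (c : C) : Rabs (Im c) <= Cmod c.
Proof. eapply Rle_trans; [apply Rmax_r|apply Rmax_Cmod]. Qed.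

Lemma Cmod_le_abs (c : C) : Cmod c <= Rabs (Re c) + Rabs (Im c).
Proof.
replace c with (RtoC (Re c) + Ci * RtoC (Im c))%C at 1.
- eapply Rle_trans; [apply Cmod_triangle|].
  rewrite Cmod_mult, Cmod_Ci, !Cmod_R; lra.
- destruct c as [a b]; unfold Ci, RtoC, Cplus, Cmult; simpl; f_equal; ring.
Qed.

Definition CD (f : R -> C) (x : R) (l : C) : Prop :=
  is_derive (fun t => Re (f t)) x (Re l) /\ is_derive (fun t => Im (f t)) x (Im l).

Lemma CD_eq f x l l' : CD f x l -> l = l' -> CD f x l'.
Proof. intros H <-; exact H. Qed.

Lemma CD_ext f g x l : (forall t, f t = g t) -> CD f x l -> CD g x l.
Proof.
intros E [H1 H2]; split; [eapply is_derive_ext; [|exact H1]|eapply is_derive_ext; [|exact H2]];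
  intros t; simpl; now rewrite E.
Qed.

Lemma CD_const (c : C) x : CD (fun _ => c) x (RtoC 0).
Proof. split; simpl; apply @is_derive_const. Qed.

Lemma CD_RtoC f x l : is_derive f x l -> CD (fun t => RtoC (f t)) x (RtoC l).
Proof. intros H; split; simpl; [exact H|apply @is_derive_const]. Qed.

Lemma CD_id x : CD (fun t => RtoC t) x (RtoC 1).
Proof. apply (CD_RtoC (fun t => t)); apply @is_derive_id. Qed.

Lemma CD_plus f g x l m : CD f x l -> CD g x m -> CD (fun t => f t + g t)%C x (l + m)%C.
Proof.
intros [A B] [A' B']; split; simpl.
- exact (is_derive_plus _ _ x _ _ A A').
- exact (is_derive_plus _ _ x _ _ B B').
Qed.

Lemma CD_opp f x l : CD f x l -> CD (fun t => - f t)%C x (- l)%C.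
Proof.
intros [A B]; split; simpl.
- exact (is_derive_opp _ x _ A).
- exact (is_derive_opp _ x _ B).
Qed.

Lemma CD_minus f g x l m : CD f x l -> CD g x m -> CD (fun t => f t - g t)%C x (l - m)%C.
Proof. intros H K; apply CD_plus; [exact H|apply CD_opp, K]. Qed.

Lemma is_derive_mult_R (f g : R -> R) (x l m : R) :
  is_derive f x l -> is_derive g x m -> is_derive (fun t => f t * g t) x (l * g x + f x * m).
Proof.
intros H K; exact (is_derive_mult f g x l m H K Rmult_comm).
Qed.

Lemma is_derive_eq (f : R -> R) x l l' : is_derive f x l -> l = l' -> is_derive f x l'.
Proof. intros H <-; exact H. Qed.

Lemma CD_mult f g x l m : CD f x l -> CD g x m ->
  CD (fun t => f t * g t)%C x (l * g x + f x * m)%C.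
Proof.
intros [A B] [A' B']; split; simpl.
- eapply is_derive_eq.
  { exact (is_derive_minus _ _ x _ _ (is_derive_mult_R _ _ _ _ _ A A') (is_derive_mult_R _ _ _ _ _ B B')). }
  unfold minus, plus, opp; simpl; unfold Re, Im; ring.
- eapply is_derive_eq.
  { exact (is_derive_plus _ _ x _ _ (is_derive_mult_R _ _ _ _ _ A B') (is_derive_mult_R _ _ _ _ _ B A')). }
  unfold minus, plus, opp; simpl; unfold Re, Im; ring.
Qed.

Lemma CD_scal (c : C) f x l : CD f x l -> CD (fun t => c * f t)%C x (c * l)%C.
Proof. intros H; eapply CD_eq; [apply CD_mult; [apply CD_const|exact H]|cbv beta; ring]. Qed.

Lemma CD_comp f (g : R -> R) x l d :
  CD f (g x) l -> is_derive g x d -> CD (fun t => f (g t)) x (d * l)%C.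
Proof.
intros [A B] G; split; simpl.
- eapply is_derive_eq; [exact (is_derive_comp (fun t => Re (f t)) g x _ _ A G)|].
  unfold scal; simpl; unfold mult; simpl; unfold Re; ring.
- eapply is_derive_eq; [exact (is_derive_comp (fun t => Im (f t)) g x _ _ B G)|].
  unfold scal; simpl; unfold mult; simpl; unfold Im; ring.
Qed.

Lemma CD_Cexp f x l : CD f x l -> CD (fun t => Cexp (f t)) x (l * Cexp (f x))%C.
Proof.
intros [A B]; split; unfold Cexp; simpl.
- eapply is_derive_eq.
  { apply is_derive_mult_R.
    - exact (is_derive_comp exp _ x _ _ (is_derive_exp _) A).
    - exact (is_derive_comp cos _ x _ _ (is_derive_cos _) B). }
  unfold scal; simpl; unfold mult; simpl; unfold Re, Im; ring.
- eapply is_derive_eq.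
  { apply is_derive_mult_R.
    - exact (is_derive_comp exp _ x _ _ (is_derive_exp _) A).
    - exact (is_derive_comp sin _ x _ _ (is_derive_sin _) B). }
  unfold scal; simpl; unfold mult; simpl; unfold Re, Im; ring.
Qed.

Lemma CD_inv f x l : f x <> RtoC 0 -> CD f x l -> CD (fun t => / f t)%C x (- (l / (f x * f x)))%C.
Proof.
intros Hf [A B].
assert (N : Re (f x) ^ 2 + Im (f x) ^ 2 <> 0).
{ intros E; apply Hf; destruct (f x) as [a b]; simpl in E.
  assert (a = 0) by nra; assert (b = 0) by nra; subst; easy. }
assert (D : is_derive (fun t => Re (f t) ^ 2 + Im (f t) ^ 2) x
   (2 * Re l * Re (f x) + 2 * Im l * Im (f x))).
{ apply (is_derive_ext (fun t => Re (f t) * Re (f t) + Im (f t) * Im (f t))); [intros t; simpl; ring|].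
  eapply is_derive_eq;
    [exact (is_derive_plus _ _ x _ _ (is_derive_mult_R _ _ _ _ _ A A) (is_derive_mult_R _ _ _ _ _ B B))|].
  unfold plus; simpl; ring. }
assert (Dn : forall u : R, u = Re (f x) ^ 2 + Im (f x) ^ 2 -> u <> 0) by (intros u ->; exact N).
split; unfold Cinv; simpl.
- eapply is_derive_eq.
  { exact (is_derive_div (fun t => Re (f t)) _ x _ _ A D N). }
  unfold Re, Im in *; destruct (f x) as [a b], l as [c d]; simpl in *; field.
  split; [|nra]. intros E; apply N; nra.
- eapply is_derive_eq.
  { exact (is_derive_div (fun t => - Im (f t)) _ x _ _ (is_derive_opp _ x _ B) D N). }
  unfold opp; simpl; unfold Re, Im in *; destruct (f x) as [a b], l as [c d]; simpl in *; field.
  split; [|nra]. intros E; apply N; nra.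
Qed.

(** This is the form in which differentiability under an integral sign arrives: Taylor's formula for
    the integrand leaves a remainder of order h^2. *)
Lemma CD_quad (f : R -> C) (x : R) (l : C) (K d0 : R) :
  0 < d0 -> (forall h, Rabs h < d0 -> Cmod (f (x + h)%R - f x - h * l)%C <= K * h ^ 2) -> CD f x l.
Proof.
intros Hd H.
assert (G : forall (p : C -> R), (forall a b, p (a - b)%C = p a - p b) ->
   (forall (h : R) a, p (h * a)%C = h * p a) -> (forall a, Rabs (p a) <= Cmod a) ->
   is_derive (fun t => p (f t)) x (p l)).
{ intros p P1 P2 P3; apply is_derive_Reals; intros eps He.
  assert (0 < Rmin d0 (eps / (Rabs K + 1))).
  { apply Rmin_glb_lt; [exact Hd|]; apply Rdiv_lt_0_compat; [exact He|]; pose proof (Rabs_pos K); lra. }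
  exists (mkposreal _ H0); intros h Hh0 Hh; simpl in Hh.
  assert (Hh1 : Rabs h < d0) by (eapply Rlt_le_trans; [exact Hh|apply Rmin_l]).
  assert (Hh2 : Rabs h < eps / (Rabs K + 1)) by (eapply Rlt_le_trans; [exact Hh|apply Rmin_r]).
  specialize (H h Hh1); eapply Rle_trans in H; [|apply P3].
  rewrite !P1, P2 in H.
  replace ((p (f (x + h)) - p (f x)) / h - p l) with ((p (f (x + h)) - p (f x) - h * p l) / h) by (field; exact Hh0).
  unfold Rdiv; rewrite Rabs_mult, Rabs_inv.
  assert (0 < Rabs h) by (apply Rabs_pos_lt; exact Hh0).
  apply Rle_lt_trans with (Rabs K * Rabs h).
  - apply Rle_trans with (K * h ^ 2 * / Rabs h).
    + apply Rmult_le_compat_r; [left; apply Rinv_0_lt_compat; lra|exact H].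
    + rewrite <- (pow2_abs h); simpl; replace (K * (Rabs h * (Rabs h * 1)) * / Rabs h) with (K * Rabs h) by (field; lra).
      apply Rmult_le_compat_r; [lra|apply Rle_abs].
  - pose proof (Rabs_pos K).
    apply Rle_lt_trans with ((Rabs K + 1) * Rabs h); [nra|].
    apply (Rmult_lt_compat_l (Rabs K + 1)) in Hh2; [|lra].
    replace ((Rabs K + 1) * (eps / (Rabs K + 1))) with eps in Hh2 by (field; lra); lra. }
split.
- apply (G Re); [intros; destruct a, b; simpl; ring|intros; destruct a; simpl; ring|apply re_le_Cmod].
- apply (G Im); [intros; destruct a, b; simpl; ring|intros; destruct a; simpl; ring|apply im_le_Cmod].
Qed.

Lemma RMVT (f df : R -> R) (a b M : R) :
  a <= b -> (forall x, a <= x <= b -> is_derive f x (df x)) ->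
  (forall x, a <= x <= b -> Rabs (df x) <= M) -> Rabs (f b - f a) <= M * (b - a).
Proof.
intros Hab D HM.
destruct (MVT_gen f a b df) as [c [Hc E]].
- intros x Hx; rewrite Rmin_left, Rmax_right in Hx by exact Hab; apply D; lra.
- intros x Hx; rewrite Rmin_left, Rmax_right in Hx by exact Hab.
  apply continuity_pt_filterlim; apply (@ex_derive_continuous R_AbsRing R_NormedModule).
  eexists; apply D; lra.
- rewrite Rmin_left, Rmax_right in Hc by exact Hab.
  rewrite E, Rabs_mult, (Rabs_pos_eq (b - a)) by lra.
  apply Rmult_le_compat_r; [lra|apply HM, Hc].
Qed.

(** The mean value theorem holds for real and imaginary part separately, at different points; hence
    the factor 2. *)
Lemma CMVT (f df : R -> C) (a b M : R) :
  a <= b -> (forall x, a <= x <= b -> CD f x (df x)) ->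
  (forall x, a <= x <= b -> Cmod (df x) <= M) -> Cmod (f b - f a)%C <= 2 * M * (b - a).
Proof.
intros Hab D HM; eapply Rle_trans; [apply Cmod_le_abs|].
assert (A := RMVT (fun t => Re (f t)) (fun t => Re (df t)) a b M Hab
  (fun x Hx => proj1 (D x Hx)) (fun x Hx => Rle_trans _ _ _ (re_le_Cmod _) (HM x Hx))).
assert (B := RMVT (fun t => Im (f t)) (fun t => Im (df t)) a b M Hab
  (fun x Hx => proj2 (D x Hx)) (fun x Hx => Rle_trans _ _ _ (im_le_Cmod _) (HM x Hx))).
replace (Re (f b - f a)%C) with (Re (f b) - Re (f a)) by (destruct (f a), (f b); simpl; ring).
replace (Im (f b - f a)%C) with (Im (f b) - Im (f a)) by (destruct (f a), (f b); simpl; ring).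
lra.
Qed.

Lemma CMVT_abs (f df : R -> C) (lo hi a b M : R) :
  lo <= a <= hi -> lo <= b <= hi -> (forall x, lo <= x <= hi -> CD f x (df x)) ->
  (forall x, lo <= x <= hi -> Cmod (df x) <= M) -> Cmod (f b - f a)%C <= 2 * M * Rabs (b - a).
Proof.
intros Ha Hb D HM; destruct (Rle_dec a b) as [L|L].
- rewrite Rabs_pos_eq by lra; apply (CMVT f df); [lra| |]; intros; [apply D|apply HM]; lra.
- replace (f b - f a)%C with (- (f a - f b))%C by ring; rewrite Cmod_opp, Rabs_minus_sym, Rabs_pos_eq by lra.
  apply (CMVT f df); [lra| |]; intros; [apply D|apply HM]; lra.
Qed.

(** The mean value bound is applied to f minus its tangent at a, and then to [f1]; each use costs a
    factor 2, hence 4 in place of 1/2. *)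
Lemma CTaylor2 (f f1 f2 : R -> C) (lo hi a b M : R) :
  lo <= a <= hi -> lo <= b <= hi ->
  (forall x, lo <= x <= hi -> CD f x (f1 x)) -> (forall x, lo <= x <= hi -> CD f1 x (f2 x)) ->
  (forall x, lo <= x <= hi -> Cmod (f2 x) <= M) ->
  Cmod (f b - f a - RtoC (b - a) * f1 a)%C <= 4 * M * (b - a) ^ 2.
Proof.
intros Ha Hb D1 D2 HM.
assert (M0 : 0 <= M) by (eapply Rle_trans; [apply Cmod_ge_0|apply (HM a Ha)]).
set (lo' := Rmin a b); set (hi' := Rmax a b).
assert (I : lo <= lo' /\ hi' <= hi).
{ split; [apply Rmin_glb; lra|apply Rmax_lub; lra]. }
assert (L : lo' <= a <= hi') by (split; [apply Rmin_l|apply Rmax_l]).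
assert (L' : lo' <= b <= hi') by (split; [apply Rmin_r|apply Rmax_r]).
assert (W : hi' - lo' = Rabs (b - a)).
{ unfold lo', hi'; destruct (Rle_dec a b).
  - rewrite Rmax_right, Rmin_left, Rabs_pos_eq; lra.
  - rewrite Rmax_left, Rmin_right, Rabs_minus_sym, Rabs_pos_eq; lra. }
replace (f b - f a - RtoC (b - a) * f1 a)%C
  with ((f b - RtoC (b - a) * f1 a) - (f a - RtoC (a - a) * f1 a))%C.
2: { replace (a - a) with 0 by ring; ring. }
replace (4 * M * (b - a) ^ 2) with (2 * (2 * M * Rabs (b - a)) * Rabs (b - a))
  by (rewrite <- (pow2_abs (b - a)); ring).
apply (CMVT_abs (fun x => f x - RtoC (x - a) * f1 a)%C (fun x => f1 x - f1 a)%C lo' hi'); try assumption.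
- intros x Hx; eapply CD_eq.
  + apply CD_minus; [apply D1; lra|].
    apply CD_mult; [|apply CD_const].
    apply (CD_RtoC (fun x => x - a) x 1); auto_derive; [easy|ring].
  + simpl; ring.
- intros x Hx; eapply Rle_trans.
  + apply (CMVT_abs f1 f2 lo hi a x M); try lra; assumption.
  + apply Rmult_le_compat_l; [lra|]; rewrite <- W; apply Rabs_le; lra.
Qed.

(** * Integrals *)

Definition Ccont (f : R -> C) : Prop :=
  forall x, continuous (fun t => Re (f t)) x /\ continuous (fun t => Im (f t)) x.

Lemma CD_Ccont f (df : R -> C) : (forall x, CD f x (df x)) -> Ccont f.
Proof.
intros H x; destruct (H x) as [A B]; split;
  apply (@ex_derive_continuous R_AbsRing R_NormedModule); eexists; eassumption.
Qed.

Lemma Ccont_const c : Ccont (fun _ => c).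
Proof. intros x; split; apply continuous_const. Qed.

Lemma Ccont_RtoC f : (forall x, continuous f x) -> Ccont (fun t => RtoC (f t)).
Proof. intros H x; split; [apply H|apply continuous_const]. Qed.

Lemma Ccont_plus f g : Ccont f -> Ccont g -> Ccont (fun t => f t + g t)%C.
Proof.
intros F G x; split; simpl.
- exact (continuous_plus _ _ x (proj1 (F x)) (proj1 (G x))).
- exact (continuous_plus _ _ x (proj2 (F x)) (proj2 (G x))).
Qed.

Lemma Ccont_mult f g : Ccont f -> Ccont g -> Ccont (fun t => f t * g t)%C.
Proof.
intros F G x; destruct (F x) as [F1 F2], (G x) as [G1 G2]; split; simpl.
- exact (continuous_minus _ _ x (continuous_mult _ _ x F1 G1) (continuous_mult _ _ x F2 G2)).
- exact (continuous_plus _ _ x (continuous_mult _ _ x F1 G2) (continuous_mult _ _ x F2 G1)).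
Qed.

Lemma Ccont_scal c f : Ccont f -> Ccont (fun t => c * f t)%C.
Proof. intros H; apply Ccont_mult; [apply Ccont_const|exact H]. Qed.

Lemma Ccont_minus f g : Ccont f -> Ccont g -> Ccont (fun t => f t - g t)%C.
Proof.
intros F G x; split; simpl.
- exact (continuous_minus _ _ x (proj1 (F x)) (proj1 (G x))).
- exact (continuous_minus _ _ x (proj2 (F x)) (proj2 (G x))).
Qed.

Definition isCI (f : R -> C) (a b : R) (l : C) : Prop :=
  is_RInt (V := C_R_NormedModule) f a b l.

Lemma isCI_pair f a b l :
  is_RInt (fun t => Re (f t)) a b (Re l) -> is_RInt (fun t => Im (f t)) a b (Im l) -> isCI f a b l.
Proof. intros H K; destruct l; exact (is_RInt_fct_extend_pair f a b _ _ H K). Qed.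

Lemma isCI_Re f a b l : isCI f a b l -> is_RInt (fun t => Re (f t)) a b (Re l).
Proof. exact (is_RInt_fct_extend_fst f a b l). Qed.

Lemma isCI_Im f a b l : isCI f a b l -> is_RInt (fun t => Im (f t)) a b (Im l).
Proof. exact (is_RInt_fct_extend_snd f a b l). Qed.

Lemma isCI_unique f a b l m : isCI f a b l -> isCI f a b m -> l = m.
Proof.
intros H K; destruct l, m; f_equal.
- exact (eq_trans (eq_sym (is_RInt_unique _ _ _ _ (isCI_Re _ _ _ _ H))) (is_RInt_unique _ _ _ _ (isCI_Re _ _ _ _ K))).
- exact (eq_trans (eq_sym (is_RInt_unique _ _ _ _ (isCI_Im _ _ _ _ H))) (is_RInt_unique _ _ _ _ (isCI_Im _ _ _ _ K))).
Qed.

Lemma isCI_plus f g a b l m : isCI f a b l -> isCI g a b m -> isCI (fun t => f t + g t)%C a b (l + m)%C.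
Proof. intros H K; exact (is_RInt_plus f g a b l m H K). Qed.

Lemma isCI_scal c f a b l : isCI f a b l -> isCI (fun t => c * f t)%C a b (c * l)%C.
Proof.
intros H; apply isCI_pair; simpl.
- exact (is_RInt_minus _ _ _ _ _ _ (is_RInt_scal _ _ _ (Re c) _ (isCI_Re _ _ _ _ H))
   (is_RInt_scal _ _ _ (Im c) _ (isCI_Im _ _ _ _ H))).
- exact (is_RInt_plus _ _ _ _ _ _ (is_RInt_scal _ _ _ (Re c) _ (isCI_Im _ _ _ _ H))
   (is_RInt_scal _ _ _ (Im c) _ (isCI_Re _ _ _ _ H))).
Qed.

Lemma isCI_ext f g a b l : (forall x, Rmin a b < x < Rmax a b -> f x = g x) -> isCI f a b l -> isCI g a b l.
Proof. intros E H; exact (is_RInt_ext f g a b l E H). Qed.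

Lemma isCI_Chasles f a b c l m : isCI f a b l -> isCI f b c m -> isCI f a c (l + m)%C.
Proof. intros H K; exact (is_RInt_Chasles f a b c l m H K). Qed.

Lemma isCI_cont f a b : Ccont f -> exists l, isCI f a b l.
Proof.
intros H.
assert (A : ex_RInt (fun t => Re (f t)) a b) by (apply @ex_RInt_continuous; intros; apply H).
assert (B : ex_RInt (fun t => Im (f t)) a b) by (apply @ex_RInt_continuous; intros; apply H).
destruct A as [u A], B as [v B]; exists (u, v); apply isCI_pair; assumption.
Qed.

Definition CI (f : R -> C) (a b : R) : C :=
  (RInt (fun t => Re (f t)) a b, RInt (fun t => Im (f t)) a b).

Lemma isCI_CI f a b l : isCI f a b l -> CI f a b = l.
Proof.
intros H; destruct l; unfold CI; f_equal.
- exact (is_RInt_unique _ _ _ _ (isCI_Re _ _ _ _ H)).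
- exact (is_RInt_unique _ _ _ _ (isCI_Im _ _ _ _ H)).
Qed.

Lemma CI_correct f a b : Ccont f -> isCI f a b (CI f a b).
Proof. intros H; destruct (isCI_cont f a b H) as [l L]; now rewrite (isCI_CI _ _ _ _ L). Qed.

Lemma isCI_FTC F f a b :
  (forall x, Rmin a b <= x <= Rmax a b -> CD F x (f x)) ->
  (forall x, Rmin a b <= x <= Rmax a b -> continuous (fun t => Re (f t)) x /\ continuous (fun t => Im (f t)) x) ->
  isCI f a b (F b - F a)%C.
Proof.
intros D K; apply isCI_pair; simpl.
- apply (is_RInt_derive (fun t => Re (F t)) (fun t => Re (f t))); intros; [apply D|apply K]; assumption.
- apply (is_RInt_derive (fun t => Im (F t)) (fun t => Im (f t))); intros; [apply D|apply K]; assumption.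
Qed.

Lemma norm_Cmod (x : C) : norm (V := C_R_NormedModule) x = Cmod x.
Proof.
unfold norm; simpl; unfold prod_norm, Cmod; f_equal; destruct x as [a b]; simpl fst; simpl snd.
unfold norm; simpl; unfold abs; simpl; assert (A := pow2_abs a); assert (B := pow2_abs b); simpl in A, B; simpl; lra.
Qed.

Lemma isCI_bound f g a b l m :
  a <= b -> (forall x, a <= x <= b -> Cmod (f x) <= g x) -> isCI f a b l -> is_RInt g a b m ->
  Cmod l <= m.
Proof.
intros Hab H K G; rewrite <- norm_Cmod.
apply (norm_RInt_le (V := C_R_NormedModule) f g a b l m Hab); try assumption.
intros x Hx; rewrite norm_Cmod; apply H, Hx.
Qed.

Lemma isCI_bound_const f a b l M :
  a <= b -> (forall x, a <= x <= b -> Cmod (f x) <= M) -> isCI f a b l -> Cmod l <= M * (b - a).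
Proof.
intros Hab H K; rewrite Rmult_comm; apply (isCI_bound f (fun _ => M) a b l _ Hab H K).
exact (is_RInt_const a b M).
Qed.

Lemma is_RInt_exp_scal (B b x y : R) : b <> 0 ->
  is_RInt (fun t => B * exp (- b * t)) x y (B / b * (exp (- b * x) - exp (- b * y))).
Proof.
intros Hb.
replace (B / b * (exp (- b * x) - exp (- b * y)))
  with (minus ((fun t => - B / b * exp (- b * t)) y) ((fun t => - B / b * exp (- b * t)) x)).
2: { cbv beta; change (- B / b * exp (- b * y) - - B / b * exp (- b * x) = B / b * (exp (- b * x) - exp (- b * y))); field; exact Hb. }
apply (is_RInt_derive (fun t => - B / b * exp (- b * t)) (fun t => B * exp (- b * t))); intros t _.
- auto_derive; [easy|field; exact Hb].
- apply (@ex_derive_continuous R_AbsRing R_NormedModule); auto_derive; easy.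
Qed.

(** * Integrals over the half line *)

Definition isI (f : R -> C) (J : C) : Prop :=
  forall eps, 0 < eps -> exists X0, forall X, X0 <= X -> exists l, isCI f 0 X l /\ Cmod (l - J)%C < eps.

Lemma isI_unique f J K : isI f J -> isI f K -> J = K.
Proof.
intros HJ HK; apply Ceq_minus, Cmod_eq_0, Rle_antisym; [|apply Cmod_ge_0].
apply le_epsilon; intros e He; rewrite Rplus_0_l.
destruct (HJ (e / 2) ltac:(lra)) as [X1 H1], (HK (e / 2) ltac:(lra)) as [X2 H2].
destruct (H1 (Rmax X1 X2) (Rmax_l _ _)) as [l [L1 L2]].
destruct (H2 (Rmax X1 X2) (Rmax_r _ _)) as [m [M1 M2]].
rewrite (isCI_unique _ _ _ _ _ M1 L1) in M2.
replace (J - K)%C with ((l - K) - (l - J))%C by ring.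
eapply Rle_trans; [apply Cmod_triangle|]; rewrite Cmod_opp; lra.
Qed.

Lemma isI_ext f g J : (forall x, 0 <= x -> f x = g x) -> isI f J -> isI g J.
Proof.
intros E H eps He; destruct (H eps He) as [X0 HX]; exists (Rmax X0 0); intros X HX'.
assert (X0 <= X) by (eapply Rle_trans; [apply Rmax_l|exact HX']).
assert (0 <= X) by (eapply Rle_trans; [apply Rmax_r|exact HX']).
destruct (HX X ltac:(lra)) as [l [L1 L2]]; exists l; split; [|exact L2].
apply (isCI_ext f g); [|exact L1]; intros x; rewrite Rmin_left, Rmax_right by lra; intros; apply E; lra.
Qed.

Lemma isI_plus f g J K : isI f J -> isI g K -> isI (fun x => f x + g x)%C (J + K)%C.
Proof.
intros HJ HK eps He.
destruct (HJ (eps / 2) ltac:(lra)) as [X1 H1], (HK (eps / 2) ltac:(lra)) as [X2 H2].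
exists (Rmax X1 X2); intros X HX.
destruct (H1 X) as [l [L1 L2]]; [eapply Rle_trans; [apply Rmax_l|exact HX]|].
destruct (H2 X) as [m [M1 M2]]; [eapply Rle_trans; [apply Rmax_r|exact HX]|].
exists (l + m)%C; split; [apply isCI_plus; assumption|].
replace (l + m - (J + K))%C with ((l - J) + (m - K))%C by ring.
eapply Rle_lt_trans; [apply Cmod_triangle|lra].
Qed.

Lemma isI_scal c f J : isI f J -> isI (fun x => c * f x)%C (c * J)%C.
Proof.
intros HJ eps He.
assert (P : 0 < Cmod c + 1) by (pose proof (Cmod_ge_0 c); lra).
destruct (HJ (eps / (Cmod c + 1))) as [X0 H0]; [apply Rdiv_lt_0_compat; lra|].
exists X0; intros X HX; destruct (H0 X HX) as [l [L1 L2]].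
exists (c * l)%C; split; [apply isCI_scal, L1|].
replace (c * l - c * J)%C with (c * (l - J))%C by ring; rewrite Cmod_mult.
apply Rle_lt_trans with ((Cmod c + 1) * Cmod (l - J)%C); [pose proof (Cmod_ge_0 (l - J)%C); nra|].
apply (Rmult_lt_compat_l (Cmod c + 1)) in L2; [|exact P].
replace ((Cmod c + 1) * (eps / (Cmod c + 1))) with eps in L2 by (field; lra); exact L2.
Qed.

Lemma exp_small (b eps B : R) : 0 < b -> 0 < eps -> exists X0, 0 <= X0 /\ forall X, X0 <= X -> B * exp (- b * X) < eps.
Proof.
intros Hb He.
exists (Rmax 0 (Rabs B / (eps * b))); split; [apply Rmax_l|]; intros X HX.
assert (0 <= X) by (eapply Rle_trans; [apply Rmax_l|exact HX]).
assert (H1 : Rabs B / (eps * b) <= X) by (eapply Rle_trans; [apply Rmax_r|exact HX]).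
assert (P : 0 < eps * b) by nra.
assert (H2 : Rabs B <= X * (eps * b)).
{ apply (Rmult_le_compat_r (eps * b)) in H1; [|lra].
  replace (Rabs B / (eps * b) * (eps * b)) with (Rabs B) in H1 by (field; lra); exact H1. }
assert (E : 1 + b * X <= exp (b * X)).
{ destruct (Req_dec (b * X) 0) as [->|N]; [rewrite exp_0; lra|left; apply exp_ineq1; exact N]. }
replace (- b * X) with (- (b * X)) by ring; rewrite exp_Ropp.
pose proof (exp_pos (b * X)); pose proof (Rle_abs B).
apply Rmult_lt_reg_r with (exp (b * X)); [lra|].
rewrite Rmult_assoc, Rinv_l, Rmult_1_r by lra; nra.
Qed.

Definition dominated (f : R -> C) (B b : R) : Prop :=
  forall x, 0 <= x -> Cmod (f x) <= B * exp (- b * x).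

Lemma dominated_pos f B b : dominated f B b -> 0 <= B.
Proof.
intros H; specialize (H 0 (Rle_refl 0)); rewrite Rmult_0_r, exp_0, Rmult_1_r in H.
eapply Rle_trans; [apply Cmod_ge_0|exact H].
Qed.

(** Cauchy's criterion is used along the integers, for the two components; the modulus e X survives
    the passage to the limit and gives the rate at every real X. *)
Lemma C_cauchy_lim (u : R -> C) (e : R -> R) (X0 : R) :
  0 <= X0 -> (forall eps, 0 < eps -> exists X1, X0 <= X1 /\ forall X, X1 <= X -> e X < eps) ->
  (forall X Y, X0 <= X -> X <= Y -> Cmod (u Y - u X)%C <= e X) ->
  exists K, forall X, X0 <= X -> Cmod (u X - K)%C <= e X.
Proof.
intros H0 He Bd.
assert (Cau : forall p : C -> R, (forall a b, p (a - b)%C = p a - p b) -> (forall a, Rabs (p a) <= Cmod a) ->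
   ex_finite_lim_seq (fun n => p (u (INR n)))).
{ intros p P1 P2; apply ex_lim_seq_cauchy_corr; intros eps.
  destruct (He eps (cond_pos eps)) as [X1 [HX1 HX]].
  destruct (nfloor_ex X1 ltac:(lra)) as [N0 [_ HN]].
  exists (S N0).
  assert (W : forall n m, (S N0 <= n)%nat -> (n <= m)%nat -> Rabs (p (u (INR m)) - p (u (INR n))) < eps).
  { intros n m Hn Hm; rewrite <- P1; eapply Rle_lt_trans; [apply P2|].
    apply le_INR in Hn; rewrite S_INR in Hn; apply le_INR in Hm.
    eapply Rle_lt_trans; [apply Bd; lra|apply HX; lra]. }
  intros n m Hn Hm; destruct (Nat.le_gt_cases n m) as [L|L].
  - rewrite Rabs_minus_sym; apply W; assumption.
  - apply W; [assumption|lia]. }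
destruct (Cau Re) as [v Hv]; [intros; destruct a, b; simpl; ring|apply re_le_Cmod|].
destruct (Cau Im) as [w Hw]; [intros; destruct a, b; simpl; ring|apply im_le_Cmod|].
exists (v, w); intros X HX.
apply le_epsilon; intros eps Heps.
apply is_lim_seq_spec in Hv; apply is_lim_seq_spec in Hw.
destruct (Hv (mkposreal (eps / 2) ltac:(lra))) as [N1 H1], (Hw (mkposreal (eps / 2) ltac:(lra))) as [N2 H2].
destruct (nfloor_ex X ltac:(lra)) as [N0 [_ HN0]].
set (n := max (max N1 N2) (S N0)).
assert (X <= INR n).
{ assert (G : (S N0 <= n)%nat) by apply Nat.le_max_r; apply le_INR in G; rewrite S_INR in G; lra. }
specialize (H1 n ltac:(lia)); specialize (H2 n ltac:(lia)).
change (Rabs (Re (u (INR n)) - v) < eps / 2) in H1.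
change (Rabs (Im (u (INR n)) - w) < eps / 2) in H2.
replace (u X - (v, w))%C with ((u (INR n) - (v, w)) - (u (INR n) - u X))%C by ring.
eapply Rle_trans; [apply Cmod_triangle|]; rewrite Cmod_opp.
specialize (Bd X (INR n) HX H).
assert (G := Cmod_le_abs (u (INR n) - (v, w))%C).
replace (Re (u (INR n) - (v, w))%C) with (Re (u (INR n)) - v) in G by (simpl; unfold Re; ring).
replace (Im (u (INR n) - (v, w))%C) with (Im (u (INR n)) - w) in G by (simpl; unfold Im; ring).
lra.
Qed.

Lemma CI_point f : CI f 0 0 = RtoC 0.
Proof. apply isCI_CI; exact (is_RInt_point f 0). Qed.

Lemma isI_exists (f : R -> C) (B b : R) :
  0 < b -> Ccont f -> dominated f B b -> exists J, isI f J /\ Cmod J <= B / b.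
Proof.
intros Hb Hc Hd.
assert (B0 := dominated_pos f B b Hd).
destruct (C_cauchy_lim (CI f 0) (fun x => B / b * exp (- b * x)) 0 (Rle_refl 0)) as [J HJ].
{ intros eps Heps; destruct (exp_small b eps (B / b) Hb Heps) as [X1 HX]; exists X1; exact HX. }
{ intros x y Hx Hxy.
  assert (E : CI f 0 y = (CI f 0 x + CI f x y)%C).
  { apply isCI_CI, (isCI_Chasles f 0 x y); apply CI_correct, Hc. }
  rewrite E; replace (CI f 0 x + CI f x y - CI f 0 x)%C with (CI f x y) by ring.
  eapply Rle_trans; [apply (isCI_bound f (fun t => B * exp (- b * t)) x y _ _ ltac:(lra)
      ltac:(intros; apply Hd; lra) (CI_correct f x y Hc) (is_RInt_exp_scal B b x y ltac:(lra)))|].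
  pose proof (exp_pos (- b * y)).
  assert (0 <= B / b) by (apply Rmult_le_pos; [lra|left; apply Rinv_0_lt_compat; lra]); nra. }
exists J; split.
- intros eps He; destruct (exp_small b eps (B / b) Hb He) as [X1 [HX1 HX]].
  exists X1; intros X HX'; exists (CI f 0 X); split; [apply CI_correct, Hc|].
  eapply Rle_lt_trans; [apply HJ; lra|apply HX, HX'].
- specialize (HJ 0 (Rle_refl 0)); rewrite CI_point, Rmult_0_r, exp_0, Rmult_1_r in HJ.
  replace (0 - J)%C with (- J)%C in HJ by ring; rewrite Cmod_opp in HJ; exact HJ.
Qed.

(* A junk value unless [isI f J] holds for some J. *)
Definition II (f : R -> C) : C :=
  (real (Lim_seq (fun n => RInt (fun t => Re (f t)) 0 (INR n))),
   real (Lim_seq (fun n => RInt (fun t => Im (f t)) 0 (INR n)))).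

Lemma isI_II f J : isI f J -> II f = J.
Proof.
intros H.
assert (G : forall p : C -> R, (forall a b, p (a - b)%C = p a - p b) -> (forall a, Rabs (p a) <= Cmod a) ->
  (forall X l, isCI f 0 X l -> is_RInt (fun t => p (f t)) 0 X (p l)) ->
  is_lim_seq (fun n => RInt (fun t => p (f t)) 0 (INR n)) (p J)).
{ intros p P1 P2 P3; apply is_lim_seq_spec; intros eps.
  destruct (H eps (cond_pos eps)) as [X0 HX].
  destruct (nfloor_ex (Rmax X0 0) (Rmax_r _ _)) as [N [_ HN]].
  exists (S N); intros n Hn.
  destruct (HX (INR n)) as [l [L1 L2]].
  { apply le_INR in Hn; rewrite S_INR in Hn; pose proof (Rmax_l X0 0); lra. }
  rewrite (is_RInt_unique _ _ _ _ (P3 _ _ L1)), <- P1.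
  eapply Rle_lt_trans; [apply P2|exact L2]. }
unfold II; destruct J as [u v]; f_equal.
- assert (A := G Re ltac:(intros; destruct a, b; simpl; ring) re_le_Cmod (fun X l => isCI_Re f 0 X l)).
  now rewrite (is_lim_seq_unique _ _ A).
- assert (A := G Im ltac:(intros; destruct a, b; simpl; ring) im_le_Cmod (fun X l => isCI_Im f 0 X l)).
  now rewrite (is_lim_seq_unique _ _ A).
Qed.

Lemma II_correct f B b : 0 < b -> Ccont f -> dominated f B b -> isI f (II f).
Proof. intros Hb Hc Hd; destruct (isI_exists f B b Hb Hc Hd) as [J [HJ _]]; now rewrite (isI_II _ _ HJ). Qed.

Lemma II_bound f B b : 0 < b -> Ccont f -> dominated f B b -> Cmod (II f) <= B / b.
Proof. intros Hb Hc Hd; destruct (isI_exists f B b Hb Hc Hd) as [J [HJ K]]; now rewrite (isI_II _ _ HJ). Qed.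

Lemma isI_FTC (F f : R -> C) (B b : R) :
  0 < b -> (forall x, CD F x (f x)) -> Ccont f -> dominated F B b -> isI f (- F 0)%C.
Proof.
intros Hb D Hc Hd eps He.
destruct (exp_small b eps B Hb He) as [X0 [X1 HX]].
exists X0; intros X HX'; exists (F X - F 0)%C; split.
- apply isCI_FTC; intros; [apply D|apply Hc].
- replace (F X - F 0 - - F 0)%C with (F X) by ring.
  eapply Rle_lt_trans; [apply Hd; lra|apply HX, HX'].
Qed.

Lemma CD_II (F F1 : R -> R -> C) (lo hi B b th : R) :
  0 < b -> lo < th < hi ->
  (forall t, lo <= t <= hi -> Ccont (F t) /\ Ccont (F1 t) /\ dominated (F t) B b /\ dominated (F1 t) B b) ->
  (forall s t, lo <= s <= hi -> lo <= t <= hi ->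
     dominated (fun x => F t x - F s x - RtoC (t - s) * F1 s x)%C (B * (t - s) ^ 2) b) ->
  CD (fun t => II (F t)) th (II (F1 th)).
Proof.
intros Hb Hth H1 H2.
apply (CD_quad _ _ _ (B / b) (Rmin (th - lo) (hi - th))); [apply Rmin_glb_lt; lra|].
intros h Hh.
assert (Rabs h < th - lo) by (eapply Rlt_le_trans; [exact Hh|apply Rmin_l]).
assert (Rabs h < hi - th) by (eapply Rlt_le_trans; [exact Hh|apply Rmin_r]).
apply Rabs_def2 in H; apply Rabs_def2 in H0.
destruct (H1 th ltac:(lra)) as [C1 [C2 [D1 D2]]], (H1 (th + h) ltac:(lra)) as [C3 [_ [D3 _]]].
specialize (H2 th (th + h) ltac:(lra) ltac:(lra)).
replace (th + h - th) with h in H2 by ring.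
assert (E : isI (fun x => F (th + h)%R x - F th x - RtoC h * F1 th x)%C
     (II (F (th + h)%R) - II (F th) - h * II (F1 th))%C).
{ apply (isI_ext (fun x => (F (th + h)%R x + -(1) * F th x) + (- RtoC h) * F1 th x)%C); [intros; ring|].
  replace (II (F (th + h)%R) - II (F th) - h * II (F1 th))%C
    with ((II (F (th + h)%R) + -(1) * II (F th)) + (- RtoC h) * II (F1 th))%C by ring.
  apply isI_plus; [apply isI_plus; [|apply isI_scal]|apply isI_scal];
    eapply II_correct; eassumption. }
rewrite <- (isI_II _ _ E).
replace (B / b * h ^ 2) with (B * h ^ 2 / b) by (field; lra).
apply II_bound; [exact Hb| |exact H2].
apply Ccont_minus; [apply Ccont_minus; assumption|apply Ccont_scal; assumption].
Qed.

Lemma isI_is_RInt_gen f J : Ccont f -> isI f J ->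
  is_RInt_gen (V := C_R_CompleteNormedModule) f (at_point 0) (Rbar_locally p_infty) J.
Proof.
intros Hc H P [eps HP].
assert (He := cond_pos eps).
destruct (H eps He) as [X0 HX].
apply Filter_prod with (Q := fun x => x = 0) (R := fun x => X0 < x).
- easy.
- exists X0; easy.
- intros x y -> Hy; exists (CI f 0 y); split; [exact (CI_correct f 0 y Hc)|].
  apply HP; destruct (HX y ltac:(lra)) as [l [L1 L2]].
  rewrite (isCI_CI _ _ _ _ L1).
  apply (norm_compat1 (V := C_R_NormedModule)).
  change (norm (V := C_R_NormedModule) (l - J)%C < eps); rewrite norm_Cmod; exact L2.
Qed.

Ltac cfield := field; repeat split; try assumption; try apply two_neq0;
  try apply Ci_neq0; try (let E := fresh in intros E; injection E; lra).

(** * Fresnel integrals *)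

Lemma Cexp_add (a b : C) : Cexp (a + b)%C = (Cexp a * Cexp b)%C.
Proof.
destruct a as [x y], b as [u v]; unfold Cexp, Cmult; simpl.
rewrite exp_plus, cos_plus, sin_plus; f_equal; ring.
Qed.

Lemma Cexp_0 : Cexp (RtoC 0) = RtoC 1.
Proof. unfold Cexp, RtoC; simpl; rewrite exp_0, cos_0, sin_0; f_equal; ring. Qed.

Lemma Cmod_Cexp (z : C) : Cmod (Cexp z) = exp (Re z).
Proof.
unfold Cexp, Cmod; simpl.
replace (exp (Re z) * cos (Im z) * (exp (Re z) * cos (Im z) * 1) + exp (Re z) * sin (Im z) * (exp (Re z) * sin (Im z) * 1))
  with (Rsqr (exp (Re z)) * ((Rsqr (sin (Im z))) + Rsqr (cos (Im z)))) by (unfold Rsqr; ring).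
rewrite sin2_cos2, Rmult_1_r, sqrt_Rsqr_abs; apply Rabs_pos_eq, Rlt_le, exp_pos.
Qed.

Lemma Cexp_neq0 (z : C) : Cexp z <> RtoC 0.
Proof. intros E; pose proof (Cmod_Cexp z) as H; rewrite E, Cmod_0 in H; pose proof (exp_pos (Re z)); lra. Qed.

Lemma Cexp_RtoC (x : R) : Cexp (RtoC x) = RtoC (exp x).
Proof. unfold Cexp, RtoC; simpl; rewrite cos_0, sin_0; f_equal; ring. Qed.

Lemma Cexp_opp (z : C) : Cexp (- z)%C = (/ Cexp z)%C.
Proof.
assert (E : (Cexp z * Cexp (- z) = 1)%C) by (rewrite <- Cexp_add, <- Cexp_0; f_equal; ring).
rewrite <- (Cmult_1_r (/ Cexp z)), <- E; field; apply Cexp_neq0.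
Qed.

Lemma Cexp_pow (z : C) (n : nat) : (Cexp z ^ n = Cexp (INR n * z))%C.
Proof.
induction n as [|n IH]; [simpl; rewrite Cmult_0_l, Cexp_0; easy|].
rewrite Cpow_S, IH, <- Cexp_add, S_INR, RtoC_plus; f_equal; ring.
Qed.

Definition gw (w : C) (v : R) : C := Cexp (- (w * RtoC (v ^ 2)))%C.

(** Covers the Gaussian w = 1 and the Fresnel weights w = i, w = -i at once. The latter lie on the
    boundary of the half plane, where integrals converge by oscillation alone. *)
Definition unit_half (w : C) : Prop := Cmod w = 1 /\ 0 <= Re w.

Lemma unit_neq0 w : unit_half w -> w <> RtoC 0.
Proof. intros [H _] E; rewrite E, Cmod_0 in H; lra. Qed.

Lemma Re_gw w (x : R) : Re (- (w * RtoC x))%C = - (Re w * x).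
Proof. destruct w; simpl; ring. Qed.

Lemma Cmod_Cexp_le1 w x : unit_half w -> 0 <= x -> Cmod (Cexp (- (w * RtoC x)))%C <= 1.
Proof.
intros [_ H] Hx; rewrite Cmod_Cexp, Re_gw, <- exp_0.
destruct (Req_dec (Re w * x) 0) as [E|E]; [rewrite E, Ropp_0; lra|].
left; apply exp_increasing; nra.
Qed.

Lemma gw_le1 w v : unit_half w -> Cmod (gw w v) <= 1.
Proof. intros H; apply Cmod_Cexp_le1; [exact H|apply pow2_ge_0]. Qed.

Lemma CD_gw w v : CD (gw w) v (- (2 * w * v) * gw w v)%C.
Proof.
unfold gw; eapply CD_eq.
- apply CD_Cexp, CD_opp, CD_scal, (CD_RtoC (fun v => v ^ 2) v (2 * v)).
  auto_derive; [easy|ring].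
- rewrite RtoC_mult; ring.
Qed.

Lemma gw_cont w : Ccont (gw w).
Proof. eapply CD_Ccont; intros x; apply CD_gw. Qed.

Definition Phi (w : C) (X : R) : C := CI (gw w) 0 X.

Lemma CI_Chasles f a b c : Ccont f -> (CI f a b + CI f b c)%C = CI f a c.
Proof. intros H; symmetry; apply isCI_CI, (isCI_Chasles f a b c); apply CI_correct, H. Qed.

Lemma is_RInt_inv2 (a b : R) : 0 < a -> a <= b -> is_RInt (fun v => / (2 * v ^ 2)) a b (/ (2 * a) - / (2 * b)).
Proof.
intros Ha Hab.
assert (G := is_RInt_derive (fun v => - / (2 * v)) (fun v => / (2 * v ^ 2)) a b).
rewrite Rmin_left, Rmax_right in G by exact Hab.
replace (/ (2 * a) - / (2 * b)) with (minus (- / (2 * b)) (- / (2 * a))).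
2: { unfold minus, plus, opp; simpl; ring. }
apply G; intros x Hx.
- auto_derive; [lra|field; lra].
- apply (@ex_derive_continuous R_AbsRing R_NormedModule); auto_derive.
  assert (0 < x * x) by nra; lra.
Qed.

(* Integration by parts against the derivative of 1 / (2 w v). *)
Lemma Phi_tail w a b : unit_half w -> 0 < a -> a <= b -> Cmod (Phi w b - Phi w a)%C <= / a.
Proof.
intros Hw Ha Hab; assert (W0 := unit_neq0 w Hw).
unfold Phi; rewrite <- (CI_Chasles (gw w) 0 a b (gw_cont w)).
replace (CI (gw w) 0 a + CI (gw w) a b - CI (gw w) 0 a)%C with (CI (gw w) a b) by ring.
set (F := fun v : R => (gw w v * / (- (2 * w) * v))%C).
set (f := fun v : R => (gw w v * (1 + / (2 * w * v ^ 2)))%C).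
assert (NZ : forall v : R, 0 < v -> RtoC v <> RtoC 0) by (intros v Hv E; injection E; lra).
assert (D : forall v, a <= v <= b -> CD F v (f v)).
{ intros v Hv; assert (V0 := NZ v ltac:(lra)).
  unfold F, f; eapply CD_eq.
  - apply CD_mult; [apply CD_gw|apply CD_inv].
    + apply Cmult_neq_0; [|exact V0]. intros E; apply W0.
      replace w with (- / 2 * (- (2 * w)))%C by (field; apply two_neq0); rewrite E; ring.
    + apply CD_scal, CD_id.
  - cbv beta; cfield. }
assert (Fc : forall v, a <= v <= b -> exists d, CD f v d).
{ intros v Hv; assert (V0 := NZ v ltac:(lra)); eexists; unfold f.
  apply CD_mult; [apply CD_gw|apply CD_plus; [apply CD_const|apply CD_inv]].
  - simpl; apply Cmult_neq_0; [apply Cmult_neq_0; [apply two_neq0|exact W0]|].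
    apply Cmult_neq_0; [exact V0|apply Cmult_neq_0; [exact V0|apply C1_neq0]].
  - apply CD_scal; simpl; apply CD_mult; [apply CD_id|apply CD_mult; [apply CD_id|apply CD_const]]. }
assert (I1 : isCI f a b (F b - F a)%C).
{ apply isCI_FTC; rewrite Rmin_left, Rmax_right by exact Hab; [exact D|].
  intros v Hv; destruct (Fc v Hv) as [d [D1 D2]]; split;
    apply (@ex_derive_continuous R_AbsRing R_NormedModule); eexists; eassumption. }
assert (I2 : isCI (fun v => f v + (-(1)) * gw w v)%C a b (F b - F a + (-(1)) * CI (gw w) a b)%C).
{ apply isCI_plus; [exact I1|apply isCI_scal, CI_correct, gw_cont]. }
assert (M : forall v : R, 0 < v -> Cmod (/ (2 * w * v ^ 2))%C = / (2 * v ^ 2)).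
{ intros v Hv; assert (V0 := NZ v Hv); rewrite Cmod_inv.
  - rewrite !Cmod_mult, Cmod_pow, !Cmod_R, (proj1 Hw), !Rabs_pos_eq by lra; f_equal; ring.
  - apply Cmult_neq_0; [apply Cmult_neq_0; [apply two_neq0|exact W0]|apply Cpow_nz, V0]. }
assert (B' : Cmod (F b - F a + - (1) * CI (gw w) a b)%C <= / (2 * a) - / (2 * b)).
{ refine (isCI_bound _ (fun v => / (2 * v ^ 2)) a b _ _ Hab _ I2 (is_RInt_inv2 a b Ha Hab)).
  intros v Hv; replace (f v + - (1) * gw w v)%C with (gw w v * / (2 * w * v ^ 2))%C by (unfold f; ring).
  rewrite Cmod_mult, M by lra.
  assert (0 < / (2 * v ^ 2)) by (apply Rinv_0_lt_compat; nra).
  pose proof (gw_le1 w v Hw); nra. }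
assert (MF : forall v : R, 0 < v -> Cmod (F v) <= / (2 * v)).
{ intros v Hv; assert (V0 := NZ v Hv); unfold F; rewrite Cmod_mult, Cmod_inv.
  - rewrite Cmod_mult, Cmod_opp, Cmod_mult, !Cmod_R, (proj1 Hw), !Rabs_pos_eq, Rmult_1_r by lra.
    assert (0 < / (2 * v)) by (apply Rinv_0_lt_compat; lra).
    pose proof (gw_le1 w v Hw); nra.
  - apply Cmult_neq_0; [|exact V0]. intros E; apply W0.
    replace w with (- / 2 * (- (2 * w)))%C by (field; apply two_neq0); rewrite E; ring. }
replace (CI (gw w) a b) with ((F b - F a) - (F b - F a + - (1) * CI (gw w) a b))%C by ring.
eapply Rle_trans; [apply Cmod_triangle|]; rewrite Cmod_opp.
assert (T := Cmod_triangle (F b) (- F a)%C); rewrite Cmod_opp in T.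
assert (A1 := MF a Ha); assert (A2 := MF b ltac:(lra)).
replace (/ a) with (/ (2 * a) + / (2 * b) + (/ (2 * a) - / (2 * b))) by (field; lra).
unfold Cminus in *; lra.
Qed.

Lemma Phi_le2 w X : unit_half w -> 0 <= X -> Cmod (Phi w X) <= 2.
Proof.
intros Hw HX.
assert (S : forall Y, 0 <= Y -> Cmod (Phi w Y) <= Y).
{ intros Y HY; replace Y with (1 * (Y - 0)) at 2 by ring.
  apply (isCI_bound_const (gw w) 0 Y); [exact HY|intros; apply gw_le1, Hw|apply CI_correct, gw_cont]. }
destruct (Rle_dec X 1) as [L|L]; [specialize (S X HX); lra|].
specialize (S 1 ltac:(lra)).
assert (T := Phi_tail w 1 X Hw ltac:(lra) ltac:(lra)); rewrite Rinv_1 in T.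
replace (Phi w X) with (Phi w 1 + (Phi w X - Phi w 1))%C by ring.
eapply Rle_trans; [apply Cmod_triangle|lra].
Qed.

Lemma inv_small eps : 0 < eps -> forall X, 2 / eps <= X -> / X < eps.
Proof.
intros He X HX.
assert (0 < 2 / eps) by (apply Rdiv_lt_0_compat; lra).
apply Rmult_lt_reg_r with X; [lra|]; rewrite Rinv_l by lra.
apply (Rmult_le_compat_r eps) in HX; [|lra].
replace (2 / eps * eps) with 2 in HX by (field; lra); lra.
Qed.

Lemma Phi_lim_exists w : unit_half w -> exists K, forall X, 0 < X -> Cmod (Phi w X - K)%C <= / X.
Proof.
intros Hw.
assert (G : forall X0, 0 < X0 -> exists K, forall X, X0 <= X -> Cmod (Phi w X - K)%C <= / X).
{ intros X0 H0; apply (C_cauchy_lim (Phi w) (fun X => / X) X0 (Rlt_le _ _ H0)).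
  - intros eps He; exists (Rmax X0 (2 / eps)); split; [apply Rmax_l|intros X HX].
    apply inv_small; [exact He|eapply Rle_trans; [apply Rmax_r|exact HX]].
  - intros X Y HX HY; apply Phi_tail; [exact Hw|lra|exact HY]. }
destruct (G 1 Rlt_0_1) as [K HK]; exists K; intros X HX.
apply le_epsilon; intros e He.
set (Y := Rmax (Rmax 1 X) (2 / e)).
assert (1 <= Y /\ X <= Y /\ 2 / e <= Y).
{ unfold Y; repeat split.
  - eapply Rle_trans; [apply (Rmax_l 1 X)|apply Rmax_l].
  - eapply Rle_trans; [apply (Rmax_r 1 X)|apply Rmax_l].
  - apply Rmax_r. }
assert (A := HK Y ltac:(lra)); assert (B := Phi_tail w X Y Hw HX ltac:(lra)).
assert (D := inv_small e He Y ltac:(lra)).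
replace (Phi w X - K)%C with ((Phi w Y - K) - (Phi w Y - Phi w X))%C by ring.
eapply Rle_trans; [apply Cmod_triangle|]; rewrite Cmod_opp; lra.
Qed.

Lemma CD_CI f a x : Ccont f -> CD (fun x => CI f a x) x (f x).
Proof.
intros H; split; simpl.
- apply (is_derive_RInt (fun t => Re (f t)) (RInt (fun t => Re (f t)) a) a x).
  + exists (mkposreal 1 Rlt_0_1); intros y _; apply (@RInt_correct R_CompleteNormedModule).
    apply (@ex_RInt_continuous R_CompleteNormedModule); intros; apply H.
  + apply H.
- apply (is_derive_RInt (fun t => Im (f t)) (RInt (fun t => Im (f t)) a) a x).
  + exists (mkposreal 1 Rlt_0_1); intros y _; apply (@RInt_correct R_CompleteNormedModule).
    apply (@ex_RInt_continuous R_CompleteNormedModule); intros; apply H.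
  + apply H.
Qed.

Lemma isCI_comp_lin f (u v a b : R) l :
  isCI f (u * a + v) (u * b + v) l -> isCI (fun y => RtoC u * f (u * y + v)%R)%C a b l.
Proof.
intros H; assert (G := is_RInt_comp_lin (V := C_R_NormedModule) f u v a b l H).
eapply is_RInt_ext; [|exact G]; intros x _; cbv beta.
destruct (f (u * x + v)) as [p q]; unfold scal; simpl; unfold prod_scal, Cmult, RtoC; simpl.
unfold scal; simpl; unfold mult; simpl; f_equal; ring.
Qed.

Lemma CD_const_fun (f : R -> C) (a b : R) : a <= b -> (forall x, a <= x <= b -> CD f x (RtoC 0)) -> f b = f a.
Proof.
intros Hab H; apply Ceq_minus, Cmod_eq_0, Rle_antisym; [|apply Cmod_ge_0].
replace 0 with (2 * 0 * (b - a)) by ring; apply (CMVT f (fun _ => RtoC 0)); [exact Hab|exact H|].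
intros; rewrite Cmod_0; lra.
Qed.

(** * The square of the complete Gaussian or Fresnel integral *)

Section Square.
Variable w : C.
Hypothesis Hw : unit_half w.

(** The auxiliary integrand of a classical evaluation: with T (X) its integral over [0, 1], the
    function Phi^2 + T / w has derivative 0 in X and equals pi / (4 w) at X = 0, while T tends to
    0. *)
Let G (X t : R) : C := (Cexp (- (w * RtoC (X ^ 2 * (1 + t ^ 2)))) * RtoC (/ (1 + t ^ 2)))%C.
Let G1 (X t : R) : C := (- (2 * w * RtoC X) * Cexp (- (w * RtoC (X ^ 2 * (1 + t ^ 2)))))%C.
Let G2 (X t : R) : C := ((- (2 * w) + RtoC (1 + t ^ 2) * ((2 * w * RtoC X) * (2 * w * RtoC X))) * Cexp (- (w * RtoC (X ^ 2 * (1 + t ^ 2)))))%C.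

Let CDe (X t : R) : CD (fun X => Cexp (- (w * RtoC (X ^ 2 * (1 + t ^ 2))))%C) X
   (- (2 * w * RtoC X * RtoC (1 + t ^ 2)) * Cexp (- (w * RtoC (X ^ 2 * (1 + t ^ 2)))))%C.
Proof.
eapply CD_eq.
- apply CD_Cexp, CD_opp, CD_scal, (CD_RtoC (fun X => X ^ 2 * (1 + t ^ 2)) X (2 * X * (1 + t ^ 2))).
  auto_derive; [easy|ring].
- rewrite !RtoC_mult; ring.
Qed.

Let tpos (t : R) : 1 <= 1 + t ^ 2.
Proof. pose proof (pow2_ge_0 t); lra. Qed.

Let CD_G X t : CD (fun X => G X t) X (G1 X t).
Proof.
unfold G, G1; eapply CD_eq; [apply CD_mult; [apply CDe|apply CD_const]|].
cbv beta; rewrite RtoC_inv by (pose proof (tpos t); lra); field.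
intros E; apply (f_equal Re) in E; simpl in E; pose proof (tpos t); simpl in *; lra.
Qed.

Let CD_G1 X t : CD (fun X => G1 X t) X (G2 X t).
Proof.
unfold G1, G2; eapply CD_eq; [apply CD_mult; [apply CD_opp, CD_scal, CD_id|apply CDe]|].
cbv beta; ring.
Qed.

Let contt (X : R) : Ccont (fun t => Cexp (- (w * RtoC (X ^ 2 * (1 + t ^ 2))))%C).
Proof.
apply (CD_Ccont _ (fun t => (- (w * RtoC (X ^ 2 * (2 * t)))) * Cexp (- (w * RtoC (X ^ 2 * (1 + t ^ 2)))))%C).
intros t; apply CD_Cexp, CD_opp, CD_scal, (CD_RtoC (fun t => X ^ 2 * (1 + t ^ 2))).
auto_derive; [easy|ring].
Qed.

Let invcont : forall x : R, continuous (fun t => / (1 + t ^ 2)) x.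
Proof.
intros t; apply (@ex_derive_continuous R_AbsRing R_NormedModule); auto_derive; pose proof (tpos t); simpl in *; lra.
Qed.

Let contG X : Ccont (G X).
Proof. apply Ccont_mult; [apply contt|apply Ccont_RtoC, invcont]. Qed.

Let contG1 X : Ccont (G1 X).
Proof. apply Ccont_scal, contt. Qed.

Let T X := CI (G X) 0 1.

Let CD_T X : CD T X (CI (G1 X) 0 1).
Proof.
set (M := 2 + 8 * (Rabs X + 1) ^ 2).
apply (CD_quad T X _ (4 * M) 1 Rlt_0_1); intros h Hh.
assert (E : isCI (fun t => G (X + h)%R t + -(1) * G X t + (- RtoC h) * G1 X t)%C 0 1
   (T (X + h)%R + -(1) * T X + (- RtoC h) * CI (G1 X) 0 1)%C).
{ apply isCI_plus; [apply isCI_plus; [|apply isCI_scal]|apply isCI_scal]; apply CI_correct;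
   [apply contG|apply contG|apply contG1]. }
replace (T (X + h)%R - T X - h * CI (G1 X) 0 1)%C with
  (T (X + h)%R + -(1) * T X + (- RtoC h) * CI (G1 X) 0 1)%C by ring.
replace (4 * M * h ^ 2) with (4 * M * h ^ 2 * (1 - 0)) by ring.
refine (isCI_bound_const _ 0 1 _ (4 * M * h ^ 2) ltac:(lra) _ E).
intros t Ht.
apply Rabs_def2 in Hh.
assert (K := CTaylor2 (fun X => G X t) (fun X => G1 X t) (fun X => G2 X t) (X - 1) (X + 1) X (X + h) M
  ltac:(lra) ltac:(lra) (fun x _ => CD_G x t) (fun x _ => CD_G1 x t)).
replace (X + h - X) with h in K by ring.
replace (G (X + h)%R t + - (1) * G X t + - h * G1 X t)%C with (G (X + h)%R t - G X t - h * G1 X t)%C by ring.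
apply K; intros x Hx; unfold G2; rewrite Cmod_mult.
assert (A : Cmod (Cexp (- (w * RtoC (x ^ 2 * (1 + t ^ 2)))))%C <= 1).
{ apply Cmod_Cexp_le1; [exact Hw|]; pose proof (tpos t); pose proof (pow2_ge_0 x); nra. }
assert (B : Cmod (- (2 * w) + RtoC (1 + t ^ 2) * (2 * w * RtoC x * (2 * w * RtoC x)))%C <= M).
{ eapply Rle_trans; [apply Cmod_triangle|].
  rewrite Cmod_opp, !Cmod_mult, !Cmod_R, (proj1 Hw), (Rabs_pos_eq 2), (Rabs_pos_eq (1 + t ^ 2))
   by (pose proof (tpos t); lra).
  assert (Rabs x <= Rabs X + 1) by (apply Rabs_le; pose proof (Rabs_pos X); pose proof (Rle_abs X); pose proof (Rle_abs (- X)); rewrite Rabs_Ropp in *; lra).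
  pose proof (Rabs_pos x).
  assert (t ^ 2 <= 1) by nra; pose proof (tpos t).
  assert (Rabs x * Rabs x <= (Rabs X + 1) ^ 2) by nra.
  unfold M; nra. }
pose proof (Cmod_ge_0 (- (2 * w) + RtoC (1 + t ^ 2) * (2 * w * RtoC x * (2 * w * RtoC x)))%C).
pose proof (Cmod_ge_0 (Cexp (- (w * RtoC (x ^ 2 * (1 + t ^ 2)))))%C).
nra.
Qed.

Let T1 X : CI (G1 X) 0 1 = (- (2 * w) * (gw w X * Phi w X))%C.
Proof.
apply isCI_CI.
assert (H := isCI_comp_lin (gw w) X 0 0 1 (Phi w X)).
replace (X * 0 + 0) with 0 in H by ring; replace (X * 1 + 0) with X in H by ring.
specialize (H (CI_correct _ _ _ (gw_cont w))).
apply (isCI_scal (- (2 * w) * gw w X)%C) in H.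
replace (- (2 * w) * (gw w X * Phi w X))%C with (- (2 * w) * gw w X * Phi w X)%C by ring.
eapply isCI_ext; [|exact H]; intros t _; unfold G1, gw.
replace (- (w * (X ^ 2 * (1 + t ^ 2))%R))%C with (- (w * (X ^ 2)%R) + - (w * ((X * t + 0) ^ 2)%R))%C.
- rewrite Cexp_add; ring.
- replace ((X * t + 0) ^ 2) with (X ^ 2 * t ^ 2) by ring.
  replace (X ^ 2 * (1 + t ^ 2)) with (X ^ 2 + X ^ 2 * t ^ 2) by ring; rewrite RtoC_plus; ring.
Qed.

Let T0 : T 0 = RtoC (PI / 4).
Proof.
apply isCI_CI.
apply isCI_ext with (f := fun t => RtoC (/ (1 + t ^ 2))).
{ intros t _; unfold G; replace (0 ^ 2 * (1 + t ^ 2)) with 0 by ring.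
  rewrite Cmult_0_r; replace (- 0)%C with (RtoC 0) by ring; rewrite Cexp_0; ring. }
apply isCI_pair; simpl.
- replace (PI / 4) with (minus (atan 1) (atan 0)).
  2: { rewrite atan_1, atan_0; unfold minus, plus, opp; simpl; ring. }
  apply (is_RInt_derive atan (fun t => / (1 + t * (t * 1)))); intros t _.
  + eapply is_derive_eq; [apply is_derive_atan|f_equal; unfold Rsqr; ring].
  + apply invcont.
- assert (Z := is_RInt_const 0 1 (0 : R)).
  change (is_RInt (fun _ : R => 0) 0 1 ((1 - 0) * 0)) in Z.
  replace ((1 - 0) * 0) with 0 in Z by ring; exact Z.
Qed.

(** For imaginary w the integrand of T does not get smaller as X grows. Integration by parts in t
    against the primitive Phi (X t) gains the factor 1 / X; the constant 6 is 2 from the boundary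
    and 4 from the remaining integral. *)
Let Tlim X : 0 < X -> Cmod (T X) <= 6 / X.
Proof.
intros HX.
assert (X0 : RtoC X <> RtoC 0) by (intros E; injection E; lra).
set (r := fun t : R => RtoC (/ (1 + t ^ 2))).
set (r1 := fun t : R => RtoC (- (2 * t) / (1 + t ^ 2) ^ 2)).
assert (Dr : forall t, CD r t (r1 t)).
{ intros t; apply (CD_RtoC (fun t => / (1 + t ^ 2))); pose proof (tpos t); simpl in *; auto_derive; [lra|field; lra]. }
assert (DP : forall t, CD (fun t => Phi w (X * t)) t (X * gw w (X * t)%R)%C).
{ intros t; apply (CD_comp (Phi w) (fun t => X * t) t); [apply CD_CI, gw_cont|auto_derive; [easy|ring]]. }
assert (cP : Ccont (fun t => Phi w (X * t))) by (eapply CD_Ccont; intros; apply DP).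
assert (cr : Ccont r) by (eapply CD_Ccont; intros; apply Dr).
assert (cr1 : Ccont r1).
{ apply Ccont_RtoC; intros t; apply (@ex_derive_continuous R_AbsRing R_NormedModule); pose proof (tpos t); simpl in *; auto_derive.
  assert (1 <= (1 + t * (t * 1)) * ((1 + t * (t * 1)) * 1)) by nra; lra. }
assert (I1 : isCI (fun t => X * gw w (X * t)%R * r t + Phi w (X * t)%R * r1 t)%C 0 1
   (Phi w (X * 1) * r 1 - Phi w (X * 0) * r 0)%C).
{ apply (isCI_FTC (fun t => Phi w (X * t)%R * r t)%C); intros t _; [exact (CD_mult (fun t => Phi w (X * t)) r t _ _ (DP t) (Dr t))|].
  apply (Ccont_plus (fun t => X * gw w (X * t)%R * r t)%C (fun t => Phi w (X * t)%R * r1 t)%C);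
    apply Ccont_mult; try assumption.
  apply Ccont_scal; eapply CD_Ccont; intros u.
  apply (CD_comp (gw w) (fun t => X * t) u); [apply CD_gw|auto_derive; [easy|reflexivity]]. }
assert (I2 := CI_correct (fun t => Phi w (X * t)%R * r1 t)%C 0 1 (Ccont_mult _ _ cP cr1)).
assert (I3 := isCI_plus _ _ _ _ _ _ I1 (isCI_scal (-(1))%C _ _ _ _ I2)).
assert (E : T X = (gw w X * (/ X * ((Phi w (X * 1) * r 1 - Phi w (X * 0) * r 0)
    + -(1) * CI (fun t => Phi w (X * t)%R * r1 t) 0 1)))%C).
{ apply isCI_CI; apply (isCI_scal (/ X)%C) in I3; apply (isCI_scal (gw w X)) in I3.
  eapply isCI_ext; [|exact I3]; intros t _; unfold G, gw, r.
  replace (X ^ 2 * (1 + t ^ 2)) with (X ^ 2 + (X * t) ^ 2) by ring.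
  replace (- (w * (X ^ 2 + (X * t) ^ 2)%R))%C with (- (w * (X ^ 2)%R) + - (w * ((X * t) ^ 2)%R))%C by (rewrite RtoC_plus; ring).
  rewrite Cexp_add.
  field; exact X0. }
rewrite E, !Cmod_mult, Cmod_inv, Cmod_R, (Rabs_pos_eq X) by (try exact X0; lra).
assert (B2 : Cmod (CI (fun t => Phi w (X * t)%R * r1 t) 0 1)%C <= 4 * (1 - 0)).
{ refine (isCI_bound_const _ 0 1 _ 4 ltac:(lra) _ I2); intros t Ht; cbv beta; rewrite Cmod_mult.
  assert (A := Phi_le2 w (X * t) Hw ltac:(nra)).
  assert (R1 : Cmod (r1 t) <= 2).
  { unfold r1; rewrite Cmod_R; unfold Rdiv; rewrite Rabs_mult, Rabs_Ropp, Rabs_inv.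
    pose proof (tpos t); assert (1 <= (1 + t ^ 2) ^ 2) by (simpl in *; nra).
    rewrite !Rabs_pos_eq by lra.
    apply Rle_trans with (2 * 1 * / 1); [|lra].
    apply Rmult_le_compat; [lra|left; apply Rinv_0_lt_compat; lra|lra|apply Rinv_le_contravar; lra]. }
  pose proof (Cmod_ge_0 (Phi w (X * t))); pose proof (Cmod_ge_0 (r1 t)); nra. }
assert (P0 : Phi w (X * 0) = RtoC 0) by (rewrite Rmult_0_r; apply CI_point).
assert (B1 : Cmod (Phi w (X * 1) * r 1 - Phi w (X * 0) * r 0)%C <= 2).
{ rewrite P0; replace (Phi w (X * 1) * r 1 - 0 * r 0)%C with (Phi w (X * 1) * r 1)%C by ring.
  rewrite Cmod_mult; unfold r; rewrite Cmod_R.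
  replace (1 + 1 ^ 2) with 2 by ring; rewrite Rabs_pos_eq by lra.
  pose proof (Phi_le2 w (X * 1) Hw ltac:(lra)); lra. }
assert (B3 := Cmod_triangle (Phi w (X * 1) * r 1 - Phi w (X * 0) * r 0)%C
   (- (1) * CI (fun t => Phi w (X * t)%R * r1 t) 0 1)%C).
replace (- (1) * CI (fun t => Phi w (X * t)%R * r1 t) 0 1)%C with (- CI (fun t => Phi w (X * t)%R * r1 t) 0 1)%C in B3 at 2 by ring.
rewrite Cmod_opp in B3.
pose proof (gw_le1 w X Hw) as B4; pose proof (Cmod_ge_0 (gw w X)).
set (u := Cmod (Phi w (X * 1) * r 1 - Phi w (X * 0) * r 0 + - (1) * CI (fun t => Phi w (X * t)%R * r1 t) 0 1)%C) in *.
assert (0 <= u) by apply Cmod_ge_0.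
assert (0 < / X) by (apply Rinv_0_lt_compat; lra).
assert (u <= 6) by lra.
apply Rle_trans with (1 * (/ X * 6)); [apply Rmult_le_compat; [lra|nra|lra|nra]|unfold Rdiv; lra].
Qed.

Lemma Phi_lim_sq (K : C) : (forall X, 0 < X -> Cmod (Phi w X - K)%C <= / X) -> (K * K = PI / (4 * w))%C.
Proof.
intros HK; assert (W0 := unit_neq0 w Hw).
assert (Id : forall X, 0 <= X -> (Phi w X * Phi w X + / w * T X = PI / (4 * w))%C).
{ intros X HX.
  rewrite (CD_const_fun (fun X => Phi w X * Phi w X + / w * T X)%C 0 X HX).
  - rewrite T0; unfold Phi; rewrite CI_point; unfold Rdiv; rewrite RtoC_mult, RtoC_inv by lra.
    cfield.
  - intros x _; eapply CD_eq.
    + apply CD_plus; [apply CD_mult; apply CD_CI, gw_cont|apply CD_scal, CD_T].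
    + rewrite T1; unfold Phi; field; exact W0. }
apply Ceq_minus, Cmod_eq_0, Rle_antisym; [|apply Cmod_ge_0].
apply le_epsilon; intros e He; rewrite Rplus_0_l.
assert (HK2 : Cmod K <= 3).
{ specialize (HK 1 Rlt_0_1); rewrite Rinv_1 in HK.
  replace K with (Phi w 1 - (Phi w 1 - K))%C by ring.
  eapply Rle_trans; [apply Cmod_triangle|]; rewrite Cmod_opp.
  pose proof (Phi_le2 w 1 Hw ltac:(lra)); lra. }
(* The two errors below are 5 / X, from |Phi - K| |Phi + K|, and 6 / X, from T. *)
set (X := 2 / (e / 11)).
assert (PX : 0 < X) by (unfold X; apply Rdiv_lt_0_compat; lra).
assert (S := inv_small (e / 11) ltac:(lra) X (Rle_refl _)).
rewrite <- (Id X ltac:(lra)).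
replace (K * K - (Phi w X * Phi w X + / w * T X))%C with
  (- ((Phi w X - K) * (Phi w X + K)) - / w * T X)%C by ring.
eapply Rle_trans; [apply Cmod_triangle|]; rewrite !Cmod_opp, !Cmod_mult, Cmod_inv, (proj1 Hw), Rinv_1 by exact W0.
assert (A1 := HK X PX); assert (A2 := Tlim X PX).
assert (A3 : Cmod (Phi w X + K)%C <= 5).
{ eapply Rle_trans; [apply Cmod_triangle|]; pose proof (Phi_le2 w X Hw ltac:(lra)); lra. }
pose proof (Cmod_ge_0 (Phi w X - K)%C); pose proof (Cmod_ge_0 (Phi w X + K)%C).
unfold Rdiv in A2; nra.
Qed.

End Square.

Lemma unit_half_i (s : R) : s * s = 1 -> unit_half (RtoC s * Ci).
Proof.
intros Hs; split.
- rewrite Cmod_mult, Cmod_Ci, Cmod_R, Rmult_1_r.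
  assert (0 <= Rabs s) by apply Rabs_pos.
  assert (Rabs s * Rabs s = 1) by (rewrite <- Rabs_mult, Hs; apply Rabs_R1); nra.
- simpl; lra.
Qed.

Lemma cos_ge (x : R) : 1 - x ^ 2 / 2 <= cos x.
Proof.
replace x with (2 * (x / 2)) at 2 by field; rewrite cos_2a_sin.
assert (Rabs (sin (x / 2)) <= Rabs (x / 2)).
{ assert (G : forall y, 0 < y -> Rabs (sin y) <= y).
  { intros y Hy; apply Rabs_le; split; [|left; apply sin_lt_x, Hy].
    destruct (Rle_dec y PI).
    - assert (0 <= sin y) by (apply sin_ge_0; lra); lra.
    - pose proof (SIN_bound y); pose proof PI2_1; lra. }
  destruct (Rtotal_order (x / 2) 0) as [L|[->|L]].
  - rewrite (Rabs_left (x / 2)), <- (Rabs_Ropp (sin _)), <- sin_neg by exact L; apply G; lra.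
  - rewrite sin_0; lra.
  - rewrite (Rabs_pos_eq (x / 2)) by lra; apply G; lra. }
assert (sin (x / 2) * sin (x / 2) <= (x / 2) * (x / 2)).
{ rewrite <- (Rabs_pos_eq (sin (x / 2) * _)), <- (Rabs_pos_eq (x / 2 * _)), !Rabs_mult by nra.
  pose proof (Rabs_pos (sin (x / 2))); nra. }
nra.
Qed.

(* The square determines the limit up to a sign, which a crude numerical bound settles. *)
Lemma Phi_lim_i (s : R) : s * s = 1 ->
  let K := (RtoC (sqrt (PI / 8)) * (1 - RtoC s * Ci))%C in
  forall X, 0 < X -> Cmod (Phi (RtoC s * Ci) X - K)%C <= / X.
Proof.
intros Hs K0; set (w := (RtoC s * Ci)%C).
assert (Hw : unit_half w) by (apply unit_half_i, Hs).
destruct (Phi_lim_exists w Hw) as [K HK].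
assert (S := Phi_lim_sq w Hw K HK).
replace K0 with K; [exact HK|].
(* K lies within 5 / 6 of Phi (6 / 5). The real part of the latter is at least 6 / 5 - (6 / 5)^5 /
   10, about 0.95, because cos x >= 1 - x^2 / 2. *)
assert (Rp : 0 < Re K).
{ assert (A := HK (6 / 5) ltac:(lra)).
  assert (B : 6 / 5 - (6 / 5) ^ 5 / 10 <= Re (Phi w (6 / 5))).
  { assert (I1 := isCI_Re _ _ _ _ (CI_correct (gw w) 0 (6 / 5) (gw_cont w))).
    assert (I2 := is_RInt_derive (fun v => v - v ^ 5 / 10) (fun v => 1 - v ^ 4 / 2) 0 (6 / 5)).
    assert (I3 : is_RInt (fun v => 1 - v ^ 4 / 2) 0 (6 / 5) (6 / 5 - (6 / 5) ^ 5 / 10)).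
    { replace (6 / 5 - (6 / 5) ^ 5 / 10) with (minus (6 / 5 - (6 / 5) ^ 5 / 10) (0 - 0 ^ 5 / 10)).
      2: { change (6 / 5 - (6 / 5) ^ 5 / 10 - (0 - 0 ^ 5 / 10) = 6 / 5 - (6 / 5) ^ 5 / 10); field. }
      apply I2; intros v _.
      - auto_derive; [easy|field].
      - apply (@ex_derive_continuous R_AbsRing R_NormedModule); auto_derive; easy. }
    apply (is_RInt_le _ _ 0 (6 / 5) _ _ ltac:(lra) I3 I1).
    intros v Hv.
    assert (Eg : Re (gw w v) = cos (s * v ^ 2)).
    { unfold gw; replace (- (w * RtoC (v ^ 2)))%C with ((0, - (s * v ^ 2)) : C).
      - change (exp 0 * cos (- (s * v ^ 2)) = cos (s * v ^ 2)); rewrite exp_0, cos_neg; ring.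
      - unfold w, RtoC, Ci, Cmult, Copp; simpl; f_equal; ring. }
    rewrite Eg; eapply Rle_trans; [|apply cos_ge].
    right; replace ((s * v ^ 2) ^ 2) with (s * s * v ^ 4) by ring; rewrite Hs; field. }
  assert (D := re_le_Cmod (Phi w (6 / 5) - K)%C).
  replace (Re (Phi w (6 / 5) - K)%C) with (Re (Phi w (6 / 5)) - Re K) in D by (destruct K, (Phi w (6 / 5)); simpl; ring).
  pose proof (Rle_abs (Re (Phi w (6 / 5)) - Re K)).
  assert (/ (6 / 5) = 5 / 6) by field.
  assert ((6 / 5) ^ 5 / 10 <= 1 / 4) by (simpl; lra); lra. }
assert (P := PI_RGT_0).
assert (Q : (K * K = RtoC (- (PI / 4) * s) * Ci)%C).
{ assert (W0 := unit_neq0 w Hw).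
  assert (Z2 : (w * w = - (1))%C).
  { unfold w; replace (s * Ci * (s * Ci))%C with (RtoC s * RtoC s * (Ci * Ci))%C by ring.
    rewrite <- RtoC_mult, Hs, Ci2, RtoC_m1; ring. }
  replace (RtoC (- (PI / 4) * s) * Ci)%C with (- (PI / 4) * w)%C.
  2: { unfold w, Rdiv, Cdiv; rewrite !RtoC_mult, RtoC_opp, RtoC_mult, RtoC_inv by lra; ring. }
  rewrite S; transitivity (PI / (4 * w) * (- (w * w)))%C; [rewrite Z2; ring|cfield]. }
destruct K as [a b]; simpl in Rp.
unfold Cmult, RtoC, Ci in Q; simpl in Q; injection Q as Q1 Q2.
assert (E1 : (a - b) * (a + b) = 0) by lra.
assert (E2 : a * b = - (PI / 8) * s) by lra.
assert (Eb : b = - (s * a)).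
{ destruct (Rmult_integral _ _ E1) as [E|E].
  - assert (b = a) by lra; subst b.
    assert (s = -1 \/ s = 1) as [->| ->] by (destruct (Rtotal_order s 0) as [?|[?|?]]; [left; nra|nra|right; nra]); [lra|nra].
  - assert (b = - a) by lra; subst b.
    assert (s = -1 \/ s = 1) as [->| ->] by (destruct (Rtotal_order s 0) as [?|[?|?]]; [left; nra|nra|right; nra]); [nra|lra]. }
assert (Ea : a = sqrt (PI / 8)).
{ symmetry; apply sqrt_lem_1; [lra|lra|].
  rewrite Eb in E2; assert (s * (a * a) = s * (PI / 8)) by lra.
  apply Rmult_eq_reg_l with s; [exact H|nra]. }
unfold K0, RtoC, Ci, Cmult, Cminus, Copp, Cplus; simpl; rewrite Eb, <- Ea; f_equal; ring.
Qed.

(** * The Mordell integral at rational parameters *)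

(** From y <= exp y at y = b x / (2 k), raised to the power k. *)
Lemma pow_exp_bound (k : nat) (b : R) : 0 < b ->
  exists K, 0 <= K /\ forall x, 0 <= x -> x ^ k * exp (- b * x) <= K * exp (- (b / 2) * x).
Proof.
intros Hb; destruct k as [|k].
- exists 1; split; [lra|]; intros x Hx; rewrite pow_O, !Rmult_1_l.
  destruct (Req_dec x 0) as [->|N]; [rewrite !Rmult_0_r; lra|left; apply exp_increasing; nra].
- set (n := INR (S k)); assert (n0 : 0 < n) by (apply lt_0_INR; lia).
  exists ((2 * n / b) ^ S k); split.
  { apply pow_le; left; apply Rdiv_lt_0_compat; lra. }
  intros x Hx.
  assert (E : (b * x / (2 * n)) ^ S k <= exp (b / 2 * x)).
  { replace (b / 2 * x) with (INR (S k) * (b * x / (2 * n))) by (unfold n; field; fold n; lra).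
    assert (P : exp (b * x / (2 * n)) ^ S k = exp (INR (S k) * (b * x / (2 * n)))).
    { generalize (b * x / (2 * n)), (S k); clear; intros y m; induction m as [|m IH].
      - simpl; rewrite Rmult_0_l, exp_0; easy.
      - rewrite S_INR, Rmult_plus_distr_r, Rmult_1_l, exp_plus, <- IH; simpl; ring. }
    rewrite <- P; apply pow_incr.
    assert (0 <= b * x / (2 * n)) by (apply Rmult_le_pos; [nra|left; apply Rinv_0_lt_compat; lra]).
    split; [assumption|]; destruct (Req_dec (b * x / (2 * n)) 0) as [->|N]; [rewrite exp_0; lra|].
    left; assert (G := exp_ineq1 _ N); lra. }
  replace (x ^ S k) with ((2 * n / b) ^ S k * (b * x / (2 * n)) ^ S k).
  2: { rewrite <- Rpow_mult_distr; f_equal; field; lra. }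
  replace (- b * x) with (- (b / 2) * x + - (b / 2 * x)) by field; rewrite exp_plus, exp_Ropp.
  assert (P1 : 0 <= (2 * n / b) ^ S k) by (apply pow_le; left; apply Rdiv_lt_0_compat; lra).
  pose proof (exp_pos (- (b / 2) * x)); pose proof (exp_pos (b / 2 * x)).
  replace ((2 * n / b) ^ S k * (b * x / (2 * n)) ^ S k * (exp (- (b / 2) * x) * / exp (b / 2 * x)))
    with ((2 * n / b) ^ S k * exp (- (b / 2) * x) * ((b * x / (2 * n)) ^ S k * / exp (b / 2 * x))) by ring.
  rewrite <- (Rmult_1_r ((2 * n / b) ^ S k * exp (- (b / 2) * x))) at 2.
  apply Rmult_le_compat_l; [nra|].
  apply Rmult_le_reg_r with (exp (b / 2 * x)); [lra|].
  rewrite Rmult_assoc, Rinv_l by lra; lra.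
Qed.

Lemma CD_II_deriv (F F1 F2 : R -> R -> C) (lo hi B b th : R) :
  0 < b -> lo < th < hi ->
  (forall t, lo <= t <= hi -> Ccont (F t) /\ Ccont (F1 t) /\
     dominated (F t) B b /\ dominated (F1 t) B b /\ dominated (F2 t) B b) ->
  (forall t x, lo <= t <= hi -> CD (fun t => F t x) t (F1 t x) /\ CD (fun t => F1 t x) t (F2 t x)) ->
  CD (fun t => II (F t)) th (II (F1 th)).
Proof.
intros Hb Hth H1 H2.
assert (B0 : 0 <= B) by (apply (dominated_pos (F th) B b), H1; lra).
apply (CD_II F F1 lo hi (4 * B) b th Hb Hth).
- intros t Ht; destruct (H1 t Ht) as [A1 [A2 [A3 [A4 _]]]].
  assert (G : forall f, dominated f B b -> dominated f (4 * B) b).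
  { intros f Hf x Hx; specialize (Hf x Hx); pose proof (exp_pos (- b * x)); nra. }
  exact (conj A1 (conj A2 (conj (G _ A3) (G _ A4)))).
- intros s t Hs Ht x Hx.
  replace (4 * B * (t - s) ^ 2 * exp (- b * x)) with (4 * (B * exp (- b * x)) * (t - s) ^ 2) by ring.
  apply (CTaylor2 (fun t => F t x) (fun t => F1 t x) (fun t => F2 t x) lo hi s t); try assumption;
   intros y Hy; [apply H2, Hy|apply H2, Hy|apply (proj2 (proj2 (proj2 (proj2 (H1 y Hy)))) x Hx)].
Qed.

Lemma C_small_0 (z : C) (K : R) : (forall M : nat, (1 <= M)%nat -> Cmod z <= K / INR M) -> z = RtoC 0.
Proof.
intros H; apply Cmod_eq_0, Rle_antisym; [|apply Cmod_ge_0].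
apply le_epsilon; intros e He; rewrite Rplus_0_l.
destruct (nfloor_ex (Rabs K / e)) as [M [_ HM]].
{ apply Rmult_le_pos; [apply Rabs_pos|left; apply Rinv_0_lt_compat; lra]. }
eapply Rle_trans; [apply (H (S M)); lia|].
rewrite S_INR; pose proof (pos_INR M).
apply Rmult_le_reg_r with (INR M + 1); [lra|].
unfold Rdiv; rewrite Rmult_assoc, Rinv_l, Rmult_1_r by lra.
apply (Rmult_lt_compat_l e) in HM; [|lra].
replace (e * (Rabs K / e)) with (Rabs K) in HM by (field; lra).
pose proof (Rle_abs K); lra.
Qed.

(** * Closed form and shifts of the integrals of exp (- i mu x^2 - c x) *)

Section Mordell.
Variable mu : R.
Hypothesis Hmu : 0 < mu.

Let mu0 : RtoC mu <> RtoC 0.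
Proof. intros E; injection E; lra. Qed.

Definition kern (m c x : R) : C := Cexp (- (Ci * RtoC (m * x ^ 2)) - RtoC (c * x))%C.

Lemma Cmod_kern m c x : Cmod (kern m c x) = exp (- c * x).
Proof. unfold kern; rewrite Cmod_Cexp; f_equal; simpl; ring. Qed.

Lemma CD_kern m c x : CD (kern m c) x ((- (2 * Ci * m * x) - c) * kern m c x)%C.
Proof.
unfold kern; eapply CD_eq.
- apply CD_Cexp, CD_minus; [apply CD_opp, CD_scal, (CD_RtoC (fun x => m * x ^ 2) x (2 * m * x))
   |apply (CD_RtoC (fun x => c * x) x c)]; auto_derive; try easy; ring.
- rewrite !RtoC_mult; ring.
Qed.

Lemma kern_cont m c : Ccont (kern m c).
Proof. eapply CD_Ccont; intros; apply CD_kern. Qed.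

Lemma kern_dom m c : dominated (kern m c) 1 c.
Proof. intros x _; rewrite Cmod_kern; lra. Qed.

Let In (c : R) : C := II (kern mu c).

Let In_bound c : 0 < c -> Cmod (In c) <= / c.
Proof. intros Hc; replace (/ c) with (1 / c) by (field; lra); apply II_bound; [exact Hc|apply kern_cont|apply kern_dom]. Qed.

Let xkern_cont c : Ccont (fun x => - RtoC x * kern mu c x)%C.
Proof.
apply Ccont_mult; [|apply kern_cont].
eapply CD_Ccont; intros x; apply CD_opp, CD_id.
Qed.

Let xkern_dom k : 0 < k -> exists K, forall c, k <= c ->
  dominated (kern mu c) K (k / 2) /\
  dominated (fun x => - RtoC x * kern mu c x)%C K (k / 2) /\ dominated (fun x => RtoC x * RtoC x * kern mu c x)%C K (k / 2).
Proof.
intros Hk; destruct (pow_exp_bound 0 k Hk) as [K0 [P0 Q0]].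
destruct (pow_exp_bound 1 k Hk) as [K1 [P1 Q1]], (pow_exp_bound 2 k Hk) as [K2 [P2 Q2]].
exists (K0 + K1 + K2); intros c Hc.
assert (E : forall x, 0 <= x -> exp (- c * x) <= exp (- k * x)).
{ intros x Hx; destruct (Req_dec (c * x) (k * x)) as [E|E].
  - right; f_equal; lra.
  - left; apply exp_increasing; nra. }
repeat split; intros x Hx; rewrite ?Cmod_mult, ?Cmod_opp, ?Cmod_R, Cmod_kern, ?(Rabs_pos_eq x) by exact Hx;
  specialize (E x Hx); specialize (Q0 x Hx); specialize (Q1 x Hx); specialize (Q2 x Hx);
  pose proof (exp_pos (- (k / 2) * x)); pose proof (exp_pos (- c * x)); simpl in *; nra.
Qed.

(** Differentiation in c brings down - x; integrating the derivative of the kernel over the half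
    line trades this x for the factor c and a boundary value 1. *)
Let CD_In c : 0 < c -> CD In c ((c * In c - 1) / (2 * Ci * mu))%C.
Proof.
intros Hc.
destruct (xkern_dom (c / 2) ltac:(lra)) as [K HK].
assert (D : CD In c (II (fun x => - RtoC x * kern mu c x)%C)).
{ apply (CD_II_deriv (kern mu) (fun c x => - RtoC x * kern mu c x)%C (fun c x => RtoC x * RtoC x * kern mu c x)%C
   (c / 2) (2 * c) K (c / 2 / 2) c); [lra|lra| |].
  - intros t Ht; destruct (HK t ltac:(lra)) as [A1 [A2 A3]].
    exact (conj (kern_cont _ _) (conj (xkern_cont t) (conj A1 (conj A2 A3)))).
  - intros t x Ht.
    assert (G : CD (fun t => kern mu t x) t (- RtoC x * kern mu t x)%C).
    { unfold kern; eapply CD_eq.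
      - apply CD_Cexp, CD_minus; [apply CD_const|apply (CD_RtoC (fun c => c * x) t x)].
        auto_derive; [easy|ring].
      - cbv beta; ring. }
    split; [exact G|]; eapply CD_eq; [apply CD_scal, G|ring]. }
eapply CD_eq; [exact D|].
destruct (HK c ltac:(lra)) as [A1 [A2 _]].
assert (I1 := isI_FTC (kern mu c) _ 1 c Hc (CD_kern mu c)).
assert (Cc : Ccont (fun x => (- (2 * Ci * mu * x) - c) * kern mu c x)%C).
{ apply Ccont_mult; [|apply kern_cont].
  eapply CD_Ccont; intros x; apply CD_minus; [apply CD_opp, CD_scal, CD_id|apply CD_const]. }
specialize (I1 Cc (kern_dom mu c)).
assert (I2 := isI_plus _ _ _ _ (isI_scal (2 * Ci * mu)%C _ _ (II_correct _ K (c / 2 / 2) ltac:(lra) (xkern_cont c) A2))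
  (isI_scal (- RtoC c)%C _ _ (II_correct _ 1 c Hc (kern_cont mu c) (kern_dom mu c)))).
apply (isI_ext _ (fun x => (- (2 * Ci * mu * x) - c) * kern mu c x)%C) in I2; [|intros; ring].
assert (E := isI_unique _ _ _ I1 I2).
assert (K0 : kern mu c 0 = RtoC 1).
{ unfold kern; rewrite <- Cexp_0; f_equal; replace (mu * 0 ^ 2) with 0 by ring; rewrite Rmult_0_r; ring. }
rewrite K0 in E; fold (In c) in E.
replace (II (fun x => - RtoC x * kern mu c x)%C) with
 ((2 * Ci * mu * II (fun x => - RtoC x * kern mu c x)%C + - c * In c + c * In c) / (2 * Ci * mu))%C by cfield.
rewrite <- E; cfield.
Qed.

Let ch (v : R) : C := Cexp (Ci * RtoC (v ^ 2 / (4 * mu)))%C.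
Let Dd (c : R) : C := CI ch 0 c.
Let kappa : C := (RtoC (sqrt (PI / (8 * mu))) * (1 - Ci))%C.

(** For c > 0 this is the integral of exp (- i m x^2 - c x) over the half line, by [II_kern]. The
    right side makes sense for every real c, and it is this continuation that gets shifted to
    negative c. *)
Definition It (m c : R) : C :=
  (Cexp (- (Ci * RtoC (c ^ 2 / (4 * m)))) * (RtoC (sqrt (PI / (8 * m))) * (1 - Ci)
    + Ci / (2 * m) * CI (fun v => Cexp (Ci * RtoC (v ^ 2 / (4 * m)))%C) 0 c))%C.

Let CD_ch v : CD ch v (Ci * RtoC (v / (2 * mu)) * ch v)%C.
Proof.
unfold ch; eapply CD_eq.
- apply CD_Cexp, CD_scal, (CD_RtoC (fun v => v ^ 2 / (4 * mu)) v (v / (2 * mu))).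
  auto_derive; [easy|field; lra].
- cbv beta; ring.
Qed.

Let ch_cont : Ccont ch.
Proof. eapply CD_Ccont; intros; apply CD_ch. Qed.

Let sqrt_mu : 0 < sqrt mu.
Proof. apply sqrt_lt_R0, Hmu. Qed.

Let Dd_Phi c : Dd c = (RtoC (2 * sqrt mu) * Phi (RtoC (-1) * Ci) (c / (2 * sqrt mu)))%C.
Proof.
set (u := / (2 * sqrt mu)).
assert (H := isCI_comp_lin (gw (RtoC (-1) * Ci)) u 0 0 c (Phi (RtoC (-1) * Ci) (c / (2 * sqrt mu)))).
replace (u * 0 + 0) with 0 in H by ring; replace (u * c + 0) with (c / (2 * sqrt mu)) in H by (unfold u; field; lra).
specialize (H (CI_correct _ _ _ (gw_cont _))).
apply (isCI_scal (RtoC (2 * sqrt mu))) in H.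
apply isCI_CI; eapply isCI_ext; [|exact H]; intros v _; cbv beta.
rewrite Cmult_assoc, <- RtoC_mult; unfold u.
replace (2 * sqrt mu * / (2 * sqrt mu)) with 1 by (field; lra).
rewrite Cmult_1_l; unfold gw, ch; f_equal.
replace ((/ (2 * sqrt mu) * v + 0) ^ 2) with (v ^ 2 / (4 * mu)); [rewrite RtoC_m1; ring|].
replace mu with (sqrt mu * sqrt mu) at 1 by (apply sqrt_sqrt; lra); field; lra.
Qed.

(** By the differential equation of [In], the combination ch (c) In (c) - i / (2 mu) Dd (c) does not
    depend on c. As c grows, [In] tends to 0 and [Dd] to a complete Fresnel integral, which
    evaluates the constant as [kappa]. *)
Lemma II_kern c : 0 < c -> II (kern mu c) = It mu c.
Proof.
intros Hc.
set (E := fun c => (ch c * In c - Ci / (2 * mu) * Dd c)%C).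
assert (DE : forall x, 0 < x -> CD E x (RtoC 0)).
{ intros x Hx; unfold E; eapply CD_eq.
  - apply CD_minus; [apply CD_mult; [apply CD_ch|apply CD_In, Hx]|apply CD_scal, CD_CI, ch_cont].
  - cbv beta; unfold Rdiv; rewrite RtoC_mult, RtoC_inv, RtoC_mult by lra.
    replace (Ci * (x * / (2 * mu)) * ch x * In x + ch x * ((x * In x - 1) / (2 * Ci * mu)) - Ci / (2 * mu) * ch x)%C
      with ((1 + Ci * Ci) * (ch x * (x * In x - 1) / (2 * Ci * mu)))%C by cfield.
    rewrite Ci2, RtoC_m1; ring. }
assert (EK : E c = kappa).
{ apply Ceq_minus, (C_small_0 _ (3 * (1 + c))); intros M HM.
  apply le_INR in HM; simpl in HM.
  set (X := c + INR M).
  rewrite <- (CD_const_fun E c X (ltac:(unfold X; lra)) (fun x Hx => DE x ltac:(lra))).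
  assert (PX : 0 < X) by (unfold X; lra).
  assert (A := In_bound X PX).
  assert (B := Phi_lim_i (-1) ltac:(lra) (X / (2 * sqrt mu)) ltac:(apply Rdiv_lt_0_compat; lra)).
  cbv zeta in B.
  assert (Kp : kappa = (- (Ci / (2 * mu)) * (RtoC (2 * sqrt mu) * (RtoC (sqrt (PI / 8)) * (1 - RtoC (-1) * Ci))))%C).
  { unfold kappa; replace (sqrt (PI / (8 * mu))) with (sqrt (PI / 8) / sqrt mu).
    2: { rewrite <- sqrt_div by (try lra; pose proof PI_RGT_0; lra); f_equal; field; lra. }
    unfold Rdiv at 1; rewrite RtoC_mult, RtoC_inv by lra.
    assert (s0 : RtoC (sqrt mu) <> RtoC 0) by (intros F; injection F; lra).
    replace (RtoC mu) with (RtoC (sqrt mu) * RtoC (sqrt mu))%C by (rewrite <- RtoC_mult, sqrt_sqrt by lra; easy).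
    rewrite RtoC_mult, RtoC_m1.
    replace (1 - Ci)%C with (- Ci - Ci * Ci)%C at 1 by (rewrite Ci2, RtoC_m1; ring).
    cfield. }
  unfold E; rewrite Dd_Phi, Kp.
  set (Kw := (sqrt (PI / 8) * (1 - -1 * Ci))%C) in *.
  set (P := Phi (-1 * Ci)%C (X / (2 * sqrt mu))) in *.
  replace (ch X * In X - Ci / (2 * mu) * (RtoC (2 * sqrt mu) * P) - - (Ci / (2 * mu)) * (RtoC (2 * sqrt mu) * Kw))%C
   with (ch X * In X - Ci / (2 * mu) * RtoC (2 * sqrt mu) * (P - Kw))%C by ring.
  eapply Rle_trans; [apply Cmod_triangle|]; rewrite Cmod_opp, !Cmod_mult.
  assert (C1 : Cmod (ch X) = 1).
  { unfold ch; rewrite Cmod_Cexp, <- exp_0; f_equal; simpl; ring. }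
  assert (C2 : Cmod (Ci / (2 * mu))%C = / (2 * mu)).
  { rewrite Cmod_div, Cmod_Ci, Cmod_mult, !Cmod_R, !Rabs_pos_eq by first [lra | apply Cmult_neq_0; [apply two_neq0|exact mu0]]; field; lra. }
  rewrite C1, C2, Cmod_R, (Rabs_pos_eq (2 * sqrt mu)) by lra.
  assert (N1 : / (2 * mu) * (2 * sqrt mu) * (/ (X / (2 * sqrt mu))) = 2 / X).
  { replace mu with (sqrt mu * sqrt mu) at 1 by (apply sqrt_sqrt; lra); field; lra. }
  assert (0 < / (2 * mu) * (2 * sqrt mu)) by (apply Rmult_lt_0_compat; [apply Rinv_0_lt_compat|]; lra).
  apply (Rmult_le_compat_l (/ (2 * mu) * (2 * sqrt mu))) in B; [|lra]; rewrite N1 in B.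
  apply Rle_trans with (3 / X); [unfold Rdiv in *; lra|].
  apply Rmult_le_reg_r with (X * INR M); [nra|].
  replace (3 / X * (X * INR M)) with (3 * INR M) by (field; lra).
  replace (3 * (1 + c) / INR M * (X * INR M)) with (3 * (1 + c) * X) by (field; lra).
  unfold X; nra. }
unfold It; fold ch; change (CI ch 0 c) with (Dd c).
change (sqrt (PI / (8 * mu)) * (1 - Ci))%C with kappa; rewrite <- EK; unfold E.
rewrite Cexp_opp; fold (ch c).
assert (ch c <> RtoC 0) by apply Cexp_neq0.
change (II (kern mu c)) with (In c); cfield.
Qed.

(** Formally c -> - c is x -> - x, and the sum is a Fresnel integral over the whole line. In the
    closed form the incomplete integrals are odd in c and cancel. *)
Lemma It_add_opp c : (It mu c + It mu (- c) = 2 * kappa * Cexp (- (Ci * RtoC (c ^ 2 / (4 * mu)))))%C.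
Proof.
assert (E : Dd (- c) = (- Dd c)%C).
{ assert (H := isCI_comp_lin ch (-1) 0 0 c (Dd (- c))).
  replace (-1 * 0 + 0) with 0 in H by ring; replace (-1 * c + 0) with (- c) in H by ring.
  specialize (H (CI_correct _ _ _ ch_cont)).
  apply (isCI_ext _ (fun y => -1 * ch y)%C) in H.
  - apply (isCI_unique _ _ _ _ _ H).
    replace (- Dd c)%C with (-1 * Dd c)%C by (rewrite RtoC_m1; ring).
    apply isCI_scal, CI_correct, ch_cont.
  - intros y _; f_equal; unfold ch; do 3 f_equal; unfold Rdiv; f_equal; ring. }
unfold It; fold ch.
change (CI ch 0 c) with (Dd c).
change (CI ch 0 (- c)) with (Dd (- c)).
rewrite E; replace ((- c) ^ 2) with (c ^ 2) by ring; unfold kappa; ring.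
Qed.

(** Stands in for moving the line of integration by an imaginary amount Y; the integral over [0, Y]
    is the contribution of the segment joining the two lines. *)
Lemma It_shift c Y : (It mu (c + 2 * mu * Y)%R =
  Cexp (- (Ci * RtoC (c * Y + mu * Y ^ 2))) *
   (It mu c + Ci * CI (fun y => Cexp (Ci * RtoC (c * y + mu * y ^ 2))) 0 Y))%C.
Proof.
set (g := fun y => Cexp (Ci * RtoC (c * y + mu * y ^ 2))%C).
assert (E : Dd (c + 2 * mu * Y) = (Dd c + 2 * mu * ch c * CI g 0 Y)%C).
{ unfold Dd; rewrite <- (CI_Chasles ch 0 c) by apply ch_cont; f_equal.
  assert (H := isCI_comp_lin ch (2 * mu) c 0 Y (CI ch c (c + 2 * mu * Y))).
  replace (2 * mu * 0 + c) with c in H by ring; replace (2 * mu * Y + c) with (c + 2 * mu * Y) in H by ring.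
  specialize (H (CI_correct _ _ _ ch_cont)).
  apply (isCI_unique _ _ _ _ _ H).
  assert (gc : Ccont g).
  { eapply CD_Ccont; intros x; apply CD_Cexp, CD_scal, (CD_RtoC (fun y => c * y + mu * y ^ 2) x (c + 2 * mu * x)).
    auto_derive; [easy|ring]. }
  apply (isCI_ext (fun y => 2 * mu * ch c * g y)%C); [|apply isCI_scal, CI_correct, gc].
  intros y _; rewrite RtoC_mult, <- !Cmult_assoc; do 2 f_equal; unfold ch, g; rewrite <- Cexp_add; f_equal.
  rewrite <- Cmult_plus_distr_l, <- RtoC_plus; do 2 f_equal; field; lra. }
unfold It; fold ch.
change (CI ch 0 c) with (Dd c).
change (CI ch 0 (c + 2 * mu * Y)) with (Dd (c + 2 * mu * Y)).
rewrite E.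
replace (- (Ci * ((c + 2 * mu * Y) ^ 2 / (4 * mu))%R))%C with
  (- (Ci * (c ^ 2 / (4 * mu))%R) + - (Ci * (c * Y + mu * Y ^ 2)%R))%C.
2: { replace ((c + 2 * mu * Y) ^ 2 / (4 * mu)) with (c ^ 2 / (4 * mu) + (c * Y + mu * Y ^ 2)) by (field; lra).
     rewrite !RtoC_plus; ring. }
rewrite Cexp_add, (Cexp_opp (Ci * (c ^ 2 / (4 * mu))%R)); fold (ch c).
assert (ch c <> RtoC 0) by apply Cexp_neq0; cfield.
Qed.

(** When the phases of the shifts by Y and by - Y agree, the two segment integrals combine and only
    the part odd in c, a sine, is left. These sines are what becomes a Dirichlet kernel after
    summation over c. *)
Lemma It_shift_sum c Y eta :
  Cexp (- (Ci * RtoC (c * Y + mu * Y ^ 2)))%C = eta -> Cexp (- (Ci * RtoC (- c * Y + mu * Y ^ 2)))%C = eta ->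
  (It mu (c + 2 * mu * Y)%R + It mu (c - 2 * mu * Y)%R =
   2 * eta * (It mu c - CI (fun y => RtoC (sin (c * y)) * Cexp (Ci * RtoC (mu * y ^ 2))) 0 Y))%C.
Proof.
intros H1 H2.
replace (c - 2 * mu * Y) with (c + 2 * mu * (- Y)) by ring.
rewrite !It_shift, H1.
replace (c * - Y + mu * (- Y) ^ 2) with (- c * Y + mu * Y ^ 2) by ring; rewrite H2.
set (g := fun s y => Cexp (Ci * RtoC (s * c * y + mu * y ^ 2))%C).
assert (gc : forall s, Ccont (g s)).
{ intros s; eapply CD_Ccont; intros x; apply CD_Cexp, CD_scal, (CD_RtoC (fun y => s * c * y + mu * y ^ 2) x (s * c + 2 * mu * x)).
  auto_derive; [easy|ring]. }
assert (E1 : CI (fun y => Cexp (Ci * RtoC (c * y + mu * y ^ 2))%C) 0 Y = CI (g 1) 0 Y).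
{ apply isCI_CI; apply (isCI_ext (g 1)); [|apply CI_correct, gc].
  intros y _; unfold g; rewrite Rmult_1_l; easy. }
assert (E2 : CI (fun y => Cexp (Ci * RtoC (c * y + mu * y ^ 2))%C) 0 (- Y) = (- CI (g (-1)%R) 0 Y)%C).
{ apply isCI_CI.
  assert (H := isCI_comp_lin (g (-1)) (-1) 0 0 (- Y) (CI (g (-1)) 0 Y)).
  replace (-1 * 0 + 0) with 0 in H by ring; replace (-1 * - Y + 0) with Y in H by ring.
  specialize (H (CI_correct _ _ _ (gc _))); apply (isCI_scal (-1)) in H.
  replace (-1 * CI (g (-1)%R) 0 Y)%C with (- CI (g (-1)%R) 0 Y)%C in H by (rewrite RtoC_m1; ring).
  eapply isCI_ext; [|exact H]; intros y _; cbv beta; unfold g.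
  rewrite Cmult_assoc, <- RtoC_mult; replace (-1 * -1)%R with 1 by ring; rewrite Cmult_1_l.
  do 3 f_equal; ring. }
assert (E3 : CI (fun y => RtoC (sin (c * y)) * Cexp (Ci * RtoC (mu * y ^ 2)))%C 0 Y = (/ (2 * Ci) * (CI (g 1) 0 Y + (-1) * CI (g (-1)%R) 0 Y))%C).
{ apply isCI_CI; eapply isCI_ext; [|apply isCI_scal, isCI_plus; [|apply isCI_scal]; apply CI_correct, gc].
  intros y _; cbv beta; unfold g.
  rewrite !RtoC_plus, !Cmult_plus_distr_l, !Cexp_add.
  assert (T : forall x, Cexp (Ci * RtoC x)%C = (RtoC (cos x) + Ci * RtoC (sin x))%C).
  { intros x; unfold Cexp, Ci, RtoC, Cmult, Cplus; simpl.
    replace (0 * x - 1 * 0) with 0 by ring; replace (0 * 0 + 1 * x) with x by ring; rewrite exp_0; f_equal; ring. }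
  rewrite (T (1 * c * y)), (T (-1 * c * y)).
  replace (1 * c * y) with (c * y) by ring; replace (-1 * c * y) with (- (c * y)) by ring.
  rewrite cos_neg, sin_neg, RtoC_opp, RtoC_m1; cfield. }
rewrite E1, E2, E3, RtoC_m1.
replace (/ (2 * Ci))%C with (- (Ci / 2))%C; [cfield|].
replace (- (Ci / 2))%C with (- (Ci * Ci) * / (2 * Ci))%C by cfield; rewrite Ci2, RtoC_m1; ring.
Qed.

End Mordell.

(** * Dirichlet kernels concentrating at the half integers *)

Fixpoint dirk (M : nat) (y : R) : R :=
  match M with O => 0 | S p => dirk p y + (-1) ^ p * sin ((2 * INR p + 1) * PI * y) end.

(** The kernel [dirk] seen from the point 1/2, where the alternating signs disappear: it is even,
    and equal to sin (2 pi M v) / (2 sin (pi v)). *)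
Fixpoint dirc (M : nat) (v : R) : R :=
  match M with O => 0 | S p => dirc p v + cos ((2 * INR p + 1) * PI * v) end.

Lemma sin_add_npi (x : R) (n : nat) : sin (x + INR n * PI) = (-1) ^ n * sin x.
Proof.
induction n as [|n IH]; [simpl; rewrite Rmult_0_l, Rplus_0_r; ring|].
rewrite S_INR; replace (x + (INR n + 1) * PI) with (x + INR n * PI + PI) by ring.
rewrite neg_sin, IH; simpl; ring.
Qed.

Lemma cos_add_npi (x : R) (n : nat) : cos (x + INR n * PI) = (-1) ^ n * cos x.
Proof.
induction n as [|n IH]; [simpl; rewrite Rmult_0_l, Rplus_0_r; ring|].
rewrite S_INR; replace (x + (INR n + 1) * PI) with (x + INR n * PI + PI) by ring.
rewrite neg_cos, IH; simpl; ring.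
Qed.

Lemma pm1_sq (n : nat) : (-1) ^ n * (-1) ^ n = 1.
Proof. rewrite <- Rpow_mult_distr; replace (-1 * -1) with 1 by ring; apply pow1. Qed.

Lemma dirk_half_plus M v : dirk M (/ 2 + v) = dirc M v.
Proof.
induction M as [|p IH]; [easy|]; simpl; rewrite IH; f_equal.
replace ((2 * INR p + 1) * PI * (/ 2 + v)) with (PI / 2 + ((2 * INR p + 1) * PI * v + INR p * PI)) by field.
rewrite <- cos_sin, cos_add_npi, <- Rmult_assoc, pm1_sq; ring.
Qed.

Lemma dirc_even M v : dirc M (- v) = dirc M v.
Proof.
induction M as [|p IH]; [easy|]; simpl; rewrite IH; f_equal.
replace ((2 * INR p + 1) * PI * - v) with (- ((2 * INR p + 1) * PI * v)) by ring; apply cos_neg.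
Qed.

Lemma dirk_shift M (j : nat) y : dirk M (INR j + y) = (-1) ^ j * dirk M y.
Proof.
induction M as [|p IH]; [simpl; ring|]; simpl; rewrite IH.
replace ((2 * INR p + 1) * PI * (INR j + y)) with ((2 * INR p + 1) * PI * y + INR ((2 * p + 1) * j) * PI).
2: { rewrite mult_INR, plus_INR, mult_INR; simpl; ring. }
rewrite sin_add_npi, pow_mult; replace ((-1) ^ (2 * p + 1)) with (-1) by (rewrite Nat.add_1_r, pow_1_odd; easy); ring.
Qed.

Lemma dirc_closed M v : 2 * sin (PI * v) * dirc M v = sin (2 * PI * INR M * v).
Proof.
induction M as [|p IH]; [replace (2 * PI * INR 0 * v) with 0 by (simpl; ring); rewrite sin_0; simpl; ring|].
change (dirc (S p) v) with (dirc p v + cos ((2 * INR p + 1) * PI * v)).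
rewrite Rmult_plus_distr_l, IH, S_INR.
replace (2 * PI * INR p * v) with ((2 * INR p + 1) * PI * v - PI * v) by ring.
replace (2 * PI * (INR p + 1) * v) with ((2 * INR p + 1) * PI * v + PI * v) by ring.
rewrite sin_plus, sin_minus; ring.
Qed.

Lemma dirc_bound M v : Rabs (dirc M v) <= INR M.
Proof.
induction M as [|p IH]; [simpl; rewrite Rabs_R0; lra|]; rewrite S_INR; simpl.
eapply Rle_trans; [apply Rabs_triang|].
assert (Rabs (cos ((2 * INR p + 1) * PI * v)) <= 1) by (apply Rabs_le, COS_bound); lra.
Qed.

Lemma dirc_cont M v : continuous (dirc M) v.
Proof.
induction M as [|p IH]; [apply continuous_const|].
apply (continuous_plus (dirc p) (fun v => cos ((2 * INR p + 1) * PI * v)) v IH).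
apply (@ex_derive_continuous R_AbsRing R_NormedModule); auto_derive; easy.
Qed.

Lemma dirk_cont M v : continuous (dirk M) v.
Proof.
induction M as [|p IH]; [apply continuous_const|].
apply (continuous_plus (dirk p) (fun v => (-1) ^ p * sin ((2 * INR p + 1) * PI * v)) v IH).
apply (@ex_derive_continuous R_AbsRing R_NormedModule); auto_derive; easy.
Qed.

(** A weak form of Jordan's inequality: sin x >= x - x^3 / 6 >= x / 3 for 0 <= x <= 2, and pi >=
    3. *)
Lemma sin_pi_ge v : 0 <= v <= / 2 -> v <= sin (PI * v).
Proof.
intros Hv; set (x := PI * v).
assert (P4 := PI_4); assert (P3 := PI2_3_2); assert (P0 := PI_RGT_0).
assert (Hx : 0 <= x <= 2) by (unfold x; nra).
destruct (MVT_gen (fun x => sin x - x + x ^ 3 / 6) 0 x (fun x => cos x - 1 + x ^ 2 / 2)) as [c [_ E]].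
- intros y _; auto_derive; [easy|field].
- intros y _; apply continuity_pt_filterlim.
  apply (@ex_derive_continuous R_AbsRing R_NormedModule (fun x => sin x - x + x ^ 3 / 6)); auto_derive; easy.
- pose proof (cos_ge c) as G; rewrite sin_0 in E.
  assert (0 <= sin x - x + x ^ 3 / 6).
  { replace (sin x - x + x ^ 3 / 6) with ((cos c - 1 + c ^ 2 / 2) * (x - 0)) by (rewrite <- E; field).
    apply Rmult_le_pos; lra. }
  assert (x ^ 3 / 6 <= x * (4 / 6)).
  { replace (x ^ 3 / 6) with (x * (x * x / 6)) by field. apply Rmult_le_compat_l; nra. }
  assert (3 * v <= x) by (unfold x; nra); lra.
Qed.

(* Integral of [dirc M] over [0, 1/2]; tends to 1/4 by Leibniz's series. *)
Fixpoint dirs (M : nat) : R :=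
  match M with O => 0 | S p => dirs p + (-1) ^ p / ((2 * INR p + 1) * PI) end.

Lemma dirc_int M : isCI (fun v => RtoC (dirc M v)) 0 (/ 2) (RtoC (dirs M)).
Proof.
induction M as [|p IH].
- assert (Z := isCI_scal (RtoC 0) _ _ _ _ (CI_correct (fun _ => RtoC 1) 0 (/ 2) (Ccont_const _))).
  rewrite Cmult_0_l in Z; eapply isCI_ext; [|exact Z]; intros v _; simpl; ring.
- apply (isCI_ext (fun v => RtoC (dirc p v) + RtoC (cos ((2 * INR p + 1) * PI * v)))%C).
  { intros v _; simpl; rewrite RtoC_plus; easy. }
  simpl dirs; rewrite RtoC_plus; apply isCI_plus; [exact IH|].
  set (a := (2 * INR p + 1) * PI).
  assert (a0 : 0 < a) by (unfold a; pose proof (pos_INR p); pose proof PI_RGT_0; nra).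
  replace (RtoC ((-1) ^ p / a)) with (RtoC (sin (a * / 2) / a) - RtoC (sin (a * 0) / a))%C.
  2: { rewrite Rmult_0_r, sin_0, <- RtoC_minus; f_equal.
       replace (a * / 2) with (PI / 2 + INR p * PI) by (unfold a; field).
       rewrite sin_add_npi, sin_PI2; field; lra. }
  apply (isCI_FTC (fun v => RtoC (sin (a * v) / a))).
  + intros v _; apply (CD_RtoC (fun v => sin (a * v) / a)); auto_derive; [easy|field; lra].
  + intros v _; apply (Ccont_RtoC (fun v => cos (a * v))); intros u.
    apply (@ex_derive_continuous R_AbsRing R_NormedModule); auto_derive; easy.
Qed.

Lemma dirs_lim : forall eps, 0 < eps -> exists M0, forall M, (M0 <= M)%nat -> Rabs (dirs M - / 4) < eps.
Proof.
intros eps He.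
assert (A := Alt_PI_eq); unfold Alt_PI in A; destruct exist_PI as [l Hl]; simpl in A.
assert (P := PI_RGT_0).
destruct (Hl (eps * PI)) as [N HN]; [nra|].
exists (S N); intros [|M] HM; [lia|].
specialize (HN M ltac:(lia)); unfold Rdist in HN.
assert (E : dirs (S M) = sum_f_R0 (tg_alt PI_tg) M / PI).
{ clear; assert (P := PI_RGT_0); induction M as [|M IH].
  - unfold tg_alt, PI_tg; simpl; field; lra.
  - change (dirs (S (S M))) with (dirs (S M) + (-1) ^ S M / ((2 * INR (S M) + 1) * PI)).
    rewrite IH, tech5.
    assert (Et : tg_alt PI_tg (S M) = (-1) ^ S M / (2 * INR (S M) + 1)).
    { unfold tg_alt, PI_tg, Rdiv; do 2 f_equal; rewrite plus_INR, mult_INR; easy. }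
    rewrite Et.
    pose proof (pos_INR (S M)); field; split; lra. }
rewrite E; replace (sum_f_R0 (tg_alt PI_tg) M / PI - / 4) with ((sum_f_R0 (tg_alt PI_tg) M - l) / PI).
- unfold Rdiv; rewrite Rabs_mult, (Rabs_pos_eq (/ PI)) by (left; apply Rinv_0_lt_compat; lra).
  apply Rmult_lt_reg_r with PI; [lra|]; rewrite Rmult_assoc, Rinv_l by lra; lra.
- replace l with (PI / 4) by lra; field; lra.
Qed.

Section Dirichlet.
Variables (F F1 F2 : R -> C) (B : R).
Hypothesis D1 : forall x, CD F x (F1 x).
Hypothesis D2 : forall x, CD F1 x (F2 x).
Hypothesis HB : forall x, 0 <= x <= 1 -> Cmod (F2 x) <= B.

(** Symmetrising about 1/2 kills the linear term, so that G is of order v^2 exactly where the kernel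
    is large. *)
Let G (v : R) : C := (F (/ 2 + v)%R + F (/ 2 + - v)%R - 2 * F (/ 2)%R)%C.
Let G1 (v : R) : C := (F1 (/ 2 + v)%R - F1 (/ 2 + - v)%R)%C.

Let DG v : CD G v (G1 v).
Proof.
unfold G, G1; eapply CD_eq.
- apply CD_minus; [apply CD_plus|apply CD_const].
  + apply (CD_comp F (fun v => / 2 + v) v (F1 (/ 2 + v)) 1); [apply D1|auto_derive; [easy|ring]].
  + apply (CD_comp F (fun v => / 2 + - v) v (F1 (/ 2 + - v)) (-1)); [apply D1|auto_derive; [easy|ring]].
- cbv beta; rewrite RtoC_m1; ring.
Qed.

Let DG1 v : CD G1 v (F2 (/ 2 + v)%R + F2 (/ 2 + - v)%R)%C.
Proof.
unfold G1; eapply CD_eq.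
- apply CD_minus.
  + apply (CD_comp F1 (fun v => / 2 + v) v (F2 (/ 2 + v)) 1); [apply D2|auto_derive; [easy|ring]].
  + apply (CD_comp F1 (fun v => / 2 + - v) v (F2 (/ 2 + - v)) (-1)); [apply D2|auto_derive; [easy|ring]].
- cbv beta; rewrite RtoC_m1; ring.
Qed.

Let B0 : 0 <= B.
Proof. eapply Rle_trans; [apply Cmod_ge_0|apply (HB 0); lra]. Qed.

Let G1_bound v : 0 <= v <= / 2 -> Cmod (G1 v) <= 4 * B * v.
Proof.
intros Hv; unfold G1; replace (4 * B * v) with (2 * B * (/ 2 + v - (/ 2 + - v))) by ring.
apply (CMVT F1 F2); [lra|intros; apply D2|intros; apply HB; lra].
Qed.

Let G_bound v : 0 <= v <= / 2 -> Cmod (G v) <= 8 * B * v ^ 2.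
Proof.
intros Hv.
assert (G0 : G 0 = RtoC 0).
{ unfold G; rewrite Ropp_0, !Rplus_0_r; ring. }
replace (G v) with (G v - G 0)%C by (rewrite G0; ring).
replace (8 * B * v ^ 2) with (2 * (4 * B * v) * (v - 0)) by ring.
apply (CMVT G G1); [lra|intros; apply DG|].
intros x Hx; eapply Rle_trans; [apply G1_bound; lra|]. pose proof B0; nra.
Qed.

Let Fc : Ccont F.
Proof. eapply CD_Ccont; apply D1. Qed.
Let Gc : Ccont G.
Proof. eapply CD_Ccont; apply DG. Qed.

Let dircC M : Ccont (fun v => RtoC (dirc M v)).
Proof. apply Ccont_RtoC, dirc_cont. Qed.

Let split_int M : (CI (fun y => F y * RtoC (dirk M y)) 0 1 =
  2 * F (/ 2)%R * RtoC (dirs M) + CI (fun v => G v * RtoC (dirc M v)) 0 (/ 2))%C.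
Proof.
set (f := fun y => (F y * RtoC (dirk M y))%C).
assert (fc : Ccont f) by (apply Ccont_mult; [exact Fc|apply Ccont_RtoC, dirk_cont]).
rewrite <- (CI_Chasles f 0 (/ 2) 1 fc).
assert (A := isCI_comp_lin f 1 (/ 2) 0 (/ 2) (CI f (/ 2) 1)).
replace (1 * 0 + / 2) with (/ 2) in A by ring; replace (1 * / 2 + / 2) with 1 in A by field.
specialize (A (CI_correct _ _ _ fc)).
assert (A' := isCI_comp_lin f (-1) (/ 2) 0 (/ 2) (CI f (/ 2) 0)).
replace (-1 * 0 + / 2) with (/ 2) in A' by ring; replace (-1 * / 2 + / 2) with 0 in A' by field.
specialize (A' (CI_correct _ _ _ fc)).
assert (Sw : CI f (/ 2) 0 = (- CI f 0 (/ 2))%C).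
{ assert (E := CI_Chasles f 0 (/ 2) 0 fc); rewrite CI_point in E.
  replace (CI f (/ 2) 0) with (CI f 0 (/ 2) + CI f (/ 2) 0 - CI f 0 (/ 2))%C by ring; rewrite E; ring. }
rewrite Sw in A'; apply (isCI_scal (-1)) in A'.
assert (S := isCI_plus _ _ _ _ _ _ A' A).
replace (CI f 0 (/ 2) + CI f (/ 2) 1)%C with (-1 * - CI f 0 (/ 2) + CI f (/ 2) 1)%C by (rewrite RtoC_m1; ring).
apply (isCI_unique _ _ _ _ _ S).
assert (T := isCI_plus _ _ _ _ _ _ (isCI_scal (2 * F (/ 2)%R) _ _ _ _ (dirc_int M))
  (CI_correct (fun v => G v * RtoC (dirc M v))%C 0 (/ 2) (Ccont_mult _ _ Gc (dircC M)))).
eapply isCI_ext; [|exact T]; intros v _; cbv beta; unfold f, G.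
replace (1 * v + / 2) with (/ 2 + v) by ring; replace (-1 * v + / 2) with (/ 2 + - v) by ring.
rewrite !dirk_half_plus, dirc_even, RtoC_m1; ring.
Qed.

(** A Riemann-Lebesgue estimate with a rate. Up to d = 1 / (4 M) the kernel is at most M and G at
    most 8 B v^2. Beyond d the closed form of the kernel is integrated by parts: because G vanishes
    to second order, G / sin and its derivative stay bounded, and the primitive of sin (2 pi M v)
    gains 1 / M. *)
Let rem_bound M : (1 <= M)%nat -> Cmod (CI (fun v => G v * RtoC (dirc M v))%C 0 (/ 2)) <= 5 * B / INR M.
Proof.
intros HM; apply le_INR in HM; simpl in HM; set (m := INR M) in *.
set (d := / (4 * m)).
assert (d0 : 0 < d) by (apply Rinv_0_lt_compat; lra).
assert (d4 : d <= / 4) by (apply Rinv_le_contravar; lra).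
assert (dm : d * m = / 4) by (unfold d; field; lra).
set (g := fun v => (G v * RtoC (dirc M v))%C).
assert (gc : Ccont g) by (apply Ccont_mult; [exact Gc|apply dircC]).
rewrite <- (CI_Chasles g 0 d (/ 2) gc).
assert (PB := B0); assert (P0 := PI_RGT_0); assert (P4 := PI_4).
assert (P3 : 3 < PI) by (pose proof PI2_3_2; lra).
assert (X1 : Cmod (CI g 0 d) <= B / m).
{ eapply Rle_trans; [apply (isCI_bound_const g 0 d _ (8 * B * d ^ 2 * m) ltac:(lra)); [|apply CI_correct, gc]|].
  - intros v Hv; unfold g; rewrite Cmod_mult, Cmod_R.
    apply Rmult_le_compat; [apply Cmod_ge_0|apply Rabs_pos| |apply dirc_bound].
    eapply Rle_trans; [apply G_bound; lra|]. apply Rmult_le_compat_l; nra.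
  - replace (8 * B * d ^ 2 * m * (d - 0)) with (2 * B * (d * d)) by (replace (8 * B * d ^ 2 * m * (d - 0)) with (8 * B * (d * d) * (d * m)) by ring; rewrite dm; field).
    replace (B / m) with (4 * B * d) by (unfold d; field; lra).
    assert (0 <= B * d) by nra; nra. }
set (H := fun v => (G v * / RtoC (2 * sin (PI * v)))%C).
set (H1 := fun v => (G1 v * / RtoC (2 * sin (PI * v)) - G v * RtoC (2 * PI * cos (PI * v)) * / RtoC (2 * sin (PI * v)) * / RtoC (2 * sin (PI * v)))%C).
assert (Sp : forall v, d <= v <= / 2 -> v <= sin (PI * v)) by (intros; apply sin_pi_ge; lra).
assert (Sn : forall v, d <= v <= / 2 -> RtoC (2 * sin (PI * v)) <> RtoC 0).
{ intros v Hv E; injection E; specialize (Sp v Hv); lra. }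
assert (Ds : forall v, CD (fun v => RtoC (2 * sin (PI * v))) v (RtoC (2 * PI * cos (PI * v)))).
{ intros v; apply (CD_RtoC (fun v => 2 * sin (PI * v))); auto_derive; [easy|ring]. }
assert (DH : forall v, d <= v <= / 2 -> CD H v (H1 v)).
{ intros v Hv; unfold H, H1; eapply CD_eq; [apply CD_mult; [apply DG|apply CD_inv; [apply Sn, Hv|apply Ds]]|].
  cbv beta; generalize (Sn v Hv); generalize (RtoC (2 * sin (PI * v))); intros; cfield. }
set (k := 2 * PI * m); assert (k6 : 6 * m < k) by (unfold k; nra).
assert (k0 : 0 < k) by lra.
set (Co := fun v => RtoC (- cos (k * v) / k)).
assert (DCo : forall v, CD Co v (RtoC (sin (k * v)))).
{ intros v; apply (CD_RtoC (fun v => - cos (k * v) / k)); auto_derive; [easy|field; lra]. }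
set (p := fun v => (H1 v * Co v + H v * RtoC (sin (k * v)))%C).
assert (DP : forall v, d <= v <= / 2 -> CD (fun v => H v * Co v)%C v (p v)).
{ intros v Hv; apply CD_mult; [apply DH, Hv|apply DCo]. }
assert (H1c : forall v, d <= v <= / 2 -> exists l, CD H1 v l).
{ intros v Hv; eexists; unfold H1.
  apply CD_minus; [apply CD_mult; [apply DG1|apply CD_inv; [apply Sn, Hv|apply Ds]]|].
  apply CD_mult; [apply CD_mult; [apply CD_mult; [apply DG|]|apply CD_inv; [apply Sn, Hv|apply Ds]]|apply CD_inv; [apply Sn, Hv|apply Ds]].
  apply (CD_RtoC (fun v => 2 * PI * cos (PI * v)) v (- (2 * PI * PI * sin (PI * v)))); auto_derive; [easy|ring]. }
assert (pc : forall v, d <= v <= / 2 -> exists l, CD p v l).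
{ intros v Hv; destruct (H1c v Hv) as [l Hl]; eexists; unfold p.
  apply CD_plus; [apply CD_mult; [exact Hl|apply DCo]|apply CD_mult; [apply DH, Hv|]].
  apply (CD_RtoC (fun v => sin (k * v)) v (k * cos (k * v))); auto_derive; [easy|ring]. }
assert (I1 : isCI p d (/ 2) (H (/ 2)%R * Co (/ 2)%R - H d * Co d)%C).
{ apply (isCI_FTC (fun v => H v * Co v)%C p); rewrite Rmin_left, Rmax_right by lra; [exact DP|].
  intros v Hv; destruct (pc v Hv) as [l [L1 L2]]; split;
    apply (@ex_derive_continuous R_AbsRing R_NormedModule); eexists; eassumption. }
assert (I2 := isCI_plus _ _ _ _ _ _ I1 (isCI_scal (-1) _ _ _ _ (CI_correct g d (/ 2) gc))).
assert (HbH : forall v, d <= v <= / 2 -> Cmod (H v) <= 2 * B).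
{ intros v Hv; unfold H; specialize (Sp v Hv).
  rewrite Cmod_mult, Cmod_inv, Cmod_R, Rabs_pos_eq by (try apply Sn; lra).
  assert (Gv := G_bound v ltac:(lra)).
  apply Rmult_le_reg_r with (2 * sin (PI * v)); [lra|].
  rewrite Rmult_assoc, Rinv_l, Rmult_1_r by lra.
  apply (Rle_trans _ _ _ Gv); assert (v ^ 2 <= v / 2) by nra; nra. }
assert (HbH1 : forall v, d <= v <= / 2 -> Cmod (H1 v) <= 18 * B).
{ intros v Hv; unfold H1; specialize (Sp v Hv).
  assert (Gv := G_bound v ltac:(lra)); assert (G1v := G1_bound v ltac:(lra)).
  set (s := 2 * sin (PI * v)) in *; assert (s2 : 2 * v <= s) by (unfold s; lra).
  eapply Rle_trans; [apply Cmod_triangle|]; rewrite Cmod_opp, !Cmod_mult, !Cmod_inv, !Cmod_R, (Rabs_pos_eq s)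
    by (try apply Sn; lra).
  assert (C1 : Rabs (2 * PI * cos (PI * v)) <= 8).
  { rewrite Rabs_mult, (Rabs_pos_eq (2 * PI)) by lra.
    assert (Rabs (cos (PI * v)) <= 1) by (apply Rabs_le, COS_bound).
    pose proof (Rabs_pos (cos (PI * v))); nra. }
  assert (T1 : Cmod (G1 v) * / s <= 2 * B).
  { apply Rmult_le_reg_r with s; [lra|]; rewrite Rmult_assoc, Rinv_l, Rmult_1_r by lra; nra. }
  assert (T2 : Cmod (G v) * / s * / s <= 2 * B).
  { apply Rmult_le_reg_r with (s * s); [nra|].
    replace (Cmod (G v) * / s * / s * (s * s)) with (Cmod (G v)) by (field; lra).
    apply (Rle_trans _ _ _ Gv); assert (4 * v ^ 2 <= s * s) by nra.
    apply (Rmult_le_compat_l (2 * B)) in H0; lra. }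
  replace (Cmod (G v) * Rabs (2 * PI * cos (PI * v)) * / s * / s) with
    (Rabs (2 * PI * cos (PI * v)) * (Cmod (G v) * / s * / s)) by ring.
  assert (0 <= Cmod (G v) * / s * / s).
  { repeat apply Rmult_le_pos; try (left; apply Rinv_0_lt_compat; lra); apply Cmod_ge_0. }
  pose proof (Rabs_pos (2 * PI * cos (PI * v))); nra. }
assert (HCo : forall v, Cmod (Co v) <= / k).
{ intros v; unfold Co; rewrite Cmod_R; unfold Rdiv; rewrite Rabs_mult, Rabs_Ropp, (Rabs_pos_eq (/ k))
   by (left; apply Rinv_0_lt_compat; lra).
  assert (Rabs (cos (k * v)) <= 1) by (apply Rabs_le, COS_bound).
  assert (0 < / k) by (apply Rinv_0_lt_compat; lra); nra. }
assert (kk : / k <= / (6 * m)) by (apply Rinv_le_contravar; lra).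
assert (k1 : 0 < / k) by (apply Rinv_0_lt_compat; lra).
assert (I2b : Cmod (H (/ 2)%R * Co (/ 2)%R - H d * Co d + -1 * CI g d (/ 2))%C <= 18 * B * / k * (/ 2 - d)).
{ refine (isCI_bound_const _ d (/ 2) _ _ ltac:(lra) _ I2); intros v Hv; cbv beta.
  replace (p v + -1 * g v)%C with (H1 v * Co v)%C.
  - rewrite Cmod_mult.
    apply Rmult_le_compat; [apply Cmod_ge_0|apply Cmod_ge_0|apply HbH1, Hv|apply HCo].
  - unfold p, g, H, k, m; rewrite <- dirc_closed, (RtoC_mult (2 * sin (PI * v)) (dirc M v)), RtoC_m1.
    generalize (Sn v Hv); generalize (RtoC (2 * sin (PI * v))); intros; cfield. }
assert (X2 : Cmod (CI g d (/ 2)) <= 4 * B / m).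
{ replace (CI g d (/ 2)) with ((H (/ 2)%R * Co (/ 2)%R - H d * Co d) - (H (/ 2)%R * Co (/ 2)%R - H d * Co d + -1 * CI g d (/ 2)))%C
   by (rewrite RtoC_m1; ring).
  eapply Rle_trans; [apply Cmod_triangle|]; rewrite Cmod_opp.
  assert (T := Cmod_triangle (H (/ 2)%R * Co (/ 2)%R)%C (- (H d * Co d))%C); rewrite Cmod_opp, !Cmod_mult in T.
  assert (Y1 := HbH (/ 2) ltac:(lra)); assert (Y2 := HbH d ltac:(lra)).
  assert (Z1 := HCo (/ 2)); assert (Z2 := HCo d).
  pose proof (Cmod_ge_0 (H (/ 2))); pose proof (Cmod_ge_0 (H d)); pose proof (Cmod_ge_0 (Co (/ 2))); pose proof (Cmod_ge_0 (Co d)).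
  assert (W1 : Cmod (H (/ 2)) * Cmod (Co (/ 2)) <= 2 * B * / k) by (apply Rmult_le_compat; assumption).
  assert (W2 : Cmod (H d) * Cmod (Co d) <= 2 * B * / k) by (apply Rmult_le_compat; assumption).
  assert (W3 : 18 * B * / k * (/ 2 - d) <= 9 * B * / k).
  { assert (0 <= B * / k) by nra; nra. }
  apply Rle_trans with (13 * (B * / k)); [unfold Cminus in *; lra|].
  assert (B * / k <= B * / (6 * m)) by nra.
  replace (4 * B / m) with (24 * (B * / (6 * m))) by (field; lra).
  assert (0 <= B * / (6 * m)) by (apply Rmult_le_pos; [lra|left; apply Rinv_0_lt_compat; lra]); lra. }
eapply Rle_trans; [apply Cmod_triangle|].
replace (5 * B / m) with (B / m + 4 * B / m) by (field; lra); lra.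
Qed.

Lemma dirichlet_unit : forall eps, 0 < eps -> exists M0, forall M, (M0 <= M)%nat ->
  Cmod (CI (fun y => F y * RtoC (dirk M y)) 0 1 - / 2 * F (/ 2)%R)%C < eps.
Proof.
intros eps He.
assert (c0 : 0 < 2 * Cmod (F (/ 2)) + 1) by (pose proof (Cmod_ge_0 (F (/ 2))); lra).
destruct (dirs_lim (eps / 2 / (2 * Cmod (F (/ 2)) + 1))) as [M1 HM1]; [apply Rdiv_lt_0_compat; lra|].
destruct (nfloor_ex (10 * B / eps)) as [M2 [_ HM2]].
{ apply Rmult_le_pos; [pose proof B0; lra|left; apply Rinv_0_lt_compat; lra]. }
exists (max M1 (S M2)); intros M HM.
rewrite split_int.
replace (2 * F (/ 2)%R * dirs M + CI (fun v => G v * dirc M v)%C 0 (/ 2) - / 2 * F (/ 2)%R)%C with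
  (2 * F (/ 2)%R * RtoC (dirs M - / 4) + CI (fun v => G v * dirc M v)%C 0 (/ 2))%C.
2: { rewrite RtoC_minus, RtoC_inv by lra; cfield. }
eapply Rle_lt_trans; [apply Cmod_triangle|]; rewrite !Cmod_mult, !Cmod_R, (Rabs_pos_eq 2) by lra.
specialize (HM1 M ltac:(lia)); assert (R := rem_bound M ltac:(lia)).
assert (S2 : INR M2 + 1 <= INR M) by (rewrite <- S_INR; apply le_INR; lia).
assert (5 * B / INR M <= eps / 2).
{ pose proof (pos_INR M2); apply Rmult_le_reg_r with (INR M); [lra|].
  replace (5 * B / INR M * INR M) with (5 * B) by (field; lra).
  assert (10 * B / eps < INR M) by lra.
  apply (Rmult_lt_compat_l eps) in H0; [|lra].
  replace (eps * (10 * B / eps)) with (10 * B) in H0 by (field; lra); lra. }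
apply (Rmult_lt_compat_l (2 * Cmod (F (/ 2)) + 1)) in HM1; [|lra].
replace ((2 * Cmod (F (/ 2)) + 1) * (eps / 2 / (2 * Cmod (F (/ 2)) + 1))) with (eps / 2) in HM1 by (field; lra).
pose proof (Rabs_pos (dirs M - / 4)); nra.
Qed.

End Dirichlet.

(** A translation by j multiplies the kernel by (-1)^j, which reduces [0, m] to unit intervals, each
    contributing its midpoint. *)
Lemma dirichlet_sum (F F1 F2 : R -> C) (B : R) (m : nat) :
  (forall x, CD F x (F1 x)) -> (forall x, CD F1 x (F2 x)) ->
  (forall x, 0 <= x <= INR m -> Cmod (F2 x) <= B) ->
  forall eps, 0 < eps -> exists M0, forall M, (M0 <= M)%nat ->
  Cmod (CI (fun y => F y * RtoC (dirk M y)) 0 (INR m) - Csum (fun j => (- (1)) ^ j * (/ 2 * F (INR j + / 2)%R)) m)%C < eps.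
Proof.
intros D1 D2; induction m as [|m IH]; intros HB eps He.
- exists 0%nat; intros M _; simpl; rewrite CI_point.
  replace (0 - 0)%C with (RtoC 0) by ring; rewrite Cmod_0; exact He.
- destruct (IH ltac:(intros; apply HB; rewrite S_INR; lra) (eps / 2) ltac:(lra)) as [M1 HM1].
  assert (Sh : forall (f f1 : R -> C), (forall x, CD f x (f1 x)) -> forall x, CD (fun y => f (INR m + y)) x (f1 (INR m + x))).
  { intros f f1 Hf x; eapply CD_eq; [apply (CD_comp f (fun y => INR m + y) x (f1 (INR m + x)) 1); [apply Hf|auto_derive; [easy|ring]]|ring]. }
  destruct (dirichlet_unit _ _ _ B (Sh F F1 D1) (Sh F1 F2 D2)
    ltac:(intros; apply HB; rewrite S_INR; pose proof (pos_INR m); lra) (eps / 2) ltac:(lra)) as [M2 HM2].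
  exists (max M1 M2); intros M HM; specialize (HM1 M ltac:(lia)); specialize (HM2 M ltac:(lia)).
  assert (Fc : Ccont F) by (eapply CD_Ccont; apply D1).
  assert (gc : Ccont (fun y => F y * RtoC (dirk M y))%C) by (apply Ccont_mult; [exact Fc|apply Ccont_RtoC, dirk_cont]).
  rewrite S_INR, <- (CI_Chasles _ 0 (INR m) (INR m + 1) gc).
  change (Csum (fun j => (- (1)) ^ j * (/ 2 * F (INR j + / 2)%R))%C (S m)) with
   (Csum (fun j => (- (1)) ^ j * (/ 2 * F (INR j + / 2)%R)) m + (- (1)) ^ m * (/ 2 * F (INR m + / 2)%R))%C.
  assert (E : CI (fun y => F y * RtoC (dirk M y))%C (INR m) (INR m + 1) =
    ((- (1)) ^ m * CI (fun y => F (INR m + y)%R * RtoC (dirk M y)) 0 1)%C).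
  { assert (A := isCI_comp_lin (fun y => F y * RtoC (dirk M y))%C 1 (INR m) 0 1
       (CI (fun y => F y * RtoC (dirk M y))%C (INR m) (INR m + 1))).
    replace (1 * 0 + INR m) with (INR m) in A by ring; replace (1 * 1 + INR m) with (INR m + 1) in A by ring.
    specialize (A (CI_correct _ _ _ gc)); apply (isCI_unique _ _ _ _ _ A).
    eapply isCI_ext; [|apply isCI_scal, CI_correct].
    - intros y _; cbv beta; replace (1 * y + INR m) with (INR m + y) by ring.
      rewrite dirk_shift, RtoC_mult, RtoC_pow, RtoC_m1; ring.
    - apply Ccont_mult; [eapply CD_Ccont; apply (Sh F F1 D1)|apply Ccont_RtoC, dirk_cont]. }
  rewrite E.
  replace (CI (fun y => F y * dirk M y)%C 0 (INR m) + (- (1)) ^ m * CI (fun y => F (INR m + y)%R * dirk M y)%C 0 1 -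
    (Csum (fun j => (- (1)) ^ j * (/ 2 * F (INR j + / 2)%R))%C m + (- (1)) ^ m * (/ 2 * F (INR m + / 2)%R)))%C
   with ((CI (fun y => F y * dirk M y)%C 0 (INR m) - Csum (fun j => (- (1)) ^ j * (/ 2 * F (INR j + / 2)%R))%C m)
     + (- (1)) ^ m * (CI (fun y => F (INR m + y)%R * dirk M y)%C 0 1 - / 2 * F (INR m + / 2)%R))%C by ring.
  eapply Rle_lt_trans; [apply Cmod_triangle|].
  rewrite Cmod_mult, Cmod_pow, Cmod_opp, Cmod_1, pow1; lra.
Qed.

(** * The Mordell integral at a rational parameter as two finite theta sums *)

Definition mord (m u : R) : C :=
  (Cexp (- (Ci * RtoC (m * u ^ 2))) * RtoC ((cosh (5 * PI * u / 6) + cosh (PI * u / 6)) / cosh (PI * u)))%C.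

Definition mordf (u : R) : R := (cosh (5 * PI * u / 6) + cosh (PI * u / 6)) / cosh (PI * u).

Lemma cosh_pos (x : R) : 0 < cosh x.
Proof. unfold cosh; pose proof (exp_pos x); pose proof (exp_pos (- x)); lra. Qed.

Definition cc (p : nat) (a : R) : R := PI * (12 * INR p + a) / 6.

Lemma cc_pos p a : 1 <= a -> 0 < cc p a.
Proof. intros Ha; unfold cc; pose proof (pos_INR p); pose proof PI_RGT_0; nra. Qed.

Definition gs (f : R -> C) (p : nat) : C := (f (cc p 1) + f (cc p 5) + f (cc p 7) + f (cc p 11))%C.

Lemma exp_nat (n : nat) (x : R) : exp (INR n * x) = exp x ^ n.
Proof.
induction n as [|n IH]; [simpl; rewrite Rmult_0_l, exp_0; easy|].
rewrite S_INR, Rmult_plus_distr_r, Rmult_1_l, exp_plus, IH; simpl; ring.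
Qed.

(** With y = exp (- pi u / 6) the quotient is (y + y^5 + y^7 + y^11) / (1 + y^12). This is where the
    residues 1, 5, 7, 11 modulo 12 come from. *)
Lemma mordf_expand (u : R) :
  mordf u * (1 + exp (- (2 * PI * u))) =
  exp (- cc 0 1 * u) + exp (- cc 0 5 * u) + exp (- cc 0 7 * u) + exp (- cc 0 11 * u).
Proof.
set (y := exp (- (PI * u / 6))).
assert (y0 : 0 < y) by apply exp_pos.
assert (E : forall n : nat, exp (- (INR n * (PI * u / 6))) = y ^ n).
{ intros n; unfold y; rewrite <- exp_nat; f_equal; ring. }
assert (E' : forall n : nat, exp (INR n * (PI * u / 6)) = / y ^ n).
{ intros n; rewrite <- E, <- exp_Ropp; f_equal; ring. }
assert (Ec : forall (n : nat) x, x = INR n * (PI * u / 6) -> cosh x = (/ y ^ n + y ^ n) / 2).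
{ intros n x ->; unfold cosh; rewrite E, E'; easy. }
assert (Ee : forall (n : nat) x, x = - (INR n * (PI * u / 6)) -> exp x = y ^ n).
{ intros n x ->; apply E. }
unfold mordf.
rewrite (Ec 5%nat (5 * PI * u / 6)), (Ec 1%nat (PI * u / 6)), (Ec 6%nat (PI * u)) by (simpl; field).
rewrite (Ee 12%nat (- (2 * PI * u))), (Ee 1%nat (- cc 0 1 * u)), (Ee 5%nat (- cc 0 5 * u)),
  (Ee 7%nat (- cc 0 7 * u)), (Ee 11%nat (- cc 0 11 * u)) by (unfold cc; simpl; field).
assert (0 < y ^ 12) by (apply pow_lt; lra).
field; split; lra.
Qed.

Lemma mordf_bounds (u : R) : 0 <= u -> 0 <= mordf u <= 2 /\ mordf u <= 4 * exp (- (PI / 6) * u).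
Proof.
intros Hu; assert (P := PI_RGT_0).
assert (Mo : forall x y, 0 <= x <= y -> exp x <= exp y).
{ intros x y [_ [L|L]]; [left; apply exp_increasing, L|rewrite L; lra]. }
assert (C1 : forall x, 0 <= x -> exp x / 2 <= cosh x <= exp x).
{ intros x Hx; unfold cosh; pose proof (exp_pos (- x)).
  assert (exp (- x) <= exp x) by (destruct Hx as [L|L]; [left; apply exp_increasing; lra|rewrite <- L, Ropp_0; lra]); lra. }
assert (C2 : forall x y, 0 <= x <= y -> cosh x <= cosh y).
{ intros x y Hxy; unfold cosh; rewrite !exp_Ropp.
  assert (A := Mo x y Hxy); assert (B := Mo 0 x ltac:(lra)); rewrite exp_0 in B.
  assert (D : / exp x - / exp y = (exp y - exp x) / (exp x * exp y)) by (field; split; lra).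
  assert ((exp y - exp x) / (exp x * exp y) <= exp y - exp x).
  { apply Rmult_le_reg_r with (exp x * exp y); [nra|].
    replace ((exp y - exp x) / (exp x * exp y) * (exp x * exp y)) with (exp y - exp x) by (field; split; lra).
    assert (1 <= exp x * exp y) by nra; nra. }
  lra. }
unfold mordf; pose proof (cosh_pos (PI * u)); pose proof (cosh_pos (5 * PI * u / 6)); pose proof (cosh_pos (PI * u / 6)).
assert (I0 : 0 < / cosh (PI * u)) by (apply Rinv_0_lt_compat; lra).
assert (Q : 0 <= PI * u) by nra.
split; [split|].
- unfold Rdiv; nra.
- apply Rmult_le_reg_r with (cosh (PI * u)); [lra|].
  unfold Rdiv; rewrite Rmult_assoc, Rinv_l by lra.
  assert (A := C2 (5 * PI * u / 6) (PI * u) ltac:(lra)); assert (B := C2 (PI * u / 6) (PI * u) ltac:(lra)); lra.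
- apply Rmult_le_reg_r with (cosh (PI * u)); [lra|].
  unfold Rdiv at 1; rewrite Rmult_assoc, Rinv_l by lra.
  assert (A := proj2 (C1 (5 * PI * u / 6) ltac:(lra))).
  assert (B := C2 (PI * u / 6) (5 * PI * u / 6) ltac:(lra)).
  assert (D := proj1 (C1 (PI * u) Q)).
  assert (E : exp (- (PI / 6) * u) * exp (PI * u) = exp (5 * PI * u / 6)) by (rewrite <- exp_plus; f_equal; field).
  pose proof (exp_pos (- (PI / 6) * u)); nra.
Qed.

Lemma Cmod_cis (x : R) : Cmod (Cexp (- (Ci * RtoC x)))%C = 1.
Proof. rewrite Cmod_Cexp, <- exp_0; f_equal; simpl; ring. Qed.

Lemma is_derive_cosh x : is_derive cosh x (sinh x).
Proof. apply is_derive_Reals, derivable_pt_lim_cosh. Qed.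

Lemma mord_cont m : Ccont (mord m).
Proof.
unfold mord; apply Ccont_mult.
- eapply CD_Ccont; intros x; apply CD_Cexp, CD_opp, CD_scal, (CD_RtoC (fun u => m * u ^ 2) x (2 * m * x)).
  auto_derive; [easy|ring].
- apply Ccont_RtoC; intros x.
  apply (@ex_derive_continuous R_AbsRing R_NormedModule).
  unfold cosh; auto_derive; pose proof (exp_pos (PI * x)); pose proof (exp_pos (- (PI * x))); lra.
Qed.

Lemma Cmod_mord m u : 0 <= u -> Cmod (mord m u) = mordf u.
Proof.
intros Hu; unfold mord; rewrite Cmod_mult, Cmod_cis, Cmod_R, Rmult_1_l.
apply Rabs_pos_eq, (mordf_bounds u Hu).
Qed.

Lemma mord_dom m : dominated (mord m) 4 (PI / 6).
Proof. intros u Hu; rewrite Cmod_mord by exact Hu; apply (mordf_bounds u Hu). Qed.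

Lemma kern_split m c u : kern m c u = (Cexp (- (Ci * RtoC (m * u ^ 2))) * RtoC (exp (- c * u)))%C.
Proof.
unfold kern; unfold Cminus; rewrite Cexp_add, <- RtoC_opp, Cexp_RtoC; do 3 f_equal; ring.
Qed.

Lemma isI_Csum (f : nat -> R -> C) (J : nat -> C) (M : nat) :
  (forall p, isI (f p) (J p)) -> isI (fun x => Csum (fun p => f p x) M) (Csum J M).
Proof.
intros H; induction M as [|M IH].
- assert (Z := isI_scal (RtoC 0) _ _ (H 0%nat)); rewrite Cmult_0_l in Z.
  eapply isI_ext; [|exact Z]; intros x _; simpl; ring.
- simpl; apply isI_plus; [exact IH|apply H].
Qed.

Lemma isI_gs (k : R -> R -> C) (v : R -> C) (p : nat) :
  (forall c, 0 < c -> isI (k c) (v c)) -> isI (fun u => gs (fun c => k c u) p) (gs v p).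
Proof.
intros H; assert (G : forall a, 1 <= a -> isI (k (cc p a)) (v (cc p a))) by (intros; apply H, cc_pos; assumption).
exact (isI_plus _ _ _ _ (isI_plus _ _ _ _ (isI_plus _ _ _ _ (G 1 ltac:(lra)) (G 5 ltac:(lra))) (G 7 ltac:(lra))) (G 11 ltac:(lra))).
Qed.

Section Star.
Variable mu : R.
Hypothesis Hmu : 0 < mu.

Let TT (M : nat) : C := Csum (fun p => (- (1)) ^ p * gs (It mu) p)%C M.

Let mord_series (M : nat) (u : R) :
  mord mu u = (Csum (fun p => (- (1)) ^ p * gs (fun c => kern mu c u) p) M
     + (- (1)) ^ M * (RtoC (exp (- (2 * PI * INR M) * u)) * mord mu u))%C.
Proof.
induction M as [|M IH].
- simpl INR; rewrite Rmult_0_r, Ropp_0, Rmult_0_l, exp_0; simpl; ring.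
- rewrite IH at 1; rewrite Csum_S, Cpow_S.
  assert (E : gs (fun c => kern mu c u) M =
    (RtoC (exp (- (2 * PI * INR M) * u)) * (mord mu u * (1 + RtoC (exp (- (2 * PI * u))))))%C).
  { unfold gs; rewrite !kern_split; unfold mord; fold (mordf u).
    assert (X : forall a, exp (- cc M a * u) = exp (- (2 * PI * INR M) * u) * exp (- cc 0 a * u)).
    { intros a; rewrite <- exp_plus; f_equal; unfold cc; simpl; field. }
    set (e := Cexp (- (Ci * RtoC (mu * u ^ 2)))%C); clearbody e.
    rewrite !X, !RtoC_mult.
    replace (1 + RtoC (exp (- (2 * PI * u))))%C with (RtoC (1 + exp (- (2 * PI * u)))) by (rewrite RtoC_plus; easy).
    transitivity (RtoC (exp (- (2 * PI * INR M) * u)) * (e * RtoC (mordf u * (1 + exp (- (2 * PI * u))))))%C.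
    - rewrite mordf_expand, !RtoC_plus; ring.
    - rewrite RtoC_mult; ring. }
  rewrite E.
  replace (exp (- (2 * PI * INR (S M)) * u)) with (exp (- (2 * PI * INR M) * u) * exp (- (2 * PI * u))).
  + rewrite RtoC_mult; ring.
  + rewrite <- exp_plus; f_equal; rewrite S_INR; ring.
Qed.

Lemma isI_kern_It c : 0 < c -> isI (kern mu c) (It mu c).
Proof.
intros Hc; rewrite <- II_kern by assumption.
apply (II_correct _ 1 c Hc); [apply kern_cont|apply kern_dom].
Qed.

(** After M terms of the geometric expansion the remainder is the integrand itself damped by exp (-
    2 pi M u), whose integral is at most 2 / (2 pi M). *)
Let TT_approx M : (1 <= M)%nat -> Cmod (II (mord mu) - TT M)%C <= / INR M.
Proof.
intros HM; apply le_INR in HM; simpl in HM; assert (P := PI_RGT_0).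
assert (I1 : isI (mord mu) (II (mord mu))).
{ apply (II_correct _ 4 (PI / 6)); [lra|apply mord_cont|apply mord_dom]. }
assert (I2 : isI (fun u => Csum (fun p => (- (1)) ^ p * gs (fun c => kern mu c u) p) M)%C (TT M)).
{ apply (isI_Csum (fun p u => (- (1)) ^ p * gs (fun c => kern mu c u) p)%C); intros p.
  exact (isI_scal _ _ _ (isI_gs (kern mu) (It mu) p isI_kern_It)). }
set (rm := fun u => ((- (1)) ^ M * (RtoC (exp (- (2 * PI * INR M) * u)) * mord mu u))%C).
assert (rc : Ccont rm).
{ apply Ccont_scal, Ccont_mult; [|apply mord_cont].
  apply Ccont_RtoC; intros x; apply (@ex_derive_continuous R_AbsRing R_NormedModule); auto_derive; easy. }
assert (rd : dominated rm 2 (2 * PI * INR M)).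
{ intros u Hu; unfold rm; rewrite !Cmod_mult, Cmod_pow, Cmod_opp, Cmod_1, pow1, Cmod_R, Cmod_mord, Rabs_pos_eq
    by (try exact Hu; left; apply exp_pos).
  pose proof (exp_pos (- (2 * PI * INR M) * u)); pose proof (proj1 (mordf_bounds u Hu)); nra. }
assert (b0 : 0 < 2 * PI * INR M) by nra.
assert (I3 := II_correct rm 2 _ b0 rc rd).
assert (I4 := isI_plus _ _ _ _ I2 I3).
apply (isI_ext _ (mord mu)) in I4; [|intros u _; symmetry; apply mord_series].
rewrite (isI_unique _ _ _ I1 I4).
replace (TT M + II rm - TT M)%C with (II rm) by ring.
eapply Rle_trans; [apply (II_bound rm 2 _ b0 rc rd)|].
apply Rmult_le_reg_r with (INR M); [lra|]; rewrite Rinv_l by lra.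
replace (2 / (2 * PI * INR M) * INR M) with (/ PI) by (field; split; lra).
rewrite <- Rinv_1; apply Rinv_le_contravar; [lra|]; pose proof PI2_3_2; lra.
Qed.

Let TT_lim : forall eps, 0 < eps -> exists M0, forall M, (M0 <= M)%nat -> Cmod (TT M - II (mord mu))%C < eps.
Proof.
intros eps He; destruct (nfloor_ex (2 / eps)) as [N [_ HN]]; [left; apply Rdiv_lt_0_compat; lra|].
exists (S N); intros M HM.
replace (TT M - II (mord mu))%C with (- (II (mord mu) - TT M))%C by ring; rewrite Cmod_opp.
eapply Rle_lt_trans; [apply TT_approx; lia|].
apply inv_small; [exact He|]; apply le_INR in HM; rewrite S_INR in HM; lra.
Qed.

(** Rationality of the parameter in the form used: as mu m = pi n, the shift of c by 2 mu m is the
    shift of the summation index p by n. The phases of that shift must not depend on p or on the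
    residue a. *)
Variables (n m : nat) (eta : C).
Hypothesis Hn : (1 <= n)%nat.
Hypothesis Hnm : mu * INR m = PI * INR n.
Hypothesis Heta : eta = (- (- (1)) ^ n)%C.
Hypothesis Hphase : forall p a, a = 1 \/ a = 5 \/ a = 7 \/ a = 11 ->
  Cexp (- (Ci * RtoC (cc p a * INR m + mu * INR m ^ 2)))%C = eta /\
  Cexp (- (Ci * RtoC (- cc p a * INR m + mu * INR m ^ 2)))%C = eta.

Let L (M : nat) : C := Csum (fun p => (- (1)) ^ p *
   gs (fun c => CI (fun y => RtoC (sin (c * y)) * Cexp (Ci * RtoC (mu * y ^ 2))) 0 (INR m)) p)%C M.

Let W (y : R) : R := cos (5 * PI * y / 6) + cos (PI * y / 6).
Let F (y : R) : C := (RtoC (2 * W y) * Cexp (Ci * RtoC (mu * y ^ 2)))%C.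

Let Fcis_cont : Ccont (fun y => Cexp (Ci * RtoC (mu * y ^ 2)))%C.
Proof.
eapply CD_Ccont; intros x; apply CD_Cexp, CD_scal, (CD_RtoC (fun u => mu * u ^ 2) x (2 * mu * x)).
auto_derive; [easy|ring].
Qed.

(** The four frequencies with index p are symmetric about (2 p + 1) pi, at distances 5 pi / 6 and pi
    / 6, so the four sines share the factor sin ((2 p + 1) pi y). *)
Let L_dirk M : L M = CI (fun y => F y * RtoC (dirk M y))%C 0 (INR m).
Proof.
symmetry; apply isCI_CI; unfold L; induction M as [|M IH].
- simpl; assert (Z := isCI_scal (RtoC 0) _ _ _ _ (CI_correct (fun _ => RtoC 1) 0 (INR m) (Ccont_const _))).
  rewrite Cmult_0_l in Z; eapply isCI_ext; [|exact Z]; intros v _; simpl; ring.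
- simpl Csum.
  assert (A : forall c, isCI (fun y => RtoC (sin (c * y)) * Cexp (Ci * RtoC (mu * y ^ 2)))%C 0 (INR m)
     (CI (fun y => RtoC (sin (c * y)) * Cexp (Ci * RtoC (mu * y ^ 2)))%C 0 (INR m))).
  { intros c; apply CI_correct, Ccont_mult; [|exact Fcis_cont].
    apply Ccont_RtoC; intros x; apply (@ex_derive_continuous R_AbsRing R_NormedModule); auto_derive; easy. }
  eapply isCI_ext; [|exact (isCI_plus _ _ _ _ _ _ IH (isCI_scal ((- (1)) ^ M)%C _ _ _ _ (isCI_plus _ _ _ _ _ _
    (isCI_plus _ _ _ _ _ _ (isCI_plus _ _ _ _ _ _ (A (cc M 1)) (A (cc M 5))) (A (cc M 7))) (A (cc M 11)))))].
  intros y _; cbv beta; unfold F; simpl dirk.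
  set (e := Cexp (Ci * RtoC (mu * y ^ 2))%C); clearbody e.
  assert (T : sin (cc M 1 * y) + sin (cc M 5 * y) + sin (cc M 7 * y) + sin (cc M 11 * y)
     = 2 * W y * sin ((2 * INR M + 1) * PI * y)).
  { unfold W, cc; set (A0 := (2 * INR M + 1) * PI * y).
    replace (PI * (12 * INR M + 1) / 6 * y) with (A0 - 5 * PI * y / 6) by (unfold A0; field).
    replace (PI * (12 * INR M + 5) / 6 * y) with (A0 - PI * y / 6) by (unfold A0; field).
    replace (PI * (12 * INR M + 7) / 6 * y) with (A0 + PI * y / 6) by (unfold A0; field).
    replace (PI * (12 * INR M + 11) / 6 * y) with (A0 + 5 * PI * y / 6) by (unfold A0; field).
    rewrite !sin_minus, !sin_plus; ring. }
  transitivity (RtoC (2 * W y) * e * RtoC (dirk M y) +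
    (- (1)) ^ M * (RtoC (sin (cc M 1 * y) + sin (cc M 5 * y) + sin (cc M 7 * y) + sin (cc M 11 * y)) * e))%C.
  + rewrite !RtoC_plus; ring.
  + rewrite T, RtoC_plus, (RtoC_mult ((-1) ^ M)), (RtoC_mult (2 * W y) (sin _)), RtoC_pow, RtoC_m1; ring.
Qed.

Let E_ (b y : R) : C := Cexp (Ci * RtoC (b * y + mu * y ^ 2))%C.
Let E1_ (b y : R) : C := (Ci * RtoC (b + 2 * mu * y) * E_ b y)%C.
Let E2_ (b y : R) : C := ((Ci * RtoC (2 * mu) + Ci * RtoC (b + 2 * mu * y) * (Ci * RtoC (b + 2 * mu * y))) * E_ b y)%C.

Let DE b y : CD (E_ b) y (E1_ b y).
Proof.
unfold E_, E1_, E_; apply CD_Cexp, CD_scal, (CD_RtoC (fun y => b * y + mu * y ^ 2)).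
auto_derive; [easy|ring].
Qed.

Let DE1 b y : CD (E1_ b) y (E2_ b y).
Proof.
unfold E1_, E2_; eapply CD_eq.
- apply CD_mult; [apply CD_scal, (CD_RtoC (fun y => b + 2 * mu * y) y (2 * mu)); auto_derive; [easy|ring]|apply DE].
- cbv beta; unfold E1_; ring.
Qed.

Let E2_bound b y : 0 <= y <= INR m -> Cmod (E2_ b y) <= 2 * mu + (Rabs b + 2 * mu * INR m) ^ 2.
Proof.
intros Hy; unfold E2_; rewrite Cmod_mult.
assert (X : Cmod (E_ b y) = 1) by (unfold E_; rewrite Cmod_Cexp, <- exp_0; f_equal; simpl; ring).
rewrite X, Rmult_1_r; eapply Rle_trans; [apply Cmod_triangle|].
rewrite !Cmod_mult, !Cmod_Ci, !Cmod_R, !Rmult_1_l, (Rabs_pos_eq (2 * mu)) by lra.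
assert (Rabs (b + 2 * mu * y) <= Rabs b + 2 * mu * INR m).
{ eapply Rle_trans; [apply Rabs_triang|]; rewrite (Rabs_pos_eq (2 * mu * y)) by nra; nra. }
pose proof (Rabs_pos (b + 2 * mu * y)); nra.
Qed.

Let Ll : C := Csum (fun j => (- (1)) ^ j * (RtoC (W (INR j + / 2)) * Cexp (Ci * RtoC (mu * (INR j + / 2) ^ 2))))%C m.

(** The weight times the Gaussian is split into four exponentials of quadratic polynomials: their
    derivatives are explicit, which supplies the bound on the second derivative that [dirichlet_sum]
    asks for. *)
Let L_lim : forall eps, 0 < eps -> exists M0, forall M, (M0 <= M)%nat -> Cmod (L M - Ll)%C < eps.
Proof.
intros eps He.
set (b1 := 5 * PI / 6); set (b2 := PI / 6).
set (f := fun y => (E_ b1 y + E_ (- b1) y + (E_ b2 y + E_ (- b2) y))%C).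
set (f1 := fun y => (E1_ b1 y + E1_ (- b1) y + (E1_ b2 y + E1_ (- b2) y))%C).
set (f2 := fun y => (E2_ b1 y + E2_ (- b1) y + (E2_ b2 y + E2_ (- b2) y))%C).
assert (Ff : forall y, F y = f y).
{ intros y; unfold F, f, E_, W.
  assert (T : forall b, (Cexp (Ci * RtoC (b * y + mu * y ^ 2)) + Cexp (Ci * RtoC (- b * y + mu * y ^ 2)) =
     RtoC (2 * cos (b * y)) * Cexp (Ci * RtoC (mu * y ^ 2)))%C).
  { intros b; rewrite !RtoC_plus, !Cmult_plus_distr_l, !Cexp_add.
    assert (Tc : forall x, Cexp (Ci * RtoC x)%C = (RtoC (cos x) + Ci * RtoC (sin x))%C).
    { intros x; unfold Cexp, Ci, RtoC, Cmult, Cplus; simpl.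
      replace (0 * x - 1 * 0) with 0 by ring; replace (0 * 0 + 1 * x) with x by ring; rewrite exp_0; f_equal; ring. }
    rewrite (Tc (b * y)), (Tc (- b * y)); replace (- b * y) with (- (b * y)) by ring.
    rewrite cos_neg, sin_neg, RtoC_opp, (RtoC_mult 2); ring. }
  rewrite !T; replace (5 * PI * y / 6) with (b1 * y) by (unfold b1; field).
  replace (PI * y / 6) with (b2 * y) by (unfold b2; field).
  replace (2 * (cos (b1 * y) + cos (b2 * y))) with (2 * cos (b1 * y) + 2 * cos (b2 * y)) by ring.
  rewrite RtoC_plus; ring. }
set (B := 2 * mu + (Rabs b1 + 2 * mu * INR m) ^ 2 + (2 * mu + (Rabs b1 + 2 * mu * INR m) ^ 2)
   + (2 * mu + (Rabs b2 + 2 * mu * INR m) ^ 2 + (2 * mu + (Rabs b2 + 2 * mu * INR m) ^ 2))).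
destruct (dirichlet_sum f f1 f2 B m) with (eps := eps) as [M0 HM0]; [| | |exact He|].
- intros x; unfold f, f1; apply CD_plus; apply CD_plus; apply DE.
- intros x; unfold f1, f2; apply CD_plus; apply CD_plus; apply DE1.
- intros x Hx; unfold f2, B.
  assert (X1 := E2_bound b1 x Hx); assert (X2 := E2_bound (- b1) x Hx).
  assert (X3 := E2_bound b2 x Hx); assert (X4 := E2_bound (- b2) x Hx); rewrite Rabs_Ropp in X2, X4.
  eapply Rle_trans; [apply Cmod_triangle|].
  apply Rplus_le_compat; (eapply Rle_trans; [apply Cmod_triangle|]; apply Rplus_le_compat; assumption).
- exists M0; intros M HM; specialize (HM0 M HM).
  assert (A1 : L M = CI (fun y => f y * RtoC (dirk M y))%C 0 (INR m)).
  { rewrite L_dirk; symmetry; apply isCI_CI.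
    apply (isCI_ext (fun y => F y * RtoC (dirk M y))%C); [intros; rewrite Ff; easy|].
    apply CI_correct, Ccont_mult; [|apply Ccont_RtoC, dirk_cont].
    unfold F; apply Ccont_mult; [|exact Fcis_cont].
    apply Ccont_RtoC; intros x; unfold W; apply (@ex_derive_continuous R_AbsRing R_NormedModule); auto_derive; easy. }
  rewrite A1; replace Ll with (Csum (fun j => (- (1)) ^ j * (/ 2 * f (INR j + / 2)%R))%C m); [exact HM0|].
  apply Csum_ext; intros j _; f_equal; rewrite <- Ff; unfold F; rewrite RtoC_mult; cfield.
Qed.

Let kappa : C := (RtoC (sqrt (PI / (8 * mu))) * (1 - Ci))%C.
Let Th : C := Csum (fun p => (- (1)) ^ p * gs (fun c => Cexp (- (Ci * RtoC (c ^ 2 / (4 * mu))))) p)%C n.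

Let cc_add p a : cc (n + p) a = cc p a + 2 * mu * INR m.
Proof.
replace (2 * mu * INR m) with (2 * (mu * INR m)) by ring; rewrite Hnm; unfold cc; rewrite plus_INR; field.
Qed.

Let cc_rev p a : (p < n)%nat -> cc (n - 1 - p) a - 2 * mu * INR m = - cc p (12 - a).
Proof.
intros Hp; replace (2 * mu * INR m) with (2 * (mu * INR m)) by ring; rewrite Hnm; unfold cc.
rewrite !minus_INR by lia; simpl; field.
Qed.

Let sgn_sq k : ((- (1)) ^ k * (- (1)) ^ k)%C = RtoC 1.
Proof. rewrite <- Cpow_add_r; replace (k + k)%nat with (2 * k)%nat by lia; apply Cm1_pow_even. Qed.

(* The two ways of shifting by 2 pi n: by reindexing the series, and by m shifts of size 2 mu. *)
Let key (M : nat) :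
  ((- (1)) ^ n * (TT (n + (n + M)) + TT M - 2 * kappa * Th) = 2 * eta * (TT (n + M) - L (n + M)))%C.
Proof.
transitivity (Csum (fun p => (- (1)) ^ p * gs (fun c => It mu (c + 2 * mu * INR m) + It mu (c - 2 * mu * INR m)) p) (n + M))%C.
- transitivity (Csum (fun p => (- (1)) ^ p * gs (fun c => It mu (c + 2 * mu * INR m)) p) (n + M) +
    Csum (fun p => (- (1)) ^ p * gs (fun c => It mu (c - 2 * mu * INR m)) p) (n + M))%C.
  2: { rewrite <- Csum_plus; apply Csum_ext; intros p _; unfold gs; ring. }
  assert (A : ((- (1)) ^ n * TT (n + (n + M)) = (- (1)) ^ n * TT n +
     Csum (fun p => (- (1)) ^ p * gs (fun c => It mu (c + 2 * mu * INR m)%R) p) (n + M))%C).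
  { unfold TT; rewrite Csum_add, Cmult_plus_distr_l; f_equal; rewrite <- Csum_scal; apply Csum_ext; intros p _.
    unfold gs; rewrite !cc_add, Cpow_add_r.
    replace ((- (1)) ^ n * ((- (1)) ^ n * (- (1)) ^ p * (It mu (cc p 1 + 2 * mu * INR m)%R + It mu (cc p 5 + 2 * mu * INR m)%R + It mu (cc p 7 + 2 * mu * INR m)%R + It mu (cc p 11 + 2 * mu * INR m)%R)))%C
      with (((- (1)) ^ n * (- (1)) ^ n) * ((- (1)) ^ p * (It mu (cc p 1 + 2 * mu * INR m)%R + It mu (cc p 5 + 2 * mu * INR m)%R + It mu (cc p 7 + 2 * mu * INR m)%R + It mu (cc p 11 + 2 * mu * INR m)%R)))%C by ring.
    rewrite sgn_sq; ring. }
  (* For p < n the downward shift leads to negative arguments. Reversing the order of these p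
     exchanges the residue a with 12 - a, which permutes 1, 5, 7, 11. *)
  assert (B1 : (Csum (fun p => (- (1)) ^ p * gs (fun c => It mu (c - 2 * mu * INR m)%R) p) n =
     - ((- (1)) ^ n * Csum (fun p => (- (1)) ^ p * gs (fun c => It mu (- c)) p) n))%C).
  { rewrite <- Csum_rev.
    replace (- ((- (1)) ^ n * Csum (fun p => (- (1)) ^ p * gs (fun c => It mu (- c)) p) n))%C with
      ((- (- (1)) ^ n) * Csum (fun p => (- (1)) ^ p * gs (fun c => It mu (- c)) p) n)%C by ring.
    rewrite <- Csum_scal; apply Csum_ext; intros p Hp; unfold gs; rewrite !cc_rev by exact Hp.
    replace (12 - 1) with 11 by ring; replace (12 - 5) with 7 by ring.
    replace (12 - 7) with 5 by ring; replace (12 - 11) with 1 by ring.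
    assert (S : ((- (1)) ^ (n - 1 - p) = - (- (1)) ^ n * (- (1)) ^ p)%C).
    { transitivity ((- (1)) ^ (n - 1 - p) * ((- (1)) ^ p * (- (1)) ^ p))%C; [rewrite sgn_sq; ring|].
      replace (- (- (1)) ^ n)%C with ((- (1)) ^ (n - 1 - p) * (- (1)) ^ p)%C; [ring|].
      rewrite <- Cpow_add_r; replace n with (S (n - 1 - p + p)) at 2 by lia; rewrite Cpow_S; ring. }
    rewrite S; ring. }
  assert (B2 : (Csum (fun p => (- (1)) ^ (n + p) * gs (fun c => It mu (c - 2 * mu * INR m)%R) (n + p)) M = (- (1)) ^ n * TT M)%C).
  { unfold TT; rewrite <- Csum_scal; apply Csum_ext; intros p _.
    assert (Cs : forall a, cc (n + p) a - 2 * mu * INR m = cc p a) by (intros; rewrite cc_add; ring).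
    unfold gs; rewrite !Cs, Cpow_add_r; ring. }
  (* The values at negative arguments are reflected by [It_add_opp]; this is how the theta sum [Th]
     appears. *)
  assert (D : (2 * kappa * Th = TT n + Csum (fun p => (- (1)) ^ p * gs (fun c => It mu (- c)) p) n)%C).
  { unfold Th, TT; rewrite <- Csum_scal, <- Csum_plus; apply Csum_ext; intros p _.
    assert (X : forall c, (It mu (- c) = 2 * kappa * Cexp (- (Ci * RtoC (c ^ 2 / (4 * mu)))) - It mu c)%C).
    { intros c; unfold kappa; rewrite <- It_add_opp by exact Hmu; ring. }
    unfold gs; rewrite !X; ring. }
  rewrite (Csum_add (fun p => (- (1)) ^ p * gs (fun c => It mu (c - 2 * mu * INR m)%R) p)%C), B1, B2, D.
  replace ((- (1)) ^ n * (TT (n + (n + M)) + TT M - (TT n + Csum (fun p => (- (1)) ^ p * gs (fun c => It mu (- c)) p) n)))%C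
    with ((- (1)) ^ n * TT (n + (n + M)) + ((- (1)) ^ n * TT M - (- (1)) ^ n * TT n - (- (1)) ^ n * Csum (fun p => (- (1)) ^ p * gs (fun c => It mu (- c)) p) n))%C by ring.
  rewrite A; ring.
- unfold TT, L; replace (2 * eta * (Csum (fun p => (- (1)) ^ p * gs (It mu) p) (n + M) - Csum (fun p => (- (1)) ^ p *
    gs (fun c => CI (fun y => RtoC (sin (c * y)) * Cexp (Ci * RtoC (mu * y ^ 2))) 0 (INR m)) p) (n + M)))%C
   with ((2 * eta) * Csum (fun p => (- (1)) ^ p * gs (It mu) p) (n + M) + (- (2 * eta)) * Csum (fun p => (- (1)) ^ p *
    gs (fun c => CI (fun y => RtoC (sin (c * y)) * Cexp (Ci * RtoC (mu * y ^ 2))) 0 (INR m)) p) (n + M))%C by ring.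
  rewrite <- !Csum_scal, <- Csum_plus; apply Csum_ext; intros p _.
  assert (X : forall a, a = 1 \/ a = 5 \/ a = 7 \/ a = 11 ->
    (It mu (cc p a + 2 * mu * INR m)%R + It mu (cc p a - 2 * mu * INR m)%R =
     2 * eta * (It mu (cc p a) - CI (fun y => RtoC (sin (cc p a * y)) * Cexp (Ci * RtoC (mu * y ^ 2))) 0 (INR m)))%C).
  { intros a Ha; destruct (Hphase p a Ha) as [H1 H2]; apply It_shift_sum; assumption. }
  unfold gs; rewrite !X by tauto; ring.
Qed.

(** All partial sums in [key] tend to the same integral J. With [eta] = -(-1)^n the terms in J from
    the two sides add up to 4 J; with the opposite sign they would cancel. *)
Lemma mordell_star :
  (2 * II (mord mu) = RtoC (sqrt (PI / (8 * mu))) * (1 - Ci) *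
     Csum (fun p => (- (1)) ^ p * gs (fun c => Cexp (- (Ci * RtoC (c ^ 2 / (4 * mu))))) p) n
   + Csum (fun j => (- (1)) ^ j * (RtoC (cos (5 * PI * (INR j + / 2) / 6) + cos (PI * (INR j + / 2) / 6))
       * Cexp (Ci * RtoC (mu * (INR j + / 2) ^ 2)))) m)%C.
Proof.
fold kappa; change (2 * II (mord mu) = kappa * Th + Ll)%C.
set (J := II (mord mu)).
apply Ceq_minus, Cmod_eq_0, Rle_antisym; [|apply Cmod_ge_0].
apply le_epsilon; intros e He; rewrite Rplus_0_l.
destruct (TT_lim (e / 4) ltac:(lra)) as [M1 H1], (L_lim (e / 4) ltac:(lra)) as [M2 H2].
set (M := max M1 M2).
assert (A1 := H1 (n + (n + M))%nat ltac:(lia)); assert (A2 := H1 M ltac:(lia)); assert (A3 := H1 (n + M)%nat ltac:(lia)).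
assert (A4 := H2 (n + M)%nat ltac:(lia)).
assert (K := key M); rewrite Heta in K.
apply (f_equal (fun x => (- (1)) ^ n * x)%C) in K.
rewrite Cmult_assoc, sgn_sq, Cmult_1_l in K.
replace ((- (1)) ^ n * (2 * - (- (1)) ^ n * (TT (n + M) - L (n + M))))%C
  with (- (2) * ((- (1)) ^ n * (- (1)) ^ n) * (TT (n + M) - L (n + M)))%C in K by ring.
rewrite sgn_sq in K.
assert (E : (2 * (2 * J - (kappa * Th + Ll)) = - (TT (n + (n + M)) - J) - (TT M - J) - 2 * (TT (n + M) - J) + 2 * (L (n + M) - Ll))%C).
{ replace (2 * (2 * J - (kappa * Th + Ll)))%C with (4 * J - 2 * Ll - 2 * kappa * Th)%C by ring.
  replace (2 * kappa * Th)%C with (TT (n + (n + M)) + TT M - (TT (n + (n + M)) + TT M - 2 * kappa * Th))%C by ring.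
  rewrite K; ring. }
apply (f_equal Cmod) in E; rewrite Cmod_mult, Cmod_R, Rabs_pos_eq in E by lra.
assert (T : Cmod (- (TT (n + (n + M)) - J) - (TT M - J) - 2 * (TT (n + M) - J) + 2 * (L (n + M) - Ll))%C <= 2 * e).
{ eapply Rle_trans; [apply Cmod_triangle|]; rewrite Cmod_mult, Cmod_R, (Rabs_pos_eq 2) by lra.
  eapply Rle_trans; [apply Rplus_le_compat_r, Cmod_triangle|]; rewrite Cmod_opp, Cmod_mult, Cmod_R, (Rabs_pos_eq 2) by lra.
  eapply Rle_trans; [apply Rplus_le_compat_r, Rplus_le_compat_r, Cmod_triangle|]; rewrite !Cmod_opp.
  fold J in A1, A2, A3; lra. }
lra.
Qed.

End Star.

(** * The transformation formulas for phi and psi at roots of unity *)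

Lemma cis_pi (n : nat) : Cexp (Ci * RtoC (PI * INR n))%C = ((- (1)) ^ n)%C.
Proof.
replace (Ci * RtoC (PI * INR n))%C with (INR n * (Ci * PI))%C by (rewrite RtoC_mult; ring).
rewrite <- Cexp_pow; f_equal.
unfold Cexp, Ci, RtoC, Cmult, Copp; simpl.
replace (0 * PI - 1 * 0) with 0 by ring; replace (0 * 0 + 1 * PI) with PI by ring.
rewrite exp_0, cos_PI, sin_PI; f_equal; ring.
Qed.

Lemma cis_pi_opp (n : nat) : Cexp (- (Ci * RtoC (PI * INR n)))%C = ((- (1)) ^ n)%C.
Proof.
rewrite Cexp_opp, cis_pi.
assert (S : ((- (1)) ^ n * (- (1)) ^ n)%C = RtoC 1).
{ rewrite <- Cpow_add_r; replace (n + n)%nat with (2 * n)%nat by lia; apply Cm1_pow_even. }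
assert (N : ((- (1)) ^ n)%C <> RtoC 0) by (apply Cpow_nz; intros E; injection E; lra).
transitivity (/ (- (1)) ^ n * ((- (1)) ^ n * (- (1)) ^ n))%C; [rewrite S; ring|cfield].
Qed.

Lemma cis_eq_1 (a N : nat) : (0 < N)%nat -> Cexp (Ci * RtoC (2 * PI * INR a / INR N))%C = RtoC 1 -> Nat.divide N a.
Proof.
intros HN E; assert (N0 : 0 < INR N) by (apply lt_0_INR, HN).
assert (P := PI_RGT_0).
assert (C1 : cos (2 * (PI * INR a / INR N)) = 1).
{ apply (f_equal Re) in E; unfold Cexp, Ci, RtoC, Cmult in E; simpl in E.
  replace (0 * (2 * PI * INR a / INR N) - 1 * 0) with 0 in E by ring.
  replace (0 * 0 + 1 * (2 * PI * INR a / INR N)) with (2 * (PI * INR a / INR N)) in E by (field; lra).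
  rewrite exp_0 in E; lra. }
rewrite cos_2a_sin in C1.
assert (S : sin (PI * INR a / INR N) = 0) by nra.
destruct (sin_eq_0_0 _ S) as [z Hz].
assert (Hz' : IZR (Z.of_nat a) = IZR (z * Z.of_nat N)).
{ rewrite mult_IZR, <- !INR_IZR_INZ.
  apply (f_equal (fun x => x * INR N / PI)) in Hz.
  replace (PI * INR a / INR N * INR N / PI) with (INR a) in Hz by (field; split; lra).
  rewrite Hz; field; lra. }
apply eq_IZR in Hz'.
exists (Z.to_nat z).
destruct (Z.le_gt_cases 0 z); nia.
Qed.

Lemma prim_cis (l N : nat) : (0 < N)%nat -> Nat.gcd l N = 1%nat ->
  prim (Cexp (Ci * RtoC (2 * PI * INR l / INR N)))%C N /\
  prim (Cexp (- (Ci * RtoC (2 * PI * INR l / INR N))))%C N.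
Proof.
intros HN G; assert (N0 : 0 < INR N) by (apply lt_0_INR, HN).
set (z := (Ci * RtoC (2 * PI * INR l / INR N))%C).
assert (H1 : (Cexp z ^ N = 1)%C).
{ rewrite Cexp_pow; unfold z; replace (INR N * (Ci * RtoC (2 * PI * INR l / INR N)))%C
    with (Ci * RtoC (PI * INR (2 * l)))%C.
  - rewrite cis_pi; apply Cm1_pow_even.
  - replace (PI * INR (2 * l)) with (INR N * (2 * PI * INR l / INR N)); [rewrite RtoC_mult; ring|].
    rewrite mult_INR; simpl; field; lra. }
assert (H2 : forall j, (0 < j < N)%nat -> (Cexp z ^ j)%C <> RtoC 1).
{ intros j Hj E; rewrite Cexp_pow in E.
  replace (INR j * z)%C with (Ci * RtoC (2 * PI * INR (l * j) / INR N))%C in E.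
  - apply cis_eq_1 in E; [|exact HN].
    apply Nat.gauss in E; [|rewrite Nat.gcd_comm; exact G].
    apply Nat.divide_pos_le in E; lia.
  - unfold z; replace (2 * PI * INR (l * j) / INR N) with (INR j * (2 * PI * INR l / INR N)); [rewrite RtoC_mult; ring|].
    rewrite mult_INR; field; lra. }
split; [split; assumption|].
assert (Hj : forall j, (Cexp (- z) ^ j = / (Cexp z ^ j))%C).
{ intros j; rewrite Cexp_opp, Cpow_inv; [easy|apply Cexp_neq0]. }
split.
- rewrite Hj, H1; cfield.
- intros j Hj' E; rewrite Hj in E; apply (H2 j Hj').
  assert (X : (Cexp z ^ j)%C <> RtoC 0) by (apply Cpow_nz, Cexp_neq0).
  transitivity (Cexp z ^ j * / Cexp z ^ j)%C; [rewrite E; ring|cfield].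
Qed.

Lemma Cmod_cis' (x : R) : ~ Cmod (Cexp (Ci * RtoC x))%C < 1.
Proof.
rewrite Cmod_Cexp; replace (Re (Ci * RtoC x)%C) with 0 by (simpl; ring); rewrite exp_0; lra.
Qed.

(** For a = 1, 5, 7, 11 one has (12 p + a)^2 = 24 k + 1. The common 1/24 is the factor q^(-1/24) of
    the statement, and the numbers k are the exponents in [theta_term]. *)
Lemma gs_theta (t : R) (p : nat) :
  ((- (1)) ^ p * gs (fun c => Cexp (- (Ci * RtoC (t * (6 * c / PI) ^ 2 / 24)))) p =
   Cexp (- (Ci * RtoC (t / 24))) * theta_term (Cexp (Ci * RtoC t)) p)%C.
Proof.
assert (P := PI_RGT_0).
assert (E : forall (a k : nat), ((12 * p + a) * (12 * p + a) = 24 * k + 1)%nat ->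
  Cexp (- (Ci * RtoC (t * (6 * cc p (INR a) / PI) ^ 2 / 24)))%C =
  (Cexp (- (Ci * RtoC (t / 24))) * (/ Cexp (Ci * RtoC t)) ^ k)%C).
{ intros a k Hk; rewrite <- Cexp_opp, Cexp_pow, <- Cexp_add; f_equal.
  assert (Hk' : (12 * INR p + INR a) ^ 2 = 24 * INR k + 1).
  { apply (f_equal INR) in Hk; rewrite !mult_INR, !plus_INR, !mult_INR in Hk.
    replace (INR 12) with 12 in Hk by (simpl; ring); replace (INR 24) with 24 in Hk by (simpl; ring).
    simpl in *; lra. }
  replace (t * (6 * cc p (INR a) / PI) ^ 2 / 24) with (t / 24 + INR k * t).
  - rewrite RtoC_plus, RtoC_mult; ring.
  - replace (6 * cc p (INR a) / PI) with (12 * INR p + INR a) by (unfold cc; field; lra).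
    rewrite Hk'; field. }
unfold gs, theta_term.
assert (E1 := E 1%nat (6 * p ^ 2 + p)%nat ltac:(simpl; lia)).
assert (E5 := E 5%nat (6 * p ^ 2 + (5 * p + 1))%nat ltac:(simpl; lia)).
assert (E7 := E 7%nat (6 * p ^ 2 + (7 * p + 2))%nat ltac:(simpl; lia)).
assert (E11 := E 11%nat (6 * p ^ 2 + (11 * p + 5))%nat ltac:(simpl; lia)).
replace (INR 1) with 1 in E1 by (simpl; ring); replace (INR 5) with 5 in E5 by (simpl; ring).
replace (INR 7) with 7 in E7 by (simpl; ring); replace (INR 11) with 11 in E11 by (simpl; ring).
rewrite E1, E5, E7, E11, !Cpow_add_r; ring.
Qed.

Lemma weight_values (p : nat) :
  let W y := cos (5 * PI * y / 6) + cos (PI * y / 6) in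
  let c := 2 * cos (PI / 4) * cos (PI / 6) in
  W (INR (6 * p) + / 2) = (-1) ^ p * c /\ W (INR (6 * p + 1) + / 2) = 0 /\
  W (INR (6 * p + 2) + / 2) = (-1) ^ p * c /\ W (INR (6 * p + 3) + / 2) = - ((-1) ^ p * c) /\
  W (INR (6 * p + 4) + / 2) = 0 /\ W (INR (6 * p + 5) + / 2) = - ((-1) ^ p * c).
Proof.
intros W c.
assert (G : forall r, W (INR (6 * p) + r) = (-1) ^ p * (2 * cos (PI * r / 2) * cos (PI * r / 3))).
{ intros r; unfold W.
  assert (S : forall A B, cos (A + B) + cos (A - B) = 2 * cos A * cos B) by (intros; rewrite cos_plus, cos_minus; ring).
  replace (5 * PI * (INR (6 * p) + r) / 6) with (PI * (INR (6 * p) + r) / 2 + PI * (INR (6 * p) + r) / 3) by field.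
  replace (PI * (INR (6 * p) + r) / 6) with (PI * (INR (6 * p) + r) / 2 - PI * (INR (6 * p) + r) / 3) by field.
  rewrite S.
  replace (PI * (INR (6 * p) + r) / 2) with (PI * r / 2 + INR (3 * p) * PI) by (rewrite !mult_INR; simpl; field).
  replace (PI * (INR (6 * p) + r) / 3) with (PI * r / 3 + INR (2 * p) * PI) by (rewrite !mult_INR; simpl; field).
  rewrite !cos_add_npi, pow_1_even, pow_mult; replace ((-1) ^ 3) with (-1) by ring; ring. }
assert (H : forall k x, x = INR (6 * p + k) + / 2 -> x = INR (6 * p) + (INR k + / 2)) by (intros k x ->; rewrite plus_INR; ring).
assert (Cs : forall x (n : nat) y, x = y + INR n * PI -> cos x = (-1) ^ n * cos y) by (intros x n y ->; apply cos_add_npi).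
unfold c; repeat split.
- rewrite G; f_equal; f_equal; [f_equal|]; f_equal; field.
- rewrite (H 1%nat _ eq_refl), G; simpl INR.
  replace (PI * (1 + / 2) / 3) with (PI / 2) by field; rewrite cos_PI2; ring.
- rewrite (H 2%nat _ eq_refl), G; simpl INR.
  rewrite (Cs (PI * (1 + 1 + / 2) / 2) 1%nat (PI / 4)), (Cs (PI * (1 + 1 + / 2) / 3) 1%nat (- (PI / 6))), cos_neg by (simpl; field); simpl; ring.
- rewrite (H 3%nat _ eq_refl), G; simpl INR.
  rewrite (Cs (PI * (1 + 1 + 1 + / 2) / 2) 2%nat (- (PI / 4))), (Cs (PI * (1 + 1 + 1 + / 2) / 3) 1%nat (PI / 6)), cos_neg by (simpl; field); simpl; ring.
- rewrite (H 4%nat _ eq_refl), G; simpl INR.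
  rewrite (Cs (PI * (1 + 1 + 1 + 1 + / 2) / 3) 1%nat (PI / 2)), cos_PI2 by (simpl; field); ring.
- rewrite (H 5%nat _ eq_refl), G; simpl INR.
  rewrite (Cs (PI * (1 + 1 + 1 + 1 + 1 + / 2) / 2) 3%nat (- (PI / 4))), (Cs (PI * (1 + 1 + 1 + 1 + 1 + / 2) / 3) 2%nat (- (PI / 6))), !cos_neg by (simpl; field); simpl; ring.
Qed.

(* Only the j congruent to 0, 2, 3, 5 modulo 6 survive: 2 j + 1 = 12 p + a with a = 1, 5, 7, 11. *)
Lemma weight_sum (mu : R) (M : nat) :
  Csum (fun j => (- (1)) ^ j * (RtoC (cos (5 * PI * (INR j + / 2) / 6) + cos (PI * (INR j + / 2) / 6))
       * Cexp (Ci * RtoC (mu * (INR j + / 2) ^ 2))))%C (6 * M)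
  = (RtoC (2 * cos (PI / 4) * cos (PI / 6)) * Csum (fun p => (- (1)) ^ p *
       gs (fun c => Cexp (Ci * RtoC (mu * (3 * c / PI) ^ 2))) p) M)%C.
Proof.
assert (P := PI_RGT_0).
induction M as [|M IH]; [simpl; ring|].
replace (6 * S M)%nat with (S (S (S (S (S (S (6 * M))))))) by lia.
rewrite !Csum_S, IH.
replace (S (S (S (S (S (6 * M)))))) with (6 * M + 5)%nat by lia.
replace (S (S (S (S (6 * M))))) with (6 * M + 4)%nat by lia.
replace (S (S (S (6 * M)))) with (6 * M + 3)%nat by lia.
replace (S (S (6 * M))) with (6 * M + 2)%nat by lia.
replace (S (6 * M)) with (6 * M + 1)%nat by lia.
destruct (weight_values M) as [W0 [W1 [W2 [W3 [W4 W5]]]]]; cbv beta in *.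
rewrite W0, W1, W2, W3, W4, W5.
set (c := 2 * cos (PI / 4) * cos (PI / 6)).
unfold gs.
replace (INR (6 * M) + / 2) with (3 * cc M 1 / PI) by (unfold cc; rewrite mult_INR; simpl; field; lra).
replace (INR (6 * M + 2) + / 2) with (3 * cc M 5 / PI) by (unfold cc; rewrite plus_INR, mult_INR; simpl; field; lra).
replace (INR (6 * M + 3) + / 2) with (3 * cc M 7 / PI) by (unfold cc; rewrite plus_INR, mult_INR; simpl; field; lra).
replace (INR (6 * M + 5) + / 2) with (3 * cc M 11 / PI) by (unfold cc; rewrite plus_INR, mult_INR; simpl; field; lra).
assert (E6 : ((- (1)) ^ (6 * M) = 1)%C) by (replace (6 * M)%nat with (2 * (3 * M))%nat by lia; apply Cm1_pow_even).
rewrite !Cpow_add_r, E6, !RtoC_opp, !(RtoC_mult ((-1) ^ M) c), RtoC_pow, RtoC_m1.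
ring.
Qed.

Lemma Csqrt_i (r : R) : 0 <= r -> Csqrt (Ci * RtoC r)%C = (RtoC (sqrt (r / 2)) * (1 + Ci))%C.
Proof.
intros Hr; replace (Ci * RtoC r)%C with ((0, r) : C) by (unfold Ci, RtoC, Cmult; simpl; f_equal; ring).
unfold Csqrt; simpl.
assert (E : Cmod (0, r) = r).
{ unfold Cmod; simpl; replace (0 * (0 * 1) + r * (r * 1)) with (r * r) by ring; apply sqrt_square, Hr. }
rewrite E; destruct (Rle_dec 0 r) as [_|N]; [|lra].
replace (r + 0) with r by ring; replace (r - 0) with r by ring.
unfold Ci, RtoC, Cmult, Cplus; simpl; f_equal; ring.
Qed.

Lemma alpha_inv (x : R) : x <> 0 -> (/ (- (Ci * RtoC x)))%C = (Ci * RtoC (/ x))%C.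
Proof.
intros Hx; assert (X : RtoC x <> RtoC 0) by (intros E; injection E; lra).
rewrite RtoC_inv by exact Hx.
transitivity (- (Ci * Ci) * / (- (Ci * RtoC x)))%C; [rewrite Ci2, RtoC_m1; ring|cfield].
Qed.

Section Transform.
Variables (x : R) (n M : nat) (eta : C).
Hypothesis Hx : 0 < x.
Hypothesis Hn : (1 <= n)%nat.
Let mu := PI ^ 2 / (6 * x).
Hypothesis Hnm : mu * INR (6 * M) = PI * INR n.
Hypothesis Heta : eta = (- (- (1)) ^ n)%C.
Hypothesis Hphase : forall p (a : nat), a = 1%nat \/ a = 5%nat \/ a = 7%nat \/ a = 11%nat ->
  ((- (1)) ^ ((12 * p + a) * M + n * (6 * M)) = eta)%C.

Let mu0 : 0 < mu.
Proof. unfold mu; pose proof PI_RGT_0; apply Rdiv_lt_0_compat; nra. Qed.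

(** The phases c^2 / (4 mu) of [mordell_star] give the theta sum at q = exp (i x), the nodes j + 1/2
    give the one at exp (- i pi^2 / x). The prefactor on the left is chosen to clear the coefficient
    of the first: the two real roots multiply to 1/2, and (1 + i) (1 - i) = 2. *)
Lemma transform_eq :
  (2 * (RtoC (sqrt (PI / (3 * x))) * (1 + Ci) * II (mord mu)) =
   Cexp (- (Ci * RtoC (x / 24))) * Csum (theta_term (Cexp (Ci * RtoC x))) n
   + RtoC (sqrt (PI / (2 * x))) * (1 + Ci) * (Cexp (Ci * RtoC (PI ^ 2 / (24 * x))) *
       Csum (theta_term (Cexp (- (Ci * RtoC (PI ^ 2 / x))))) M))%C.
Proof.
assert (P := PI_RGT_0).
assert (S := mordell_star mu mu0 n (6 * M) eta Hn Hnm Heta).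
assert (Hph : forall p a, a = 1 \/ a = 5 \/ a = 7 \/ a = 11 ->
  Cexp (- (Ci * RtoC (cc p a * INR (6 * M) + mu * INR (6 * M) ^ 2)))%C = eta /\
  Cexp (- (Ci * RtoC (- cc p a * INR (6 * M) + mu * INR (6 * M) ^ 2)))%C = eta).
{ intros p a Ha.
  assert (exists a' : nat, a = INR a' /\ (a' = 1%nat \/ a' = 5%nat \/ a' = 7%nat \/ a' = 11%nat)) as [a' [-> Ha']].
  { destruct Ha as [->|[->|[->| ->]]]; [exists 1%nat|exists 5%nat|exists 7%nat|exists 11%nat]; split; try tauto; simpl; ring. }
  assert (Q := Hphase p a' Ha').
  replace (mu * INR (6 * M) ^ 2) with (PI * INR (n * (6 * M))).
  2: { rewrite (mult_INR n); replace (mu * INR (6 * M) ^ 2) with (mu * INR (6 * M) * INR (6 * M)) by ring; rewrite Hnm; ring. }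
  replace (cc p (INR a') * INR (6 * M)) with (PI * INR ((12 * p + a') * M)).
  2: { unfold cc; rewrite !mult_INR, plus_INR, mult_INR; simpl; field. }
  replace (- cc p (INR a') * INR (6 * M)) with (- (PI * INR ((12 * p + a') * M))).
  2: { unfold cc; rewrite !mult_INR, plus_INR, mult_INR; simpl; field. }
  rewrite !RtoC_plus, RtoC_opp, <- Q, Cpow_add_r.
  split.
  - replace (- (Ci * (RtoC (PI * INR ((12 * p + a') * M)) + RtoC (PI * INR (n * (6 * M))))))%C with
      (- (Ci * RtoC (PI * INR ((12 * p + a') * M))) + - (Ci * RtoC (PI * INR (n * (6 * M)))))%C by ring.
    rewrite Cexp_add, !cis_pi_opp; easy.
  - replace (- (Ci * (- RtoC (PI * INR ((12 * p + a') * M)) + RtoC (PI * INR (n * (6 * M))))))%C with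
      ((Ci * RtoC (PI * INR ((12 * p + a') * M))) + - (Ci * RtoC (PI * INR (n * (6 * M)))))%C by ring.
    rewrite Cexp_add, cis_pi, cis_pi_opp; easy. }
specialize (S Hph).
rewrite weight_sum in S.
assert (T1 : Csum (fun p => (- (1)) ^ p * gs (fun c => Cexp (- (Ci * RtoC (c ^ 2 / (4 * mu))))) p)%C n =
  (Cexp (- (Ci * RtoC (x / 24))) * Csum (theta_term (Cexp (Ci * RtoC x))) n)%C).
{ rewrite <- Csum_scal; apply Csum_ext; intros p _; rewrite <- gs_theta; unfold gs.
  assert (E : forall c, c ^ 2 / (4 * mu) = x * (6 * c / PI) ^ 2 / 24) by (intros; unfold mu; field; split; lra).
  rewrite !E; easy. }
assert (T2 : Csum (fun p => (- (1)) ^ p * gs (fun c => Cexp (Ci * RtoC (mu * (3 * c / PI) ^ 2))) p)%C M =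
  (Cexp (Ci * RtoC (PI ^ 2 / (24 * x))) * Csum (theta_term (Cexp (- (Ci * RtoC (PI ^ 2 / x))))) M)%C).
{ rewrite <- Csum_scal; apply Csum_ext; intros p _.
  assert (G := gs_theta (- (PI ^ 2 / x)) p).
  replace (- (Ci * RtoC (- (PI ^ 2 / x) / 24)))%C with (Ci * RtoC (PI ^ 2 / (24 * x)))%C in G.
  2: { replace (- (PI ^ 2 / x) / 24) with (- (PI ^ 2 / (24 * x))) by (field; lra); rewrite RtoC_opp; ring. }
  replace (Ci * RtoC (- (PI ^ 2 / x)))%C with (- (Ci * RtoC (PI ^ 2 / x)))%C in G by (rewrite RtoC_opp; ring).
  rewrite <- G; unfold gs.
  assert (E : forall c, (Ci * RtoC (mu * (3 * c / PI) ^ 2) = - (Ci * RtoC (- (PI ^ 2 / x) * (6 * c / PI) ^ 2 / 24)))%C).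
  { intros c; replace (- (PI ^ 2 / x) * (6 * c / PI) ^ 2 / 24) with (- (mu * (3 * c / PI) ^ 2)) by (unfold mu; field; split; lra).
    rewrite RtoC_opp; ring. }
  rewrite !E; easy. }
rewrite T1, T2 in S.
replace (2 * (RtoC (sqrt (PI / (3 * x))) * (1 + Ci) * II (mord mu)))%C with
  (RtoC (sqrt (PI / (3 * x))) * (1 + Ci) * (2 * II (mord mu)))%C by ring.
rewrite S.
assert (K1 : sqrt (PI / (3 * x)) * sqrt (PI / (8 * mu)) = / 2).
{ rewrite <- sqrt_mult by (left; apply Rdiv_lt_0_compat; lra).
  replace (PI / (3 * x) * (PI / (8 * mu))) with (/ 2 * / 2) by (unfold mu; field; split; lra).
  apply sqrt_square; lra. }
assert (K2 : sqrt (PI / (3 * x)) * (2 * cos (PI / 4) * cos (PI / 6)) = sqrt (PI / (2 * x))).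
{ rewrite cos_PI4, cos_PI6.
  assert (s2 : 0 < sqrt 2) by (apply sqrt_lt_R0; lra).
  replace (2 * (1 / sqrt 2) * (sqrt 3 / 2)) with (sqrt 3 / sqrt 2) by (field; lra).
  rewrite <- sqrt_div, <- sqrt_mult by (try lra; left; apply Rdiv_lt_0_compat; lra).
  f_equal; field; lra. }
rewrite <- K2, !RtoC_mult.
apply (f_equal RtoC) in K1; rewrite RtoC_mult, RtoC_inv in K1 by lra.
set (u := (Cexp (- (Ci * RtoC (x / 24))) * Csum (theta_term (Cexp (Ci * RtoC x))) n)%C).
set (v := (Cexp (Ci * RtoC (PI ^ 2 / (24 * x))) * Csum (theta_term (Cexp (- (Ci * RtoC (PI ^ 2 / x))))) M)%C).
transitivity ((RtoC (sqrt (PI / (3 * x))) * RtoC (sqrt (PI / (8 * mu)))) * (1 - Ci * Ci) * u +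
  RtoC (sqrt (PI / (3 * x))) * (2 * cos (PI / 4) * cos (PI / 6)) * (1 + Ci) * v)%C; [ring|].
rewrite K1, Ci2, RtoC_m1; cfield.
Qed.

End Transform.

Lemma mordell_integral_exists (x : R) : 0 < x ->
  is_mordell_integral (- (Ci * RtoC x))%C (II (mord (PI ^ 2 / (6 * x)))).
Proof.
intros Hx; unfold is_mordell_integral; assert (P := PI_RGT_0).
set (mu := PI ^ 2 / (6 * x)).
assert (E : forall u, mord mu u = mordell_integrand (- (Ci * RtoC x))%C u).
{ intros u; unfold mord, mordell_integrand; f_equal; f_equal; f_equal.
  unfold Cdiv; replace (/ (6 * - (Ci * RtoC x)))%C with (/ 6 * / (- (Ci * RtoC x)))%C.
  - rewrite alpha_inv, <- !RtoC_pow by lra; unfold mu, Rdiv.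
    rewrite !RtoC_mult, RtoC_inv, RtoC_inv, RtoC_mult by lra.
    assert (X : RtoC x <> RtoC 0) by (intros F; injection F; lra). cfield.
  - assert (X : RtoC x <> RtoC 0) by (intros F; injection F; lra). cfield. }
assert (I1 : isI (mord mu) (II (mord mu))).
{ apply (II_correct _ 4 (PI / 6)); [lra|apply mord_cont|apply mord_dom]. }
apply (is_RInt_gen_ext (V := C_R_CompleteNormedModule) (mord mu)); [|apply isI_is_RInt_gen; [apply mord_cont|exact I1]].
apply filter_forall; intros ab u _; apply E.
Qed.

Lemma alpha_conv (x : R) : 0 < x -> let alpha := (- (Ci * RtoC x))%C in
  (alpha / 24 = - (Ci * RtoC (x / 24)))%C /\ (- alpha = Ci * RtoC x)%C /\
  (PI ^ 2 / alpha = Ci * RtoC (PI ^ 2 / x))%C /\ (PI ^ 2 / (24 * alpha) = Ci * RtoC (PI ^ 2 / (24 * x)))%C /\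
  (forall a b : R, b <> 0 -> (a / (b * alpha) = Ci * RtoC (a / (b * x)))%C).
Proof.
intros Hx alpha.
assert (X : RtoC x <> RtoC 0) by (intros F; injection F; lra).
assert (A : forall a b : R, b <> 0 -> (a / (b * alpha) = Ci * RtoC (a / (b * x)))%C).
{ intros a b Hb; assert (B : RtoC b <> RtoC 0) by (intros F; injection F; lra).
  unfold Cdiv; replace (/ (b * alpha))%C with (/ b * / alpha)%C by (unfold alpha; cfield).
  unfold alpha; rewrite alpha_inv by lra; unfold Rdiv.
  rewrite RtoC_mult, Rinv_mult, RtoC_mult, (RtoC_inv b) by lra; ring. }
assert (P2 : (PI ^ 2)%C = RtoC (PI ^ 2)) by (rewrite RtoC_pow; easy).
repeat split.
- unfold alpha, Rdiv; rewrite RtoC_mult, RtoC_inv by lra; cfield.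
- unfold alpha; ring.
- rewrite P2; assert (E := A (PI ^ 2) 1 ltac:(lra)).
  replace (1 * x)%R with x in E by ring; rewrite <- E; f_equal; ring.
- rewrite P2; apply A; lra.
- exact A.
Qed.

Lemma sqrt_half (a b : R) : 0 <= a -> b = 4 * a -> sqrt b = 2 * sqrt a.
Proof.
intros Ha ->; rewrite sqrt_mult by lra; f_equal.
replace 4 with (2 * 2) by ring; apply sqrt_square; lra.
Qed.

(** The case n = 2 k + 1, M = 2 l of [transform_eq]. The first theta sum is 2 phi (q); the second is
    -4 psi (q_1), because q_1^(2 l) = exp (- i pi (2 k + 1)) = -1. *)
Lemma phi_transform (k l : nat) : (1 <= l)%nat -> Nat.gcd l (2 * k + 1) = 1%nat ->
  let x := 2 * PI * INR l / INR (2 * k + 1) in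
  let alpha := (- (Ci * RtoC x))%C in
  (Cexp (alpha / 24) * phi (Cexp (- alpha)) =
    Csqrt (4 * PI / alpha) * Cexp (PI ^ 2 / (24 * alpha)) * psi (Cexp (- (PI ^ 2 / alpha)))
    + Csqrt (2 * PI / (3 * alpha)) * II (mord (PI ^ 2 / (6 * x))))%C.
Proof.
intros Hl G x alpha; assert (P := PI_RGT_0).
assert (l0 : 0 < INR l) by (apply lt_0_INR; lia).
assert (N0 : 0 < INR (2 * k + 1)) by (apply lt_0_INR; lia).
assert (Hx : 0 < x) by (unfold x; apply Rdiv_lt_0_compat; nra).
destruct (alpha_conv x Hx) as [A1 [A2 [A3 [A4 A5]]]]; fold alpha in A1, A2, A3, A4, A5.
replace (4 * PI / alpha)%C with (Ci * RtoC (4 * PI / x))%C.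
2: { assert (E := A5 (4 * PI) 1 ltac:(lra)); replace (1 * x)%R with x in E by ring; rewrite <- E, RtoC_mult, Cmult_1_l; easy. }
replace (2 * PI / (3 * alpha))%C with (Ci * RtoC (2 * PI / (3 * x)))%C by (rewrite <- A5, RtoC_mult by lra; easy).
rewrite A1, A2, A3, A4, !Csqrt_i by (left; apply Rdiv_lt_0_compat; lra).
assert (Hodd : Nat.Odd (2 * k + 1)) by (exists k; lia).
destruct (prim_cis l (2 * k + 1) ltac:(lia) G) as [Hp _]; fold x in Hp.
assert (T := phi_theta _ _ Hodd Hp (Cmod_cis' x)).
set (q1 := Cexp (- (Ci * RtoC (PI ^ 2 / x)))%C).
assert (Q1 : (q1 ^ (2 * l) = - (1))%C).
{ unfold q1; rewrite Cexp_pow.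
  replace (INR (2 * l) * - (Ci * RtoC (PI ^ 2 / x)))%C with (- (Ci * RtoC (PI * INR (2 * k + 1))))%C.
  - rewrite cis_pi_opp; apply Cm1_pow_odd.
  - replace (PI * INR (2 * k + 1)) with (INR (2 * l) * (PI ^ 2 / x)); [rewrite RtoC_mult; ring|].
    unfold x; rewrite (mult_INR 2 l); change (INR 2) with 2; field; repeat split; lra. }
assert (N1 : ~ Cmod q1 < 1).
{ unfold q1; rewrite Cmod_cis; lra. }
assert (T1 := psi_theta q1 l ltac:(lia) Q1 N1).
assert (F := transform_eq x (2 * k + 1) (2 * l) (RtoC 1) Hx ltac:(lia)).
assert (F1 : PI ^ 2 / (6 * x) * INR (6 * (2 * l)) = PI * INR (2 * k + 1)).
{ unfold x; rewrite !(mult_INR 6), (mult_INR 2 l); change (INR 2) with 2; replace (INR 6) with 6 by (simpl; ring).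
  field; repeat split; lra. }
specialize (F F1 ltac:(rewrite Cm1_pow_odd; ring)).
assert (F2 : forall p a : nat, a = 1%nat \/ a = 5%nat \/ a = 7%nat \/ a = 11%nat ->
    ((- (1)) ^ ((12 * p + a) * (2 * l) + (2 * k + 1) * (6 * (2 * l))))%C = RtoC 1).
{ intros p a _; replace ((12 * p + a) * (2 * l) + (2 * k + 1) * (6 * (2 * l)))%nat with
   (2 * ((12 * p + a) * l + (2 * k + 1) * (6 * l)))%nat by ring; apply Cm1_pow_even. }
specialize (F F2); fold q1 in F; rewrite <- T, <- T1 in F.
replace (4 * PI / x / 2) with (2 * PI / x) by (field; lra).
replace (2 * PI / (3 * x) / 2) with (PI / (3 * x)) by (field; lra).
rewrite (sqrt_half (PI / (2 * x)) (2 * PI / x)) by (try (field; lra); left; apply Rdiv_lt_0_compat; lra).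
rewrite RtoC_mult.
set (s2 := (RtoC (sqrt (PI / (3 * x))) * (1 + Ci))%C) in *.
set (s3 := (RtoC (sqrt (PI / (2 * x))) * (1 + Ci))%C) in *.
set (J := II (mord (PI ^ 2 / (6 * x)))) in *.
set (e := Cexp (- (Ci * RtoC (x / 24)))%C) in *; set (e1 := Cexp (Ci * RtoC (PI ^ 2 / (24 * x)))%C) in *.
replace (s2 * J)%C with (/ 2 * (2 * (s2 * J)))%C by cfield.
rewrite F; unfold s3; fold q1; cfield.
Qed.

(** The case n = 2 k, M = l. The first theta sum is -4 psi (q), and the second is 2 phi (q_1): here
    q_1 is a primitive root of unity of order l, and l is odd as it is prime to 4 k. *)
Lemma psi_transform (k l : nat) : (1 <= k)%nat -> (1 <= l)%nat -> Nat.gcd l (4 * k) = 1%nat ->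
  let x := 2 * PI * INR l / INR (4 * k) in
  let alpha := (- (Ci * RtoC x))%C in
  (Cexp (alpha / 24) * psi (Cexp (- alpha)) =
    Csqrt (PI / (4 * alpha)) * Cexp (PI ^ 2 / (24 * alpha)) * phi (Cexp (- (PI ^ 2 / alpha)))
    - Csqrt (PI / (6 * alpha)) * II (mord (PI ^ 2 / (6 * x))))%C.
Proof.
intros Hk Hl G x alpha; assert (P := PI_RGT_0).
assert (l0 : 0 < INR l) by (apply lt_0_INR; lia).
assert (k0 : 0 < INR k) by (apply lt_0_INR; lia).
assert (N0 : INR (4 * k) = 4 * INR k) by (rewrite mult_INR; simpl; ring).
assert (Hx : 0 < x) by (unfold x; rewrite N0; apply Rdiv_lt_0_compat; nra).
assert (Hlk : Nat.gcd l k = 1%nat).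
{ apply Nat.divide_1_r; rewrite <- G; apply Nat.gcd_greatest; [apply Nat.gcd_divide_l|].
  apply Nat.divide_mul_r, Nat.gcd_divide_r. }
assert (Hodd : Nat.Odd l).
{ destruct (Nat.Even_or_Odd l) as [[j Hj]|H]; [|exact H].
  exfalso; assert (D : Nat.divide 2 (Nat.gcd l (4 * k))).
  { apply Nat.gcd_greatest; [exists j; lia|exists (2 * k)%nat; lia]. }
  rewrite G in D; apply Nat.divide_1_r in D; lia. }
destruct (alpha_conv x Hx) as [A1 [A2 [A3 [A4 A5]]]]; fold alpha in A1, A2, A3, A4, A5.
rewrite (A5 PI 4), (A5 PI 6) by lra.
rewrite A1, A2, A3, A4, !Csqrt_i by (left; apply Rdiv_lt_0_compat; lra).
set (q := Cexp (Ci * RtoC x)%C).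
assert (Q : (q ^ (2 * k) = - (1))%C).
{ unfold q; rewrite Cexp_pow.
  replace (INR (2 * k) * (Ci * RtoC x))%C with (Ci * RtoC (PI * INR l))%C.
  - rewrite cis_pi; destruct Hodd as [j ->]; apply Cm1_pow_odd.
  - replace (PI * INR l) with (INR (2 * k) * x); [rewrite RtoC_mult; ring|].
    unfold x; rewrite N0, mult_INR; change (INR 2) with 2; field; lra. }
assert (T := psi_theta q k ltac:(lia) Q (Cmod_cis' x)).
set (q1 := Cexp (- (Ci * RtoC (PI ^ 2 / x)))%C).
assert (Hp : prim q1 l).
{ destruct (prim_cis k l ltac:(lia) ltac:(rewrite Nat.gcd_comm; exact Hlk)) as [_ Hp].
  unfold q1; replace (PI ^ 2 / x) with (2 * PI * INR k / INR l); [exact Hp|].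
  unfold x; rewrite N0; field; repeat split; lra. }
assert (N1 : ~ Cmod q1 < 1).
{ unfold q1; rewrite Cmod_cis; lra. }
assert (T1 := phi_theta q1 l Hodd Hp N1).
assert (F := transform_eq x (2 * k) l (- (1))%C Hx ltac:(lia)).
assert (F1 : PI ^ 2 / (6 * x) * INR (6 * l) = PI * INR (2 * k)).
{ unfold x; rewrite N0, !(mult_INR 6), (mult_INR 2 k); change (INR 2) with 2; replace (INR 6) with 6 by (simpl; ring).
  field; repeat split; lra. }
specialize (F F1 ltac:(rewrite Cm1_pow_even; ring)).
assert (F2 : forall p a : nat, a = 1%nat \/ a = 5%nat \/ a = 7%nat \/ a = 11%nat ->
    ((- (1)) ^ ((12 * p + a) * l + 2 * k * (6 * l)))%C = (- (1))%C).
{ intros p a Ha; destruct Hodd as [j ->].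
  assert (exists b, a = (2 * b + 1)%nat) as [b ->].
  { destruct Ha as [->|[->|[->| ->]]]; [exists 0%nat|exists 2%nat|exists 3%nat|exists 5%nat]; easy. }
  replace ((12 * p + (2 * b + 1)) * (2 * j + 1) + 2 * k * (6 * (2 * j + 1)))%nat with
   (2 * ((6 * p + b) * (2 * j + 1) + j + k * (6 * (2 * j + 1))) + 1)%nat by ring; apply Cm1_pow_odd. }
specialize (F F2); fold q q1 in F; rewrite <- T, <- T1 in F.
replace (PI / (4 * x) / 2) with (PI / (8 * x)) by (field; lra).
replace (PI / (6 * x) / 2) with (PI / (12 * x)) by (field; lra).
rewrite (sqrt_half (PI / (8 * x)) (PI / (2 * x))) in F by (try (field; lra); left; apply Rdiv_lt_0_compat; lra).
rewrite (sqrt_half (PI / (12 * x)) (PI / (3 * x))) in F by (try (field; lra); left; apply Rdiv_lt_0_compat; lra).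
rewrite !RtoC_mult in F.
set (J := II (mord (PI ^ 2 / (6 * x)))) in *.
set (e := Cexp (- (Ci * RtoC (x / 24)))%C) in *; set (e1 := Cexp (Ci * RtoC (PI ^ 2 / (24 * x)))%C) in *.
transitivity (- / 4 * (2 * (2 * RtoC (sqrt (PI / (12 * x))) * (1 + Ci) * J) -
  2 * RtoC (sqrt (PI / (8 * x))) * (1 + Ci) * (e1 * (2 * phi q1))))%C; [|cfield].
rewrite F; cfield.
Qed.

(** * Asymptotics of Gaussian and Fresnel averages *)

Lemma II_split_bound (f : R -> C) (B b d M1 M2 : R) :
  0 < b -> Ccont f -> dominated f B b -> 0 <= d -> 0 <= M2 ->
  (forall x, 0 <= x <= d -> Cmod (f x) <= M1) ->
  (forall x, d <= x -> Cmod (f x) <= M2 * exp (- b * x)) ->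
  Cmod (II f) <= M1 * d + M2 / b.
Proof.
intros Hb Hc Hd Hdd HM H1 H2.
apply le_epsilon; intros e He.
destruct (II_correct f B b Hb Hc Hd e He) as [X0 HX].
set (X := Rmax X0 d); destruct (HX X (Rmax_l _ _)) as [l [L1 L2]].
assert (dX : d <= X) by apply Rmax_r.
rewrite <- (isCI_CI _ _ _ _ L1), <- (CI_Chasles f 0 d X Hc) in L2.
assert (A := isCI_bound_const f 0 d _ M1 Hdd H1 (CI_correct f 0 d Hc)).
assert (B1 := isCI_bound f (fun t => M2 * exp (- b * t)) d X _ _ dX
  (fun x Hx => H2 x (proj1 Hx)) (CI_correct f d X Hc) (is_RInt_exp_scal M2 b d X (Rgt_not_eq _ _ Hb))).
assert (B2 : M2 / b * (exp (- b * d) - exp (- b * X)) <= M2 / b).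
{ pose proof (exp_pos (- b * X)).
  assert (exp (- b * d) <= 1).
  { rewrite <- exp_0; destruct (Req_dec (b * d) 0) as [E|E]; [right; f_equal; lra|left; apply exp_increasing; nra]. }
  assert (0 <= M2 / b) by (apply Rmult_le_pos; [lra|left; apply Rinv_0_lt_compat; lra]); nra. }
replace (II f) with ((CI f 0 d + CI f d X) - (CI f 0 d + CI f d X - II f))%C by ring.
eapply Rle_trans; [apply Cmod_triangle|]; rewrite Cmod_opp.
eapply Rle_trans; [apply Rplus_le_compat_r, Cmod_triangle|].
replace (M1 * (d - 0)) with (M1 * d) in A by ring; lra.
Qed.

Lemma dominated_weaken (f : R -> C) B B' b : B <= B' -> dominated f B b -> dominated f B' b.
Proof. intros H Hd x Hx; specialize (Hd x Hx); pose proof (exp_pos (- b * x)); nra. Qed.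

Lemma RtoC_neq0 (x : R) : x <> 0 -> RtoC x <> RtoC 0.
Proof. intros H E; apply H; apply (f_equal Re) in E; exact E. Qed.

Section Weight.
Variable w : C.
Hypothesis Hw : unit_half w.

Definition wt (w : C) (tau x : R) : C := Cexp (- (w * RtoC (x ^ 2 / tau)))%C.

Let w0 : w <> RtoC 0 := unit_neq0 w Hw.

Lemma wt_le1 tau x : 0 < tau -> Cmod (wt w tau x) <= 1.
Proof.
intros Ht; apply Cmod_Cexp_le1; [exact Hw|].
apply Rmult_le_pos; [apply pow2_ge_0|left; apply Rinv_0_lt_compat, Ht].
Qed.

Lemma CD_wt tau x : 0 < tau -> CD (wt w tau) x (- (2 * w * RtoC (x / tau)) * wt w tau x)%C.
Proof.
intros Ht; unfold wt; eapply CD_eq.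
- apply CD_Cexp, CD_opp, CD_scal, (CD_RtoC (fun x => x ^ 2 / tau) x (2 * (x / tau))).
  auto_derive; [lra|field; lra].
- rewrite RtoC_mult; ring.
Qed.

Lemma wt_cont tau : 0 < tau -> Ccont (wt w tau).
Proof. intros Ht; eapply CD_Ccont; intros; apply CD_wt, Ht. Qed.

Lemma wt_prim tau x : 0 < tau -> CI (wt w tau) 0 x = (RtoC (sqrt tau) * Phi w (x / sqrt tau))%C.
Proof.
intros Ht; assert (S := sqrt_lt_R0 tau Ht).
assert (H := isCI_comp_lin (gw w) (/ sqrt tau) 0 0 x (Phi w (x / sqrt tau))).
replace (/ sqrt tau * 0 + 0) with 0 in H by ring; replace (/ sqrt tau * x + 0) with (x / sqrt tau) in H by (field; lra).
specialize (H (CI_correct _ _ _ (gw_cont _))).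
apply (isCI_scal (RtoC (sqrt tau))) in H.
apply isCI_CI; eapply isCI_ext; [|exact H]; intros v _; cbv beta.
rewrite Cmult_assoc, <- RtoC_mult, Rinv_r, Cmult_1_l by lra; unfold gw, wt; do 4 f_equal.
replace tau with (sqrt tau * sqrt tau) at 2 by (apply sqrt_sqrt; lra); field; lra.
Qed.

(* Integration by parts against the primitive of the weight. *)
Lemma wt_by_parts (h h1 : R -> C) (B b tau : R) : 0 < b -> 0 < tau ->
  (forall x, CD h x (h1 x)) -> Ccont h1 -> dominated h B b -> dominated h1 B b ->
  II (fun x => wt w tau x * h x)%C = (- RtoC (sqrt tau) * II (fun x => Phi w (x / sqrt tau) * h1 x))%C.
Proof.
intros Hb Ht D Hc Dh Dh1; assert (S := sqrt_lt_R0 tau Ht).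
assert (B0 := dominated_pos _ _ _ Dh).
set (F := fun x => (RtoC (sqrt tau) * Phi w (x / sqrt tau) * h x)%C).
assert (Hh : Ccont h) by (eapply CD_Ccont; exact D).
assert (DP : forall x, CD (fun x => RtoC (sqrt tau) * Phi w (x / sqrt tau))%C x (wt w tau x)).
{ intros x; apply (CD_ext (fun x => CI (wt w tau) 0 x)); [intros; apply wt_prim, Ht|apply CD_CI, wt_cont, Ht]. }
assert (DPb : forall x, 0 <= x -> Cmod (RtoC (sqrt tau) * Phi w (x / sqrt tau))%C <= 2 * sqrt tau).
{ intros x Hx; rewrite Cmod_mult, Cmod_R, Rabs_pos_eq by lra.
  assert (A := Phi_le2 w (x / sqrt tau) Hw).
  assert (0 <= x / sqrt tau) by (apply Rmult_le_pos; [lra|left; apply Rinv_0_lt_compat; lra]).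
  specialize (A H); nra. }
assert (DF : forall x, CD F x (wt w tau x * h x + RtoC (sqrt tau) * Phi w (x / sqrt tau) * h1 x)%C).
{ intros x; apply (CD_mult (fun x => RtoC (sqrt tau) * Phi w (x / sqrt tau))%C h); [apply DP|apply D]. }
assert (cP : Ccont (fun x => RtoC (sqrt tau) * Phi w (x / sqrt tau))%C) by (eapply CD_Ccont; exact DP).
assert (c1 : Ccont (fun x => wt w tau x * h x)%C) by (apply Ccont_mult; [apply wt_cont, Ht|exact Hh]).
assert (c2 : Ccont (fun x => RtoC (sqrt tau) * Phi w (x / sqrt tau) * h1 x)%C) by (apply Ccont_mult; assumption).
assert (I1 := isI_FTC F _ (2 * sqrt tau * B) b Hb DF (Ccont_plus _ _ c1 c2)).
assert (Fd : dominated F (2 * sqrt tau * B) b).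
{ intros x Hx; unfold F; rewrite Cmod_mult, Rmult_assoc.
  apply Rmult_le_compat; [apply Cmod_ge_0|apply Cmod_ge_0|apply DPb, Hx|apply Dh, Hx]. }
specialize (I1 Fd).
assert (F0 : F 0 = RtoC 0).
{ unfold F; replace (0 / sqrt tau) with 0 by (field; lra); unfold Phi; rewrite CI_point; ring. }
rewrite F0 in I1.
assert (d1 : dominated (fun x => wt w tau x * h x)%C B b).
{ intros x Hx; rewrite Cmod_mult; specialize (Dh x Hx); pose proof (wt_le1 tau x Ht); pose proof (Cmod_ge_0 (h x)); nra. }
assert (d2 : dominated (fun x => RtoC (sqrt tau) * Phi w (x / sqrt tau) * h1 x)%C (2 * sqrt tau * B) b).
{ intros x Hx; rewrite Cmod_mult, Rmult_assoc.
  apply Rmult_le_compat; [apply Cmod_ge_0|apply Cmod_ge_0|apply DPb, Hx|apply Dh1, Hx]. }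
assert (I2 := isI_plus _ _ _ _ (II_correct _ _ _ Hb c1 d1) (II_correct _ _ _ Hb c2 d2)).
assert (E := isI_unique _ _ _ I2 I1).
assert (E2 : II (fun x => RtoC (sqrt tau) * Phi w (x / sqrt tau) * h1 x)%C = (RtoC (sqrt tau) * II (fun x => Phi w (x / sqrt tau) * h1 x))%C).
{ apply isI_II; apply (isI_ext (fun x => RtoC (sqrt tau) * (Phi w (x / sqrt tau) * h1 x))%C); [intros; ring|].
  apply isI_scal, (II_correct _ (2 * B) b Hb).
  - apply Ccont_mult; [|exact Hc]; eapply CD_Ccont; intros x.
    apply (CD_comp (Phi w) (fun x => x / sqrt tau) x); [apply CD_CI, gw_cont|auto_derive; [lra|reflexivity]].
  - intros x Hx; rewrite Cmod_mult.
    assert (A := Phi_le2 w (x / sqrt tau) Hw).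
    assert (0 <= x / sqrt tau) by (apply Rmult_le_pos; [lra|left; apply Rinv_0_lt_compat; lra]).
    rewrite Rmult_assoc; apply Rmult_le_compat; [apply Cmod_ge_0|apply Cmod_ge_0|apply A, H|apply Dh1, Hx]. }
rewrite E2 in E.
replace (II (fun x => wt w tau x * h x)%C) with
  (II (fun x => wt w tau x * h x)%C + RtoC (sqrt tau) * II (fun x => Phi w (x / sqrt tau) * h1 x)%C
    - RtoC (sqrt tau) * II (fun x => Phi w (x / sqrt tau) * h1 x)%C)%C by ring.
rewrite E; ring.
Qed.

Lemma phi_div_cont tau : 0 < tau -> Ccont (fun x => Phi w (x / sqrt tau)).
Proof.
intros Ht; assert (S := sqrt_lt_R0 tau Ht); eapply CD_Ccont; intros x.
apply (CD_comp (Phi w) (fun x => x / sqrt tau) x); [apply CD_CI, gw_cont|auto_derive; [lra|reflexivity]].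
Qed.

(** The bound is uniform in tau although 1 / sqrt tau is not: integration by parts produces a factor
    sqrt tau and leaves the bounded primitive [Phi]. For an oscillating weight no estimate of the
    modulus of the integrand would do. *)
Lemma wt_bound (h h1 : R -> C) (B b tau : R) : 0 < b -> 0 < tau ->
  (forall x, CD h x (h1 x)) -> Ccont h1 -> dominated h B b -> dominated h1 B b ->
  Cmod (/ RtoC (sqrt tau) * II (fun x => wt w tau x * h x))%C <= 2 * B / b.
Proof.
intros Hb Ht D Hc Dh Dh1; assert (S := sqrt_lt_R0 tau Ht).
rewrite (wt_by_parts h h1 B b tau) by assumption.
assert (s0 : RtoC (sqrt tau) <> RtoC 0) by (intros E; injection E; lra).
replace (/ RtoC (sqrt tau) * (- RtoC (sqrt tau) * II (fun x => Phi w (x / sqrt tau) * h1 x)))%C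
  with (- II (fun x => Phi w (x / sqrt tau) * h1 x)%C)%C by cfield.
rewrite Cmod_opp; apply II_bound; [exact Hb|apply Ccont_mult; [apply phi_div_cont, Ht|exact Hc]|].
intros x Hx; rewrite Cmod_mult.
assert (A := Phi_le2 w (x / sqrt tau) Hw).
assert (0 <= x / sqrt tau) by (apply Rmult_le_pos; [lra|left; apply Rinv_0_lt_compat; lra]).
rewrite Rmult_assoc; apply Rmult_le_compat; [apply Cmod_ge_0|apply Cmod_ge_0|apply A, H|apply Dh1, Hx].
Qed.

Variable K : C.
Hypothesis HK : forall X, 0 < X -> Cmod (Phi w X - K)%C <= / X.

(** After integration by parts the primitive Phi (x / sqrt tau) tends to K for every x > 0, and the
    integral of h1 is - h 0. The splitting point d isolates the short interval near 0 where the
    primitive has not yet settled. *)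
Lemma wt_lim (h h1 : R -> C) (B b : R) : 0 < b ->
  (forall x, CD h x (h1 x)) -> Ccont h1 -> dominated h B b -> dominated h1 B b ->
  forall eps, 0 < eps -> exists t0, 0 < t0 /\ forall tau, 0 < tau -> tau < t0 ->
  Cmod (/ RtoC (sqrt tau) * II (fun x => wt w tau x * h x) - K * h 0%R)%C < eps.
Proof.
intros Hb D Hc Dh Dh1 eps He.
assert (B0 := dominated_pos _ _ _ Dh).
assert (K5 : forall X, 0 <= X -> Cmod (Phi w X - K)%C <= 5).
{ assert (HK3 : Cmod K <= 3).
  { assert (A := HK 1 Rlt_0_1); rewrite Rinv_1 in A.
    replace K with (Phi w 1 - (Phi w 1 - K))%C by ring.
    eapply Rle_trans; [apply Cmod_triangle|]; rewrite Cmod_opp; pose proof (Phi_le2 w 1 Hw ltac:(lra)); lra. }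
  intros X HX; eapply Rle_trans; [apply Cmod_triangle|]; rewrite Cmod_opp; pose proof (Phi_le2 w X Hw HX); lra. }
set (d := eps / (4 * (5 * B + 1))).
assert (d0 : 0 < d) by (apply Rdiv_lt_0_compat; lra).
set (e2 := eps * b * d / (4 * (B + 1))).
assert (e20 : 0 < e2) by (apply Rdiv_lt_0_compat; [apply Rmult_lt_0_compat; [apply Rmult_lt_0_compat; lra|exact d0]|lra]).
exists (e2 ^ 2); split; [apply pow_lt, e20|]; intros tau Ht Ht2.
assert (S := sqrt_lt_R0 tau Ht).
assert (Se : sqrt tau < e2).
{ rewrite <- (sqrt_pow2 e2) by lra; apply sqrt_lt_1; [lra|apply pow2_ge_0|exact Ht2]. }
rewrite (wt_by_parts h h1 B b tau) by assumption.
assert (s0 : RtoC (sqrt tau) <> RtoC 0) by (intros E; injection E; lra).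
assert (hI : isI h1 (- h 0%R)%C) by (apply (isI_FTC h h1 B b); assumption).
assert (Pc := phi_div_cont tau Ht).
assert (I1 : isI (fun x => Phi w (x / sqrt tau) * h1 x)%C (II (fun x => Phi w (x / sqrt tau) * h1 x)%C)).
{ apply (II_correct _ (2 * B) b Hb); [apply Ccont_mult; assumption|].
  intros x Hx; rewrite Cmod_mult, Rmult_assoc.
  assert (0 <= x / sqrt tau) by (apply Rmult_le_pos; [lra|left; apply Rinv_0_lt_compat; lra]).
  apply Rmult_le_compat; [apply Cmod_ge_0|apply Cmod_ge_0|apply Phi_le2; assumption|apply Dh1, Hx]. }
assert (I2 := isI_plus _ _ _ _ I1 (isI_scal (- K)%C _ _ hI)).
apply (isI_ext _ (fun x => (Phi w (x / sqrt tau) - K) * h1 x)%C) in I2; [|intros; ring].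
replace (/ RtoC (sqrt tau) * (- RtoC (sqrt tau) * II (fun x => Phi w (x / sqrt tau) * h1 x)) - K * h 0%R)%C
  with (- (II (fun x => Phi w (x / sqrt tau) * h1 x)%C + - K * - h 0%R))%C by cfield.
rewrite Cmod_opp, <- (isI_II _ _ I2).
apply Rle_lt_trans with (5 * B * d + (sqrt tau / d * B) / b).
- apply (II_split_bound _ (5 * B) b); [exact Hb| | |lra| | |].
  + apply Ccont_mult; [|exact Hc]; apply Ccont_minus; [exact Pc|apply Ccont_const].
  + intros x Hx; rewrite Cmod_mult, Rmult_assoc.
    assert (0 <= x / sqrt tau) by (apply Rmult_le_pos; [lra|left; apply Rinv_0_lt_compat; lra]).
    apply Rmult_le_compat; [apply Cmod_ge_0|apply Cmod_ge_0|apply K5; assumption|apply Dh1, Hx].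
  + apply Rmult_le_pos; [left; apply Rdiv_lt_0_compat; lra|exact B0].
  + intros x Hx; rewrite Cmod_mult.
    assert (0 <= x / sqrt tau) by (apply Rmult_le_pos; [lra|left; apply Rinv_0_lt_compat; lra]).
    apply Rmult_le_compat; [apply Cmod_ge_0|apply Cmod_ge_0|apply K5; assumption|].
    eapply Rle_trans; [apply Dh1; lra|].
    assert (exp (- b * x) <= 1).
    { rewrite <- exp_0; destruct (Req_dec (b * x) 0) as [E|E]; [right; f_equal; lra|left; apply exp_increasing; nra]. }
    nra.
  + intros x Hx; rewrite Cmod_mult, Rmult_assoc.
    apply Rmult_le_compat; [apply Cmod_ge_0|apply Cmod_ge_0| |apply Dh1; lra].
    eapply Rle_trans; [apply HK, Rdiv_lt_0_compat; lra|].
    replace (/ (x / sqrt tau)) with (sqrt tau * / x) by (field; split; lra).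
    apply Rmult_le_compat_l; [lra|apply Rinv_le_contravar; lra].
- assert (A1 : 5 * B * d <= eps / 4).
  { unfold d; apply Rmult_le_reg_r with (4 * (5 * B + 1)); [lra|].
    replace (5 * B * (eps / (4 * (5 * B + 1))) * (4 * (5 * B + 1))) with (5 * B * eps) by (field; lra); nra. }
  assert (A2 : sqrt tau / d * B / b <= eps / 4).
  { apply Rle_trans with (e2 / d * B / b).
    - unfold Rdiv; apply Rmult_le_compat_r; [left; apply Rinv_0_lt_compat; lra|].
      apply Rmult_le_compat_r; [exact B0|]; apply Rmult_le_compat_r; [left; apply Rinv_0_lt_compat; lra|lra].
    - unfold e2; replace (eps * b * d / (4 * (B + 1)) / d * B / b) with (eps / 4 * (B / (B + 1))) by (field; repeat split; lra).
      rewrite <- (Rmult_1_r (eps / 4)) at 2; apply Rmult_le_compat_l; [lra|].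
      apply Rmult_le_reg_r with (B + 1); [lra|]; unfold Rdiv; rewrite Rmult_assoc, Rinv_l by lra; lra. }
  lra.
Qed.

(** ** Expansion in powers of tau *)

Definition gavg (w : C) (g : R -> R) (tau : R) : C :=
  (/ RtoC (sqrt tau) * II (fun x => wt w tau x * RtoC (g x)))%C.

Variable g : nat -> R -> R.
Hypothesis g_der : forall k x, is_derive (g k) x (g (S k) x).
Hypothesis g_dom : forall k, exists B, dominated (fun x => RtoC (g k x)) B 1.
Hypothesis g_odd : forall k, g (2 * k + 1) 0 = 0.

Let CDg k x : CD (fun x => RtoC (g k x)) x (RtoC (g (S k) x)).
Proof. apply CD_RtoC, g_der. Qed.

Let g_cont k : Ccont (fun x => RtoC (g k x)).
Proof. eapply CD_Ccont; intros; apply CDg. Qed.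

Let g_xdom k : exists B, 0 <= B /\
  forall j, (j <= 4)%nat -> forall i, (k <= i <= k + 2)%nat -> dominated (fun x => RtoC (x ^ j * g i x)) B (/ 2).
Proof.
assert (G : forall i, exists B, 0 <= B /\ forall j, (j <= 4)%nat -> dominated (fun x => RtoC (x ^ j * g i x)) B (/ 2)).
{ intros i; destruct (g_dom i) as [B HB]; assert (B0 := dominated_pos _ _ _ HB).
  assert (P : forall j, exists K, 0 <= K /\ forall x, 0 <= x -> x ^ j * exp (- (1) * x) <= K * exp (- (/ 2) * x)).
  { intros j; destruct (pow_exp_bound j 1 Rlt_0_1) as [K0 [K1 K2]]; exists K0; split; [exact K1|].
    intros x Hx; specialize (K2 x Hx); replace (1 / 2) with (/ 2) in K2 by field; exact K2. }
  destruct (P 0%nat) as [K0 [P0 Q0]], (P 1%nat) as [K1 [P1 Q1]], (P 2%nat) as [K2 [P2 Q2]], (P 3%nat) as [K3 [P3 Q3]], (P 4%nat) as [K4 [P4 Q4]].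
  exists (B * (K0 + K1 + K2 + K3 + K4)); split; [apply Rmult_le_pos; lra|].
  intros j Hj x Hx; rewrite RtoC_mult, Cmod_mult, !Cmod_R, Rabs_pos_eq by (apply pow_le, Hx).
  specialize (HB x Hx); cbv beta in HB; rewrite Cmod_R in HB.
  assert (Z : x ^ j * exp (- (1) * x) <= (K0 + K1 + K2 + K3 + K4) * exp (- (/ 2) * x)).
  { pose proof (exp_pos (- (/ 2) * x)).
    destruct j as [|[|[|[|[|j]]]]]; [| | | | |lia];
     [specialize (Q0 x Hx)|specialize (Q1 x Hx)|specialize (Q2 x Hx)|specialize (Q3 x Hx)|specialize (Q4 x Hx)]; nra. }
  apply Rle_trans with (x ^ j * (B * exp (- (1) * x))).
  - apply Rmult_le_compat_l; [apply pow_le, Hx|exact HB].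
  - replace (x ^ j * (B * exp (- (1) * x))) with (B * (x ^ j * exp (- (1) * x))) by ring.
    rewrite Rmult_assoc; apply Rmult_le_compat_l; assumption. }
destruct (G k) as [A0 [A1 A2]], (G (k + 1)%nat) as [B0 [B1 B2]], (G (k + 2)%nat) as [C0 [C1 C2]].
exists (A0 + B0 + C0); split; [lra|]; intros j Hj i Hi.
assert (i = k \/ i = k + 1 \/ i = k + 2)%nat as [->|[->| ->]] by lia;
  [apply (dominated_weaken _ A0)|apply (dominated_weaken _ B0)|apply (dominated_weaken _ C0)]; try lra; auto.
Qed.

Let xg_cont j k : Ccont (fun x => RtoC (x ^ j * g k x)).
Proof.
apply (CD_Ccont _ (fun x => RtoC (INR j * x ^ pred j * g k x + x ^ j * g (S k) x))).
intros x; apply CD_RtoC.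
apply (is_derive_mult_R (fun x => x ^ j) (g k) x (INR j * x ^ pred j)); [auto_derive; [easy|ring]|apply g_der].
Qed.

Let wxg_dom j k B tau : 0 < tau -> dominated (fun x => RtoC (x ^ j * g k x)) B (/ 2) ->
  dominated (fun x => wt w tau x * RtoC (x ^ j * g k x))%C B (/ 2).
Proof.
intros Ht H x Hx; rewrite Cmod_mult; specialize (H x Hx).
pose proof (wt_le1 tau x Ht); pose proof (Cmod_ge_0 (RtoC (x ^ j * g k x))); nra.
Qed.

Let I (j k : nat) (tau : R) : C := II (fun x => wt w tau x * RtoC (x ^ j * g k x))%C.

Let isII j k tau B : 0 < tau -> dominated (fun x => RtoC (x ^ j * g k x)) B (/ 2) ->
  isI (fun x => wt w tau x * RtoC (x ^ j * g k x))%C (I j k tau).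
Proof.
intros Ht H; apply (II_correct _ B (/ 2)); [lra| |apply wxg_dom; assumption].
apply Ccont_mult; [apply wt_cont, Ht|apply xg_cont].
Qed.

Let half2 : 0 < / 2. Proof. lra. Qed.

Let parts j k tau : 0 < tau -> (0 ^ j * g k 0 = 0) -> (j <= 2)%nat ->
  (2 * w / RtoC tau * I (S j) k tau = RtoC (INR j) * I (pred j) k tau + I j (S k) tau)%C.
Proof.
intros Ht H0 Hj; destruct (g_xdom k) as [B [B0 HB]].
assert (t0 : RtoC tau <> RtoC 0) by (intros E; injection E; lra).
assert (D : forall x, CD (fun x => wt w tau x * RtoC (x ^ j * g k x))%C x
  ((- (2 * w / RtoC tau)) * (wt w tau x * RtoC (x ^ S j * g k x)) + (RtoC (INR j) * (wt w tau x * RtoC (x ^ pred j * g k x))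
    + wt w tau x * RtoC (x ^ j * g (S k) x)))%C).
{ intros x; eapply CD_eq.
  - apply CD_mult; [apply CD_wt, Ht|apply (CD_RtoC (fun x => x ^ j * g k x) x (INR j * x ^ pred j * g k x + x ^ j * g (S k) x))].
    apply (is_derive_mult_R (fun x => x ^ j) (g k) x (INR j * x ^ pred j)); [auto_derive; [easy|ring]|apply g_der].
  - cbv beta; rewrite RtoC_plus; unfold Rdiv; simpl (x ^ S j); rewrite !RtoC_mult, RtoC_inv by lra; cfield. }
assert (c1 : forall j k, Ccont (fun x => wt w tau x * RtoC (x ^ j * g k x))%C).
{ intros; apply Ccont_mult; [apply wt_cont, Ht|apply xg_cont]. }
assert (I1 := isI_FTC _ _ B (/ 2) half2 D).
assert (Cc : Ccont (fun x => (- (2 * w / RtoC tau)) * (wt w tau x * RtoC (x ^ S j * g k x)) + (RtoC (INR j) * (wt w tau x * RtoC (x ^ pred j * g k x))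
    + wt w tau x * RtoC (x ^ j * g (S k) x)))%C).
{ apply Ccont_plus; [apply Ccont_scal, c1|apply Ccont_plus; [apply Ccont_scal, c1|apply c1]]. }
specialize (I1 Cc ltac:(apply wxg_dom; [exact Ht|apply HB; lia])).
assert (I2 := isI_plus _ _ _ _ (isI_scal (- (2 * w / RtoC tau))%C _ _ (isII (S j) k tau B Ht ltac:(apply HB; lia)))
  (isI_plus _ _ _ _ (isI_scal (RtoC (INR j)) _ _ (isII (pred j) k tau B Ht ltac:(apply HB; lia))) (isII j (S k) tau B Ht ltac:(apply HB; lia)))).
assert (E := isI_unique _ _ _ I2 I1); cbv beta in E; rewrite H0, Cmult_0_r in E.
replace (2 * w / RtoC tau * I (S j) k tau)%C with
 (RtoC (INR j) * I (pred j) k tau + I j (S k) tau -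
   (- (2 * w / RtoC tau) * I (S j) k tau + (RtoC (INR j) * I (pred j) k tau + I j (S k) tau)))%C by ring.
rewrite E; ring.
Qed.

Let CD_I k tau : 0 < tau -> CD (fun t => I 0 k t) tau (w / RtoC (tau ^ 2) * I 2 k tau)%C.
Proof.
intros Ht; destruct (g_xdom k) as [B [B0 HB]].
set (F1 := fun t x => (w / RtoC (t ^ 2) * (wt w t x * RtoC (x ^ 2 * g k x)))%C).
set (F2 := fun t x => ((w / RtoC (t ^ 2) * (w / RtoC (t ^ 2))) * (wt w t x * RtoC (x ^ 4 * g k x)) - 2 * (w / RtoC (t ^ 3)) * (wt w t x * RtoC (x ^ 2 * g k x)))%C).
assert (T0 : forall t, 0 < t -> RtoC t <> RtoC 0) by (intros t H E; injection E; lra).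
set (m := tau / 2); assert (m0 : 0 < m) by (unfold m; lra).
set (A := / m ^ 2); set (A3 := / m ^ 3).
assert (A0 : 0 < A) by (apply Rinv_0_lt_compat, pow_lt, m0); assert (A30 : 0 < A3) by (apply Rinv_0_lt_compat, pow_lt, m0).
assert (Cm : forall t n, m <= t -> Cmod (w / RtoC (t ^ n))%C <= / m ^ n).
{ intros t n H; assert (0 < t ^ n) by (apply pow_lt; lra); assert (0 < m ^ n) by (apply pow_lt; lra).
  rewrite Cmod_div by (intros E; injection E; lra).
  rewrite (proj1 Hw), Cmod_R, Rabs_pos_eq by lra; unfold Rdiv; rewrite Rmult_1_l.
  apply Rinv_le_contravar; [assumption|apply pow_incr; lra]. }
assert (Dw : forall t x, 0 < t -> CD (fun t => wt w t x) t (w * RtoC (x ^ 2 / t ^ 2) * wt w t x)%C).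
{ intros t x H; unfold wt; eapply CD_eq.
  - apply CD_Cexp, CD_opp, CD_scal, (CD_RtoC (fun t => x ^ 2 / t) t (- (x ^ 2 / t ^ 2))).
    auto_derive; [lra|field; lra].
  - rewrite RtoC_opp; ring. }
set (BB := B + A * B + (A * A * B + 2 * A3 * B)).
assert (HBB : B <= BB /\ A * B <= BB /\ A * A * B + 2 * A3 * B <= BB).
{ assert (0 <= A * B) by nra; assert (0 <= A3 * B) by nra; assert (0 <= A * A * B) by (apply Rmult_le_pos; nra).
  unfold BB; repeat split; lra. }
assert (G : CD (fun t => II (fun x => wt w t x * RtoC (x ^ 0 * g k x))%C) tau (II (F1 tau))).
{ apply (CD_II_deriv (fun t x => wt w t x * RtoC (x ^ 0 * g k x))%C F1 F2 m (2 * tau) BB (/ 2)); [lra|unfold m; lra| |].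
  - intros t Htt; assert (tp : 0 < t) by lra.
    split; [apply Ccont_mult; [apply wt_cont, tp|apply xg_cont]|].
    split; [apply Ccont_scal, Ccont_mult; [apply wt_cont, tp|apply xg_cont]|].
    assert (W : forall j, (j <= 4)%nat -> dominated (fun x => wt w t x * RtoC (x ^ j * g k x))%C B (/ 2)).
    { intros j Hj; apply wxg_dom; [exact tp|apply HB; lia]. }
    split; [apply (dominated_weaken _ B); [apply HBB|apply W; lia]|].
    split.
    + apply (dominated_weaken _ (A * B)); [apply HBB|]; intros x Hx; unfold F1; rewrite Cmod_mult, Rmult_assoc.
      apply Rmult_le_compat; [apply Cmod_ge_0|apply Cmod_ge_0|apply Cm; lra|apply W; [lia|exact Hx]].
    + apply (dominated_weaken _ (A * A * B + 2 * A3 * B)); [apply HBB|]; intros x Hx; unfold F2.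
      eapply Rle_trans; [apply Cmod_triangle|]; rewrite Cmod_opp.
      rewrite (Cmod_mult (w / RtoC (t ^ 2) * (w / RtoC (t ^ 2)))), (Cmod_mult (w / _) (w / _)), (Cmod_mult (2 * _)), (Cmod_mult 2), (Cmod_R 2), (Rabs_pos_eq 2) by lra.
      rewrite Rmult_plus_distr_r; apply Rplus_le_compat.
      * rewrite (Rmult_assoc (A * A)); apply Rmult_le_compat; [apply Rmult_le_pos; apply Cmod_ge_0|apply Cmod_ge_0| |apply W; [lia|exact Hx]].
        apply Rmult_le_compat; try apply Cmod_ge_0; apply Cm; lra.
      * rewrite (Rmult_assoc (2 * A3)); apply Rmult_le_compat; [apply Rmult_le_pos; [lra|apply Cmod_ge_0]|apply Cmod_ge_0| |apply W; [lia|exact Hx]].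
        apply Rmult_le_compat_l; [lra|]; apply Cm; lra.
  - intros t x Htt; assert (tp : 0 < t) by lra; assert (tC := T0 t tp).
    split.
    + eapply CD_eq; [apply CD_mult; [apply Dw, tp|apply CD_const]|].
      cbv beta; unfold F1, Rdiv; simpl (x ^ 0); rewrite !RtoC_mult, RtoC_inv by (apply pow_nonzero; lra).
      rewrite !RtoC_pow; cfield.
    + unfold F1, F2; eapply CD_eq.
      * apply CD_mult; [apply (CD_scal w), CD_inv; [|apply (CD_RtoC (fun t => t ^ 2) t (2 * t)); auto_derive; [easy|ring]]|apply CD_mult; [apply Dw, tp|apply CD_const]].
        rewrite RtoC_pow; apply Cpow_nz, tC.
      * cbv beta; unfold Rdiv; rewrite !RtoC_mult, RtoC_inv by (apply pow_nonzero; lra).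
        rewrite !RtoC_pow; cfield. }
eapply CD_eq; [exact G|].
apply isI_II; unfold F1; apply isI_scal, (isII 2 k tau B Ht); apply HB; lia.
Qed.

Let I0 k tau : I 0 k tau = II (fun x => wt w tau x * RtoC (g k x))%C.
Proof. unfold I; f_equal; apply functional_extensionality; intros x; simpl; rewrite Rmult_1_l; easy. Qed.

(** A heat equation: differentiation in the width amounts to two derivatives of g and a factor 1 /
    (4 w). It takes two integrations by parts; the boundary term of the second is an odd derivative
    of g at 0, and vanishes. The factor 1 / sqrt tau is the one that absorbs the lower order
    term. *)
Let CD_gavg j tau : 0 < tau -> CD (gavg w (g (2 * j))) tau (/ (4 * w) * gavg w (g (2 * S j)) tau)%C.
Proof.
intros Ht; assert (S := sqrt_lt_R0 tau Ht).
set (k := (2 * j)%nat).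
apply (CD_ext (fun t => RtoC (/ sqrt t) * I 0 k t)%C).
{ intros t; unfold gavg; rewrite I0; f_equal.
  destruct (Req_dec (sqrt t) 0) as [E|E]; [rewrite E|apply RtoC_inv, E].
  unfold RtoC, Cinv; simpl; rewrite Rinv_0; f_equal; unfold Rdiv; ring. }
assert (s0 : RtoC (sqrt tau) <> RtoC 0) by (intros E; injection E; lra).
assert (P1 := parts 1 k tau Ht ltac:(simpl; ring) ltac:(lia)).
assert (P0 := parts 0 (Datatypes.S k) tau Ht ltac:(simpl; rewrite Rmult_1_l; unfold k; replace (Datatypes.S (2 * j)) with (2 * j + 1)%nat by lia; apply g_odd) ltac:(lia)).
simpl pred in *; simpl INR in *.
assert (t0 : RtoC tau <> RtoC 0) by (intros E; injection E; lra).
eapply CD_eq.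
- apply CD_mult; [apply (CD_RtoC (fun t => / sqrt t) tau (- / (2 * tau * sqrt tau)))|apply CD_I, Ht].
  auto_derive; [split; [lra|split; [lra|easy]]|].
  replace (sqrt tau * sqrt tau) with tau by (symmetry; apply sqrt_sqrt; lra); field; lra.
- cbv beta; unfold gavg; rewrite <- (I0 (2 * Datatypes.S j)).
  replace (2 * Datatypes.S j)%nat with (Datatypes.S (Datatypes.S k)) by (unfold k; lia).
  rewrite RtoC_opp, !RtoC_inv, !RtoC_mult, RtoC_pow by (try lra; apply Rmult_integral_contrapositive_currified; lra).
  assert (X1 : (I 2 k tau = RtoC tau / (2 * w) * (I 0 k tau + RtoC tau / (2 * w) * I 0 (Datatypes.S (Datatypes.S k)) tau))%C).
  { transitivity (RtoC tau / (2 * w) * (2 * w / RtoC tau * I 2 k tau))%C; [cfield|]; rewrite P1.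
    transitivity (RtoC tau / (2 * w) * (1 * I 0 k tau + RtoC tau / (2 * w) * (2 * w / RtoC tau * I 1 (Datatypes.S k) tau)))%C; [cfield|].
    rewrite P0; ring. }
  rewrite X1; cfield.
Qed.

Definition gavg_exp (w K : C) (g : nat -> R -> R) (j A : nat) (tau : R) : C :=
  (K * Csum (fun a => (RtoC tau / (4 * w)) ^ a / RtoC (INR (fact a)) * RtoC (g (2 * (j + a))%nat 0)) A)%C.

Lemma gavg_bound j : exists M, forall tau, 0 < tau -> Cmod (gavg w (g j) tau) <= M.
Proof.
destruct (g_dom j) as [B1 H1], (g_dom (S j)) as [B2 H2].
exists (2 * (B1 + B2) / 1); intros tau Ht; unfold gavg.
assert (P1 := dominated_pos _ _ _ H1); assert (P2 := dominated_pos _ _ _ H2).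
apply (wt_bound (fun x => RtoC (g j x)) (fun x => RtoC (g (S j) x)) (B1 + B2) 1 tau); try lra;
  [apply CDg|apply g_cont|apply (dominated_weaken _ B1)|apply (dominated_weaken _ B2)]; try lra; assumption.
Qed.

Lemma fact_C_neq0 n : RtoC (INR (fact n)) <> RtoC 0.
Proof. apply RtoC_neq0, INR_fact_neq_0. Qed.

(** Induction on the order: by the heat equation the error for j has as derivative 1 / (4 w) times
    the error for j + 1, and it tends to 0 with tau by [wt_lim]. *)
Lemma gavg_expansion A : forall j, exists M, forall tau, 0 < tau -> tau <= 1 ->
  Cmod (gavg w (g (2 * j)) tau - gavg_exp w K g j A tau)%C <= M * tau ^ A.
Proof.
induction A as [|A IH]; intros j.
- destruct (gavg_bound (2 * j)) as [M HM]; exists M; intros tau Ht _; unfold gavg_exp; simpl.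
  replace (gavg w (g (j + (j + 0))) tau - K * 0)%C with (gavg w (g (2 * j)) tau) by (simpl; ring).
  rewrite Rmult_1_r; apply HM, Ht.
- destruct (IH (S j)) as [M HM]; exists (M / 2); intros tau Ht Ht1.
  set (D := fun t => (gavg w (g (2 * j)) t - gavg_exp w K g j (S A) t)%C).
  assert (De : forall t, CD (gavg_exp w K g j (S A)) t (/ (4 * w) * gavg_exp w K g (S j) A t)%C).
  { intros t; unfold gavg_exp.
    assert (G : forall n, CD (fun tau => Csum (fun a => (RtoC tau / (4 * w)) ^ a / RtoC (INR (fact a)) * RtoC (g (2 * (j + a))%nat 0)) (S n))%C t
       (/ (4 * w) * Csum (fun a => (RtoC t / (4 * w)) ^ a / RtoC (INR (fact a)) * RtoC (g (2 * (S j + a))%nat 0)) n)%C).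
    { induction n as [|n IHn].
      - apply (CD_ext (fun _ => RtoC (g (2 * (j + 0))%nat 0))); [intros s; simpl; field; apply C1_neq0|].
        simpl; eapply CD_eq; [apply CD_const|ring].
      - apply (CD_ext (fun tau => Csum (fun a => (RtoC tau / (4 * w)) ^ a / RtoC (INR (fact a)) * RtoC (g (2 * (j + a))%nat 0)) (S n) +
           (RtoC tau / (4 * w)) ^ S n / RtoC (INR (fact (S n))) * RtoC (g (2 * (j + S n))%nat 0))%C); [intros; easy|].
        rewrite Csum_S, Cmult_plus_distr_l; apply CD_plus; [exact IHn|].
        apply (CD_ext (fun s => (/ (4 * w)) ^ S n / RtoC (INR (fact (S n))) * RtoC (g (2 * (j + S n))%nat 0) * RtoC (s ^ S n))%C).
        { intros s; rewrite RtoC_pow; unfold Cdiv; rewrite Cpow_mult_l; ring. }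
        eapply CD_eq.
        + apply CD_scal, (CD_RtoC (fun s => s ^ S n) t (INR (S n) * t ^ n)); auto_derive; [easy|apply Rmult_1_l].
        + replace (j + S n)%nat with (S j + n)%nat by lia.
          replace (fact (S n)) with (S n * fact n)%nat by easy; rewrite mult_INR, !RtoC_mult, RtoC_pow.
          unfold Cdiv; rewrite Cpow_mult_l, Cpow_S.
          assert (N1 : RtoC (INR (S n)) <> RtoC 0) by (apply RtoC_neq0, not_0_INR; lia).
          assert (N2 := fact_C_neq0 n).
          generalize dependent (RtoC (INR (S n))); generalize dependent (RtoC (INR (fact n))); intros; cfield. }
    eapply CD_eq; [apply CD_scal, G|ring]. }
  assert (DD : forall t, 0 < t -> CD D t (/ (4 * w) * (gavg w (g (2 * S j)) t - gavg_exp w K g (S j) A t))%C).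
  { intros t H; unfold D; eapply CD_eq; [apply CD_minus; [apply CD_gavg, H|apply De]|ring]. }
  assert (M0 : 0 <= M * tau ^ A).
  { eapply Rle_trans; [apply Cmod_ge_0|apply (HM tau Ht Ht1)]. }
  assert (pA : 0 < tau ^ A) by (apply pow_lt, Ht).
  assert (M1 : 0 <= M) by nra.
  assert (cw : Cmod (/ (4 * w))%C = / 4).
  { rewrite Cmod_inv by (apply Cmult_neq_0; [intros E; injection E; lra|exact w0]).
    rewrite Cmod_mult, (proj1 Hw), Cmod_R, Rabs_pos_eq by lra; f_equal; ring. }
  assert (Step : forall s, 0 < s <= tau -> Cmod (D tau - D s)%C <= M / 2 * tau ^ S A).
  { intros s Hs.
    apply Rle_trans with (2 * (/ 4 * (M * tau ^ A)) * (tau - s)).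
    - apply (CMVT D (fun t => / (4 * w) * (gavg w (g (2 * S j)) t - gavg_exp w K g (S j) A t))%C); [lra|intros; apply DD; lra|].
      intros t Htt; rewrite Cmod_mult, cw; apply Rmult_le_compat_l; [lra|].
      eapply Rle_trans; [apply HM; lra|]; apply Rmult_le_compat_l; [exact M1|apply pow_incr; lra].
    - simpl; replace (M / 2 * (tau * tau ^ A)) with (2 * (/ 4 * (M * tau ^ A)) * tau) by field.
      apply Rmult_le_compat_l; lra. }
  apply le_epsilon; intros e He.
  destruct (g_dom (2 * j)) as [B1 H1], (g_dom (S (2 * j))) as [B2 H2].
  assert (P1 := dominated_pos _ _ _ H1); assert (P2 := dominated_pos _ _ _ H2).
  destruct (wt_lim (fun x => RtoC (g (2 * j) x)) (fun x => RtoC (g (S (2 * j)) x)) (B1 + B2) 1 Rlt_0_1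
    (CDg _) (g_cont _) ltac:(apply (dominated_weaken _ B1); [lra|exact H1]) ltac:(apply (dominated_weaken _ B2); [lra|exact H2]) (e / 2) ltac:(lra)) as [t0 [T0 HT]].
  assert (E0 : exists t1, 0 < t1 /\ forall s, 0 < s -> s < t1 -> Cmod (gavg_exp w K g j (S A) s - K * RtoC (g (2 * j) 0))%C < e / 2).
  { assert (Z : gavg_exp w K g j (S A) 0 = (K * RtoC (g (2 * j)%nat 0))%C).
    { unfold gavg_exp; rewrite Csum_S_l, Csum_0.
      - rewrite Nat.add_0_r; simpl; field; apply C1_neq0.
      - intros n _; simpl; field; split; [apply w0|]. apply (fact_C_neq0 (S n)). }
    assert (Cn := proj1 (CD_Ccont _ _ De 0)); assert (Cn2 := proj2 (CD_Ccont _ _ De 0)).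
    assert (e4 : 0 < e / 4) by lra.
    apply (proj1 (filterlim_locally _ _)) with (eps := mkposreal _ e4) in Cn.
    apply (proj1 (filterlim_locally _ _)) with (eps := mkposreal _ e4) in Cn2.
    destruct Cn as [d1 Hd1], Cn2 as [d2 Hd2].
    exists (Rmin d1 d2); split; [apply Rmin_glb_lt; apply cond_pos|]; intros s S0 S1.
    assert (B01 : ball 0 d1 s).
    { unfold ball; simpl; unfold AbsRing_ball, abs, minus, plus, opp; simpl.
      rewrite Ropp_0, Rplus_0_r, Rabs_pos_eq by lra; eapply Rlt_le_trans; [exact S1|apply Rmin_l]. }
    assert (B02 : ball 0 d2 s).
    { unfold ball; simpl; unfold AbsRing_ball, abs, minus, plus, opp; simpl.
      rewrite Ropp_0, Rplus_0_r, Rabs_pos_eq by lra; eapply Rlt_le_trans; [exact S1|apply Rmin_r]. }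
    specialize (Hd1 s B01); specialize (Hd2 s B02); rewrite <- Z.
    eapply Rle_lt_trans; [apply Cmod_le_abs|].
    change (Rabs (Re (gavg_exp w K g j (S A) s) - Re (gavg_exp w K g j (S A) 0)) < e / 4) in Hd1.
    change (Rabs (Im (gavg_exp w K g j (S A) s) - Im (gavg_exp w K g j (S A) 0)) < e / 4) in Hd2.
    replace (Re (gavg_exp w K g j (S A) s - gavg_exp w K g j (S A) 0)%C) with
      (Re (gavg_exp w K g j (S A) s) - Re (gavg_exp w K g j (S A) 0)) by (simpl; unfold Re; ring).
    replace (Im (gavg_exp w K g j (S A) s - gavg_exp w K g j (S A) 0)%C) with
      (Im (gavg_exp w K g j (S A) s) - Im (gavg_exp w K g j (S A) 0)) by (simpl; unfold Im; ring).
    lra. }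
  destruct E0 as [t1 [T1 HT1]].
  (* A small s > 0 stands in for the end point 0, where the normalisation by 1 / sqrt tau breaks
     down. *)
  set (s := Rmin tau (Rmin (t0 / 2) (t1 / 2))).
  assert (Hs : 0 < s) by (repeat apply Rmin_glb_lt; lra).
  assert (s <= tau) by apply Rmin_l.
  assert (s <= t0 / 2) by (eapply Rle_trans; [apply Rmin_r|apply Rmin_l]).
  assert (s <= t1 / 2) by (eapply Rle_trans; [apply Rmin_r|apply Rmin_r]).
  assert (A1 := HT s Hs ltac:(lra)); assert (A2 := HT1 s Hs ltac:(lra)); assert (A3 := Step s ltac:(lra)).
  fold (D tau).
  replace (D tau) with ((D tau - D s) + ((gavg w (g (2 * j)) s - K * RtoC (g (2 * j) 0)) - (gavg_exp w K g j (S A) s - K * RtoC (g (2 * j) 0))))%C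
    by (unfold D; ring).
  eapply Rle_trans; [apply Cmod_triangle|].
  assert (A4 := Cmod_triangle (gavg w (g (2 * j)) s - K * RtoC (g (2 * j)%nat 0))%C (- (gavg_exp w K g j (S A) s - K * RtoC (g (2 * j)%nat 0)))%C).
  rewrite Cmod_opp in A4; unfold gavg in A4 at 2; unfold Cminus in *; lra.
Qed.

End Weight.

(** * Taylor expansion in the frequency kap of the factor cosh (kap x) *)

Ltac rring := match goal with |- ?a = ?b => change (a = b :> R); ring end.

Lemma CD_expsum (c : C) (a : nat -> C) (N : nat) (x : R) :
  CD (fun x => Csum (fun n => (c * RtoC x) ^ n / RtoC (INR (fact n)) * a n) (S N))%C x
     (c * Csum (fun n => (c * RtoC x) ^ n / RtoC (INR (fact n)) * a (S n)) N)%C.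
Proof.
induction N as [|n IH].
- apply (CD_ext (fun _ => a 0%nat)); [intros s; simpl; field; apply C1_neq0|].
  simpl; eapply CD_eq; [apply CD_const|ring].
- apply (CD_ext (fun x => Csum (fun n => (c * RtoC x) ^ n / RtoC (INR (fact n)) * a n) (S n) +
       (c * RtoC x) ^ S n / RtoC (INR (fact (S n))) * a (S n))%C); [intros; easy|].
  rewrite Csum_S, Cmult_plus_distr_l; apply CD_plus; [exact IH|].
  apply (CD_ext (fun s => c ^ S n / RtoC (INR (fact (S n))) * a (S n) * RtoC (s ^ S n))%C).
  { intros s; rewrite RtoC_pow, Cpow_mult_l; unfold Cdiv; ring. }
  eapply CD_eq.
  + apply CD_scal, (CD_RtoC (fun s => s ^ S n) x (INR (S n) * x ^ n)); auto_derive; [easy|apply Rmult_1_l].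
  + replace (fact (S n)) with (S n * fact n)%nat by easy; rewrite mult_INR, !RtoC_mult, RtoC_pow.
    rewrite Cpow_mult_l, Cpow_S.
    assert (N1 : RtoC (INR (S n)) <> RtoC 0) by (apply RtoC_neq0, not_0_INR; lia).
    assert (N2 := fact_C_neq0 n).
    generalize dependent (RtoC (INR (S n))); generalize dependent (RtoC (INR (fact n))); intros; cfield.
Qed.

(** Taylor's formula for a family in which differentiation is a shift of the index up to the factor
    c. The 2 in the remainder is the one of [CMVT], once per order. *)
Lemma CTaylor_seq (q : nat -> R -> C) (c : C) (y M : R) (N : nat) : forall k,
  (forall k x, 0 <= x <= y -> CD (q k) x (c * q (S k) x)%C) ->
  (forall x, 0 <= x <= y -> Cmod (q (k + N)%nat x) <= M) ->
  forall x, 0 <= x <= y ->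
  Cmod (q k x - Csum (fun n => (c * RtoC x) ^ n / RtoC (INR (fact n)) * q (k + n)%nat 0) N)%C <= M * (2 * Cmod c * x) ^ N.
Proof.
induction N as [|N IH]; intros k D HM x Hx.
- rewrite Nat.add_0_r in HM; simpl; replace (q k x - 0)%C with (q k x) by ring; rewrite Rmult_1_r; apply HM, Hx.
- set (F := fun x => (q k x - Csum (fun n => (c * RtoC x) ^ n / RtoC (INR (fact n)) * q (k + n)%nat 0) (S N))%C).
  assert (F0 : F 0 = RtoC 0).
  { unfold F; rewrite Csum_S_l, Csum_0.
    - rewrite Nat.add_0_r; simpl; field; apply C1_neq0.
    - intros n _; simpl; field; apply (fact_C_neq0 (S n)). }
  assert (M0 : 0 <= M) by (eapply Rle_trans; [apply Cmod_ge_0|apply (HM x Hx)]).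
  fold (F x); replace (F x) with (F x - F 0)%C by (rewrite F0; ring).
  assert (Hc := Cmod_ge_0 c).
  replace (M * (2 * Cmod c * x) ^ S N) with (2 * (Cmod c * (M * (2 * Cmod c * x) ^ N)) * (x - 0)) by (simpl; ring).
  apply (CMVT F (fun x => c * (q (S k) x - Csum (fun n => (c * RtoC x) ^ n / RtoC (INR (fact n)) * q (S k + n)%nat 0) N))%C); [lra| |].
  + intros z Hz; unfold F; eapply CD_eq.
    * apply CD_minus; [apply D; lra|apply (CD_expsum c (fun n => q (k + n)%nat 0))].
    * rewrite (Csum_ext (fun n => (c * z) ^ n / INR (fact n) * q (S k + n)%nat 0)%C
        (fun n => (c * z) ^ n / INR (fact n) * q (k + S n)%nat 0)%C); [ring|].
      intros n _; do 2 f_equal; lia.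
  + intros z Hz; rewrite Cmod_mult; apply Rmult_le_compat_l; [exact Hc|].
    eapply Rle_trans; [apply IH; [exact D| |lra]|].
    * intros s Hs; replace (S k + N)%nat with (k + S N)%nat by lia; apply HM, Hs.
    * apply Rmult_le_compat_l; [exact M0|]; apply pow_incr; split; [apply Rmult_le_pos; nra|nra].
Qed.

(** These are the successive derivatives of cosh, of period 2 in k. *)
Definition chk (k : nat) (y : R) : R := if Nat.even k then cosh y else sinh y.

Lemma chk_SS k : chk (S (S k)) = chk k.
Proof. easy. Qed.

Lemma is_derive_sinh x : is_derive sinh x (cosh x).
Proof. apply is_derive_Reals, derivable_pt_lim_sinh. Qed.

Lemma is_derive_chk k y : is_derive (chk k) y (chk (S k) y).
Proof.
unfold chk; rewrite Nat.even_succ, <- Nat.negb_even; destruct (Nat.even k); simpl;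
  [apply is_derive_cosh|apply is_derive_sinh].
Qed.

Lemma exp_abs_le (x y : R) : x <= y -> exp x <= exp y.
Proof. intros [H|H]; [left; apply exp_increasing, H|rewrite H; lra]. Qed.

Lemma chk_bound k y : Rabs (chk k y) <= exp (Rabs y).
Proof.
assert (A := exp_abs_le _ _ (Rle_abs y)); assert (B := exp_abs_le _ _ (Rle_abs (- y))); rewrite Rabs_Ropp in B.
pose proof (exp_pos y); pose proof (exp_pos (- y)).
unfold chk, cosh, sinh; destruct (Nat.even k); apply Rabs_le; lra.
Qed.

Lemma isI_0 : isI (fun _ => RtoC 0) (RtoC 0).
Proof.
intros e He; exists 0; intros X _; exists (RtoC 0); split.
- assert (Z := isCI_scal (RtoC 0) _ _ _ _ (CI_correct (fun _ => RtoC 0) 0 X (Ccont_const _))).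
  rewrite Cmult_0_l in Z; eapply isCI_ext; [|exact Z]; intros; cbv beta; ring.
- replace (0 - 0)%C with (RtoC 0) by ring; rewrite Cmod_0; exact He.
Qed.

Section Kappa.
Variables (w : C) (tau kap0 b : R) (g : nat -> R -> R).
Hypothesis Hw : unit_half w.
Hypothesis Ht : 0 < tau.
Hypothesis Hb : 0 < b.
Hypothesis g_der : forall k x, is_derive (g k) x (g (S k) x).
Hypothesis g_odd : forall k, g (2 * k + 1) 0 = 0.
(** A joint bound on weight and function. For w = 1 the Gaussian absorbs any exponential, so kap may
    be arbitrary; for w = i the decay has to come from g, and restricts kap. The same lemmas serve
    both. *)
Hypothesis g_wdom : forall k, exists B, 0 <= B /\ forall x, 0 <= x ->
  Cmod (wt w tau x) * (exp (kap0 * x) * Rabs (g k x)) <= B * exp (- b * x).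

Let F i k j kap x := (wt w tau x * RtoC (x ^ j * (chk i (kap * x) * g k x)))%C.

Let Fdom k : exists B, 0 <= B /\ forall i j kap, (j <= 2)%nat -> - kap0 <= kap <= kap0 -> dominated (F i k j kap) B (b / 2).
Proof.
destruct (g_wdom k) as [B [B0 HB]].
destruct (pow_exp_bound 0 b Hb) as [K0 [P0 Q0]], (pow_exp_bound 1 b Hb) as [K1 [P1 Q1]], (pow_exp_bound 2 b Hb) as [K2 [P2 Q2]].
exists (B * (K0 + K1 + K2)); split; [apply Rmult_le_pos; lra|].
intros i j kap Hj Hk x Hx; unfold F.
rewrite Cmod_mult, Cmod_R, !Rabs_mult, (Rabs_pos_eq (x ^ j)) by (apply pow_le, Hx).
assert (C1 : Rabs (chk i (kap * x)) <= exp (kap0 * x)).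
{ eapply Rle_trans; [apply chk_bound|]; apply exp_abs_le; rewrite Rabs_mult, (Rabs_pos_eq x) by exact Hx.
  apply Rmult_le_compat_r; [exact Hx|apply Rabs_le, Hk]. }
assert (Z : x ^ j * exp (- b * x) <= (K0 + K1 + K2) * exp (- (b / 2) * x)).
{ pose proof (exp_pos (- (b / 2) * x)).
  destruct j as [|[|[|j]]]; [| | |lia]; [specialize (Q0 x Hx)|specialize (Q1 x Hx)|specialize (Q2 x Hx)]; nra. }
apply Rle_trans with (x ^ j * (Cmod (wt w tau x) * (exp (kap0 * x) * Rabs (g k x)))).
- replace (Cmod (wt w tau x) * (x ^ j * (Rabs (chk i (kap * x)) * Rabs (g k x)))) with
    (x ^ j * (Cmod (wt w tau x) * (Rabs (chk i (kap * x)) * Rabs (g k x)))) by ring.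
  apply Rmult_le_compat_l; [apply pow_le, Hx|]; apply Rmult_le_compat_l; [apply Cmod_ge_0|].
  apply Rmult_le_compat_r; [apply Rabs_pos|exact C1].
- apply Rle_trans with (x ^ j * (B * exp (- b * x))); [apply Rmult_le_compat_l; [apply pow_le, Hx|apply HB, Hx]|].
  replace (x ^ j * (B * exp (- b * x))) with (B * (x ^ j * exp (- b * x))) by ring.
  rewrite Rmult_assoc; apply Rmult_le_compat_l; assumption.
Qed.

Let CD_F i k kap x : CD (F i k 0 kap) x
  ((- (2 * w / RtoC tau)) * F i k 1 kap x + (RtoC kap * F (S i) k 0 kap x + F i (S k) 0 kap x))%C.
Proof.
apply (CD_ext (fun x => wt w tau x * RtoC (chk i (kap * x) * g k x))%C); [intros y; unfold F; simpl; rewrite Rmult_1_l; easy|].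
eapply CD_eq.
- apply CD_mult; [apply CD_wt, Ht|].
  apply (CD_RtoC (fun x => chk i (kap * x) * g k x) x (kap * chk (S i) (kap * x) * g k x + chk i (kap * x) * g (S k) x)).
  apply (is_derive_mult_R (fun x => chk i (kap * x)) (g k) x (kap * chk (S i) (kap * x))); [|apply g_der].
  apply (is_derive_comp (chk i) (fun x => kap * x) x _ kap (is_derive_chk i (kap * x))).
  auto_derive; [easy|ring].
- unfold F; assert (t0 : RtoC tau <> RtoC 0) by (apply RtoC_neq0; lra).
  simpl pow; rewrite !Rmult_1_l, Rmult_1_r; unfold Rdiv; rewrite RtoC_plus, !RtoC_mult, RtoC_inv by lra; cfield.
Qed.

Let Fc i k j kap : Ccont (F i k j kap).
Proof.
apply Ccont_mult; [apply wt_cont, Ht|].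
apply (CD_Ccont _ (fun x => RtoC (INR j * x ^ pred j * (chk i (kap * x) * g k x) +
   x ^ j * (kap * chk (S i) (kap * x) * g k x + chk i (kap * x) * g (S k) x)))).
intros x; apply CD_RtoC.
apply (is_derive_mult_R (fun x => x ^ j) (fun x => chk i (kap * x) * g k x) x (INR j * x ^ pred j)); [auto_derive; [easy|ring]|].
apply (is_derive_mult_R (fun x => chk i (kap * x)) (g k) x (kap * chk (S i) (kap * x))); [|apply g_der].
apply (is_derive_comp (chk i) (fun x => kap * x) x _ kap (is_derive_chk i (kap * x))).
auto_derive; [easy|ring].
Qed.

(* The exponential factor turns the derivative in kap into the shift k -> k + 1, up to a constant. *)
Definition Qk (w : C) (tau : R) (g : nat -> R -> R) (k : nat) (kap : R) : C :=
  (Cexp (- (RtoC (kap ^ 2 * tau / 4) / w)) * II (fun x => wt w tau x * RtoC (chk k (kap * x) * g k x)))%C.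

Let Jf i k j kap := II (F i k j kap).

Let J0 k kap : II (fun x => wt w tau x * RtoC (chk k (kap * x) * g k x))%C = Jf k k 0 kap.
Proof. unfold Jf, F; f_equal; apply functional_extensionality; intros x; simpl; rewrite Rmult_1_l; easy. Qed.

Let parts k kap : - kap0 <= kap <= kap0 ->
  (2 * w / RtoC tau * Jf (S k) k 1 kap = RtoC kap * Jf k k 0 kap + Jf (S k) (S k) 0 kap)%C.
Proof.
intros Hk; destruct (Fdom k) as [B1 [P1 D1]], (Fdom (S k)) as [B2 [P2 D2]].
assert (b2 : 0 < b / 2) by lra.
assert (is0 : forall i j, (j <= 2)%nat -> isI (F i k j kap) (Jf i k j kap)).
{ intros i j Hj; apply (II_correct _ B1 (b / 2)); [exact b2|apply Fc|apply D1; assumption]. }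
assert (is1 : isI (F (S k) (S k) 0 kap) (Jf (S k) (S k) 0 kap)).
{ apply (II_correct _ B2 (b / 2)); [exact b2|apply Fc|apply D2; [lia|assumption]]. }
assert (I1 := isI_FTC (F (S k) k 0 kap) _ B1 (b / 2) b2 (CD_F (S k) k kap)).
assert (Cc : Ccont (fun x => (- (2 * w / RtoC tau)) * F (S k) k 1 kap x + (RtoC kap * F (S (S k)) k 0 kap x + F (S k) (S k) 0 kap x))%C).
{ apply Ccont_plus; [apply Ccont_scal, Fc|apply Ccont_plus; [apply Ccont_scal, Fc|apply Fc]]. }
specialize (I1 Cc ltac:(apply D1; [lia|assumption])).
assert (I2 := isI_plus _ _ _ _ (isI_scal (- (2 * w / RtoC tau))%C _ _ (is0 (S k) 1%nat ltac:(lia)))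
  (isI_plus _ _ _ _ (isI_scal (RtoC kap) _ _ (is0 (S (S k)) 0%nat ltac:(lia))) is1)).
assert (E := isI_unique _ _ _ I2 I1).
assert (Z : F (S k) k 0 kap 0 = RtoC 0).
{ unfold F; simpl; rewrite Rmult_0_r.
  replace (chk (S k) 0 * g k 0) with 0; [rewrite Rmult_0_r; apply Cmult_0_r|].
  destruct (Nat.Even_or_Odd k) as [[m ->]|[m ->]].
  - replace (chk (S (2 * m)) 0) with (sinh 0); [rewrite sinh_0; ring|].
    unfold chk; rewrite Nat.even_succ, <- Nat.negb_even, Nat.even_even; easy.
  - rewrite g_odd; ring. }
rewrite Z in E.
replace (Jf (S (S k)) k 0 kap) with (Jf k k 0 kap) in E by (unfold Jf, F; rewrite chk_SS; easy).
replace (2 * w / RtoC tau * Jf (S k) k 1 kap)%C with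
 (RtoC kap * Jf k k 0 kap + Jf (S k) (S k) 0 kap -
   (- (2 * w / RtoC tau) * Jf (S k) k 1 kap + (RtoC kap * Jf k k 0 kap + Jf (S k) (S k) 0 kap)))%C by ring.
rewrite E; ring.
Qed.

(** The derivative in kap brings down x, which integration by parts replaces by tau / (2 w) times
    kap plus a derivative of g. The exponential prefactor cancels the part with kap. *)
Lemma CD_Qk k kap : - kap0 < kap < kap0 ->
  CD (Qk w tau g k) kap (RtoC tau / (2 * w) * Qk w tau g (S k) kap)%C.
Proof.
intros Hk; assert (w0 := unit_neq0 w Hw); assert (t0 : RtoC tau <> RtoC 0) by (apply RtoC_neq0; lra).
destruct (Fdom k) as [B [P D]].
assert (DJ : CD (fun kap => Jf k k 0 kap) kap (Jf (S k) k 1 kap)).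
{ apply (CD_II_deriv (F k k 0) (F (S k) k 1) (F k k 2) (- kap0) kap0 B (b / 2)); [lra|lra| |].
  - intros t Htt; exact (conj (Fc _ _ _ _) (conj (Fc _ _ _ _) (conj (D k 0%nat t ltac:(lia) Htt)
      (conj (D (S k) 1%nat t ltac:(lia) Htt) (D k 2%nat t ltac:(lia) Htt))))).
  - assert (G : forall i j t x, CD (fun t => F i k j t x) t (F (S i) k (S j) t x)).
    { intros i j t x; unfold F; apply CD_scal.
      apply (CD_RtoC (fun t => x ^ j * (chk i (t * x) * g k x)) t (x ^ S j * (chk (S i) (t * x) * g k x))).
      apply (is_derive_ext (fun t => x ^ j * g k x * chk i (t * x))); [intros; rring|].
      replace (x ^ S j * (chk (S i) (t * x) * g k x)) with (x ^ j * g k x * (x * chk (S i) (t * x))) by (simpl; ring).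
      apply (is_derive_scal (fun t => chk i (t * x))).
      apply (is_derive_comp (chk i) (fun t => t * x) t _ x (is_derive_chk i (t * x))).
      auto_derive; [easy|ring]. }
    intros t x _; split; [apply G|].
    eapply CD_eq; [apply G|]; unfold F; rewrite chk_SS; easy. }
apply (CD_ext (fun kap => Cexp (- (RtoC (kap ^ 2 * tau / 4) / w)) * Jf k k 0 kap)%C).
{ intros t; unfold Qk; rewrite J0; easy. }
unfold Qk; rewrite J0; eapply CD_eq.
- apply CD_mult; [apply CD_Cexp, CD_opp|exact DJ].
  apply (CD_mult (fun kap => RtoC (kap ^ 2 * tau / 4)) (fun _ => / w)%C).
  + apply (CD_RtoC (fun kap => kap ^ 2 * tau / 4) kap (kap * tau / 2)); auto_derive; [easy|field].
  + apply CD_const.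
- cbv beta.
  replace (Jf (S k) k 1 kap) with (RtoC tau / (2 * w) * (2 * w / RtoC tau * Jf (S k) k 1 kap))%C by cfield.
  rewrite parts by lra; unfold Rdiv; rewrite !RtoC_mult, RtoC_inv by lra; cfield.
Qed.

End Kappa.

Lemma Re_inv_unit w (x : R) : unit_half w -> 0 <= x -> Cmod (Cexp (- (RtoC x / w)))%C <= 1.
Proof.
intros Hw Hx; rewrite Cmod_Cexp, <- exp_0; apply exp_abs_le.
destruct Hw as [H1 H2]; assert (E : Re w ^ 2 + Im w ^ 2 = 1).
{ assert (A := sqrt_sqrt (Re w ^ 2 + Im w ^ 2) ltac:(nra)).
  change (sqrt (Re w ^ 2 + Im w ^ 2) = 1) in H1; rewrite H1 in A; lra. }
destruct w as [u v]; simpl in *; replace (u * (u * 1) + v * (v * 1)) with 1 by lra; nra.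
Qed.

Section Asymptotics.
Variables (w K : C) (g : nat -> R -> R).
Hypothesis Hw : unit_half w.
Hypothesis HK : forall X, 0 < X -> Cmod (Phi w X - K)%C <= / X.
Hypothesis g_der : forall k x, is_derive (g k) x (g (S k) x).
Hypothesis g_dom : forall k, exists B, dominated (fun x => RtoC (g k x)) B 1.
Hypothesis g_odd : forall k, g (2 * k + 1) 0 = 0.

Definition asy_sum (w : C) (g : nat -> R -> R) (kap tau : R) (N : nat) : C :=
  Csum (fun b => (RtoC (kap * tau) / (2 * w)) ^ (2 * b) / RtoC (INR (fact (2 * b))) *
    Csum (fun a => (RtoC tau / (4 * w)) ^ a / RtoC (INR (fact a)) * RtoC (g (2 * (b + a))%nat 0)) N)%C N.

(** Taylor expansion in kap at 0 up to order 2 N. The odd orders vanish with sinh 0, the even ones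
    are averages of g (2 b) and are expanded in tau by [gavg_expansion]. Each order in kap carries a
    factor tau, so the remainder is O(tau^(2 N)). *)
Lemma cosh_weight_expansion (kap : R) (N : nat) : 0 <= kap < 1 ->
  exists M, forall tau, 0 < tau -> tau <= 1 ->
  Cmod (/ RtoC (sqrt tau) * Qk w tau g 0 kap - K * asy_sum w g kap tau N)%C <= M * tau ^ N.
Proof.
intros Hk; assert (w0 := unit_neq0 w Hw).
(* Above kap, so that derivatives at kap are taken inside an open interval, and below 1, so that the
   product with g keeps the decay rate 1 - k1. *)
set (k1 := (1 + kap) / 2).
assert (Cw : forall tau, 0 < tau -> Cmod (RtoC tau / (2 * w))%C = tau / 2).
{ intros tau Ht; rewrite Cmod_div by (apply Cmult_neq_0; [apply two_neq0|exact w0]).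
  rewrite Cmod_mult, (proj1 Hw), !Cmod_R, !Rabs_pos_eq by lra; field. }
destruct (g_dom (2 * N)) as [B1 H1], (g_dom (S (2 * N))) as [B2 H2].
assert (P1 := dominated_pos _ _ _ H1); assert (P2 := dominated_pos _ _ _ H2).
set (M1 := 2 * (2 * B1 + B2) / (1 - kap)).
assert (Bd : forall tau, 0 < tau -> forall x, 0 <= x <= kap -> Cmod (/ RtoC (sqrt tau) * Qk w tau g (2 * N) x)%C <= M1).
{ intros tau Ht x Hx; unfold Qk.
  set (h := fun y => RtoC (chk (2 * N) (x * y) * g (2 * N)%nat y)).
  set (h1 := fun y => RtoC (x * chk (S (2 * N)) (x * y) * g (2 * N)%nat y + chk (2 * N) (x * y) * g (S (2 * N)) y)).
  replace (/ RtoC (sqrt tau) * (Cexp (- (RtoC (x ^ 2 * tau / 4) / w)) * II (fun y => wt w tau y * RtoC (chk (2 * N) (x * y) * g (2 * N)%nat y))))%C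
   with (Cexp (- (RtoC (x ^ 2 * tau / 4) / w)) * (/ RtoC (sqrt tau) * II (fun y => wt w tau y * h y)))%C by (unfold h; ring).
  rewrite Cmod_mult.
  assert (A1 := Re_inv_unit w (x ^ 2 * tau / 4) Hw ltac:(pose proof (pow2_ge_0 x); nra)).
  assert (cb : forall i y, 0 <= y -> Rabs (chk i (x * y)) <= exp (kap * y)).
  { intros i y Hy; eapply Rle_trans; [apply chk_bound|]; apply exp_abs_le; rewrite Rabs_pos_eq by nra; nra. }
  assert (gb : forall k B, dominated (fun x => RtoC (g k x)) B 1 -> forall y i, 0 <= y -> Rabs (chk i (x * y) * g k y) <= B * exp (- (1 - kap) * y)).
  { intros k B HB y i Hy; specialize (HB y Hy); cbv beta in HB; rewrite Cmod_R in HB; rewrite Rabs_mult.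
    apply Rle_trans with (exp (kap * y) * (B * exp (- (1) * y))).
    - apply Rmult_le_compat; try apply Rabs_pos; [apply cb, Hy|exact HB].
    - right; replace (- (1 - kap) * y) with (kap * y + - (1) * y) by ring; rewrite exp_plus; ring. }
  assert (Dg : forall i k y, is_derive (fun y => chk i (x * y) * g k y) y (x * chk (S i) (x * y) * g k y + chk i (x * y) * g (S k) y)).
  { intros i k y; apply (is_derive_mult_R (fun y => chk i (x * y)) (g k) y (x * chk (S i) (x * y))); [|apply g_der].
    apply (is_derive_comp (chk i) (fun y => x * y) y _ x (is_derive_chk i (x * y))); auto_derive; [easy|ring]. }
  assert (A2 := wt_bound w Hw h h1 (2 * B1 + B2) (1 - kap) tau ltac:(lra) Ht).
  assert (D1 : dominated h (2 * B1 + B2) (1 - kap)).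
  { apply (dominated_weaken _ B1); [lra|]; intros y Hy; unfold h; rewrite Cmod_R; apply gb; assumption. }
  assert (D2 : dominated h1 (2 * B1 + B2) (1 - kap)).
  { intros y Hy; unfold h1; rewrite Cmod_R; eapply Rle_trans; [apply Rabs_triang|].
    assert (G1 := gb _ _ H1 y (S (2 * N)) Hy); assert (G2 := gb _ _ H2 y (2 * N)%nat Hy).
    rewrite Rmult_assoc, (Rabs_mult x), (Rabs_pos_eq x) by lra.
    pose proof (Rabs_pos (chk (S (2 * N)) (x * y) * g (2 * N)%nat y)).
    assert (0 <= B1 * exp (- (1 - kap) * y)) by (pose proof (exp_pos (- (1 - kap) * y)); nra).
    rewrite Rmult_plus_distr_r; apply Rplus_le_compat; [|exact G2]; nra. }
  assert (hc1 : Ccont h1).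
  { unfold h1. apply Ccont_RtoC; intros y; apply (@ex_derive_continuous R_AbsRing R_NormedModule).
    eexists. apply (is_derive_plus (fun y => x * chk (S (2 * N)) (x * y) * g (2 * N)%nat y) (fun y => chk (2 * N) (x * y) * g (S (2 * N)) y)).
    - apply (is_derive_ext (fun y => x * (chk (S (2 * N)) (x * y) * g (2 * N)%nat y))); [intros; rring|].
      apply (is_derive_scal (fun y => chk (S (2 * N)) (x * y) * g (2 * N)%nat y)), Dg.
    - apply Dg. }
  specialize (A2 ltac:(intros y; apply CD_RtoC, Dg) hc1 D1 D2).
  pose proof (Cmod_ge_0 (/ RtoC (sqrt tau) * II (fun y => wt w tau y * h y))%C).
  pose proof (Cmod_ge_0 (Cexp (- (RtoC (x ^ 2 * tau / 4) / w)))%C).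
  unfold M1; nra. }
assert (Ev : forall j, exists M, forall tau, 0 < tau -> tau <= 1 ->
   Cmod (gavg w (g (2 * j)%nat) tau - gavg_exp w K g j N tau)%C <= M * tau ^ N).
{ intros j; apply gavg_expansion; assumption. }
assert (Sb : forall n, exists M, 0 <= M /\ forall tau, 0 < tau -> tau <= 1 ->
  Cmod (Csum (fun b => (RtoC (kap * tau) / (2 * w)) ^ (2 * b) / RtoC (INR (fact (2 * b))) * gavg w (g (2 * b)%nat) tau) n
   - Csum (fun b => (RtoC (kap * tau) / (2 * w)) ^ (2 * b) / RtoC (INR (fact (2 * b))) * gavg_exp w K g b N tau) n)%C <= M * tau ^ N).
{ induction n as [|n [M [M0 IH]]].
  - exists 0; split; [lra|]; intros; simpl; replace (0 - 0)%C with (RtoC 0) by ring; rewrite Cmod_0; lra.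
  - destruct (Ev n) as [M' HM'].
    assert (M'0 : 0 <= M').
    { specialize (HM' 1 ltac:(lra) ltac:(lra)); rewrite pow1, Rmult_1_r in HM'; eapply Rle_trans; [apply Cmod_ge_0|exact HM']. }
    exists (M + M'); split; [lra|]; intros tau Ht Ht1; specialize (IH tau Ht Ht1); specialize (HM' tau Ht Ht1); rewrite !Csum_S.
    match goal with |- Cmod (?a + ?c * ?x - (?b + ?c * ?y))%C <= _ =>
      replace (a + c * x - (b + c * y))%C with ((a - b) + c * (x - y))%C by ring end.
    eapply Rle_trans; [apply Cmod_triangle|]; rewrite Rmult_plus_distr_r; apply Rplus_le_compat; [exact IH|].
    rewrite Cmod_mult.
    assert (Q : Cmod ((RtoC (kap * tau) / (2 * w)) ^ (2 * n) / RtoC (INR (fact (2 * n))))%C <= 1).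
    { rewrite Cmod_div by apply fact_C_neq0.
      replace (RtoC (kap * tau) / (2 * w))%C with (RtoC kap * (RtoC tau / (2 * w)))%C by (rewrite RtoC_mult; unfold Cdiv; ring).
      rewrite Cmod_pow, Cmod_mult, (Cw tau Ht), !Cmod_R, (Rabs_pos_eq kap), (Rabs_pos_eq (INR _)) by (try apply pos_INR; lra).
      assert (1 <= INR (fact (2 * n))) by (apply (le_INR 1), lt_O_fact).
      assert (0 <= (kap * (tau / 2)) ^ (2 * n) <= 1).
      { split; [apply pow_le; nra|]; rewrite <- (pow1 (2 * n)); apply pow_incr; split; nra. }
      apply Rmult_le_reg_r with (INR (fact (2 * n))); [lra|]; unfold Rdiv; rewrite Rmult_assoc, Rinv_l by lra; lra. }
    pose proof (Cmod_ge_0 (gavg w (g (2 * n)%nat) tau - gavg_exp w K g n N tau)%C).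
    pose proof (Cmod_ge_0 ((RtoC (kap * tau) / (2 * w)) ^ (2 * n) / RtoC (INR (fact (2 * n))))%C). nra. }
destruct (Sb N) as [M [M0 HM]].
exists (M1 + M); intros tau Ht Ht1.
set (q := fun k x => (/ RtoC (sqrt tau) * Qk w tau g k x)%C).
assert (wd : forall k, exists B, 0 <= B /\ forall x, 0 <= x ->
  Cmod (wt w tau x) * (exp (k1 * x) * Rabs (g k x)) <= B * exp (- (1 - k1) * x)).
{ intros k; destruct (g_dom k) as [B HB]; assert (B0 := dominated_pos _ _ _ HB); exists B; split; [exact B0|]; intros x Hx.
  specialize (HB x Hx); cbv beta in HB; rewrite Cmod_R in HB.
  assert (W := wt_le1 w Hw tau x Ht); pose proof (Cmod_ge_0 (wt w tau x)).
  replace (- (1 - k1) * x) with (k1 * x + - (1) * x) by ring; rewrite exp_plus.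
  pose proof (exp_pos (k1 * x)); pose proof (Rabs_pos (g k x)).
  assert (exp (k1 * x) * Rabs (g k x) <= exp (k1 * x) * (B * exp (- (1) * x))) by (apply Rmult_le_compat_l; lra).
  assert (0 <= exp (k1 * x) * Rabs (g k x)) by (apply Rmult_le_pos; lra). nra. }
assert (Dq : forall k x, 0 <= x <= kap -> CD (q k) x (RtoC tau / (2 * w) * q (S k) x)%C).
{ intros k x Hx; unfold q; eapply CD_eq; [apply CD_scal, (CD_Qk w tau k1 (1 - k1) g); try assumption; unfold k1; lra|ring]. }
assert (T := CTaylor_seq q (RtoC tau / (2 * w))%C kap M1 (2 * N) 0 Dq (Bd tau Ht) kap ltac:(lra)).
rewrite (Cw tau Ht) in T.
assert (SS : forall n, Csum (fun n => (RtoC tau / (2 * w) * RtoC kap) ^ n / RtoC (INR (fact n)) * q (0 + n)%nat 0)%C (2 * n)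
   = Csum (fun b => (RtoC (kap * tau) / (2 * w)) ^ (2 * b) / RtoC (INR (fact (2 * b))) * gavg w (g (2 * b)%nat) tau)%C n).
{ induction n as [|n IHn]; [easy|].
  replace (2 * S n)%nat with (S (S (2 * n))) by lia; rewrite !Csum_S, IHn.
  replace (q (0 + S (2 * n))%nat 0) with (RtoC 0).
  2: { change (0 + S (2 * n))%nat with (S (2 * n)); unfold q, Qk.
    replace (II _) with (RtoC 0); [ring|]; symmetry; apply isI_II.
    apply (isI_ext (fun _ => RtoC 0)); [|exact isI_0]; intros x _; cbv beta.
    replace (chk (S (2 * n)) (0 * x)) with 0; [rewrite (Rmult_0_l (g _ x)), Cmult_0_r; easy|].
    unfold chk; rewrite Nat.even_succ, <- Nat.negb_even, Nat.even_even; simpl; rewrite Rmult_0_l, sinh_0; easy. }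
  replace (q (0 + 2 * n)%nat 0) with (gavg w (g (2 * n)%nat) tau).
  2: { change (0 + 2 * n)%nat with (2 * n)%nat; unfold q, Qk, gavg; f_equal.
    replace (0 ^ 2 * tau / 4) with 0 by field.
    replace (- (RtoC 0 / w))%C with (RtoC 0) by (field; exact w0). rewrite Cexp_0, Cmult_1_l. f_equal.
    apply functional_extensionality; intros x; f_equal; f_equal.
    unfold chk; rewrite Nat.even_even, Rmult_0_l, cosh_0; ring. }
  replace (RtoC tau / (2 * w) * RtoC kap)%C with (RtoC (kap * tau) / (2 * w))%C by (rewrite RtoC_mult; unfold Cdiv; ring).
  ring. }
rewrite SS in T.
specialize (HM tau Ht Ht1).
replace (Csum (fun b => (RtoC (kap * tau) / (2 * w)) ^ (2 * b) / RtoC (INR (fact (2 * b))) * gavg_exp w K g b N tau)%C N)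
  with (K * asy_sum w g kap tau N)%C in HM.
2: { unfold asy_sum, gavg_exp; rewrite <- Csum_scal; apply Csum_ext; intros b _; ring. }
fold (q 0%nat kap).
match type of HM with Cmod (?a - ?c)%C <= _ => set (A := a) in *; set (C0 := c) in * end.
replace (q 0%nat kap - C0)%C with ((q 0%nat kap - A) + (A - C0))%C by ring.
eapply Rle_trans; [apply Cmod_triangle|]; rewrite Rmult_plus_distr_r; apply Rplus_le_compat; [|exact HM].
eapply Rle_trans; [exact T|].
assert (M10 : 0 <= M1).
{ eapply Rle_trans; [apply Cmod_ge_0|apply (Bd tau Ht 0 ltac:(lra))]. }
apply Rmult_le_compat_l; [exact M10|].
replace (2 * (tau / 2) * kap) with (tau * kap) by field.
rewrite pow_mult; apply pow_incr; split; [apply pow2_ge_0|].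
assert (0 <= tau * kap <= tau) by nra; simpl; nra.
Qed.

End Asymptotics.

(** * Derivatives of the hyperbolic secant *)

(* Polynomials in tanh; their products with 1 / cosh are stable under differentiation. *)
Inductive tpoly : Type :=
  | TC (c : R) | TT | TAdd (p q : tpoly) | TMul (p q : tpoly).

Fixpoint teval (p : tpoly) (x : R) : R :=
  match p with
  | TC c => c
  | TT => sinh x / cosh x
  | TAdd p q => teval p x + teval q x
  | TMul p q => teval p x * teval q x
  end.

Fixpoint tder (p : tpoly) : tpoly :=
  match p with
  | TC _ => TC 0
  | TT => TAdd (TC 1) (TMul (TC (-1)) (TMul TT TT))
  | TAdd p q => TAdd (tder p) (tder q)
  | TMul p q => TAdd (TMul (tder p) q) (TMul p (tder q))
  end.

Lemma teval_derive p x : is_derive (teval p) x (teval (tder p) x).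
Proof.
assert (C0 := cosh_pos x).
induction p as [c| |p IHp q IHq|p IHp q IHq]; simpl.
- apply @is_derive_const.
- eapply is_derive_eq.
  + apply (is_derive_div sinh cosh x _ _ (is_derive_sinh x) (is_derive_cosh x)); lra.
  + match goal with |- ?a = ?b => change (a = b :> R) end; field; lra.
- exact (is_derive_plus _ _ x _ _ IHp IHq).
- exact (is_derive_mult_R _ _ x _ _ IHp IHq).
Qed.

Lemma teval_bounded p : exists B, forall x, Rabs (teval p x) <= B.
Proof.
induction p as [c| |p [B1 H1] q [B2 H2]|p [B1 H1] q [B2 H2]]; simpl.
- exists (Rabs c); intros; lra.
- exists 1; intros x; assert (C0 := cosh_pos x).
  unfold Rdiv; rewrite Rabs_mult, Rabs_inv, (Rabs_pos_eq (cosh x)) by lra.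
  apply Rmult_le_reg_r with (cosh x); [lra|]; rewrite Rmult_assoc, Rinv_l by lra.
  pose proof (exp_pos x); pose proof (exp_pos (- x)); unfold cosh, sinh; rewrite Rmult_1_r, Rmult_1_l.
  apply Rabs_le; lra.
- exists (B1 + B2); intros x; eapply Rle_trans; [apply Rabs_triang|]; specialize (H1 x); specialize (H2 x); lra.
- exists (B1 * B2); intros x; rewrite Rabs_mult; apply Rmult_le_compat; try apply Rabs_pos; auto.
Qed.

Definition sech (x : R) : R := / cosh x.

Fixpoint sech_poly (k : nat) : tpoly :=
  match k with
  | O => TC 1
  | S k => TAdd (TMul (TMul (TC (-1)) TT) (sech_poly k)) (tder (sech_poly k))
  end.

Lemma sech_derive x : is_derive sech x (- (sinh x / cosh x) * sech x).
Proof.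
assert (C0 := cosh_pos x); unfold sech; eapply is_derive_eq.
- apply (is_derive_inv cosh x _ (is_derive_cosh x)); lra.
- match goal with |- ?a = ?b => change (a = b :> R) end; field; lra.
Qed.

Lemma sech_poly_derive k x :
  is_derive (fun x => sech x * teval (sech_poly k) x) x (sech x * teval (sech_poly (S k)) x).
Proof.
eapply is_derive_eq; [apply (is_derive_mult_R _ _ x _ _ (sech_derive x) (teval_derive _ x))|].
simpl; rring.
Qed.

Lemma sech_Derive_n k x : Derive_n sech k x = sech x * teval (sech_poly k) x.
Proof.
revert x; induction k as [|k IH]; intros x; simpl; [ring|].
rewrite (Derive_ext _ _ x IH); apply is_derive_unique, sech_poly_derive.
Qed.

Definition sechd (k : nat) (x : R) : R := Derive_n sech k x.

Lemma sechd_der k x : is_derive (sechd k) x (sechd (S k) x).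
Proof.
unfold sechd; rewrite sech_Derive_n.
apply (is_derive_ext (fun x => sech x * teval (sech_poly k) x)); [intros; symmetry; apply sech_Derive_n|].
apply sech_poly_derive.
Qed.

Lemma sechd_dom k : exists B, dominated (fun x => RtoC (sechd k x)) B 1.
Proof.
destruct (teval_bounded (sech_poly k)) as [B HB]; exists (2 * B); intros x Hx.
assert (B0 : 0 <= B) by (eapply Rle_trans; [apply Rabs_pos|apply (HB 0)]).
assert (C0 := cosh_pos x).
rewrite Cmod_R; unfold sechd; rewrite sech_Derive_n, Rabs_mult.
assert (S : Rabs (sech x) <= 2 * exp (- (1) * x)).
{ unfold sech; rewrite Rabs_inv, Rabs_pos_eq by lra.
  replace (2 * exp (- (1) * x)) with (/ (exp x / 2)).
  2: { replace (- (1) * x) with (- x) by ring; rewrite exp_Ropp; field; apply Rgt_not_eq, exp_pos. }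
  apply Rinv_le_contravar; [pose proof (exp_pos x); lra|]; unfold cosh; pose proof (exp_pos (- x)); lra. }
replace (2 * B * exp (- (1) * x)) with (2 * exp (- (1) * x) * B) by ring.
apply Rmult_le_compat; try apply Rabs_pos; [exact S|apply HB].
Qed.

Lemma sechd_odd k : sechd (2 * k + 1) 0 = 0.
Proof.
assert (E := Derive_n_comp_opp sech (2 * k + 1) 0).
assert (H : locally (- 0) (fun y => forall j, (j <= 2 * k + 1)%nat -> ex_derive_n sech j y)).
{ apply filter_forall; intros y [|j] _; [easy|]; simpl.
  eexists; apply (sechd_der j y). }
specialize (E H).
rewrite (Derive_n_ext (fun y => sech (- y)) sech), Ropp_0 in E.
2: { intros t; unfold sech, cosh; rewrite Ropp_involutive; f_equal; f_equal; ring. }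
replace ((-1) ^ (2 * k + 1)) with (-1) in E.
2: { rewrite Nat.add_1_r, pow_1_odd; easy. }
unfold sechd; lra.
Qed.

(** * Rearranging truncated multiple power series *)

Definition smallO (N : nat) (f : R -> C) : Prop :=
  exists M, 0 <= M /\ forall t, 0 < t <= 1 -> Cmod (f t) <= M * t ^ N.

Lemma smallO_ext N f g : (forall t, 0 < t <= 1 -> f t = g t) -> smallO N f -> smallO N g.
Proof. intros E [M [M0 H]]; exists M; split; [exact M0|]; intros t Ht; rewrite <- E by exact Ht; apply H, Ht. Qed.

Lemma smallO_plus N f g : smallO N f -> smallO N g -> smallO N (fun t => f t + g t)%C.
Proof.
intros [M [M0 H]] [K [K0 G]]; exists (M + K); split; [lra|]; intros t Ht.
eapply Rle_trans; [apply Cmod_triangle|]; specialize (H t Ht); specialize (G t Ht); lra.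
Qed.

Lemma smallO_pow N k (c : C) : (N <= k)%nat -> smallO N (fun t => c * RtoC t ^ k)%C.
Proof.
intros Hk; exists (Cmod c); split; [apply Cmod_ge_0|]; intros t Ht.
rewrite Cmod_mult, Cmod_pow, Cmod_R, Rabs_pos_eq by lra; apply Rmult_le_compat_l; [apply Cmod_ge_0|].
replace k with (N + (k - N))%nat by lia; rewrite pow_add.
assert (0 <= t ^ N) by (apply pow_le; lra).
assert (t ^ (k - N) <= 1) by (rewrite <- (pow1 (k - N)); apply pow_incr; lra). nra.
Qed.

Lemma smallO_Csum N (f : nat -> R -> C) n : (forall i, (i < n)%nat -> smallO N (f i)) -> smallO N (fun t => Csum (fun i => f i t) n).
Proof.
intros H; induction n as [|n IH].
- exists 0; split; [lra|]; intros t _; simpl; rewrite Cmod_0; lra.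
- simpl; apply smallO_plus; [apply IH; intros; apply H; lia|apply H; lia].
Qed.

Lemma Csum_minus (a b : nat -> C) N : Csum (fun n => a n - b n)%C N = (Csum a N - Csum b N)%C.
Proof. induction N as [|N IH]; simpl; [ring|rewrite IH; ring]. Qed.

Lemma Csum_swap (f : nat -> nat -> C) (n m : nat) :
  Csum (fun i => Csum (fun j => f i j) m) n = Csum (fun j => Csum (fun i => f i j) n) m.
Proof.
induction n as [|n IH]; simpl; [symmetry; apply Csum_0; easy|].
rewrite IH, <- Csum_plus; easy.
Qed.

Lemma Csum_extend (f : nat -> C) (n N : nat) : (n <= N)%nat ->
  (forall i, (n <= i < N)%nat -> f i = RtoC 0) -> Csum f n = Csum f N.
Proof.
intros H Z; replace N with (n + (N - n))%nat by lia; rewrite Csum_add, (Csum_0 (fun i => f (n + i)%nat)); [ring|].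
intros i Hi; apply Z; lia.
Qed.

Lemma Csum_delta (f : nat -> C) (k N : nat) :
  Csum (fun n => if Nat.eqb k n then f n else RtoC 0) N = if Nat.ltb k N then f k else RtoC 0.
Proof.
induction N as [|N IH]; [easy|]; simpl Csum; rewrite IH.
destruct (Nat.eqb_spec k N) as [->|E].
- rewrite Nat.ltb_irrefl; replace (Nat.ltb N (S N)) with true by (symmetry; apply Nat.ltb_lt; lia); ring.
- destruct (Nat.ltb_spec k N); destruct (Nat.ltb_spec k (S N)); try lia; ring.
Qed.

(** The part of weight n of a triple series. Indices up to n suffice, since each index is at most
    the weight. *)
Definition graded3 (X : nat -> nat -> nat -> C) (n : nat) : C :=
  Csum (fun a => Csum (fun b => Csum (fun c => if Nat.eqb (a + 2 * b + c) n then X a b c else RtoC 0) (S n)) (S n)) (S n).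

(** The cube of indices below N contains every term of weight below N; all its other terms are
    O(t^N). *)
Lemma graded3_expansion (X : nat -> nat -> nat -> C) (N : nat) :
  smallO N (fun t => Csum (fun a => Csum (fun b => Csum (fun c => X a b c * RtoC t ^ (a + 2 * b + c)) N) N) N
     - Csum (fun n => graded3 X n * RtoC t ^ n) N)%C.
Proof.
apply (smallO_ext N (fun t => Csum (fun a => Csum (fun b => Csum (fun c =>
   (if Nat.ltb (a + 2 * b + c) N then RtoC 0 else X a b c) * RtoC t ^ (a + 2 * b + c)) N) N) N))%C.
- intros t _.
  assert (E : Csum (fun n => graded3 X n * RtoC t ^ n)%C N = Csum (fun a => Csum (fun b => Csum (fun c =>
     (if Nat.ltb (a + 2 * b + c) N then X a b c else RtoC 0) * RtoC t ^ (a + 2 * b + c)) N) N)%C N).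
  { transitivity (Csum (fun n => Csum (fun a => Csum (fun b => Csum (fun c =>
      if Nat.eqb (a + 2 * b + c) n then X a b c * RtoC t ^ n else RtoC 0) N) N) N) N)%C.
    - apply Csum_ext; intros n Hn; unfold graded3.
      assert (Z : forall a b c, (n < a + 2 * b + c)%nat -> (if Nat.eqb (a + 2 * b + c) n then X a b c else RtoC 0) = RtoC 0).
      { intros a b c Habc; destruct (Nat.eqb_spec (a + 2 * b + c) n); [lia|easy]. }
      rewrite Cmult_comm, (Csum_extend _ (S n) N) by
       (try lia; intros a Ha; apply Csum_0; intros b _; apply Csum_0; intros c _; apply Z; lia).
      rewrite <- Csum_scal; apply Csum_ext; intros a _; rewrite (Csum_extend _ (S n) N) by
       (try lia; intros b Hb; apply Csum_0; intros c _; apply Z; lia).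
      rewrite <- Csum_scal; apply Csum_ext; intros b _; rewrite (Csum_extend _ (S n) N) by
       (try lia; intros c Hc; apply Z; lia).
      rewrite <- Csum_scal.
      apply Csum_ext; intros c _; destruct (Nat.eqb _ n); ring.
    - rewrite Csum_swap; apply Csum_ext; intros a _; rewrite Csum_swap; apply Csum_ext; intros b _.
      rewrite Csum_swap; apply Csum_ext; intros c _.
      rewrite (Csum_delta (fun n => X a b c * RtoC t ^ n)%C); destruct (Nat.ltb _ N); ring. }
  rewrite E, <- Csum_minus; apply Csum_ext; intros a _; rewrite <- Csum_minus; apply Csum_ext; intros b _.
  rewrite <- Csum_minus; apply Csum_ext; intros c _; destruct (Nat.ltb _ N); ring.
- apply smallO_Csum; intros a _; apply smallO_Csum; intros b _; apply smallO_Csum; intros c _.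
  destruct (Nat.ltb_spec (a + 2 * b + c) N); [|apply smallO_pow; assumption].
  exists 0; split; [lra|]; intros t _; rewrite Cmult_0_l, Cmod_0; lra.
Qed.

Definition graded2 (X : nat -> nat -> C) (n : nat) : C :=
  Csum (fun a => Csum (fun b => if Nat.eqb (a + 2 * b) n then X a b else RtoC 0) (S n)) (S n).

Lemma graded2_expansion (X : nat -> nat -> C) (N : nat) :
  smallO N (fun t => Csum (fun a => Csum (fun b => X a b * RtoC t ^ (a + 2 * b)) N) N
     - Csum (fun n => graded2 X n * RtoC t ^ n) N)%C.
Proof.
destruct N as [|N]; [exists 0; split; [lra|]; intros; simpl; replace (0 - 0)%C with (RtoC 0) by ring; rewrite Cmod_0; lra|].
assert (H := graded3_expansion (fun a b c => if Nat.eqb c 0 then X a b else RtoC 0) (S N)).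
revert H; apply smallO_ext; intros t _; f_equal; apply Csum_ext.
- intros a _; apply Csum_ext; intros b _; rewrite Csum_S_l, Csum_0; [|intros; simpl; ring].
  rewrite Nat.add_0_r; simpl; ring.
- intros n _; f_equal; unfold graded2, graded3; apply Csum_ext; intros a _; apply Csum_ext; intros b _.
  rewrite Csum_S_l, Csum_0, Nat.add_0_r; [destruct (Nat.eqb _ n); simpl; ring|].
  intros c _; destruct (Nat.eqb _ n); easy.
Qed.

Lemma sum_n_Csum (a : nat -> C) (n : nat) : sum_n a n = Csum a (S n).
Proof.
induction n as [|n IH]; [rewrite sum_O; simpl; ring|].
rewrite sum_Sn, IH; easy.
Qed.

(** * The expansions along roots of unity *)

Lemma isI_scale f J c : 0 < c -> isI f J -> isI (fun u => RtoC c * f (c * u)%R)%C J.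
Proof.
intros Hc H e He; destruct (H e He) as [X0 HX]; exists (X0 / c); intros X HX'.
destruct (HX (c * X)) as [l [L1 L2]].
{ apply (Rmult_le_compat_l c) in HX'; [|lra]; replace (c * (X0 / c)) with X0 in HX' by (field; lra); exact HX'. }
exists l; split; [|exact L2].
assert (G := isCI_comp_lin f c 0 0 X l).
replace (c * 0 + 0) with 0 in G by ring; rewrite Rplus_0_r in G.
specialize (G L1); eapply isCI_ext; [|exact G]; intros u _; cbv beta; rewrite Rplus_0_r; easy.
Qed.

Lemma cosh_weight_isI w tau kap : unit_half w -> 0 < tau -> 0 <= kap < 1 ->
  isI (fun x => wt w tau x * RtoC (cosh (kap * x) * sech x))%C
      (II (fun x => wt w tau x * RtoC (cosh (kap * x) * sech x))%C).
Proof.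
intros Hw Ht Hk; destruct (sechd_dom 0) as [B HB]; assert (B0 := dominated_pos _ _ _ HB).
apply (II_correct _ B (1 - kap)); [lra| |].
- apply Ccont_mult; [apply wt_cont, Ht|]; apply Ccont_RtoC; intros x.
  apply (@ex_derive_continuous R_AbsRing R_NormedModule); eexists.
  apply (is_derive_mult_R (fun x => cosh (kap * x)) sech x (kap * sinh (kap * x))); [|apply sech_derive].
  apply (is_derive_comp cosh (fun x => kap * x) x _ kap (is_derive_cosh _)); auto_derive; [easy|ring].
- intros x Hx; specialize (HB x Hx); cbv beta in HB; rewrite Cmod_R in HB.
  change (Rabs (sech x) <= B * exp (- (1) * x)) in HB.
  assert (W := wt_le1 w Hw tau x Ht).
  assert (C1 := chk_bound 0 (kap * x)); rewrite (Rabs_pos_eq (kap * x)) in C1 by nra.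
  change (Rabs (cosh (kap * x)) <= exp (kap * x)) in C1.
  rewrite Cmod_mult, Cmod_R, Rabs_mult.
  replace (- (1 - kap) * x) with (kap * x + - (1) * x) by ring; rewrite exp_plus.
  pose proof (Rabs_pos (cosh (kap * x))); pose proof (Rabs_pos (sech x)); pose proof (Cmod_ge_0 (wt w tau x)).
  assert (Rabs (cosh (kap * x)) * Rabs (sech x) <= exp (kap * x) * (B * exp (- (1) * x))) by (apply Rmult_le_compat; assumption).
  assert (0 <= Rabs (cosh (kap * x)) * Rabs (sech x)) by (apply Rmult_le_pos; assumption).
  nra.
Qed.

Lemma cosh_weight_Qk w tau kap : w <> RtoC 0 ->
  II (fun x => wt w tau x * RtoC (cosh (kap * x) * sech x))%C
  = (Cexp (RtoC (kap ^ 2 * tau / 4) / w) * Qk w tau sechd 0 kap)%C.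
Proof.
intros Hw; unfold Qk; rewrite Cexp_opp, Cmult_assoc, Cinv_r, Cmult_1_l by apply Cexp_neq0; easy.
Qed.

Lemma cosh_pair_weight w tau : unit_half w -> 0 < tau ->
  isI (fun x => wt w tau x * RtoC ((cosh (5 * x / 6) + cosh (x / 6)) / cosh x))%C
   (Cexp (RtoC (25 * tau / 144) / w) * Qk w tau sechd 0 (5 / 6)
    + Cexp (RtoC (tau / 144) / w) * Qk w tau sechd 0 (1 / 6))%C.
Proof.
intros Hw Ht; assert (w0 := unit_neq0 w Hw).
assert (A := isI_plus _ _ _ _ (cosh_weight_isI w tau (5 / 6) Hw Ht ltac:(lra)) (cosh_weight_isI w tau (1 / 6) Hw Ht ltac:(lra))).
rewrite !cosh_weight_Qk in A by exact w0.
replace ((5 / 6) ^ 2 * tau / 4) with (25 * tau / 144) in A by field.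
replace ((1 / 6) ^ 2 * tau / 4) with (tau / 144) in A by field.
eapply isI_ext; [|exact A]; intros x _; cbv beta.
rewrite <- Cmult_plus_distr_l, <- RtoC_plus; unfold sech, Rdiv; do 2 f_equal; rewrite <- Rmult_plus_distr_r; do 3 f_equal; ring.
Qed.

(** Rescaling the variable by pi gives averages with w = i, width 6 x and frequencies 5/6 and 1/6.
    Undoing the prefactor exp (- kap^2 tau / (4 w)) of [Qk] leaves the phases exp (- 25 i x / 24)
    and exp (- i x / 24), which become the roots of unity in front of c_n and b_n. *)
Lemma mord_Qk (x : R) : 0 < x ->
  II (mord (PI ^ 2 / (6 * x))) = (/ PI * (Cexp (- (Ci * RtoC (25 * x / 24))) * Qk Ci (6 * x) sechd 0 (5 / 6)
    + Cexp (- (Ci * RtoC (x / 24))) * Qk Ci (6 * x) sechd 0 (1 / 6)))%C.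
Proof.
intros Hx; assert (P := PI_RGT_0).
assert (Hw : unit_half Ci).
{ assert (H := unit_half_i 1 ltac:(ring)); rewrite Cmult_1_l in H; exact H. }
assert (H := cosh_pair_weight Ci (6 * x) Hw ltac:(lra)).
assert (EC : forall y, (RtoC y / Ci = - (Ci * RtoC y))%C).
{ intros y; transitivity (RtoC y * (- (Ci * Ci)) / Ci)%C; [rewrite Ci2, RtoC_m1; field; apply Ci_neq0|field; apply Ci_neq0]. }
rewrite !EC in H.
replace (25 * (6 * x) / 144) with (25 * x / 24) in H by field.
replace (6 * x / 144) with (x / 24) in H by field.
apply (isI_scale _ _ PI P), (isI_scal (/ PI)%C) in H.
apply isI_II; eapply isI_ext; [|exact H]; intros u _; cbv beta; unfold mord, wt.
assert (P0 : RtoC PI <> RtoC 0) by (apply RtoC_neq0; lra).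
rewrite Cmult_assoc, Cinv_l, Cmult_1_l by exact P0.
replace ((PI * u) ^ 2 / (6 * x)) with (PI ^ 2 / (6 * x) * u ^ 2) by (field; lra).
replace (5 * (PI * u) / 6) with (5 * PI * u / 6) by field; easy.
Qed.

Definition Xcoef (c : C) (a b : nat) : C :=
  (RtoC PI ^ (a + 2 * b) * ((- (1)) ^ (a + b) * (3 * Ci) ^ a * c ^ (2 * b)
      / (INR (fact a) * INR (fact (2 * b))) * euler_number (2 * a + 2 * b)))%C.

Lemma graded2_scal_pow (p : C) (X : nat -> nat -> C) n :
  graded2 (fun a b => p ^ (a + 2 * b) * X a b)%C n = (p ^ n * graded2 X n)%C.
Proof.
unfold graded2; rewrite <- Csum_scal; apply Csum_ext; intros a _.
rewrite <- Csum_scal; apply Csum_ext; intros b _.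
destruct (Nat.eqb_spec (a + 2 * b) n) as [->|]; ring.
Qed.

Lemma coef_b_graded n : coef_b n = graded2 (Xcoef 1) n.
Proof.
unfold Xcoef; rewrite graded2_scal_pow; unfold coef_b, graded2; f_equal.
rewrite sum_n_Csum; apply Csum_ext; intros a _; rewrite sum_n_Csum; apply Csum_ext; intros b _.
destruct (Nat.eqb _ n); [|easy]; rewrite Cpow_1_l, Cmult_1_r; easy.
Qed.

Lemma coef_c_graded n : coef_c n = graded2 (Xcoef 5) n.
Proof.
unfold Xcoef; rewrite graded2_scal_pow; unfold coef_c, graded2; f_equal.
rewrite sum_n_Csum; apply Csum_ext; intros a _; rewrite sum_n_Csum; apply Csum_ext; intros b _.
destruct (Nat.eqb _ n); easy.
Qed.

(** For tau = 12 pi s and kap = c / 6 one has tau / (4 i) = - 3 i pi s and kap tau / (2 i) = - i c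
    pi s; hence the powers of 3 i and of c = 1 or 5, and the sign (-1)^(a + b). *)
Lemma asy_sum_Xcoef (c s : R) (N : nat) :
  asy_sum Ci sechd (c / 6) (12 * PI * s) N = Csum (fun a => Csum (fun b => Xcoef c a b * RtoC s ^ (a + 2 * b)) N)%C N.
Proof.
unfold asy_sum; rewrite Csum_swap; apply Csum_ext; intros b _; rewrite <- Csum_scal; apply Csum_ext; intros a _.
assert (EC : forall y, (y / Ci = - (Ci * y))%C).
{ intros y; transitivity (y * (- (Ci * Ci)) / Ci)%C; [rewrite Ci2, RtoC_m1; field; apply Ci_neq0|field; apply Ci_neq0]. }
replace (RtoC (c / 6 * (12 * PI * s)) / (2 * Ci))%C with (- Ci * c * PI * s)%C.
2: { replace (c / 6 * (12 * PI * s)) with (2 * (c * PI * s)) by field.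
  rewrite !RtoC_mult; transitivity (RtoC c * PI * s / Ci)%C; [rewrite EC; ring|cfield]. }
replace (RtoC (12 * PI * s) / (4 * Ci))%C with (- (1) * (3 * Ci) * PI * s)%C.
2: { replace (12 * PI * s) with (4 * (3 * PI * s)) by field.
  rewrite !RtoC_mult; transitivity (3 * PI * s / Ci)%C; [rewrite EC; ring|cfield]. }
rewrite !Cpow_mult_l.
replace ((- Ci) ^ (2 * b))%C with ((- (1)) ^ b)%C.
2: { rewrite Cpow_mult_r; f_equal; rewrite <- RtoC_m1, <- Ci2; ring. }
unfold Xcoef; rewrite !Cpow_mult_l, !Cpow_add_r.
replace (2 * a + 2 * b)%nat with (2 * (b + a))%nat by lia.
change (euler_number (2 * (b + a))) with (sechd (2 * (b + a)) 0).
assert (N1 := fact_C_neq0 a); assert (N2 := fact_C_neq0 (2 * b)).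
field; split; assumption.
Qed.

(** The condition 48 <= m guarantees tau = 12 pi / m <= 1, as pi <= 4. The square root in front of
    the integral combines with pi and sqrt tau to a constant [c0] inverse to the complete Fresnel
    integral K, so that the expansion carries no further factor. *)
Lemma mordell_expansion (N : nat) : exists M, forall m : R, 48 <= m ->
  let x := 2 * PI / m in let alpha := (- (Ci * RtoC x))%C in
  Cmod (Csqrt (2 * PI / (3 * alpha)) * II (mord (PI ^ 2 / (6 * x)))
    - Csum (fun n => (Cexp (- (Ci * RtoC (x / 24))) * coef_b n + Cexp (- (Ci * RtoC (25 * x / 24))) * coef_c n) / RtoC m ^ n) N)%C <= M / m ^ N.
Proof.
assert (P := PI_RGT_0).
assert (Hw : unit_half Ci).
{ assert (H := unit_half_i 1 ltac:(ring)); rewrite Cmult_1_l in H; exact H. }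
set (K := (RtoC (sqrt (PI / 8)) * (1 - Ci))%C).
assert (HK : forall X, 0 < X -> Cmod (Phi Ci X - K)%C <= / X).
{ assert (H := Phi_lim_i 1 ltac:(ring)); cbv zeta in H; rewrite Cmult_1_l in H; exact H. }
assert (G : forall c : R, 0 <= c / 6 < 1 -> exists M, 0 <= M /\ forall s, 0 < s <= / 48 ->
   Cmod (/ RtoC (sqrt (12 * PI * s)) * Qk Ci (12 * PI * s) sechd 0 (c / 6) - K * Csum (fun n => graded2 (Xcoef c) n * RtoC s ^ n) N)%C <= M * s ^ N).
{ intros c Hc.
  destruct (cosh_weight_expansion Ci K sechd Hw HK sechd_der sechd_dom sechd_odd (c / 6) N Hc) as [M1 H1].
  destruct (graded2_expansion (Xcoef c) N) as [M2 [M20 H2]].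
  exists (Rabs M1 * (12 * PI) ^ N + Cmod K * M2); split.
  { apply Rplus_le_le_0_compat; apply Rmult_le_pos; try assumption; [apply Rabs_pos|apply pow_le; lra|apply Cmod_ge_0]. }
  intros s Hs; specialize (H2 s ltac:(lra)); specialize (H1 (12 * PI * s) ltac:(apply Rmult_lt_0_compat; lra)).
  assert (12 * PI * s <= 1).
  { pose proof PI_4; apply Rle_trans with (48 * s); [apply Rmult_le_compat_r; lra|lra]. }
  specialize (H1 H); rewrite asy_sum_Xcoef in H1; cbv beta in H2.
  match type of H1 with Cmod (?a - K * ?b)%C <= _ => match type of H2 with Cmod (_ - ?d)%C <= _ =>
    replace (a - K * d)%C with ((a - K * b) + K * (b - d))%C by ring end end.
  eapply Rle_trans; [apply Cmod_triangle|]; rewrite Rmult_plus_distr_r; apply Rplus_le_compat.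
  - eapply Rle_trans; [exact H1|]; rewrite Rpow_mult_distr, Rmult_assoc; apply Rmult_le_compat_r; [|apply Rle_abs].
    apply Rmult_le_pos; apply pow_le; lra.
  - rewrite Cmod_mult, Rmult_assoc; apply Rmult_le_compat_l; [apply Cmod_ge_0|exact H2]. }
destruct (G 1 ltac:(lra)) as [M1 [M10 H1]], (G 5 ltac:(lra)) as [M2 [M20 H2]].
set (c0 := (/ PI * RtoC (sqrt 2 * sqrt PI) * (1 + Ci))%C).
exists (Cmod c0 * (M1 + M2)); intros m Hm x alpha.
set (s := / m).
assert (Hs : 0 < s <= / 48) by (split; [apply Rinv_0_lt_compat; lra|apply Rinv_le_contravar; lra]).
assert (Hx : 0 < x) by (apply Rdiv_lt_0_compat; lra).
assert (x6 : 6 * x = 12 * PI * s) by (unfold x, s; field; lra).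
specialize (H1 s Hs); specialize (H2 s Hs).
assert (Sq : 0 < sqrt (12 * PI * s)) by (apply sqrt_lt_R0; rewrite <- x6; lra).
assert (sC : RtoC (sqrt (12 * PI * s)) <> RtoC 0) by (apply RtoC_neq0; lra).
assert (PC : RtoC PI <> RtoC 0) by (apply RtoC_neq0; lra).
assert (E1 : (Csqrt (2 * PI / (3 * alpha)) * (/ PI * RtoC (sqrt (12 * PI * s))) = c0)%C).
{ destruct (alpha_conv x Hx) as [_ [_ [_ [_ A]]]]; fold alpha in A.
  replace (2 * PI)%C with (RtoC (2 * PI)) by (rewrite RtoC_mult; easy); rewrite A by lra.
  rewrite Csqrt_i by (apply Rmult_le_pos; [lra|left; apply Rinv_0_lt_compat; lra]).
  unfold c0; transitivity (/ PI * RtoC (sqrt (2 * PI / (3 * x) / 2) * sqrt (12 * PI * s)) * (1 + Ci))%C; [rewrite RtoC_mult; ring|].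
  do 3 f_equal; rewrite <- !sqrt_mult; try lra.
  - f_equal; rewrite <- x6; field; lra.
  - left; apply Rdiv_lt_0_compat; [apply Rdiv_lt_0_compat|]; lra.
  }
assert (E2 : (c0 * K = 1)%C).
{ unfold c0, K.
  transitivity (/ PI * RtoC (sqrt 2 * sqrt PI * sqrt (PI / 8)) * (1 - Ci * Ci))%C; [rewrite !RtoC_mult; ring|].
  rewrite <- (sqrt_mult 2 PI), <- sqrt_mult by lra.
  replace (2 * PI * (PI / 8)) with ((PI / 2) * (PI / 2)) by field; rewrite sqrt_square by lra.
  rewrite Ci2, RtoC_m1; unfold Rdiv; rewrite RtoC_mult, RtoC_inv by lra; cfield. }
rewrite mord_Qk by exact Hx; rewrite x6.
set (z1 := Cexp (- (Ci * RtoC (x / 24)))%C); set (z2 := Cexp (- (Ci * RtoC (25 * x / 24)))%C).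
set (S1 := Csum (fun n => graded2 (Xcoef 1) n * RtoC s ^ n)%C N) in *; set (S2 := Csum (fun n => graded2 (Xcoef 5) n * RtoC s ^ n)%C N) in *.
set (Q1 := Qk Ci (12 * PI * s) sechd 0 (1 / 6)) in *; set (Q2 := Qk Ci (12 * PI * s) sechd 0 (5 / 6)) in *.
replace (Csum (fun n => (z1 * coef_b n + z2 * coef_c n) / RtoC m ^ n)%C N) with (z1 * S1 + z2 * S2)%C.
2: { unfold S1, S2; rewrite <- !Csum_scal, <- Csum_plus; apply Csum_ext; intros n _.
  rewrite coef_b_graded, coef_c_graded; unfold s; rewrite RtoC_inv, Cpow_inv by (try apply RtoC_neq0; lra).
  unfold Cdiv; ring. }
replace (Csqrt (2 * PI / (3 * alpha)) * (/ PI * (z2 * Q2 + z1 * Q1)) - (z1 * S1 + z2 * S2))%C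
  with (c0 * (z1 * (/ RtoC (sqrt (12 * PI * s)) * Q1 - K * S1) + z2 * (/ RtoC (sqrt (12 * PI * s)) * Q2 - K * S2)))%C.
2: { transitivity (c0 * / RtoC (sqrt (12 * PI * s)) * (z2 * Q2 + z1 * Q1) - c0 * K * (z1 * S1 + z2 * S2))%C; [ring|].
  rewrite E2, <- E1; cfield. }
replace (Cmod c0 * (M1 + M2) / m ^ N) with (Cmod c0 * ((M1 + M2) * / m ^ N)) by (unfold Rdiv; ring).
rewrite Cmod_mult; apply Rmult_le_compat_l; [apply Cmod_ge_0|].
eapply Rle_trans; [apply Cmod_triangle|]; rewrite !Cmod_mult; unfold z1, z2; rewrite !Cmod_cis, !Rmult_1_l.
rewrite <- pow_inv; fold s; lra.
Qed.

Lemma psi_quarter (q : C) : (q ^ 2 = - (1))%C -> psi q = q.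
Proof.
intros H; unfold psi; destruct (Rlt_dec (Cmod q) 1) as [L|_].
- exfalso; assert (E := f_equal Cmod H); rewrite Cmod_pow, Cmod_opp, Cmod_1 in E.
  pose proof (Cmod_ge_0 q); nra.
- rewrite (CSeries_finite _ 1); [simpl; ring|].
  intros n Hn; rewrite (qpoch_zero _ _ 0 n) by (try lia; simpl (_ ^ 0)%C; rewrite H; ring); ring.
Qed.

Lemma phi_one : phi 1 = RtoC 2.
Proof.
unfold phi; destruct (Rlt_dec (Cmod 1) 1) as [L|_]; [rewrite Cmod_1 in L; lra|].
rewrite (CSeries_finite _ 1); [simpl; ring|].
intros n Hn; rewrite (qpoch_zero _ _ 0 n) by (try lia; simpl; ring); ring.
Qed.

Lemma zeta_opp (N : nat) (c x : R) : (0 < N)%nat -> 2 * PI * c / INR N = x -> zeta N (- c) = Cexp (- (Ci * RtoC x))%C.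
Proof.
intros HN <-; assert (N0 : INR N <> 0) by (apply not_0_INR; lia).
unfold zeta; f_equal; unfold Rdiv; rewrite RtoC_opp, !RtoC_mult, RtoC_inv by exact N0; unfold Cdiv; ring.
Qed.

Lemma zeta_pos (N : nat) (c x : R) : (0 < N)%nat -> 2 * PI * c / INR N = x -> zeta N c = Cexp (Ci * RtoC x)%C.
Proof.
intros HN <-; assert (N0 : INR N <> 0) by (apply not_0_INR; lia).
unfold zeta; f_equal; unfold Rdiv; rewrite !RtoC_mult, RtoC_inv by exact N0; unfold Cdiv; ring.
Qed.

Lemma gcd_one_l n : Nat.gcd 1 n = 1%nat.
Proof. apply Nat.divide_1_r, Nat.gcd_divide_l. Qed.

(** For l = 1 the transformed point satisfies q_1^2 = -1, where psi (q_1) = q_1. Together with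
    q_1^(-1/24) this is q_1^(23/24), the root of unity in the leading term. From k = 24 on, m = 2 k
    + 1 is at least 48. *)
Lemma phi_expansion_infty :
  asymp_at_infty
     (fun k => zeta (24 * (2 * k + 1)) (-1) * phi (zeta (2 * k + 1) 1))%C
     (fun k => Csqrt (2 * INR (2 * k + 1) * Ci) * zeta 96 (- (23 * INR (2 * k + 1))))%C
     (fun k => (2 * k + 1)%nat)
     (fun n k => zeta (24 * (2 * k + 1)) (-1) * coef_b n + zeta (24 * (2 * k + 1)) (-25) * coef_c n)%C.
Proof.
intros N; destruct (mordell_expansion N) as [M HM]; exists M; exists 24%nat; intros k Hk.
assert (P := PI_RGT_0).
set (m := INR (2 * k + 1)).
assert (Hm : 48 <= m).
{ unfold m; apply Rle_trans with (INR 48); [simpl; lra|apply le_INR; lia]. }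
specialize (HM m Hm); cbv zeta in HM; revert HM.
assert (T := phi_transform k 1 (le_n _) (gcd_one_l _)); cbv zeta in T; revert T.
fold m; replace (2 * PI * INR 1 / m) with (2 * PI / m) by (simpl; field; lra).
set (x := 2 * PI / m).
assert (Hx : 0 < x) by (apply Rdiv_lt_0_compat; lra).
destruct (alpha_conv x Hx) as [A1 [A2 [A3 [A4 A5]]]]; set (alpha := (- (Ci * RtoC x))%C) in *.
rewrite A1, A2, A3, A4; intros T HM.
rewrite (zeta_opp _ 1 (x / 24)), (zeta_opp _ 25 (25 * x / 24)), (zeta_pos (2 * k + 1) 1 x);
  try lia; try (unfold x; fold m; field; lra); try (rewrite mult_INR; unfold x; fold m; simpl (INR 24); field; lra).
assert (x2 : PI ^ 2 / x = PI * INR (2 * k + 1) / 2) by (fold m; unfold x; field; lra).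
rewrite T, psi_quarter.
2: { rewrite Cexp_pow, x2, <- (Cm1_pow_odd k), <- cis_pi_opp; f_equal; unfold Rdiv; replace (INR 2) with 2 by (simpl; ring); rewrite !RtoC_mult, RtoC_inv by lra; cfield. }
replace (zeta 96 (- (23 * m))) with (Cexp (Ci * RtoC (PI ^ 2 / (24 * x))) * Cexp (- (Ci * RtoC (PI ^ 2 / x))))%C.
2: { rewrite (zeta_opp 96 (23 * m) (23 * (PI ^ 2 / x) / 24)) by (try lia; unfold x; simpl (INR 96); field; lra).
  rewrite <- Cexp_add; f_equal; replace (PI ^ 2 / (24 * x)) with (PI ^ 2 / x - 23 * (PI ^ 2 / x) / 24) by (field; lra).
  rewrite RtoC_minus; ring. }
replace (2 * m * Ci)%C with (4 * PI / alpha)%C.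
2: { replace (4 * PI / alpha)%C with (RtoC (4 * PI) / (1 * alpha))%C by (rewrite RtoC_mult, Cmult_1_l; easy).
  rewrite A5 by lra; replace (4 * PI / (1 * x)) with (2 * m) by (unfold x; field; lra).
  rewrite RtoC_mult; ring. }
match goal with |- Cmod (?a + ?J - ?b - ?d)%C <= _ => replace (a + J - b - d)%C with (J - d)%C by ring end.
exact HM.
Qed.

(** For l = 1 the transformed point is q_1 = 1, and phi (1) = 2. The factor - 1/2 of the expansion
    compares the two square roots in front of the Mordell integral, whose radicands differ by a
    factor 4. *)
Lemma psi_expansion_infty :
  asymp_at_infty
     (fun k => zeta (96 * k) (-1) * psi (zeta (4 * k) 1))%C
     (fun k => Csqrt (2 * INR k * Ci) * zeta 24 (INR k))%C
     (fun k => (4 * k)%nat)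
     (fun n k => - (1 / 2) * (zeta (96 * k) (-1) * coef_b n + zeta (96 * k) (-25) * coef_c n))%C.
Proof.
intros N; destruct (mordell_expansion N) as [M HM]; exists (/ 2 * M); exists 24%nat; intros k Hk.
assert (P := PI_RGT_0).
set (m := INR (4 * k)).
assert (Hm : 48 <= m).
{ unfold m; apply Rle_trans with (INR 48); [simpl; lra|apply le_INR; lia]. }
assert (mk : m = 4 * INR k) by (unfold m; rewrite mult_INR; simpl; ring).
specialize (HM m Hm); cbv zeta in HM; revert HM.
assert (T := psi_transform k 1 ltac:(lia) (le_n _) (gcd_one_l _)); cbv zeta in T; revert T.
fold m; replace (2 * PI * INR 1 / m) with (2 * PI / m) by (simpl; field; lra).
set (x := 2 * PI / m).
assert (Hx : 0 < x) by (apply Rdiv_lt_0_compat; lra).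
destruct (alpha_conv x Hx) as [A1 [A2 [A3 [A4 A5]]]]; set (alpha := (- (Ci * RtoC x))%C) in *.
rewrite A1, A2, A3, A4; intros T HM.
assert (m24 : INR (96 * k) = 24 * m) by (rewrite mk, mult_INR; simpl (INR 96); ring).
rewrite (zeta_opp _ 1 (x / 24)), (zeta_opp _ 25 (25 * x / 24)), (zeta_pos (4 * k) 1 x);
  try lia; try (unfold x; fold m; field; lra); try (rewrite m24; unfold x; field; lra).
assert (q1 : Cexp (- (Ci * RtoC (PI ^ 2 / x)))%C = RtoC 1).
{ replace (PI ^ 2 / x) with (PI * INR (2 * k)).
  - rewrite cis_pi_opp; apply Cm1_pow_even.
  - unfold x; rewrite mk, mult_INR; simpl (INR 2); field; split; lra. }
rewrite T, q1, phi_one.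
rewrite (zeta_pos 24 (INR k) (PI ^ 2 / (24 * x))) by (try lia; unfold x; rewrite mk; simpl (INR 24); field; split; lra).
assert (R1 : (Csqrt (2 * INR k * Ci) = 2 * Csqrt (PI / (4 * alpha)))%C).
{ rewrite A5 by lra.
  replace (2 * INR k * Ci)%C with (Ci * RtoC (2 * INR k))%C by (rewrite RtoC_mult; ring).
  rewrite !Csqrt_i by (try (left; apply Rdiv_lt_0_compat); lra).
  rewrite Cmult_assoc, <- RtoC_mult; do 2 f_equal; apply sqrt_half; [left; repeat apply Rdiv_lt_0_compat; lra|unfold x; rewrite mk; field; split; lra]. }
assert (R2 : (Csqrt (2 * PI / (3 * alpha)) = 2 * Csqrt (PI / (6 * alpha)))%C).
{ replace (2 * PI)%C with (RtoC (2 * PI)) by (rewrite RtoC_mult; easy); rewrite !A5 by lra.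
  rewrite !Csqrt_i by (left; apply Rdiv_lt_0_compat; lra).
  rewrite Cmult_assoc, <- RtoC_mult; do 2 f_equal; apply sqrt_half; [left; repeat apply Rdiv_lt_0_compat; lra|field; lra]. }
rewrite R1; rewrite R2 in HM.
rewrite (Csum_ext _ (fun n => - / 2 * ((Cexp (- (Ci * RtoC (x / 24))) * coef_b n + Cexp (- (Ci * RtoC (25 * x / 24))) * coef_c n) / RtoC m ^ n))%C)
  by (intros n _; assert (RtoC m ^ n <> RtoC 0)%C by (apply Cpow_nz, RtoC_neq0; lra); cfield).
rewrite Csum_scal.
set (d := Csum _ N) in *.
replace (Csqrt (PI / (4 * alpha)) * Cexp (Ci * RtoC (PI ^ 2 / (24 * x))) * 2 - Csqrt (PI / (6 * alpha)) * II (mord (PI ^ 2 / (6 * x)))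
  - 2 * Csqrt (PI / (4 * alpha)) * Cexp (Ci * RtoC (PI ^ 2 / (24 * x))) - - / 2 * d)%C
  with (- / 2 * (2 * Csqrt (PI / (6 * alpha)) * II (mord (PI ^ 2 / (6 * x))) - d))%C by cfield.
rewrite Cmod_mult, Cmod_opp, Cmod_inv, Cmod_R, Rabs_pos_eq by (try apply two_neq0; lra).
replace (/ 2 * M / m ^ N) with (/ 2 * (M / m ^ N)) by (unfold Rdiv; ring).
apply Rmult_le_compat_l; [lra|exact HM].
Qed.

(** * Functions with geometrically bounded derivatives *)

(* The i-th derivative of f is bounded by A L^i on [0, T] for i <= k. *)
Fixpoint Bd (T : R) (k : nat) (A : R -> R) (L : R) (f : R -> C) : Prop :=
  (forall u, 0 <= u <= T -> Cmod (f u) <= A u) /\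
  match k with
  | O => True
  | S k => exists f1, (forall u, 0 <= u <= T -> CD f u (f1 u)) /\ Bd T k (fun u => L * A u) L f1
  end.

Lemma Bd_0 T k A L f : Bd T k A L f -> forall u, 0 <= u <= T -> Cmod (f u) <= A u.
Proof. destruct k; intros [H _]; exact H. Qed.

Lemma Bd_weaken T k : forall A B L M f, 0 <= L <= M -> (forall u, 0 <= u <= T -> A u <= B u) ->
  Bd T k A L f -> Bd T k B M f.
Proof.
induction k as [|k IH]; intros A B L M f HL HA H; assert (H0 := Bd_0 _ _ _ _ _ H); split;
  try (intros u Hu; eapply Rle_trans; [apply H0, Hu|apply HA, Hu]); [exact I|].
destruct H as [_ [f1 [D H1]]]; exists f1; split; [exact D|].
apply (IH (fun u => L * A u) _ L); [exact HL| |exact H1].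
intros u Hu; pose proof (H0 u Hu); pose proof (Cmod_ge_0 (f u)); specialize (HA u Hu).
apply Rmult_le_compat; lra.
Qed.

Lemma Bd_plus T k : forall A B L f g, Bd T k A L f -> Bd T k B L g -> 0 <= L ->
  Bd T k (fun u => A u + B u) L (fun u => f u + g u)%C.
Proof.
induction k as [|k IH]; intros A B L f g H G HL; assert (H0 := Bd_0 _ _ _ _ _ H); assert (G0 := Bd_0 _ _ _ _ _ G);
 (split; [intros u Hu; eapply Rle_trans; [apply Cmod_triangle|]; specialize (H0 u Hu); specialize (G0 u Hu); lra|]); [exact I|].
destruct H as [_ [f1 [D H1]]], G as [_ [g1 [E G1]]].
exists (fun u => f1 u + g1 u)%C; split; [intros u Hu; apply CD_plus; auto|].
apply (Bd_weaken T k (fun u => L * A u + L * B u) _ L L); [lra|intros; lra|].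
apply (IH (fun u => L * A u) (fun u => L * B u)); assumption.
Qed.

Lemma Bd_scal T k : forall A L c f, 0 <= L -> Bd T k A L f -> Bd T k (fun u => Cmod c * A u) L (fun u => c * f u)%C.
Proof.
induction k as [|k IH]; intros A L c f HL H; assert (H0 := Bd_0 _ _ _ _ _ H);
 (split; [intros u Hu; rewrite Cmod_mult; apply Rmult_le_compat_l; [apply Cmod_ge_0|apply H0, Hu]|]); [exact I|].
destruct H as [_ [f1 [D H1]]]; exists (fun u => c * f1 u)%C; split; [intros u Hu; apply CD_scal; auto|].
apply (Bd_weaken T k (fun u => Cmod c * (L * A u)) _ L L); [lra|intros; lra|].
apply IH; assumption.
Qed.

(* Leibniz: the binomial sum collapses to (L + M)^i. *)
Lemma Bd_mult T k : forall A B L M f g, 0 <= L -> 0 <= M -> Bd T k A L f -> Bd T k B M g ->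
  Bd T k (fun u => A u * B u) (L + M) (fun u => f u * g u)%C.
Proof.
induction k as [|k IH]; intros A B L M f g HL HM H G; assert (H0 := Bd_0 _ _ _ _ _ H); assert (G0 := Bd_0 _ _ _ _ _ G);
 (split; [intros u Hu; rewrite Cmod_mult; apply Rmult_le_compat; try apply Cmod_ge_0; auto|]); [exact I|].
assert (H' : Bd T k A L f /\ Bd T k B M g).
{ split; [clear - H|clear - G].
  - revert A f H; induction k as [|k IH]; intros A f [H1 H2]; split; try exact H1; [exact I|].
    destruct H2 as [f1 [D H2]]; exists f1; split; [exact D|apply IH, H2].
  - revert B g G; induction k as [|k IH]; intros A f [H1 H2]; split; try exact H1; [exact I|].
    destruct H2 as [f1 [D H2]]; exists f1; split; [exact D|apply IH, H2]. }
destruct H' as [Hk Gk].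
destruct H as [_ [f1 [D H1]]], G as [_ [g1 [E G1]]].
exists (fun u => f1 u * g u + f u * g1 u)%C; split; [intros u Hu; apply CD_mult; auto|].
apply (Bd_weaken T k (fun u => (L * A u) * B u + A u * (M * B u)) _ (L + M) (L + M)); [lra|intros; lra|].
apply (Bd_plus T k (fun u => (L * A u) * B u) (fun u => A u * (M * B u))); [| |lra].
- apply (IH (fun u => L * A u) B); assumption.
- apply (IH A (fun u => M * B u)); assumption.
Qed.

Lemma Bd_exp T k c lam : forall d : C,
  Bd T k (fun u => Cmod (d * (c * RtoC (exp (- lam * u)))))%C (Rabs lam) (fun u => d * (c * RtoC (exp (- lam * u))))%C.
Proof.
induction k as [|k IH]; intros d; (split; [intros; lra|]); [exact I|].
exists (fun u => (- lam)%R * d * (c * RtoC (exp (- lam * u))))%C; split.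
- intros u _; eapply CD_eq.
  + apply CD_scal, CD_scal, (CD_RtoC (fun u => exp (- lam * u)) u (- lam * exp (- lam * u))); auto_derive; [easy|ring].
  + rewrite RtoC_mult; ring.
- eapply Bd_weaken; [| |apply IH]; [split; [apply Rabs_pos|lra]|].
  intros u _; cbv beta; rewrite !Cmod_mult, (Cmod_R (- lam)), Rabs_Ropp; lra.
Qed.

Section InverseFactor.
Variables (T : R) (c : C) (lam P : R).
Let wf (u : R) : C := (c * RtoC (exp (- lam * u)))%C.
Hypothesis Hnz : forall u, 0 <= u <= T -> (1 + wf u <> 0)%C.
Hypothesis HP : forall u, 0 <= u <= T -> Cmod (wf u * / (1 + wf u))%C <= P.
Hypothesis P0 : 0 <= P.

Let CDw u : CD (fun u => 1 + wf u)%C u (- RtoC lam * wf u)%C.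
Proof.
unfold wf; eapply CD_eq.
- apply CD_plus; [apply CD_const|apply CD_scal, (CD_RtoC (fun u => exp (- lam * u)) u (- lam * exp (- lam * u)))]; auto_derive; [easy|ring].
- rewrite RtoC_mult, RtoC_opp; ring.
Qed.

Let rf (u : R) : C := (/ (1 + wf u))%C.
Let pf (u : R) : C := (wf u * / (1 + wf u))%C.

Let CDr u : 0 <= u <= T -> CD rf u (RtoC lam * (pf u * rf u))%C.
Proof.
intros Hu; assert (N := Hnz u Hu); unfold rf, pf; eapply CD_eq; [apply CD_inv; [exact N|apply CDw]|]; cbv beta; cfield.
Qed.

(** The logistic equation p' = lam (p^2 - p) for p = w / (1 + w): derivatives of every order are
    polynomials in p, so a bound on p alone controls them. *)
Let CDp u : 0 <= u <= T -> CD pf u (RtoC lam * (pf u * pf u + - (1) * pf u))%C.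
Proof.
intros Hu; assert (N := Hnz u Hu).
apply (CD_ext (fun u => wf u * rf u)%C); [easy|].
eapply CD_eq.
- apply CD_mult; [|apply CDr, Hu].
  apply (CD_ext (fun u => (1 + wf u) + - (1))%C); [intros; ring|].
  apply CD_plus; [apply CDw|apply CD_const].
- unfold pf, rf; cfield.
Qed.

Let L0 := Rabs lam * (P + 1).

Let L0pos : 0 <= L0.
Proof. unfold L0; pose proof (Rabs_pos lam); nra. Qed.

(** The square in the logistic equation doubles the rate with each differentiation, hence 2^k. The
    order k is fixed while the number of factors in the products grows, so this only affects a
    constant. *)
Let Bd_p k : Bd T k (fun _ => P) (2 ^ k * L0) pf.
Proof.
assert (L1 := L0pos); assert (Z := Rabs_pos lam).
induction k as [|k IH]; (split; [exact HP|]); [exact I|].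
assert (P2 : 1 <= 2 ^ k) by (apply pow_R1_Rle; lra).
assert (L2 : 0 <= 2 ^ k * L0) by nra.
eexists; split; [apply CDp|].
apply (Bd_weaken T k (fun _ => Cmod (RtoC lam) * (P * P + Cmod (- (1))%C * P)) _ (2 ^ k * L0 + 2 ^ k * L0)); [simpl; lra| |].
- intros u _; rewrite Cmod_opp, Cmod_1, Cmod_R; simpl.
  apply Rle_trans with (1 * L0 * P); [unfold L0; right; ring|].
  apply Rmult_le_compat_r; [exact P0|]; nra.
- apply (Bd_scal T k (fun _ => P * P + Cmod (- (1))%C * P)); [lra|].
  apply (Bd_plus T k (fun _ => P * P) (fun _ => Cmod (- (1))%C * P)); [| |lra].
  + apply (Bd_mult T k (fun _ => P) (fun _ => P)); assumption.
  + apply (Bd_weaken T k (fun _ => Cmod (- (1))%C * P) _ (2 ^ k * L0)); [lra|intros; lra|].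
    apply (Bd_scal T k (fun _ => P)); assumption.
Qed.

Lemma Bd_inv_factor k : Bd T k (fun u => Cmod (/ (1 + wf u))%C) (2 ^ S k * L0) (fun u => / (1 + wf u))%C.
Proof.
assert (L1 := L0pos); assert (Z := Rabs_pos lam).
change (Bd T k (fun u => Cmod (rf u)) (2 ^ S k * L0) rf).
induction k as [|k IH]; (split; [intros; lra|]); [exact I|].
assert (P2 : 1 <= 2 ^ k) by (apply pow_R1_Rle; lra).
assert (L2 : 0 <= 2 ^ k * L0) by nra.
eexists; split; [apply CDr|].
apply (Bd_weaken T k (fun u => Cmod (RtoC lam) * (P * Cmod (rf u))) _ (2 ^ k * L0 + 2 ^ S k * L0)); [simpl; lra| |].
- intros u _; rewrite Cmod_R; rewrite <- Rmult_assoc; apply Rmult_le_compat_r; [apply Cmod_ge_0|].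
  apply Rle_trans with (1 * L0); [unfold L0; lra|]; apply Rmult_le_compat_r; [exact L1|simpl; lra].
- apply (Bd_scal T k (fun u => P * Cmod (rf u))); [simpl; lra|].
  apply (Bd_mult T k (fun _ => P) (fun u => Cmod (rf u))); [exact L2|simpl; lra|apply Bd_p|exact IH].
Qed.

End InverseFactor.

Fixpoint prodr (c : nat -> C) (lam : nat -> R) (n : nat) (u : R) : C :=
  match n with
  | O => RtoC 1
  | S n => (prodr c lam n u * / (1 + c n * RtoC (exp (- lam n * u))))%C
  end.

Lemma Bd_one T k : Bd T k (fun _ => Cmod 1) 0 (fun _ => RtoC 1).
Proof.
assert (G : forall k, Bd T k (fun _ => 0) 0 (fun _ => RtoC 0)).
{ induction k0 as [|j IH]; (split; [intros; rewrite Cmod_0; lra|]); [exact I|].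
  exists (fun _ => RtoC 0); split; [intros; apply CD_const|].
  apply (Bd_weaken T j (fun _ => 0) _ 0); [lra|intros; lra|exact IH]. }
destruct k as [|k]; (split; [intros; lra|]); [exact I|].
exists (fun _ => RtoC 0); split; [intros; apply CD_const|].
apply (Bd_weaken T k (fun _ => 0) _ 0); [lra|intros; lra|apply G].
Qed.

(** Rates add over the factors of a product: n factors cost n times the rate of one, which is the
    polynomial growth in n needed for summation. *)
Lemma Bd_prodr T k c lam Lam P n : 0 <= P ->
  (forall j u, (j < n)%nat -> 0 <= u <= T -> (1 + c j * RtoC (exp (- lam j * u)) <> 0)%C) ->
  (forall j u, (j < n)%nat -> 0 <= u <= T ->
     Cmod (c j * RtoC (exp (- lam j * u)) * / (1 + c j * RtoC (exp (- lam j * u))))%C <= P) ->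
  (forall j, (j < n)%nat -> Rabs (lam j) <= Lam) ->
  Bd T k (fun u => Cmod (prodr c lam n u)) (INR n * (2 ^ S k * (Lam * (P + 1)))) (prodr c lam n).
Proof.
intros P0; induction n as [|n IH]; intros H1 H2 H3.
- apply (Bd_weaken T k (fun _ => Cmod 1) _ 0); [simpl; lra|intros; simpl; lra|apply Bd_one].
- assert (l0 : 0 <= Lam) by (eapply Rle_trans; [apply Rabs_pos|apply (H3 n); lia]).
  assert (P2 : 0 <= 2 ^ S k) by (apply pow_le; lra).
  assert (Q0 : 0 <= 2 ^ S k * (Lam * (P + 1))) by (apply Rmult_le_pos; [lra|apply Rmult_le_pos; lra]).
  assert (Q1 : 2 ^ S k * (Rabs (lam n) * (P + 1)) <= 2 ^ S k * (Lam * (P + 1))).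
  { apply Rmult_le_compat_l; [lra|]; apply Rmult_le_compat_r; [lra|apply H3; lia]. }
  assert (Q2 : 0 <= 2 ^ S k * (Rabs (lam n) * (P + 1))).
  { apply Rmult_le_pos; [lra|]; apply Rmult_le_pos; [apply Rabs_pos|lra]. }
  pose proof (pos_INR n).
  assert (Q3 : 0 <= INR n * (2 ^ S k * (Lam * (P + 1)))) by (apply Rmult_le_pos; assumption).
  apply (Bd_weaken T k (fun u => Cmod (prodr c lam n u) * Cmod (/ (1 + c n * RtoC (exp (- lam n * u))))%C) _
    (INR n * (2 ^ S k * (Lam * (P + 1))) + 2 ^ S k * (Rabs (lam n) * (P + 1)))).
  + rewrite S_INR; lra.
  + intros u _; simpl; rewrite Cmod_mult; lra.
  + apply (Bd_mult T k (fun u => Cmod (prodr c lam n u)) (fun u => Cmod (/ (1 + c n * RtoC (exp (- lam n * u))))%C) _ _ (prodr c lam n)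
      (fun u => / (1 + c n * RtoC (exp (- lam n * u))))%C); [exact Q3|exact Q2| |].
    * apply IH; intros; [apply H1|apply H2|apply H3]; try lia; assumption.
    * apply Bd_inv_factor; [intros u Hu; apply H1; [lia|exact Hu]|intros u Hu; apply H2; [lia|exact Hu]|exact P0].
Qed.

Lemma Bd_taylor T K : forall A L f, 0 <= T -> 0 <= L -> Bd T K (fun _ => A) L f ->
  exists a : nat -> C, (forall i, Cmod (a i) <= A * L ^ i) /\
  forall u, 0 <= u <= T ->
    Cmod (f u - Csum (fun n => (1 * RtoC u) ^ n / RtoC (INR (fact n)) * a n) K)%C <= A * (2 * L) ^ K * u ^ K.
Proof.
induction K as [|K IH]; intros A L f HT HL H.
- assert (H0 := Bd_0 _ _ _ _ _ H); cbv beta in H0.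
  assert (A0 : 0 <= A) by (eapply Rle_trans; [apply Cmod_ge_0|apply (H0 0); lra]).
  exists (fun _ => RtoC 0); split.
  + intros i; rewrite Cmod_0; apply Rmult_le_pos; [exact A0|apply pow_le, HL].
  + intros u Hu; simpl; replace (f u - 0)%C with (f u) by ring; rewrite !Rmult_1_r; apply H0, Hu.
- destruct H as [H0 [f1 [D H1]]]; destruct (IH (L * A) L f1 HT HL H1) as [a [Ha Hr]].
  assert (A0 : 0 <= A) by (eapply Rle_trans; [apply Cmod_ge_0|apply (H0 0); lra]).
  set (a' := fun i => match i with O => f 0 | S j => a j end).
  exists a'; split.
  + intros [|i]; simpl; [rewrite Rmult_1_r; apply H0; lra|eapply Rle_trans; [apply Ha|right; ring]].
  + intros u Hu.
    set (F := fun u => (f u - Csum (fun n => (1 * RtoC u) ^ n / RtoC (INR (fact n)) * a' n) (S K))%C).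
    assert (F0 : F 0 = RtoC 0).
    { unfold F; rewrite Csum_S_l, Csum_0.
      - simpl; field; apply C1_neq0.
      - intros n _; simpl Cpow; unfold Cdiv; ring. }
    change (Cmod (F u) <= A * (2 * L) ^ S K * u ^ S K).
    replace (F u) with (F u - F 0)%C by (rewrite F0; ring).
    replace (A * (2 * L) ^ S K * u ^ S K) with (2 * (L * A * (2 * L) ^ K * u ^ K) * (u - 0)) by (simpl; ring).
    apply (CMVT F (fun u => f1 u - Csum (fun n => (1 * RtoC u) ^ n / RtoC (INR (fact n)) * a n) K)%C); [lra| |].
    * intros v Hv; unfold F; eapply CD_eq; [apply CD_minus; [apply D; lra|apply (CD_expsum 1 a')]|].
      unfold a'; ring.
    * intros v Hv; eapply Rle_trans; [apply Hr; lra|].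
      apply Rmult_le_compat_l; [apply Rmult_le_pos; [nra|apply pow_le; lra]|apply pow_incr; lra].
Qed.

Fixpoint fd (h : R) (k : nat) (f : R -> C) (u : R) : C :=
  match k with
  | O => f u
  | S k => (fd h k f (u + h)%R - fd h k f u)%C
  end.

Lemma fd_S_l h k : forall f u, fd h (S k) f u = fd h k (fun v => f (v + h)%R - f v)%C u.
Proof.
induction k as [|k IH]; intros f u; [easy|].
change (fd h (S (S k)) f u) with (fd h (S k) f (u + h)%R - fd h (S k) f u)%C; rewrite (IH f (u + h)), (IH f u); reflexivity.
Qed.

(** Each difference spends one derivative, gains a factor h and shortens the interval by h; the
    factor 2 is again that of [CMVT]. Iterated, this bounds the k-th difference in [Bd_fd]. *)
Lemma Bd_diff T k h : 0 <= h -> forall A L f, 0 <= L -> Bd T (S k) (fun _ => A) L f ->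
  Bd (T - h) k (fun _ => 2 * h * L * A) L (fun v => f (v + h)%R - f v)%C.
Proof.
intros Hh; induction k as [|k IH]; intros A L f HL [H0 [f1 [D H1]]]; assert (G0 := Bd_0 _ _ _ _ _ H1); cbv beta in G0;
 (split; [intros u Hu; replace (2 * h * L * A) with (2 * (L * A) * (u + h - u)) by ring;
   apply (CMVT f f1); [lra|intros; apply D; lra|intros; apply G0; lra]|]); [exact I|].
exists (fun v => f1 (v + h)%R - f1 v)%C; split.
- intros u Hu; apply CD_minus; [|apply D; lra].
  eapply CD_eq; [apply (CD_comp f (fun v => v + h) u (f1 (u + h)%R) 1); [apply D; lra|auto_derive; [easy|ring]]|ring].
- apply (Bd_weaken (T - h) k (fun _ => 2 * h * L * (L * A)) _ L); [lra|intros; lra|].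
  apply IH; assumption.
Qed.

Lemma Bd_fd k : forall T A L f h u, 0 <= L -> 0 <= h -> 0 <= u -> u + INR k * h <= T ->
  Bd T k (fun _ => A) L f -> Cmod (fd h k f u) <= A * (2 * L * h) ^ k.
Proof.
induction k as [|k IH]; intros T A L f h u HL Hh Hu HT H.
- simpl in *; rewrite Rmult_1_r; apply (proj1 H); lra.
- rewrite fd_S_l; rewrite S_INR in HT.
  replace (A * (2 * L * h) ^ S k) with (2 * h * L * A * (2 * L * h) ^ k) by (simpl; ring).
  apply (IH (T - h)); [exact HL|exact Hh|exact Hu|lra|apply Bd_diff; assumption].
Qed.

(** * Complex series *)

Lemma CSeries_ext a b : (forall n, a n = b n) -> CSeries a = CSeries b.
Proof. intros E; unfold CSeries; f_equal; apply Series_ext; intros n; rewrite E; easy. Qed.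

Lemma ex_series_Re (a : nat -> C) b : (forall n, Cmod (a n) <= b n) -> ex_series b -> ex_series (fun n => Re (a n)).
Proof.
intros H E; apply (ex_series_le (fun n => Re (a n)) b); [|exact E].
intros n; eapply Rle_trans; [apply re_le_Cmod|apply H].
Qed.

Lemma ex_series_Im (a : nat -> C) b : (forall n, Cmod (a n) <= b n) -> ex_series b -> ex_series (fun n => Im (a n)).
Proof.
intros H E; apply (ex_series_le (fun n => Im (a n)) b); [|exact E].
intros n; eapply Rle_trans; [apply im_le_Cmod|apply H].
Qed.

Lemma CSeries_plus a b A B : (forall n, Cmod (a n) <= A n) -> ex_series A -> (forall n, Cmod (b n) <= B n) -> ex_series B ->
  CSeries (fun n => a n + b n)%C = (CSeries a + CSeries b)%C.
Proof.
intros H1 E1 H2 E2; unfold CSeries, Cplus; simpl; f_equal.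
- rewrite <- Series_plus by (eapply ex_series_Re; eassumption); apply Series_ext; easy.
- rewrite <- Series_plus by (eapply ex_series_Im; eassumption); apply Series_ext; easy.
Qed.

Lemma CSeries_scal (c : C) a A : (forall n, Cmod (a n) <= A n) -> ex_series A ->
  CSeries (fun n => c * a n)%C = (c * CSeries a)%C.
Proof.
intros H E; assert (R1 := ex_series_Re _ _ H E); assert (I1 := ex_series_Im _ _ H E).
unfold CSeries, Cmult; simpl; f_equal.
- rewrite <- !Series_scal_l, <- Series_minus; [apply Series_ext; easy| |];
   apply (ex_series_scal (V := R_NormedModule)); assumption.
- rewrite <- !Series_scal_l, <- Series_plus; [apply Series_ext; easy| |];
   apply (ex_series_scal (V := R_NormedModule)); assumption.
Qed.

Lemma CSeries_minus a b A B : (forall n, Cmod (a n) <= A n) -> ex_series A -> (forall n, Cmod (b n) <= B n) -> ex_series B ->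
  CSeries (fun n => a n - b n)%C = (CSeries a - CSeries b)%C.
Proof.
intros H1 E1 H2 E2.
transitivity (CSeries a + (- (1)) * CSeries b)%C; [|ring].
rewrite <- (CSeries_scal _ b B) by assumption.
rewrite <- (CSeries_plus a _ A B); [apply CSeries_ext; intros; ring|assumption|assumption| |assumption].
intros n; rewrite Cmod_mult, Cmod_opp, Cmod_1, Rmult_1_l; apply H2.
Qed.

Lemma CSeries_bound a b : (forall n, Cmod (a n) <= b n) -> ex_series b -> Cmod (CSeries a) <= 2 * Series b.
Proof.
intros H E; assert (R1 := ex_series_Re _ _ H E); assert (I1 := ex_series_Im _ _ H E).
assert (G : forall r : nat -> R, (forall n, Rabs (r n) <= b n) -> Rabs (Series r) <= Series b).
{ intros r Hr; eapply Rle_trans; [apply Series_Rabs|apply Series_le; [|exact E]].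
  - apply (ex_series_le (fun n => Rabs (r n)) b); [|exact E].
    intros n; eapply Rle_trans; [|apply Hr]; right; apply Rabs_Rabsolu.
  - intros n; split; [apply Rabs_pos|apply Hr]. }
eapply Rle_trans; [apply Cmod_le_abs|]; unfold CSeries; simpl.
assert (A1 := G (fun n => Re (a n)) (fun n => Rle_trans _ _ _ (re_le_Cmod _) (H n))).
assert (A2 := G (fun n => Im (a n)) (fun n => Rle_trans _ _ _ (im_le_Cmod _) (H n))).
unfold Re, Im in *; lra.
Qed.

Lemma CSeries_lim a b : (forall n, Cmod (a n) <= b n) -> ex_series b ->
  forall eps, 0 < eps -> exists N0, forall N, (N0 <= N)%nat -> Cmod (Csum a N - CSeries a)%C < eps.
Proof.
intros H E eps He; assert (R1 := ex_series_Re _ _ H E); assert (I1 := ex_series_Im _ _ H E).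
apply Series_correct in R1; apply Series_correct in I1.
assert (e2 : 0 < eps / 2) by lra.
destruct (proj1 (filterlim_locally _ _) R1 (mkposreal _ e2)) as [N1 H1].
destruct (proj1 (filterlim_locally _ _) I1 (mkposreal _ e2)) as [N2 H2].
exists (S (max N1 N2)); intros [|N] HN; [lia|].
specialize (H1 N ltac:(lia)); specialize (H2 N ltac:(lia)).
rewrite sum_n_Re_Csum in H1; rewrite sum_n_Im_Csum in H2.
eapply Rle_lt_trans; [apply Cmod_le_abs|].
change (Rabs (Re (Csum a (S N)) - Series (fun n => Re (a n))) < eps / 2) in H1.
change (Rabs (Im (Csum a (S N)) - Series (fun n => Im (a n))) < eps / 2) in H2.
change (Re (Csum a (S N) - CSeries a)%C) with (Re (Csum a (S N)) - Series (fun n => Re (a n))).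
change (Im (Csum a (S N) - CSeries a)%C) with (Im (Csum a (S N)) - Series (fun n => Im (a n))).
lra.
Qed.

Lemma CSeries_Csum (c : nat -> nat -> C) (B : nat -> nat -> R) K :
  (forall i n, (i < K)%nat -> Cmod (c i n) <= B i n) -> (forall i, (i < K)%nat -> ex_series (B i)) ->
  CSeries (fun n => Csum (fun i => c i n) K) = Csum (fun i => CSeries (c i)) K /\
  exists D, (forall n, Cmod (Csum (fun i => c i n) K) <= D n) /\ ex_series D.
Proof.
intros H E; induction K as [|K IH].
- split.
  + exact (CSeries_finite (fun _ => RtoC 0) 0 (fun _ _ => eq_refl)).
  + exists (fun _ => 0); split; [intros; simpl; rewrite Cmod_0; lra|].
    apply (ex_series_ext (fun n => 0 * (/ 2) ^ n)); [intros; rring|].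
    apply (ex_series_scal (V := R_NormedModule) 0), ex_series_geom; rewrite Rabs_pos_eq; lra.
- destruct (IH (fun i n Hi => H i n (Nat.lt_lt_succ_r _ _ Hi)) (fun i Hi => E i (Nat.lt_lt_succ_r _ _ Hi))) as [IH1 [D [D1 D2]]].
  assert (HK := fun n => H K n (le_n _)); assert (EK := E K (le_n _)).
  split.
  + simpl; rewrite <- IH1.
    apply (CSeries_plus _ _ D (B K)); assumption.
  + exists (fun n => D n + B K n); split; [|apply (ex_series_plus D (B K)); assumption].
    intros n; simpl; eapply Rle_trans; [apply Cmod_triangle|]; specialize (D1 n); specialize (HK n); lra.
Qed.

Lemma ex_series_pow_exp (C0 s : R) (j : nat) : 0 < s -> ex_series (fun n => C0 * INR n ^ j * exp (- s * INR n)).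
Proof.
intros Hs; destruct (pow_exp_bound j s Hs) as [K [K0 HK]].
apply (ex_series_le (fun n => C0 * INR n ^ j * exp (- s * INR n)) (fun n => Rabs C0 * K * exp (- (s / 2)) ^ n)).
- intros n; change (Rabs (C0 * INR n ^ j * exp (- s * INR n)) <= Rabs C0 * K * exp (- (s / 2)) ^ n).
  rewrite Rmult_assoc, Rabs_mult, Rmult_assoc; apply Rmult_le_compat_l; [apply Rabs_pos|].
  rewrite Rabs_pos_eq by (apply Rmult_le_pos; [apply pow_le, pos_INR|left; apply exp_pos]).
  eapply Rle_trans; [apply HK, pos_INR|]; right; f_equal; rewrite <- exp_nat; f_equal; ring.
- apply (ex_series_scal (V := R_NormedModule) (Rabs C0 * K)), ex_series_geom.
  rewrite Rabs_pos_eq by (left; apply exp_pos); rewrite <- exp_0; apply exp_increasing; lra.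
Qed.

(** * Expansions at the roots of unity *)

Lemma choice_fun (X Y : Type) (R : X -> Y -> Prop) : (forall x, exists y, R x y) -> exists f, forall x, R x (f x).
Proof.
intros H; exists (fun x => proj1_sig (constructive_indefinite_description _ (H x))).
intros x; exact (proj2_sig (constructive_indefinite_description _ (H x))).
Qed.

(** Allows the coefficients to be chosen anew for each order N. Uniqueness, through [poly_small_0],
    makes the choices coincide wherever they overlap. *)
Lemma expansion_choice (f : R -> C) :
  (forall N, exists c M t0, 0 < t0 /\ forall t, 0 < t < t0 -> Cmod (f t - Csum (fun n => c n * RtoC t ^ n) N)%C <= M * t ^ N) ->
  exists d, asymp_at_0 f d.
Proof.
intros H; destruct (choice_fun _ _ (fun N c => exists M t0, 0 < t0 /\ forall t, 0 < t < t0 ->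
  Cmod (f t - Csum (fun n => c n * RtoC t ^ n) N)%C <= M * t ^ N) H) as [c Hc].
(* The n-th coefficient is read off from the expansion of order n + 1, the first one that contains
   it. *)
exists (fun n => c (S n) n); intros N.
destruct (Hc N) as [M [t0 [T0 HM]]].
assert (E : forall n, (n < N)%nat -> c N n = c (S n) n).
{ intros n Hn; destruct (Hc (S n)) as [M' [t1 [T1 HM']]].
  assert (Z : forall i, (i < S n)%nat -> (c N i - c (S n) i = 0)%C).
  { set (B := fun i => Cmod (c N (S n + i)%nat)).
    set (B0 := sum_f_R0 B (pred (N - S n)) + Rabs (B 0%nat)).
    apply (poly_small_0 (S n) (fun i => c N i - c (S n) i)%C (Rabs M + M' + B0) (Rmin (Rmin t0 t1) 1)).
    { apply Rmin_glb_lt; [apply Rmin_glb_lt; assumption|lra]. }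
    intros t Ht.
    assert (t < t0) by (eapply Rlt_le_trans; [apply Ht|eapply Rle_trans; [apply Rmin_l|apply Rmin_l]]).
    assert (t < t1) by (eapply Rlt_le_trans; [apply Ht|eapply Rle_trans; [apply Rmin_l|apply Rmin_r]]).
    assert (t < 1) by (eapply Rlt_le_trans; [apply Ht|apply Rmin_r]).
    specialize (HM t ltac:(lra)); specialize (HM' t ltac:(lra)).
    rewrite (Csum_ext _ (fun i => c N i * RtoC t ^ i - c (S n) i * RtoC t ^ i)%C) by (intros; ring).
    rewrite Csum_minus.
    assert (S1 : Csum (fun i => c N i * RtoC t ^ i)%C N =
       (Csum (fun i => c N i * RtoC t ^ i) (S n) + RtoC t ^ S n * Csum (fun i => c N (S n + i)%nat * RtoC t ^ i) (N - S n))%C).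
    { transitivity (Csum (fun i => c N i * RtoC t ^ i)%C (S n + (N - S n))); [f_equal; lia|]; rewrite Csum_add, <- Csum_scal; f_equal.
      apply Csum_ext; intros i _; rewrite Cpow_add_r; ring. }
    rewrite S1 in HM.
    set (s1 := Csum (fun i => c N i * RtoC t ^ i)%C (S n)) in *; set (s2 := Csum (fun i => c N (S n + i)%nat * RtoC t ^ i)%C (N - S n)) in *.
    set (s3 := Csum (fun i => c (S n) i * RtoC t ^ i)%C (S n)) in *.
    assert (B2 : Cmod s2 <= B0).
    { apply Cmod_Csum; intros i _; unfold B; rewrite Cmod_mult, Cmod_pow, Cmod_R, Rabs_pos_eq by lra.
      assert (t ^ i <= 1) by (rewrite <- (pow1 i); apply pow_incr; lra).
      pose proof (Cmod_ge_0 (c N (S n + i)%nat)); nra. }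
    assert (tN : M * t ^ N <= Rabs M * t ^ S n).
    { replace N with (S n + (N - S n))%nat by lia; rewrite pow_add.
      assert (0 < t ^ S n) by (apply pow_lt; lra).
      assert (0 < t ^ (N - S n)) by (apply pow_lt; lra).
      assert (t ^ (N - S n) <= 1) by (rewrite <- (pow1 (N - S n)); apply pow_incr; lra).
      pose proof (Rle_abs M); pose proof (Rabs_pos M).
      apply Rle_trans with (Rabs M * (t ^ S n * t ^ (N - S n))); [apply Rmult_le_compat_r; [apply Rmult_le_pos; lra|lra]|].
      apply Rmult_le_compat_l; [lra|]; nra. }
    replace (s1 - s3)%C with ((f t - s3) - (f t - (s1 + RtoC t ^ S n * s2)) - RtoC t ^ S n * s2)%C by ring.
    assert (X1 := Cmod_triangle (f t - s3 - (f t - (s1 + RtoC t ^ S n * s2)))%C (- (RtoC t ^ S n * s2))%C).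
    assert (X2 := Cmod_triangle (f t - s3)%C (- (f t - (s1 + RtoC t ^ S n * s2)))%C).
    rewrite Cmod_opp in X1, X2; rewrite (Cmod_mult (RtoC t ^ S n)), Cmod_pow, Cmod_R, (Rabs_pos_eq t) in X1 by lra.
    assert (t ^ S n * Cmod s2 <= t ^ S n * B0) by (apply Rmult_le_compat_l; [apply pow_le; lra|exact B2]).
    unfold Cminus in *; lra. }
  specialize (Z n ltac:(lia)); replace (c N n) with ((c N n - c (S n) n) + c (S n) n)%C by ring; rewrite Z; ring. }
exists M; exists (mkposreal t0 T0); intros t Ht Ht0.
assert (t < t0).
{ unfold ball in Ht; simpl in Ht; unfold AbsRing_ball, abs, minus, plus, opp in Ht; simpl in Ht.
  rewrite Ropp_0, Rplus_0_r, Rabs_pos_eq in Ht by lra; exact Ht. }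
specialize (HM t ltac:(lra)).
rewrite (Csum_ext _ (fun n => c N n * RtoC t ^ n)%C); [exact HM|].
intros n Hn; rewrite E by exact Hn; easy.
Qed.

(** Each term is replaced by its Taylor polynomial. The rates grow only like the square of the
    index, so their powers remain summable against the geometric factor, and the series of the
    coefficients and of the remainders converge. *)
Lemma series_expansion (T : nat -> R -> C) (t0 G s : R) : 0 < t0 -> 0 < s -> 0 <= G ->
  (forall K, exists L, 0 <= L /\ forall n, Bd t0 K (fun _ => G * exp (- s * INR (S n))) (L * INR (S n) ^ 2) (T n)) ->
  forall N, exists c M, forall t, 0 < t < t0 -> Cmod (CSeries (fun n => T n t) - Csum (fun n => c n * RtoC t ^ n) N)%C <= M * t ^ N.
Proof.
intros Ht0 Hs G0 H N; destruct (H N) as [L [L0 HL]].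
assert (S0 : forall j C0, ex_series (fun n => C0 * INR (S n) ^ j * exp (- s * INR (S n)))).
{ intros j C0; apply (ex_series_incr_1 (fun n => C0 * INR n ^ j * exp (- s * INR n))), ex_series_pow_exp, Hs. }
assert (LL : forall n, 0 <= L * INR (S n) ^ 2) by (intros n; apply Rmult_le_pos; [exact L0|apply pow2_ge_0]).
destruct (choice_fun _ _ (fun n (a : nat -> C) => (forall i, Cmod (a i) <= G * exp (- s * INR (S n)) * (L * INR (S n) ^ 2) ^ i) /\
  forall u, 0 <= u <= t0 ->
    Cmod (T n u - Csum (fun i => (1 * RtoC u) ^ i / RtoC (INR (fact i)) * a i) N)%C <= G * exp (- s * INR (S n)) * (2 * (L * INR (S n) ^ 2)) ^ N * u ^ N))
  as [a Ha].
{ intros n; apply Bd_taylor; [lra|apply LL|apply HL]. }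
set (A := fun i n => G * L ^ i * INR (S n) ^ (2 * i) * exp (- s * INR (S n))).
assert (HA : forall i n, Cmod (a n i) <= A i n).
{ intros i n; eapply Rle_trans; [apply Ha|]; unfold A; rewrite Rpow_mult_distr, pow_mult; right; ring. }
set (D := fun n => G * (2 * L) ^ N * INR (S n) ^ (2 * N) * exp (- s * INR (S n))).
exists (fun i => / RtoC (INR (fact i)) * CSeries (fun n => a n i))%C, (2 * Series D); intros t Ht.
set (cf := fun i => ((1 * RtoC t) ^ i / RtoC (INR (fact i)))%C).
assert (EX : forall i n, Cmod (cf i * a n i)%C <= Cmod (cf i) * A i n).
{ intros i n; rewrite Cmod_mult; apply Rmult_le_compat_l; [apply Cmod_ge_0|apply HA]. }
assert (EY : forall i, ex_series (fun n => Cmod (cf i) * A i n)).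
{ intros i; apply (ex_series_scal (V := R_NormedModule) (Cmod (cf i))), S0. }
destruct (CSeries_Csum (fun i n => cf i * a n i)%C (fun i n => Cmod (cf i) * A i n) N (fun i n _ => EX i n) (fun i _ => EY i)) as [E1 [D1 [E2 E3]]].
replace (Csum (fun n => / RtoC (INR (fact n)) * CSeries (fun n0 => a n0 n) * RtoC t ^ n)%C N)
  with (CSeries (fun n => Csum (fun i => cf i * a n i) N))%C.
2: { rewrite E1; apply Csum_ext; intros i _; rewrite (CSeries_scal (cf i) _ (A i)) by (try apply HA; apply S0).
  unfold cf, Cdiv; rewrite Cmult_1_l; ring. }
rewrite <- (CSeries_minus _ _ (fun n => G * exp (- s * INR (S n))) D1); [| | |exact E2|exact E3].
- replace (2 * Series D * t ^ N) with (2 * Series (fun n => t ^ N * D n)) by (rewrite Series_scal_l; ring).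
  apply CSeries_bound.
  + intros n; eapply Rle_trans; [apply (proj2 (Ha n) t ltac:(lra))|]; unfold D; right.
    replace (2 * (L * INR (S n) ^ 2)) with (2 * L * INR (S n) ^ 2) by ring; rewrite Rpow_mult_distr, <- pow_mult; ring.
  + apply (ex_series_scal (V := R_NormedModule) (t ^ N)), S0.
- intros n; apply (Bd_0 _ _ _ _ _ (HL n)); lra.
- apply (ex_series_ext (fun n => G * INR (S n) ^ 0 * exp (- s * INR (S n)))); [intros; rring|apply S0].
Qed.

(** * Uniform bounds for the series at a damped root of unity *)

Section Root.
(** One family for both functions: [a0] = - ze^2 and mu = 2 for phi, [a0] = ze and mu = 1 for psi,
    with eta = ze^2 in both cases. The condition a0^P = -1 keeps the denominators away from 0 as t
    -> 0. *)
Variables (P : nat) (eta a0 ze : C) (mu : R).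
Hypothesis HP : (0 < P)%nat.
Hypothesis Heta : prim eta P.
Hypothesis eta1 : Cmod eta = 1.
Hypothesis a01 : Cmod a0 = 1.
Hypothesis a0P : (a0 ^ P = - (1))%C.
Hypothesis ze1 : Cmod ze = 1.
Hypothesis Hmu : 0 <= mu <= 2.

Let cc (j : nat) : C := (- (a0 * eta ^ j))%C.
Let lam (j : nat) : R := mu + 2 * INR j.
Let x (j : nat) (t : R) : R := exp (- lam j * t).

Let x01 j t : 0 <= t -> 0 < x j t <= 1.
Proof.
intros Ht; split; [apply exp_pos|]; unfold x; rewrite <- exp_0; apply exp_abs_le; unfold lam; pose proof (pos_INR j).
assert (0 <= (mu + 2 * INR j) * t) by (apply Rmult_le_pos; lra); lra.
Qed.

Let ccmod j : Cmod (cc j) = 1.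
Proof. unfold cc; rewrite Cmod_opp, Cmod_mult, Cmod_pow, a01, eta1, pow1; ring. Qed.

Let fac_le2 (j : nat) (y : R) : 0 <= y <= 1 -> Cmod (1 + cc j * RtoC y)%C <= 2.
Proof.
intros Hy; eapply Rle_trans; [apply Cmod_triangle|]; rewrite Cmod_1, Cmod_mult, ccmod, Cmod_R, Rabs_pos_eq; lra.
Qed.

Fixpoint blk (f : nat -> C) (n : nat) : C := match n with O => RtoC 1 | S n => (blk f n * f n)%C end.

Lemma blk_bound f n : (forall j, (j < n)%nat -> Cmod (f j) <= 2) -> Cmod (blk f n) <= 2 ^ n.
Proof.
intros H; induction n as [|n IH]; [simpl; rewrite Cmod_1; lra|].
simpl; rewrite Cmod_mult, Rmult_comm; apply Rmult_le_compat; try apply Cmod_ge_0; [apply H; lia|apply IH; intros; apply H; lia].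
Qed.

Lemma blk_factor f n j : (forall j, (j < n)%nat -> Cmod (f j) <= 2) -> (j < n)%nat -> Cmod (blk f n) <= 2 ^ n * Cmod (f j).
Proof.
intros H Hj; induction n as [|n IH]; [lia|]; simpl; rewrite Cmod_mult.
assert (B := blk_bound f n ltac:(intros; apply H; lia)).
assert (0 <= 2 ^ n) by (apply pow_le; lra).
destruct (Nat.eq_dec j n) as [->|Hn].
- pose proof (Cmod_ge_0 (f n)); nra.
- specialize (IH ltac:(intros; apply H; lia) ltac:(lia)); pose proof (H n ltac:(lia)); pose proof (Cmod_ge_0 (f n)).
  pose proof (Cmod_ge_0 (blk f n)); pose proof (Cmod_ge_0 (f j)).
  apply Rle_trans with (2 ^ n * Cmod (f j) * 2); [apply Rmult_le_compat; assumption|lra].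
Qed.

Lemma blk_diff f g n e : (forall j, (j < n)%nat -> Cmod (f j) <= 2 /\ Cmod (g j) <= 2 /\ Cmod (f j - g j)%C <= e) -> 0 <= e ->
  Cmod (blk f n - blk g n)%C <= INR n * 2 ^ n * e.
Proof.
intros H He; induction n as [|n IH].
- simpl; replace (1 - 1)%C with (RtoC 0) by ring; rewrite Cmod_0; lra.
- specialize (IH ltac:(intros; apply H; lia)); destruct (H n ltac:(lia)) as [F [G D]].
  assert (B := blk_bound g n ltac:(intros; apply H; lia)).
  simpl blk; replace (blk f n * f n - blk g n * g n)%C with ((blk f n - blk g n) * f n + blk g n * (f n - g n))%C by ring.
  eapply Rle_trans; [apply Cmod_triangle|]; rewrite !Cmod_mult, S_INR.
  assert (0 <= 2 ^ n) by (apply pow_le; lra); pose proof (pos_INR n).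
  assert (A1 : Cmod (blk f n - blk g n)%C * Cmod (f n) <= INR n * 2 ^ n * e * 2) by (apply Rmult_le_compat; try apply Cmod_ge_0; assumption).
  assert (A2 : Cmod (blk g n) * Cmod (f n - g n)%C <= 2 ^ n * e) by (apply Rmult_le_compat; try apply Cmod_ge_0; assumption).
  simpl; assert (0 <= 2 ^ n * e) by (apply Rmult_le_pos; assumption).
  apply Rle_trans with (INR n * 2 ^ n * e * 2 + 2 ^ n * e); [lra|]; nra.
Qed.

(** By [qpoch_prim], P consecutive factors at one and the same y multiply to 1 - a0^P y^P = 1 + y^P
    >= 1, although single factors may be small. *)
Let full (n : nat) (y : R) : blk (fun i => 1 + cc (n + i) * RtoC y)%C P = RtoC (1 + y ^ P).
Proof.
assert (E : forall m, blk (fun i => 1 + cc (n + i) * RtoC y)%C m = qpoch (a0 * eta ^ n * RtoC y) eta m).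
{ induction m as [|m IH]; [easy|]; simpl; rewrite IH; unfold cc; rewrite Cpow_add_r; ring. }
rewrite E, (qpoch_prim _ _ _ HP Heta), !Cpow_mult_l, a0P, <- Cpow_mult_r, Nat.mul_comm, (pow_one _ _ _ (proj1 Heta)).
rewrite RtoC_plus, RtoC_pow; ring.
Qed.

(** No factor can be smaller than 2^(- P), since the block of P factors is at least 1 and every
    factor at most 2. *)
Let delta_bound (j : nat) (y : R) : 0 <= y <= 1 -> / 2 ^ P <= Cmod (1 + cc j * RtoC y)%C.
Proof.
intros Hy; assert (p2 : 0 < 2 ^ P) by (apply pow_lt; lra).
assert (F := blk_factor (fun i => 1 + cc (j + i) * RtoC y)%C P 0 ltac:(intros; apply fac_le2, Hy) HP).
cbv beta in F; rewrite full, Cmod_R, Nat.add_0_r in F.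
assert (0 <= y ^ P) by (apply pow_le; lra); rewrite Rabs_pos_eq in F by lra.
apply Rmult_le_reg_l with (2 ^ P); [exact p2|]; rewrite Rinv_r; lra.
Qed.

Let fac_nz (j : nat) (y : R) : 0 <= y <= 1 -> (1 + cc j * RtoC y <> 0)%C.
Proof.
intros Hy E; assert (D := delta_bound j y Hy); rewrite E, Cmod_0 in D.
assert (0 < / 2 ^ P) by (apply Rinv_0_lt_compat, pow_lt; lra); lra.
Qed.

Let inv_le (j : nat) (y : R) : 0 <= y <= 1 -> Cmod (/ (1 + cc j * RtoC y))%C <= 2 ^ P.
Proof.
intros Hy; rewrite Cmod_inv by (apply fac_nz, Hy).
rewrite <- (Rinv_inv (2 ^ P)); apply Rinv_le_contravar; [apply Rinv_0_lt_compat, pow_lt; lra|apply delta_bound, Hy].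
Qed.

Let R (n : nat) (t : Rdefinitions.R) : C := prodr cc lam n t.

Let R_crude n t : 0 <= t -> Cmod (R n t) <= (2 ^ P) ^ n.
Proof.
intros Ht; unfold R; induction n as [|n IH]; [simpl; rewrite Cmod_1; lra|].
simpl; rewrite Cmod_mult, Rmult_comm; apply Rmult_le_compat; try apply Cmod_ge_0; [|exact IH].
apply inv_le; destruct (x01 n t Ht); unfold x in *; lra.
Qed.

Let R_blk n i t : 0 <= t -> R (n + i) t = (R n t * / blk (fun i => 1 + cc (n + i) * RtoC (x (n + i) t)) i)%C /\
   (blk (fun i => 1 + cc (n + i) * RtoC (x (n + i) t)) i <> 0)%C.
Proof.
intros Ht; induction i as [|i [IH N]].
- split; [rewrite Nat.add_0_r; simpl; field; apply C1_neq0|simpl; apply C1_neq0].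
- rewrite Nat.add_succ_r; simpl blk.
  assert (N2 : (1 + cc (n + i) * RtoC (x (n + i) t) <> 0)%C) by (apply fac_nz; destruct (x01 (n + i) t Ht); lra).
  split; [|apply Cmult_neq_0; assumption].
  change (R (S (n + i)) t) with (R (n + i) t * / (1 + cc (n + i) * RtoC (x (n + i) t)))%C; rewrite IH; cfield.
Qed.

(** [c1] separates two regimes. For n t <= c1 every block exceeds 1 by a fixed margin: [x1] is a
    lower bound for the values of y there, and [t0] keeps the change of y within a block from using
    up more than half of x1^P. For n t > c1 the numerator exp (- n^2 t) <= exp (- (P + 1) n) beats
    the crude bound (2^P)^n <= exp (P n). *)
Let c1 := INR P + 1.
Let x1 := exp (- (2 + 2 * c1)).
Let b := ln (1 + x1 ^ P / 2).
Let Cc := INR P * 2 ^ P * (2 * INR P).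
Let t0 := Rmin 1 (x1 ^ P / 2 / Cc).

Let Ppos : 1 <= INR P.
Proof. apply (le_INR 1); lia. Qed.

Let Ccpos : 0 < Cc.
Proof. unfold Cc; assert (0 < 2 ^ P) by (apply pow_lt; lra); apply Rmult_lt_0_compat; [apply Rmult_lt_0_compat|]; lra. Qed.

Let x1pos : 0 < x1 ^ P.
Proof. apply pow_lt, exp_pos. Qed.

Let bpos : 0 < b.
Proof. unfold b; rewrite <- ln_1; apply ln_increasing; pose proof x1pos; lra. Qed.

Let t0pos : 0 < t0.
Proof. unfold t0; apply Rmin_glb_lt; [lra|]; apply Rdiv_lt_0_compat; [pose proof x1pos; lra|exact Ccpos]. Qed.

(** Comparison with the block in which y is frozen at its first value: each factor moves by at most
    2 P t, hence the product by at most Cc t. *)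
Let block_ge n t : 0 <= t <= t0 -> INR n * t <= c1 -> exp b <= Cmod (blk (fun i => 1 + cc (n + i) * RtoC (x (n + i) t)) P)%C.
Proof.
intros Ht Hn; assert (t1 : t <= 1) by (eapply Rle_trans; [apply Ht|apply Rmin_l]).
assert (Hx := x01 n t (proj1 Ht)).
set (f := fun i => (1 + cc (n + i) * RtoC (x (n + i) t))%C); set (g := fun i => (1 + cc (n + i) * RtoC (x n t))%C).
assert (Dx : forall i, (i < P)%nat -> Rabs (x (n + i) t - x n t) <= 2 * INR P * t).
{ intros i Hi; assert (INR i <= INR P) by (apply le_INR; lia); pose proof (pos_INR i).
  unfold x; replace (- lam (n + i) * t) with (- lam n * t + - (2 * INR i * t)) by (unfold lam; rewrite plus_INR; ring).
  rewrite exp_plus; fold (x n t).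
  assert (0 <= 2 * INR i * t <= 2 * INR P * t) by (split; [apply Rmult_le_pos; lra|apply Rmult_le_compat_r; lra]).
  assert (E1 : 1 + - (2 * INR i * t) <= exp (- (2 * INR i * t))).
  { destruct (Req_dec (- (2 * INR i * t)) 0) as [->|Z]; [rewrite exp_0; lra|left; apply exp_ineq1, Z]. }
  assert (E2 : exp (- (2 * INR i * t)) <= 1) by (rewrite <- exp_0; apply exp_abs_le; lra).
  rewrite Rabs_left1 by nra; nra. }
assert (D := blk_diff f g P (2 * INR P * t)).
assert (Hfg : forall j, (j < P)%nat -> Cmod (f j) <= 2 /\ Cmod (g j) <= 2 /\ Cmod (f j - g j)%C <= 2 * INR P * t).
{ intros j Hj; split; [apply fac_le2; destruct (x01 (n + j) t (proj1 Ht)); lra|split; [apply fac_le2; lra|]].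
  unfold f, g; replace (1 + cc (n + j) * RtoC (x (n + j) t) - (1 + cc (n + j) * RtoC (x n t)))%C with
    (cc (n + j) * RtoC (x (n + j) t - x n t))%C by (rewrite RtoC_minus; ring).
  rewrite Cmod_mult, ccmod, Cmod_R, Rmult_1_l; apply Dx, Hj. }
specialize (D Hfg ltac:(apply Rmult_le_pos; lra)).
assert (Fg : Cmod (blk g P) = 1 + x n t ^ P).
{ unfold g; rewrite full, Cmod_R, Rabs_pos_eq; [easy|]; assert (0 <= x n t ^ P) by (apply pow_le; lra); lra. }
assert (X1 : x1 ^ P <= x n t ^ P).
{ apply pow_incr; split; [left; apply exp_pos|]; unfold x1, x; apply exp_abs_le; unfold lam.
  assert (mu * t <= 2 * 1) by (apply Rmult_le_compat; lra); lra. }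
assert (T1 : INR P * 2 ^ P * (2 * INR P * t) <= x1 ^ P / 2).
{ replace (INR P * 2 ^ P * (2 * INR P * t)) with (Cc * t) by (unfold Cc; ring).
  apply Rle_trans with (Cc * (x1 ^ P / 2 / Cc)).
  - apply Rmult_le_compat_l; [left; exact Ccpos|]; eapply Rle_trans; [apply Ht|apply Rmin_r].
  - right; field; apply Rgt_not_eq, Ccpos. }
assert (Tr := Cmod_triangle (blk f P) (- (blk f P - blk g P))%C).
replace (blk f P + - (blk f P - blk g P))%C with (blk g P) in Tr by ring; rewrite Cmod_opp, Fg in Tr.
unfold b; rewrite exp_ln by (pose proof x1pos; lra); lra.
Qed.

Let s := Rmin 1 (b / INR P).

Let spos : 0 < s.
Proof. unfold s; apply Rmin_glb_lt; [lra|]; apply Rdiv_lt_0_compat; [exact bpos|lra]. Qed.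

Let G0 := (2 ^ P) ^ P * exp b.

Let G0pos : 1 <= G0.
Proof.
unfold G0; assert (1 <= 2 ^ P) by (apply pow_R1_Rle; lra); assert (1 <= (2 ^ P) ^ P) by (apply pow_R1_Rle; lra).
assert (1 <= exp b) by (rewrite <- exp_0; apply exp_abs_le; left; exact bpos); nra.
Qed.

(** Descent by whole blocks, each of which gains exp (- b); the constant [G0] absorbs the fewer than
    P factors that remain. *)
Let R_small t : 0 <= t <= t0 -> forall n, INR n * t <= c1 -> Cmod (R n t) <= G0 * exp (- (b / INR P) * INR n).
Proof.
intros Ht n; induction n as [n IH] using (well_founded_induction Wf_nat.lt_wf); intros Hn.
destruct (Nat.lt_ge_cases n P) as [L|L].
- eapply Rle_trans; [apply R_crude; lra|]; unfold G0; rewrite Rmult_assoc, <- exp_plus.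
  assert (A1 : (2 ^ P) ^ n <= (2 ^ P) ^ P) by (apply Rle_pow; [apply pow_R1_Rle; lra|lia]).
  assert (A2 : 1 <= exp (b + - (b / INR P) * INR n)).
  { rewrite <- exp_0; apply exp_abs_le; assert (INR n <= INR P) by (apply le_INR; lia).
    replace (b + - (b / INR P) * INR n) with (b / INR P * (INR P - INR n)) by (field; lra).
    apply Rmult_le_pos; [left; apply Rdiv_lt_0_compat; [exact bpos|lra]|lra]. }
  assert (0 < (2 ^ P) ^ P) by (apply pow_lt, pow_lt; lra); nra.
- set (m := (n - P)%nat); assert (nm : n = (m + P)%nat) by lia.
  assert (Hm : INR m * t <= c1).
  { eapply Rle_trans; [|exact Hn]; apply Rmult_le_compat_r; [lra|apply le_INR; lia]. }
  specialize (IH m ltac:(lia) Hm); destruct (R_blk m P t (proj1 Ht)) as [E N].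
  rewrite nm, E, Cmod_mult, Cmod_inv by exact N.
  assert (Bg := block_ge m t Ht Hm).
  replace (G0 * exp (- (b / INR P) * INR (m + P))) with (G0 * exp (- (b / INR P) * INR m) * / exp b).
  2: { rewrite Rmult_assoc, <- exp_Ropp, <- exp_plus; do 2 f_equal; rewrite plus_INR; field; lra. }
  apply Rmult_le_compat; [apply Cmod_ge_0|left; apply Rinv_0_lt_compat; eapply Rlt_le_trans; [apply exp_pos|exact Bg]|exact IH|].
  apply Rinv_le_contravar; [apply exp_pos|exact Bg].
Qed.

Definition rterm (n : nat) (t : Rdefinitions.R) : C :=
  (RtoC 1 * (ze ^ (n ^ 2) * RtoC (exp (- INR (n ^ 2) * t))) * prodr (fun j => - (a0 * eta ^ j)) (fun j => mu + 2 * INR j)%R n t)%C.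

Let num_mod n t : Cmod (RtoC 1 * (ze ^ (n ^ 2) * RtoC (exp (- INR (n ^ 2) * t))))%C = exp (- INR (n ^ 2) * t).
Proof. rewrite Cmult_1_l, Cmod_mult, Cmod_pow, ze1, pow1, Cmod_R, Rmult_1_l; apply Rabs_pos_eq; left; apply exp_pos. Qed.

Let rterm_small n t : 0 <= t <= t0 -> Cmod (rterm n t) <= G0 * exp (- s * INR n).
Proof.
intros Ht; unfold rterm; rewrite Cmod_mult, num_mod; fold cc lam; fold (R n t); pose proof (pos_INR n).
destruct (Rle_dec (INR n * t) c1) as [L|L].
- assert (A := R_small t Ht n L).
  assert (E : exp (- INR (n ^ 2) * t) <= 1).
  { rewrite <- exp_0; apply exp_abs_le; assert (0 <= INR (n ^ 2) * t) by (apply Rmult_le_pos; [apply pos_INR|lra]); lra. }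
  assert (F : exp (- (b / INR P) * INR n) <= exp (- s * INR n)).
  { apply exp_abs_le; assert (s <= b / INR P) by apply Rmin_r; nra. }
  pose proof (Cmod_ge_0 (R n t)); pose proof (exp_pos (- INR (n ^ 2) * t)); pose proof G0pos; nra.
- assert (A := R_crude n t (proj1 Ht)).
  assert (B1 : (2 ^ P) ^ n <= exp (INR P * INR n)).
  { rewrite <- pow_mult, <- mult_INR, <- (Rmult_1_r (INR (P * n))), exp_nat; apply pow_incr.
    pose proof (exp_ineq1 1 ltac:(lra)); lra. }
  apply Rle_trans with (exp (- INR (n ^ 2) * t) * exp (INR P * INR n)).
  { apply Rmult_le_compat_l; [left; apply exp_pos|lra]. }
  rewrite <- exp_plus; apply Rle_trans with (exp (- s * INR n)).
  + apply exp_abs_le; assert (s <= 1) by apply Rmin_l.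
    rewrite pow_INR; unfold c1 in L.
    assert (INR n * (INR P + 1) <= INR n * (INR n * t)) by (apply Rmult_le_compat_l; lra); simpl; nra.
  + pose proof G0pos; pose proof (exp_pos (- s * INR n)); nra.
Qed.

(** The rate is quadratic in n: n^2 from the numerator exp (- n^2 t), and n factors in the
    denominator with exponents up to 2 n. *)
Let rterm_Bd K : exists L, 0 <= L /\ forall n, Bd t0 K (fun u => Cmod (rterm n u)) (L * INR (S n) ^ 2) (rterm n).
Proof.
set (L := 1 + 2 ^ S K * (2 * (2 ^ P + 1))).
assert (p2 : 0 < 2 ^ P) by (apply pow_lt; lra); assert (pK : 0 < 2 ^ S K) by (apply pow_lt; lra).
assert (Q : 0 < 2 ^ S K * (2 * (2 ^ P + 1))) by (apply Rmult_lt_0_compat; lra).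
exists L; split; [unfold L; lra|]; intros n; pose proof (pos_INR n).
assert (B1 := Bd_exp t0 K (ze ^ (n ^ 2))%C (INR (n ^ 2)) 1).
assert (B2 := Bd_prodr t0 K cc lam (2 * INR (S n)) (2 ^ P) n (Rlt_le _ _ p2)).
assert (B2' : Bd t0 K (fun u => Cmod (prodr cc lam n u)) (INR n * (2 ^ S K * (2 * INR (S n) * (2 ^ P + 1)))) (prodr cc lam n)).
{ apply B2.
  - intros j u _ Hu; apply fac_nz; destruct (x01 j u (proj1 Hu)); unfold x in *; lra.
  - intros j u _ Hu; destruct (x01 j u (proj1 Hu)); fold (x j u); rewrite Cmod_mult, Cmod_mult, ccmod, Cmod_R, Rabs_pos_eq by lra.
    assert (A := inv_le j (x j u) ltac:(lra)); pose proof (Cmod_ge_0 (/ (1 + cc j * RtoC (x j u)))%C); nra.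
  - intros j Hj; unfold lam; assert (INR (S j) <= INR n) by (apply le_INR; lia); rewrite S_INR in *; pose proof (pos_INR j).
    rewrite Rabs_pos_eq; lra. }
assert (i0 : 0 <= INR n * (2 ^ S K * (2 * INR (S n) * (2 ^ P + 1)))).
{ apply Rmult_le_pos; [lra|]; apply Rmult_le_pos; [lra|]; apply Rmult_le_pos; [rewrite S_INR|]; lra. }
assert (B3 := Bd_mult t0 K _ _ _ _ _ _ (Rabs_pos (INR (n ^ 2))) i0 B1 B2').
apply (Bd_weaken t0 K _ _ _ (L * INR (S n) ^ 2)) with (3 := B3).
- pose proof (Rabs_pos (INR (n ^ 2))); split; [lra|].
  rewrite Rabs_pos_eq, pow_INR, S_INR by apply pos_INR; unfold L; simpl (_ ^ 2).
  assert (INR n * (2 ^ S K * (2 * (INR n + 1) * (2 ^ P + 1))) <= (INR n + 1) * (2 ^ S K * (2 * (INR n + 1) * (2 ^ P + 1)))).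
  { apply Rmult_le_compat_r; [|lra]; apply Rmult_le_pos; [lra|]; apply Rmult_le_pos; lra. }
  nra.
- intros u _; cbv beta; right; unfold rterm; symmetry; apply Cmod_mult.
Qed.

(** The shift j accommodates psi, whose series starts at index 1. *)
Lemma rterm_expansion (j : nat) (f : Rdefinitions.R -> C) :
  (forall t, 0 < t -> f t = CSeries (fun n => rterm (n + j) t)) -> exists d, asymp_at_0 f d.
Proof.
intros Hf; apply expansion_choice; intros N.
assert (J0 := pos_INR j).
destruct (series_expansion (fun n => rterm (n + j)) t0 (G0 * exp s) s t0pos spos) with (N := N) as [c [M HM]].
- apply Rmult_le_pos; [pose proof G0pos; lra|left; apply exp_pos].
- intros K; destruct (rterm_Bd K) as [L [L0 HL]]; exists (L * (INR j + 1) ^ 2); split; [apply Rmult_le_pos; [exact L0|apply pow2_ge_0]|].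
  intros n; pose proof (pos_INR n).
  apply (Bd_weaken t0 K _ _ _ (L * (INR j + 1) ^ 2 * INR (S n) ^ 2)) with (3 := HL (n + j)%nat).
  + rewrite !S_INR, plus_INR; split; [apply Rmult_le_pos; [exact L0|apply pow2_ge_0]|].
    rewrite Rmult_assoc, <- Rpow_mult_distr; apply Rmult_le_compat_l; [exact L0|]; apply pow_incr; nra.
  + intros u Hu; eapply Rle_trans; [apply rterm_small, Hu|].
    rewrite Rmult_assoc, <- exp_plus; apply Rmult_le_compat_l; [pose proof G0pos; lra|]; apply exp_abs_le.
    rewrite S_INR, plus_INR; pose proof spos; nra.
- exists c, M, t0; split; [exact t0pos|]; intros t Ht; rewrite Hf by lra; apply HM, Ht.
Qed.

End Root.

Lemma RtoC_exp_pow (t : R) (n : nat) : (RtoC (exp (- t)) ^ n)%C = RtoC (exp (- INR n * t)).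
Proof. rewrite <- RtoC_pow; f_equal; rewrite <- exp_nat; f_equal; ring. Qed.

Lemma qpoch_prodr (a0 eta : C) (mu t : R) (n : nat) :
  (forall j, (1 - a0 * RtoC (exp (- mu * t)) * (eta * RtoC (exp (- 2 * t))) ^ j <> 0)%C) ->
  (/ qpoch (a0 * RtoC (exp (- mu * t))) (eta * RtoC (exp (- 2 * t))) n)%C
  = prodr (fun j => - (a0 * eta ^ j))%C (fun j => mu + 2 * INR j) n t.
Proof.
intros H; induction n as [|n IH]; [simpl; field; apply C1_neq0|].
assert (N : qpoch (a0 * RtoC (exp (- mu * t))) (eta * RtoC (exp (- 2 * t))) n <> RtoC 0).
{ apply qpoch_nz; intros k _ E; apply (H k); rewrite E; ring. }
simpl; rewrite <- IH.
replace (1 + - (a0 * eta ^ n) * RtoC (exp (- (mu + 2 * INR n) * t)))%C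
  with (1 - a0 * RtoC (exp (- mu * t)) * (eta * RtoC (exp (- 2 * t))) ^ n)%C.
- specialize (H n); cfield.
- rewrite Cpow_mult_l; replace (RtoC (exp (- 2 * t)) ^ n)%C with (RtoC (exp (- (2 * INR n) * t))).
  + replace (- (mu + 2 * INR n) * t) with (- mu * t + - (2 * INR n) * t) by ring; rewrite exp_plus, RtoC_mult; ring.
  + rewrite <- RtoC_pow, <- exp_nat; do 2 f_equal; ring.
Qed.

Lemma one_minus_neq0 (z : C) : Cmod z < 1 -> (1 - z <> 0)%C.
Proof.
intros H E; assert (E2 : z = RtoC 1) by (replace z with (1 - (1 - z))%C by ring; rewrite E; ring).
rewrite E2, Cmod_1 in H; lra.
Qed.

Lemma Cmod_damped (ze : C) t : Cmod ze = 1 -> 0 < t -> Cmod (RtoC (exp (- t)) * ze)%C < 1.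
Proof.
intros H Ht; rewrite Cmod_mult, H, Cmod_R, Rmult_1_r, Rabs_pos_eq by (left; apply exp_pos).
rewrite <- exp_0; apply exp_increasing; lra.
Qed.

Lemma zeta_prim (N l : nat) : (0 < N)%nat -> Nat.gcd l N = 1%nat -> prim (zeta N (INR l)) N /\ Cmod (zeta N (INR l)) = 1.
Proof.
intros HN Hg; rewrite (zeta_pos N (INR l) _ HN eq_refl); split; [apply prim_cis; assumption|].
rewrite Cmod_Cexp, <- exp_0; f_equal; simpl; ring.
Qed.

Lemma phi_term (ze : C) (t : R) (n : nat) : Cmod ze = 1 -> 0 < t ->
  ((RtoC (exp (- t)) * ze) ^ (n ^ 2) / qpoch (- (RtoC (exp (- t)) * ze) ^ 2) ((RtoC (exp (- t)) * ze) ^ 2) n)%C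
  = rterm (ze ^ 2) (- ze ^ 2) ze 2 n t.
Proof.
intros H1 Ht.
assert (Q2 : ((RtoC (exp (- t)) * ze) ^ 2)%C = (ze ^ 2 * RtoC (exp (- 2 * t)))%C).
{ rewrite Cpow_mult_l, RtoC_exp_pow; replace (- INR 2 * t) with (-2 * t) by (simpl; ring); ring. }
assert (Qm := Cmod_damped ze t H1 Ht).
unfold rterm, Cdiv; rewrite <- qpoch_prodr; replace (- (2) * t) with (-2 * t) by ring.
- rewrite Q2; replace (- (ze ^ 2 * RtoC (exp (- 2 * t))))%C with (- ze ^ 2 * RtoC (exp (- 2 * t)))%C by ring.
  rewrite Cpow_mult_l, RtoC_exp_pow; ring.
- intros j; apply one_minus_neq0; replace (- ze ^ 2 * RtoC (exp (- 2 * t)) * (ze ^ 2 * RtoC (exp (- 2 * t))) ^ j)%C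
   with (- ((RtoC (exp (- t)) * ze) ^ (2 * S j)))%C.
  + rewrite Cmod_opp, Cmod_pow; apply pow_lt_1_compat; [split; [apply Cmod_ge_0|exact Qm]|lia].
  + rewrite Cpow_mult_r, Q2, Cpow_S; ring.
Qed.

Lemma phi_damped (ze : C) (t : R) : Cmod ze = 1 -> 0 < t ->
  phi (RtoC (exp (- t)) * ze)%C = CSeries (fun n => rterm (ze ^ 2) (- ze ^ 2) ze 2 (n + 0) t).
Proof.
intros H1 Ht; assert (Qm := Cmod_damped ze t H1 Ht).
unfold phi; destruct (Rlt_dec _ 1) as [_|X]; [|contradiction].
apply CSeries_ext; intros n; rewrite Nat.add_0_r; apply phi_term; assumption.
Qed.

Lemma psi_damped (ze : C) (t : R) : Cmod ze = 1 -> 0 < t ->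
  psi (RtoC (exp (- t)) * ze)%C = CSeries (fun n => rterm (ze ^ 2) ze ze 1 (n + 1) t).
Proof.
intros H1 Ht; assert (Qm := Cmod_damped ze t H1 Ht).
assert (Q2 : ((RtoC (exp (- t)) * ze) ^ 2)%C = (ze ^ 2 * RtoC (exp (- 2 * t)))%C).
{ rewrite Cpow_mult_l, RtoC_exp_pow; replace (- INR 2 * t) with (-2 * t) by (simpl; ring); ring. }
assert (Q1 : (RtoC (exp (- t)) * ze)%C = (ze * RtoC (exp (- (1) * t)))%C).
{ replace (- (1) * t) with (- t) by ring; ring. }
unfold psi; destruct (Rlt_dec _ 1) as [_|X]; [|contradiction].
apply CSeries_ext; intros n; unfold rterm, Cdiv; rewrite <- qpoch_prodr.
- rewrite Cpow_mult_l, RtoC_exp_pow, Q2, Q1; ring.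
- intros j; apply one_minus_neq0; rewrite <- Q1, <- Q2, <- Cpow_mult_r, <- Cpow_S, Cmod_pow.
  apply pow_lt_1_compat; [split; [apply Cmod_ge_0|exact Qm]|lia].
Qed.

(** Since 2 is invertible modulo 2 k + 1, ze^2 is again primitive of that order, and a0 = - ze^2
    satisfies a0^P = -1 because P is odd. *)
Lemma phi_expansion_root (k l : nat) : Nat.gcd l (2 * k + 1) = 1%nat ->
  exists d, asymp_at_0 (fun t => phi (RtoC (exp (- t)) * zeta (2 * k + 1) (INR l))%C) d.
Proof.
intros Hg; destruct (zeta_prim (2 * k + 1) l ltac:(lia) Hg) as [[E1 E2] Z1].
set (ze := zeta (2 * k + 1) (INR l)) in *.
assert (Z2 : Cmod (ze ^ 2)%C = 1) by (rewrite Cmod_pow, Z1; apply pow1).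
apply (rterm_expansion (2 * k + 1) (ze ^ 2)%C (- ze ^ 2)%C ze 2) with (j := 0%nat); try assumption; try lra; try lia.
- split; [rewrite <- Cpow_mult_r, Nat.mul_comm; apply pow_one, E1|].
  intros j Hj E; rewrite <- Cpow_mult_r in E.
  destruct (Nat.lt_ge_cases (2 * j) (2 * k + 1)) as [L|L]; [apply (E2 (2 * j)%nat); [lia|exact E]|].
  apply (E2 (2 * j - (2 * k + 1))%nat); [lia|].
  replace (2 * j)%nat with ((2 * k + 1) + (2 * j - (2 * k + 1)))%nat in E by lia.
  rewrite Cpow_add_r, E1, Cmult_1_l in E; exact E.
- rewrite Cmod_opp; exact Z2.
- replace (- ze ^ 2)%C with (- (1) * ze ^ 2)%C by ring; rewrite Cpow_mult_l, Cm1_pow_odd, <- Cpow_mult_r, Nat.mul_comm, (pow_one _ _ _ E1); ring.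
- intros t Ht; apply phi_damped; assumption.
Qed.

(** Here ze^2 has order P = 2 k, and ze^(2 k), a square root of 1 different from 1, is -1. *)
Lemma psi_expansion_root (k l : nat) : (1 <= k)%nat -> Nat.gcd l (4 * k) = 1%nat ->
  exists d, asymp_at_0 (fun t => psi (RtoC (exp (- t)) * zeta (4 * k) (INR l))%C) d.
Proof.
intros Hk Hg; destruct (zeta_prim (4 * k) l ltac:(lia) Hg) as [[E1 E2] Z1].
set (ze := zeta (4 * k) (INR l)) in *.
apply (rterm_expansion (2 * k) (ze ^ 2)%C ze ze 1) with (j := 1%nat); try assumption; try lra; try lia.
- split; [rewrite <- Cpow_mult_r; replace (2 * (2 * k))%nat with (4 * k)%nat by lia; exact E1|].
  intros j Hj E; rewrite <- Cpow_mult_r in E; apply (E2 (2 * j)%nat); [lia|exact E].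
- rewrite Cmod_pow, Z1; apply pow1.
- assert (E3 : ((ze ^ (2 * k) - 1) * (ze ^ (2 * k) + 1) = 0)%C).
  { replace (4 * k)%nat with (2 * k + 2 * k)%nat in E1 by lia; rewrite Cpow_add_r in E1.
    transitivity (ze ^ (2 * k) * ze ^ (2 * k) - 1)%C; [ring|rewrite E1; ring]. }
  assert (N : (ze ^ (2 * k) - 1 <> 0)%C).
  { intros F; apply (E2 (2 * k)%nat); [lia|]; replace (ze ^ (2 * k))%C with ((ze ^ (2 * k) - 1) + 1)%C by ring; rewrite F; ring. }
  transitivity (/ (ze ^ (2 * k) - 1) * ((ze ^ (2 * k) - 1) * (ze ^ (2 * k) + 1)) - 1)%C; [field; exact N|rewrite E3; ring].
- intros t Ht; apply psi_damped; assumption.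
Qed.

(** * The expansion of phi at 1 *)

Lemma pm_i_opp e : e = Ci \/ e = (- Ci)%C -> (- e)%C = Ci \/ (- e)%C = (- Ci)%C.
Proof. intros [->| ->]; [right; easy|left; ring]. Qed.

Lemma pm_i_mod e (r : R) : e = Ci \/ e = (- Ci)%C -> Cmod (1 + e * RtoC r)%C = sqrt (1 + r ^ 2).
Proof.
intros [->| ->]; unfold Cmod, Ci, RtoC, Cplus, Cmult, Copp; simpl; f_equal; ring.
Qed.

(** Since |1 + e r|^2 = 1 + r^2 for e = i and e = -i, no factor of the denominators on the imaginary
    axis is smaller than 1; this is the advantage of splitting phi into its parts at z = i and z =
    -i. *)
Lemma pm_i_ge1 e (r : R) : e = Ci \/ e = (- Ci)%C -> 1 <= Cmod (1 + e * RtoC r)%C.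
Proof.
intros H; rewrite pm_i_mod by exact H; rewrite <- sqrt_1 at 1; apply sqrt_le_1_alt; pose proof (pow2_ge_0 r); lra.
Qed.

Lemma pm_i_nz e (r : R) : e = Ci \/ e = (- Ci)%C -> (1 + e * RtoC r <> 0)%C.
Proof. intros H E; pose proof (pm_i_ge1 e r H) as G; rewrite E, Cmod_0 in G; lra. Qed.

Lemma pm_i_cmod e : e = Ci \/ e = (- Ci)%C -> Cmod e = 1.
Proof. intros [->| ->]; rewrite ?Cmod_opp; apply Cmod_Ci. Qed.

Lemma pm_i_ratio e (r : R) : e = Ci \/ e = (- Ci)%C -> Cmod (e * RtoC r * / (1 + e * RtoC r))%C <= 1.
Proof.
intros H; assert (G := pm_i_ge1 e r H).
rewrite Cmod_mult, Cmod_inv, Cmod_mult, (pm_i_cmod e H), Cmod_R, Rmult_1_l by (apply pm_i_nz, H).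
apply Rmult_le_reg_r with (Cmod (1 + e * RtoC r)%C); [lra|]; rewrite Rmult_assoc, Rinv_l, Rmult_1_r, Rmult_1_l by lra.
rewrite pm_i_mod by exact H; rewrite <- (sqrt_Rsqr_abs r); apply sqrt_le_1_alt; unfold Rsqr; simpl; lra.
Qed.

Lemma pm_i_ratio2 e (a b : R) : e = Ci \/ e = (- Ci)%C ->
  Cmod (e * RtoC a * RtoC b * / (1 + e * RtoC a * RtoC b))%C <= 1.
Proof. intros H; replace (e * RtoC a * RtoC b)%C with (e * RtoC (a * b))%C by (rewrite RtoC_mult; ring); apply pm_i_ratio, H. Qed.

Lemma pm_i_ne1 e (r : R) : e = Ci \/ e = (- Ci)%C -> (e * RtoC r <> 1)%C.
Proof.
intros H E; apply (pm_i_nz (- e)%C r (pm_i_opp e H)); replace (1 + - e * RtoC r)%C with (1 - e * RtoC r)%C by ring; rewrite E; ring.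
Qed.

Lemma pm_i_inv e : e = Ci \/ e = (- Ci)%C -> (/ e = - e)%C.
Proof.
intros H; assert (S := pm_i_sq e H); assert (N := pm_i_neq0 e H); rewrite RtoC_m1 in S.
transitivity (- (e * e) * / e)%C; [rewrite S; ring|field; exact N].
Qed.

Lemma inv_qpoch_prodr (a b : C) (c : nat -> C) (lam : nat -> R) (u : R) (n : nat) :
  (forall j, (1 - a * b ^ j = 1 + c j * RtoC (exp (- lam j * u)))%C) ->
  (forall j, (1 + c j * RtoC (exp (- lam j * u)) <> 0)%C) ->
  (/ qpoch a b n)%C = prodr c lam n u /\ qpoch a b n <> RtoC 0.
Proof.
intros H N; induction n as [|n [IH Z]]; [split; [simpl; field; apply C1_neq0|apply C1_neq0]|].
rewrite qpoch_S; simpl prodr; rewrite <- IH, H; split; [|apply Cmult_neq_0; [exact Z|apply N]].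
specialize (N n); cfield.
Qed.

(** The term of Y at z = e exp (- 2 u), as a smooth function of u with t fixed; the points z = e
    q^(2 j) of [mix] are u = j t. The exponent - 2 in the second product comes from q / z. *)
Definition yt (e : C) (t : R) (n : nat) (u : R) : C :=
  (RtoC (exp (- INR (n ^ 2) * t)) *
    (prodr (fun j => - e * RtoC (exp (- INR j * t))) (fun _ => 2%R) (S n) u *
     prodr (fun j => e * RtoC (exp (- INR (S j) * t))) (fun _ => (-2)%R) n u))%C.

Lemma yt_posterm e t n u : e = Ci \/ e = (- Ci)%C ->
  posterm (RtoC (exp (- t))) (e * RtoC (exp (- 2 * u)))%C n = yt e t n u.
Proof.
intros He; assert (He' := pm_i_opp e He).
assert (E0 : RtoC (exp (- 2 * u)) <> RtoC 0) by (apply RtoC_neq0, Rgt_not_eq, exp_pos).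
assert (N0 := pm_i_neq0 e He).
destruct (inv_qpoch_prodr (e * RtoC (exp (- 2 * u)))%C (RtoC (exp (- t))) (fun j => - e * RtoC (exp (- INR j * t)))%C (fun _ => 2%R) u (S n)) as [A1 A2].
{ intros j; rewrite RtoC_exp_pow; replace (- (2) * u) with (-2 * u) by ring; ring. }
{ intros j; rewrite <- Cmult_assoc, <- RtoC_mult; apply pm_i_nz, He'. }
destruct (inv_qpoch_prodr (RtoC (exp (- t)) / (e * RtoC (exp (- 2 * u))))%C (RtoC (exp (- t))) (fun j => e * RtoC (exp (- INR (S j) * t)))%C (fun _ => (-2)%R) u n) as [B1 B2].
{ intros j; rewrite RtoC_exp_pow.
  replace (RtoC (exp (- t)) / (e * RtoC (exp (-2 * u))))%C with (/ e * RtoC (exp (- t) * exp (2 * u)))%C.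
  2: { replace (exp (2 * u)) with (/ exp (-2 * u)) by (rewrite <- exp_Ropp; f_equal; ring).
    rewrite RtoC_mult, RtoC_inv by (apply Rgt_not_eq, exp_pos); field; split; assumption. }
  rewrite (pm_i_inv e He), <- Cmult_assoc, <- Cmult_assoc, <- !RtoC_mult.
  replace (exp (- t) * exp (2 * u) * exp (- INR j * t)) with (exp (- INR (S j) * t) * exp (- -2 * u)); [ring|].
  rewrite <- !exp_plus; f_equal; rewrite S_INR; ring. }
{ intros j; rewrite <- Cmult_assoc, <- RtoC_mult; apply pm_i_nz, He. }
unfold posterm, yt; rewrite <- A1, <- B1, RtoC_exp_pow; field; split; assumption.
Qed.

Lemma prodr_le (c : nat -> C) (lam : nat -> R) (u : R) (b : R) n : 0 < b ->
  (forall j, (j < n)%nat -> b <= Cmod (1 + c j * RtoC (exp (- lam j * u)))%C) -> Cmod (prodr c lam n u) <= (/ b) ^ n.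
Proof.
intros Hb H; induction n as [|n IH]; [simpl; rewrite Cmod_1; lra|].
assert (N : (1 + c n * RtoC (exp (- lam n * u)) <> 0)%C).
{ intros E; specialize (H n ltac:(lia)); rewrite E, Cmod_0 in H; lra. }
simpl; rewrite Cmod_mult, Cmod_inv, Rmult_comm by exact N.
apply Rmult_le_compat; [left; apply Rinv_0_lt_compat; specialize (H n ltac:(lia)); lra|apply Cmod_ge_0| |apply IH; intros; apply H; lia].
apply Rinv_le_contravar; [exact Hb|apply H; lia].
Qed.

Lemma prodr_le1 (c : nat -> C) (lam : nat -> R) (u : R) n :
  (forall j, (j < n)%nat -> 1 <= Cmod (1 + c j * RtoC (exp (- lam j * u)))%C) -> Cmod (prodr c lam n u) <= 1.
Proof. intros H; eapply Rle_trans; [apply (prodr_le c lam u 1 n Rlt_0_1 H)|rewrite Rinv_1, pow1; lra]. Qed.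

Lemma yt_factors e t u : e = Ci \/ e = (- Ci)%C ->
  (forall n, Cmod (prodr (fun j => - e * RtoC (exp (- INR j * t)))%C (fun _ => 2%R) n u) <= 1) /\
  (forall n, Cmod (prodr (fun j => e * RtoC (exp (- INR (S j) * t)))%C (fun _ => (-2)%R) n u) <= 1).
Proof.
intros He; split; intros n; apply prodr_le1; intros j _; rewrite <- Cmult_assoc, <- RtoC_mult; apply pm_i_ge1;
  [apply pm_i_opp, He|exact He].
Qed.

Lemma yt_le e t n u : e = Ci \/ e = (- Ci)%C -> Cmod (yt e t n u) <= exp (- INR (n ^ 2) * t).
Proof.
intros He; destruct (yt_factors e t u He) as [A B]; specialize (A (S n)); specialize (B n).
unfold yt; rewrite !Cmod_mult, Cmod_R, Rabs_pos_eq by (left; apply exp_pos).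
pose proof (exp_pos (- INR (n ^ 2) * t)).
assert (Z : Cmod (prodr (fun j => - e * RtoC (exp (- INR j * t)))%C (fun _ => 2%R) (S n) u) *
  Cmod (prodr (fun j => e * RtoC (exp (- INR (S j) * t)))%C (fun _ => (-2)%R) n u) <= 1 * 1)
 by (apply Rmult_le_compat; try apply Cmod_ge_0; assumption).
nra.
Qed.

(** The smaller of two decay rates. For n t <= 1 and u <= 1 the exponents j t + 2 u are at most 3,
    so each factor of the first product has modulus at least sqrt (1 + exp (-3)^2). For n t > 1 the
    numerator is at most exp (- n). *)
Definition ys : R := Rmin 1 (ln (sqrt (1 + exp (-3) ^ 2))).

Lemma ys_base : 1 < sqrt (1 + exp (-3) ^ 2).
Proof. rewrite <- sqrt_1 at 1; apply sqrt_lt_1; pose proof (exp_pos (-3)); nra. Qed.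

Lemma ys_pos : 0 < ys.
Proof. unfold ys; apply Rmin_glb_lt; [lra|]; rewrite <- ln_1; apply ln_increasing; [lra|apply ys_base]. Qed.

Lemma yt_small e t n u : e = Ci \/ e = (- Ci)%C -> 0 < t -> 0 <= u <= 1 ->
  Cmod (yt e t n u) <= exp ys * exp (- ys * INR (S n)).
Proof.
intros He Ht Hu; rewrite <- exp_plus; assert (P := ys_pos); pose proof (pos_INR n).
replace (ys + - ys * INR (S n)) with (- ys * INR n) by (rewrite S_INR; ring).
destruct (Rle_dec (INR n * t) 1) as [L|L].
- destruct (yt_factors e t u He) as [_ B]; specialize (B n).
  assert (A := prodr_le (fun j => - e * RtoC (exp (- INR j * t)))%C (fun _ => 2%R) u (sqrt (1 + exp (-3) ^ 2)) (S n) ltac:(pose proof ys_base; lra)).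
  assert (A' : Cmod (prodr (fun j => - e * RtoC (exp (- INR j * t)))%C (fun _ => 2%R) (S n) u) <= (/ sqrt (1 + exp (-3) ^ 2)) ^ S n).
  { apply A; intros j Hj; rewrite <- Cmult_assoc, <- RtoC_mult, (pm_i_mod _ _ (pm_i_opp e He)); apply sqrt_le_1_alt.
    apply Rplus_le_compat_l, pow_incr; split; [left; apply exp_pos|]; rewrite <- exp_plus; apply exp_abs_le.
    assert (INR j <= INR n) by (apply le_INR; lia).
    assert (INR j * t <= INR n * t) by (apply Rmult_le_compat_r; lra); lra. }
  assert (Y := ys_base).
  assert (EB : (/ sqrt (1 + exp (-3) ^ 2)) ^ S n <= exp (- ys * INR n)).
  { rewrite <- (exp_ln (sqrt (1 + exp (-3) ^ 2))) by lra; rewrite <- exp_Ropp, <- exp_nat; apply exp_abs_le.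
    assert (ys <= ln (sqrt (1 + exp (-3) ^ 2))) by apply Rmin_r; rewrite S_INR.
    assert (ys * (INR n) <= ln (sqrt (1 + exp (-3) ^ 2)) * INR n) by (apply Rmult_le_compat_r; lra); nra. }
  unfold yt; rewrite !Cmod_mult, Cmod_R, Rabs_pos_eq by (left; apply exp_pos).
  assert (E1 : exp (- INR (n ^ 2) * t) <= 1).
  { rewrite <- exp_0; apply exp_abs_le; assert (0 <= INR (n ^ 2) * t) by (apply Rmult_le_pos; [apply pos_INR|lra]); lra. }
  pose proof (exp_pos (- INR (n ^ 2) * t)).
  replace (exp (- ys * INR n)) with (1 * (exp (- ys * INR n) * 1)) by ring.
  apply Rmult_le_compat; [lra|apply Rmult_le_pos; apply Cmod_ge_0|lra|].
  apply Rmult_le_compat; try apply Cmod_ge_0; [lra|exact B].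
- eapply Rle_trans; [apply yt_le, He|]; apply exp_abs_le; assert (ys <= 1) by apply Rmin_l.
  rewrite pow_INR; assert (INR n * 1 <= INR n * (INR n * t)) by (apply Rmult_le_compat_l; lra).
  assert (ys * INR n <= 1 * INR n) by (apply Rmult_le_compat_r; lra); simpl; nra.
Qed.

(** The derivatives are those in u, and the bound does not depend on t. This uniformity is what
    allows differences with step t to be estimated as t -> 0. *)
Lemma yt_Bd e t K : e = Ci \/ e = (- Ci)%C -> 0 < t -> forall n,
  Bd 1 K (fun _ => exp ys * exp (- ys * INR (S n))) (2 ^ S K * 8 * INR (S n)) (yt e t n).
Proof.
intros He Ht n; assert (pK : 0 < 2 ^ S K) by (apply pow_lt; lra); pose proof (pos_INR n).
assert (B1 := Bd_prodr 1 K (fun j => - e * RtoC (exp (- INR j * t)))%C (fun _ => 2%R) 2 1 (S n) ltac:(lra)).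
assert (B2 := Bd_prodr 1 K (fun j => e * RtoC (exp (- INR (S j) * t)))%C (fun _ => (-2)%R) 2 1 n ltac:(lra)).
assert (C1 : Bd 1 K (fun u => Cmod (prodr (fun j => - e * RtoC (exp (- INR j * t)))%C (fun _ => 2%R) (S n) u)) (INR (S n) * (2 ^ S K * (2 * (1 + 1))))
  (prodr (fun j => - e * RtoC (exp (- INR j * t)))%C (fun _ => 2%R) (S n))).
{ apply B1; intros; [rewrite <- Cmult_assoc, <- RtoC_mult; apply pm_i_nz, pm_i_opp, He| |rewrite Rabs_pos_eq; lra].
  apply pm_i_ratio2, pm_i_opp, He. }
assert (C2 : Bd 1 K (fun u => Cmod (prodr (fun j => e * RtoC (exp (- INR (S j) * t)))%C (fun _ => (-2)%R) n u)) (INR n * (2 ^ S K * (2 * (1 + 1))))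
  (prodr (fun j => e * RtoC (exp (- INR (S j) * t)))%C (fun _ => (-2)%R) n)).
{ apply B2; intros; [rewrite <- Cmult_assoc, <- RtoC_mult; apply pm_i_nz, He| |rewrite Rabs_left; lra].
  apply pm_i_ratio2, He. }
assert (l1 : 0 <= INR (S n) * (2 ^ S K * (2 * (1 + 1)))) by (apply Rmult_le_pos; [apply pos_INR|lra]).
assert (l2 : 0 <= INR n * (2 ^ S K * (2 * (1 + 1)))) by (apply Rmult_le_pos; [apply pos_INR|lra]).
assert (B3 := Bd_scal 1 K _ _ (RtoC (exp (- INR (n ^ 2) * t))) _ (Rplus_le_le_0_compat _ _ l1 l2) (Bd_mult 1 K _ _ _ _ _ _ l1 l2 C1 C2)).
apply (Bd_weaken 1 K _ _ _ (2 ^ S K * 8 * INR (S n))) with (3 := B3).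
- split; [lra|]; rewrite S_INR; nra.
- intros u Hu; cbv beta; rewrite <- !Cmod_mult; apply (yt_small e t n u He Ht Hu).
Qed.

Definition Climit (u : nat -> C) (l : C) : Prop :=
  forall eps, 0 < eps -> exists N0, forall N, (N0 <= N)%nat -> Cmod (u N - l)%C < eps.

Lemma Climit_unique u l m : Climit u l -> Climit u m -> l = m.
Proof.
intros H K; apply Ceq_minus, Cmod_eq_0, Rle_antisym; [|apply Cmod_ge_0].
apply le_epsilon; intros e He; rewrite Rplus_0_l.
destruct (H (e / 2) ltac:(lra)) as [N1 H1], (K (e / 2) ltac:(lra)) as [N2 H2].
specialize (H1 (max N1 N2) ltac:(lia)); specialize (H2 (max N1 N2) ltac:(lia)).
replace (l - m)%C with ((u (max N1 N2) - m) - (u (max N1 N2) - l))%C by ring.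
eapply Rle_trans; [apply Cmod_triangle|]; rewrite Cmod_opp; lra.
Qed.

Lemma Climit_plus u v l m : Climit u l -> Climit v m -> Climit (fun n => u n + v n)%C (l + m)%C.
Proof.
intros H K e He; destruct (H (e / 2) ltac:(lra)) as [N1 H1], (K (e / 2) ltac:(lra)) as [N2 H2].
exists (max N1 N2); intros N HN; specialize (H1 N ltac:(lia)); specialize (H2 N ltac:(lia)).
replace (u N + v N - (l + m))%C with ((u N - l) + (v N - m))%C by ring.
eapply Rle_lt_trans; [apply Cmod_triangle|lra].
Qed.

Lemma Climit_scal c u l : Climit u l -> Climit (fun n => c * u n)%C (c * l)%C.
Proof.
intros H e He; pose proof (Cmod_ge_0 c).
destruct (H (e / (Cmod c + 1)) ltac:(apply Rdiv_lt_0_compat; lra)) as [N1 H1]; exists N1; intros N HN; specialize (H1 N HN).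
replace (c * u N - c * l)%C with (c * (u N - l))%C by ring; rewrite Cmod_mult.
apply (Rmult_lt_compat_l (Cmod c + 1)) in H1; [|lra].
replace ((Cmod c + 1) * (e / (Cmod c + 1))) with e in H1 by (field; lra).
pose proof (Cmod_ge_0 (u N - l)%C); nra.
Qed.

Lemma Climit_exp u (B t : R) : 0 < t -> (forall n, Cmod (u n) <= B * exp (- t * INR n)) -> Climit u (RtoC 0).
Proof.
intros Ht H e He; destruct (exp_small t e B Ht He) as [X0 [X1 HX]].
destruct (nfloor_ex X0 X1) as [N0 [_ HN0]]; exists (S N0); intros N HN.
replace (u N - 0)%C with (u N) by ring; eapply Rle_lt_trans; [apply H|apply HX].
apply le_INR in HN; rewrite S_INR in HN; lra.
Qed.

(** * The difference equation of the series at q = e^(-t) *)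

Section Real.
Variable t : R.
Hypothesis Ht : 0 < t.
Let q : C := RtoC (exp (- t)).
Let Y (z : C) : C := CSeries (posterm q z).

Let qpow n : (q ^ n)%C = RtoC (exp (- INR n * t)).
Proof. apply RtoC_exp_pow. Qed.

Let zform e j : (e * q ^ j)%C = (e * RtoC (exp (- 2 * (INR j * t / 2))))%C.
Proof. rewrite qpow; do 3 f_equal; field. Qed.

Let exs : ex_series (fun n => 1 * INR n ^ 0 * exp (- t * INR n)).
Proof. apply ex_series_pow_exp, Ht. Qed.

Let yt_dom e u n : e = Ci \/ e = (- Ci)%C -> Cmod (yt e t n u) <= 1 * INR n ^ 0 * exp (- t * INR n).
Proof.
intros He; eapply Rle_trans; [apply yt_le, He|]; simpl (INR n ^ 0); rewrite !Rmult_1_l; apply exp_abs_le.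
assert (INR n <= INR (n ^ 2)) by (apply le_INR; simpl; nia); nra.
Qed.

Let Yseries e j : e = Ci \/ e = (- Ci)%C -> Climit (fun N => Csum (posterm q (e * q ^ j)) N) (Y (e * q ^ j)%C).
Proof.
intros He; unfold Y, Climit; refine (CSeries_lim _ (fun n => 1 * INR n ^ 0 * exp (- t * INR n)) _ exs).
intros n; rewrite zform; unfold q; rewrite yt_posterm by exact He; apply yt_dom, He.
Qed.

(** The limit N -> infinity of [possum_shift]: the boundary term is a bounded multiple of a term of
    a convergent series. *)
Lemma Y_shift e j : e = Ci \/ e = (- Ci)%C ->
  Y (q * (e * q ^ j)) = (1 * (1 - q * (e * q ^ j) ^ 2) - q * (e * q ^ j) ^ 3 * Y (e * q ^ j))%C.
Proof.
intros He; assert (N0 := pm_i_neq0 e He); assert (He' := pm_i_opp e He).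
assert (q0 : q <> RtoC 0) by (apply RtoC_neq0, Rgt_not_eq, exp_pos).
assert (z0 : (e * q ^ j <> 0)%C) by (apply Cmult_neq_0; [exact N0|apply Cpow_nz, q0]).
assert (z1 : forall i, (e * q ^ j * q ^ i <> 1)%C).
{ intros i; rewrite !qpow, <- Cmult_assoc, <- RtoC_mult; apply pm_i_ne1, He. }
assert (z2 : forall i, (/ (e * q ^ j) * q ^ i <> 1)%C).
{ intros i; replace (/ (e * q ^ j) * q ^ i)%C with (- e * RtoC (/ exp (- INR j * t) * exp (- INR i * t)))%C; [apply pm_i_ne1, He'|].
  rewrite RtoC_mult, RtoC_inv, <- !qpow, <- (pm_i_inv e He) by (apply Rgt_not_eq, exp_pos).
  assert (q ^ j <> 0)%C by (apply Cpow_nz, q0); cfield. }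
assert (L1 := Yseries e (S j) He).
replace (e * q ^ S j)%C with (q * (e * q ^ j))%C in L1 by (rewrite Cpow_S; ring).
assert (L2 := Climit_plus _ _ _ _ L1 (Climit_scal (q * (e * q ^ j) ^ 3)%C _ _ (Yseries e j He))).
assert (L3 : Climit (fun N => (e * q ^ j - q ^ N) * posterm q (e * q ^ j) N)%C (RtoC 0)).
{ apply (Climit_exp _ 2 t Ht); intros n; rewrite Cmod_mult.
  assert (P1 : Cmod (posterm q (e * q ^ j)%C n) <= exp (- t * INR n)).
  { rewrite zform; unfold q; rewrite yt_posterm by exact He; eapply Rle_trans; [apply yt_dom, He|simpl; lra]. }
  assert (E1 : forall i, exp (- INR i * t) <= 1).
  { intros i; rewrite <- exp_0; apply exp_abs_le; assert (0 <= INR i * t) by (apply Rmult_le_pos; [apply pos_INR|lra]); lra. }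
  assert (P2 : Cmod (e * q ^ j - q ^ n)%C <= 2).
  { eapply Rle_trans; [apply Cmod_triangle|]; rewrite Cmod_opp, Cmod_mult, (pm_i_cmod e He), !qpow, !Cmod_R, !Rabs_pos_eq by (left; apply exp_pos).
    pose proof (E1 j); pose proof (E1 n); lra. }
  apply Rmult_le_compat; try apply Cmod_ge_0; assumption. }
assert (L4 := Climit_scal (1 - q * (e * q ^ j) ^ 2)%C _ _ L3).
assert (L5 : Climit (fun _ => (1 - q * (e * q ^ j) ^ 2)%C) (1 - q * (e * q ^ j) ^ 2)%C).
{ intros eps He2; exists 0%nat; intros N _; match goal with |- Cmod ?x < _ => replace x with (RtoC 0) by ring end; rewrite Cmod_0; exact He2. }
assert (L6 := Climit_plus _ _ _ _ L5 L4).
assert (E : (Y (q * (e * q ^ j)) + q * (e * q ^ j) ^ 3 * Y (e * q ^ j) = 1 - q * (e * q ^ j) ^ 2 + (1 - q * (e * q ^ j) ^ 2) * 0)%C).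
{ apply (Climit_unique (fun N => Csum (posterm q (q * (e * q ^ j))) N + q * (e * q ^ j) ^ 3 * Csum (posterm q (e * q ^ j)) N)%C); [exact L2|].
  intros eps He2; destruct (L6 eps He2) as [M0 HM]; exists M0; intros N HN; specialize (HM N HN); cbv beta in HM |- *.
  rewrite (possum_shift q _ N q0 z0 z1 z2).
  replace ((1 - q * (e * q ^ j) ^ 2) * (1 + (e * q ^ j - q ^ N) * posterm q (e * q ^ j) N))%C with
   (1 - q * (e * q ^ j) ^ 2 + (1 - q * (e * q ^ j) ^ 2) * ((e * q ^ j - q ^ N) * posterm q (e * q ^ j) N))%C by ring; exact HM. }
transitivity ((Y (q * (e * q ^ j)) + q * (e * q ^ j) ^ 3 * Y (e * q ^ j)) - q * (e * q ^ j) ^ 3 * Y (e * q ^ j))%C; [ring|].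
rewrite E; ring.
Qed.

Definition Yt (t : R) (n : nat) (u : R) : C := (/ 2 * ((1 - Ci) * yt Ci t n u + (1 + Ci) * yt (- Ci)%C t n u))%C.
Definition Ufun (t : R) (u : R) : C := CSeries (fun n => Yt t n u).

Lemma Ufun_mix j : Ufun t (INR j * t) = mix Y q j.
Proof.
unfold Ufun, mix, Yt.
assert (P1 : Ci = Ci \/ Ci = (- Ci)%C) by (left; easy); assert (P2 : (- Ci)%C = Ci \/ (- Ci)%C = (- Ci)%C) by (right; easy).
assert (D1 := fun u n => yt_dom Ci u n P1); assert (D2 := fun u n => yt_dom (- Ci)%C u n P2).
assert (EY : forall e, e = Ci \/ e = (- Ci)%C -> Y (e * q ^ (2 * j))%C = CSeries (fun n => yt e t n (INR j * t))).
{ intros e He; unfold Y; apply CSeries_ext; intros n; rewrite zform; unfold q; rewrite yt_posterm by exact He.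
  f_equal; rewrite mult_INR; simpl (INR 2); field. }
rewrite (EY Ci P1), (EY (- Ci)%C P2).
assert (S1 : forall c e, e = Ci \/ e = (- Ci)%C -> forall n, Cmod (c * yt e t n (INR j * t))%C <= Cmod c * (1 * INR n ^ 0 * exp (- t * INR n))).
{ intros c e He n; rewrite Cmod_mult; apply Rmult_le_compat_l; [apply Cmod_ge_0|apply yt_dom, He]. }
assert (X1 : forall c : R, ex_series (fun n => c * (1 * INR n ^ 0 * exp (- t * INR n)))).
{ intros c; apply (ex_series_scal (V := R_NormedModule) c), exs. }
rewrite (CSeries_scal (/ 2)%C (fun n => (1 - Ci) * yt Ci t n (INR j * t) + (1 + Ci) * yt (- Ci) t n (INR j * t))%C
  (fun n => Cmod (1 - Ci)%C * (1 * INR n ^ 0 * exp (- t * INR n)) + Cmod (1 + Ci)%C * (1 * INR n ^ 0 * exp (- t * INR n)))).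
- f_equal; rewrite (CSeries_plus _ _ _ _ (S1 (1 - Ci)%C Ci P1) (X1 _) (S1 (1 + Ci)%C (- Ci)%C P2) (X1 _)).
  f_equal; [exact (CSeries_scal _ _ _ (D1 (INR j * t)) exs)|exact (CSeries_scal _ _ _ (D2 (INR j * t)) exs)].
- intros n; eapply Rle_trans; [apply Cmod_triangle|]; apply Rplus_le_compat; apply S1; assumption.
- apply (ex_series_plus (fun n => Cmod (1 - Ci)%C * (1 * INR n ^ 0 * exp (- t * INR n)))); apply X1.
Qed.

Lemma Ufun_rec j : Ufun t (INR (S j) * t) =
  (1 + q ^ (4 * j + 3) + q ^ (6 * j + 4) + q ^ (10 * j + 5) - q ^ (12 * j + 5) * Ufun t (INR j * t))%C.
Proof.
rewrite !Ufun_mix, (mix_rec Y q 1 j); [ring|].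
intros e i He; apply Y_shift, He.
Qed.

Lemma Ufun_0 : Ufun t 0 = phi q.
Proof.
unfold phi; destruct (Rlt_dec (Cmod q) 1) as [_|X].
- unfold Ufun; apply CSeries_ext; intros n; unfold Yt.
  rewrite <- (yt_posterm Ci) by (left; easy); rewrite <- (yt_posterm (- Ci)%C) by (right; easy); fold q.
  replace (RtoC (exp (- 2 * 0))) with (RtoC 1) by (rewrite Rmult_0_r, exp_0; easy).
  rewrite !Cmult_1_r; unfold posterm.
  assert (P1 : Ci = Ci \/ Ci = (- Ci)%C) by (left; easy).
  assert (I1 := pm_i_inv Ci P1).
  assert (NZ : forall e j, e = Ci \/ e = (- Ci)%C -> (1 - e * q ^ j <> 0)%C).
  { intros e j He; rewrite qpow; replace (1 - e * RtoC (exp (- INR j * t)))%C with (1 + - e * RtoC (exp (- INR j * t)))%C by ring.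
    apply pm_i_nz, pm_i_opp, He. }
  assert (NQ : forall e, e = Ci \/ e = (- Ci)%C -> qpoch (e * q) q n <> RtoC 0).
  { intros e He; apply qpoch_nz; intros k _ E; apply (NZ e (S k) He); rewrite Cpow_S, Cmult_assoc, E; ring. }
  assert (N1 := NZ Ci 0%nat P1); assert (N2 := NZ (- Ci)%C 0%nat (or_intror eq_refl)).
  assert (N3 := NQ Ci P1); assert (N4 := NQ (- Ci)%C (or_intror eq_refl)).
  rewrite !qpoch_S_l.
  replace (q / Ci)%C with (- Ci * q)%C by (unfold Cdiv; rewrite I1; ring).
  replace (q / - Ci)%C with (Ci * q)%C.
  2: { unfold Cdiv; rewrite (pm_i_inv (- Ci)%C) by (right; easy); ring. }
  rewrite <- qpoch_i.
  replace (1 - Ci * q ^ 0)%C with (1 - Ci)%C in N1 by (simpl; ring).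
  replace (1 - - Ci * q ^ 0)%C with (1 + Ci)%C in N2 by (simpl; ring).
  replace (1 - - Ci)%C with (1 + Ci)%C by ring.
  set (A := qpoch (Ci * q) q n) in *; set (B := qpoch (- Ci * q) q n) in *.
  cfield.
- exfalso; apply X; unfold q; rewrite Cmod_R, Rabs_pos_eq by (left; apply exp_pos); rewrite <- exp_0; apply exp_increasing; lra.
Qed.

End Real.

Lemma fd_bound h k (f : R -> C) B : forall u, 0 <= h -> (forall v, u <= v <= u + INR k * h -> Cmod (f v) <= B) ->
  Cmod (fd h k f u) <= 2 ^ k * B.
Proof.
induction k as [|k IH]; intros u Hh H; [simpl; rewrite Rmult_1_l; apply H; simpl; lra|].
rewrite S_INR in H; pose proof (pos_INR k); assert (0 <= INR k * h) by (apply Rmult_le_pos; lra).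
simpl; eapply Rle_trans; [apply Cmod_triangle|]; rewrite Cmod_opp.
assert (A := IH (u + h) Hh ltac:(intros v Hv; apply H; lra)); assert (C0 := IH u Hh ltac:(intros v Hv; apply H; lra)).
lra.
Qed.

Lemma fd_minus h k f g : forall u, fd h k (fun v => f v - g v)%C u = (fd h k f u - fd h k g u)%C.
Proof. induction k as [|k IH]; intros u; simpl; [easy|rewrite !IH; ring]. Qed.

Lemma fd_CSeries h k (y : nat -> R -> C) (b : nat -> R) T : 0 <= h -> ex_series b ->
  (forall n u, 0 <= u <= T -> Cmod (y n u) <= b n) -> forall u, 0 <= u -> u + INR k * h <= T ->
  fd h k (fun v => CSeries (fun n => y n v)) u = CSeries (fun n => fd h k (y n) u).
Proof.
intros Hh Eb H; induction k as [|k IH]; intros u Hu HT; [easy|].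
rewrite S_INR in HT; pose proof (pos_INR k); assert (0 <= INR k * h) by (apply Rmult_le_pos; lra).
simpl; rewrite !IH by lra; symmetry.
assert (X : ex_series (fun n => 2 ^ k * b n)) by (apply (ex_series_scal (V := R_NormedModule) (2 ^ k)), Eb).
apply (CSeries_minus _ _ (fun n => 2 ^ k * b n) (fun n => 2 ^ k * b n)); try exact X;
 intros n; apply fd_bound; try exact Hh; intros v Hv; apply H; lra.
Qed.

Lemma Ufun_fd K : exists M, forall t, 0 < t -> INR K * t <= 1 -> Cmod (fd t K (Ufun t) 0) <= M * t ^ K.
Proof.
set (A := fun n => 2 * exp ys * exp (- ys * INR (S n))).
assert (c2 : Cmod (1 - Ci)%C <= 2 /\ Cmod (1 + Ci)%C <= 2).
{ split; (eapply Rle_trans; [apply Cmod_triangle|]); rewrite ?Cmod_opp, Cmod_1, Cmod_Ci; lra. }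
assert (S0 : forall j C0, ex_series (fun n => C0 * INR (S n) ^ j * exp (- ys * INR (S n)))).
{ intros j C0; apply (ex_series_incr_1 (fun n => C0 * INR n ^ j * exp (- ys * INR n))), ex_series_pow_exp, ys_pos. }
assert (P1 : Ci = Ci \/ Ci = (- Ci)%C) by (left; easy); assert (P2 : (- Ci)%C = Ci \/ (- Ci)%C = (- Ci)%C) by (right; easy).
assert (HB : forall t, 0 < t -> forall n, Bd 1 K (fun _ => A n) (2 ^ S K * 8 * INR (S n)) (Yt t n)).
{ intros t Ht n; assert (L0 : 0 <= 2 ^ S K * 8 * INR (S n)) by (apply Rmult_le_pos; [apply Rmult_le_pos; [apply pow_le|]; lra|apply pos_INR]).
  assert (B := Bd_scal 1 K _ _ (/ 2)%C _ L0 (Bd_plus 1 K _ _ _ _ _ (Bd_scal 1 K _ _ (1 - Ci)%C _ L0 (yt_Bd Ci t K P1 Ht n))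
    (Bd_scal 1 K _ _ (1 + Ci)%C _ L0 (yt_Bd (- Ci)%C t K P2 Ht n)) L0)).
  apply (Bd_weaken 1 K _ _ _ (2 ^ S K * 8 * INR (S n))) with (3 := B); [lra|].
  intros u _; cbv beta; rewrite Cmod_inv, Cmod_R, Rabs_pos_eq by (try apply two_neq0; lra); unfold A.
  pose proof (exp_pos ys); pose proof (exp_pos (- ys * INR (S n))).
  assert (0 < exp ys * exp (- ys * INR (S n))) by (apply Rmult_lt_0_compat; assumption).
  destruct c2; nra. }
set (D := fun n => 2 * exp ys * (2 * (2 ^ S K * 8)) ^ K * INR (S n) ^ K * exp (- ys * INR (S n))).
exists (2 * Series D); intros t Ht HK.
assert (XA : ex_series A).
{ apply (ex_series_ext (fun n => 2 * exp ys * INR (S n) ^ 0 * exp (- ys * INR (S n)))); [intros; unfold A; rring|apply S0]. }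
unfold Ufun; rewrite (fd_CSeries t K (Yt t) A 1); [|lra|exact XA| |lra|lra].
2: { intros n u Hu; apply (Bd_0 _ _ _ _ _ (HB t Ht n) u Hu). }
replace (2 * Series D * t ^ K) with (2 * Series (fun n => t ^ K * D n)) by (rewrite Series_scal_l; ring).
apply CSeries_bound; [|apply (ex_series_scal (V := R_NormedModule) (t ^ K)), S0].
intros n; eapply Rle_trans.
- apply (Bd_fd K 1 (A n) (2 ^ S K * 8 * INR (S n))); [|lra|lra|lra|apply HB, Ht].
  apply Rmult_le_pos; [apply Rmult_le_pos; [apply pow_le|]; lra|apply pos_INR].
- right; unfold A, D; replace (2 * (2 ^ S K * 8 * INR (S n)) * t) with (2 * (2 ^ S K * 8) * INR (S n) * t) by ring.
  rewrite (Rpow_mult_distr _ t), (Rpow_mult_distr _ (INR (S n))); ring.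
Qed.

(* The signs alternate along the progression, so that no cancellation occurs in the K-th difference. *)
Lemma alternating_fd (f : R -> C) h (rho : nat -> R) : (forall j, 0 <= rho j) ->
  (forall j, f (INR (S j) * h)%R = (- RtoC (rho j) * f (INR j * h)%R)%C) ->
  forall K, Cmod (f 0) <= Cmod (fd h K f 0).
Proof.
intros Hr H K.
assert (Hc : exists c : nat -> R, c 0%nat = 1 /\ (forall j, 0 <= c j) /\ forall j, f (INR j * h)%R = ((- (1)) ^ j * RtoC (c j) * f 0%R)%C).
{ exists (fix c j := match j with O => 1 | S j => rho j * c j end); split; [easy|]; split.
  - induction j as [|j IH]; [lra|apply Rmult_le_pos; [apply Hr|exact IH]].
  - induction j as [|j IH]; [simpl; rewrite Rmult_0_l; ring|]; rewrite H, IH, RtoC_mult, Cpow_S; ring. }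
destruct Hc as [c [c0 [cp Hc]]].
assert (G : forall K j, exists e, c j <= e /\ fd h K f (INR j * h)%R = ((- (1)) ^ (K + j) * RtoC e * f 0%R)%C).
{ induction K0 as [|k IH]; intros j.
  - exists (c j); split; [lra|apply Hc].
  - destruct (IH j) as [e1 [A1 B1]], (IH (S j)) as [e2 [A2 B2]]; exists (e1 + e2); split; [specialize (cp (S j)); lra|].
    simpl fd; replace (INR j * h + h) with (INR (S j) * h) by (rewrite S_INR; ring); rewrite B1, B2, RtoC_plus.
    replace (k + S j)%nat with (S (k + j)) by lia; replace (S k + j)%nat with (S (k + j)) by lia; rewrite !Cpow_S; ring. }
destruct (G K 0%nat) as [e [A B]]; simpl INR in B; rewrite Rmult_0_l in B; rewrite B, !Cmod_mult, Cmod_pow, Cmod_opp, Cmod_1, pow1, Cmod_R, Rmult_1_l.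
rewrite c0 in A; rewrite Rabs_pos_eq by lra; pose proof (Cmod_ge_0 (f 0)); nra.
Qed.

(** * Gaussian integrals of hyperbolic functions *)

Lemma one_unit : unit_half 1.
Proof. split; [apply Cmod_1|simpl; lra]. Qed.

Lemma Cexp_div1 y : Cexp (RtoC y / 1)%C = RtoC (exp y).
Proof. rewrite <- Cexp_RtoC; f_equal; field; apply C1_neq0. Qed.

Lemma wt1_real tau x : wt 1 tau x = RtoC (exp (- (x ^ 2 / tau))).
Proof. unfold wt; rewrite <- Cexp_RtoC, RtoC_opp; f_equal; ring. Qed.

Lemma wt1_mod tau x : Cmod (wt 1 tau x) = exp (- (x ^ 2 / tau)).
Proof. rewrite wt1_real, Cmod_R, Rabs_pos_eq; [easy|left; apply exp_pos]. Qed.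

(** Completing the square: the exponents differ by (x - (k0 + 1) tau / 2)^2 / tau. *)
Lemma gauss_decay tau k0 x : 0 < tau -> exp (- (x ^ 2 / tau)) * exp (k0 * x) <= exp ((k0 + 1) ^ 2 * tau / 4) * exp (- (1) * x).
Proof.
intros Ht; rewrite <- !exp_plus; apply exp_abs_le.
assert (A : 0 <= (x - (k0 + 1) * tau / 2) ^ 2 / tau) by (apply Rmult_le_pos; [apply pow2_ge_0|left; apply Rinv_0_lt_compat, Ht]).
replace ((x - (k0 + 1) * tau / 2) ^ 2 / tau) with (x ^ 2 / tau - (k0 + 1) * x + (k0 + 1) ^ 2 * tau / 4) in A by (field; lra); lra.
Qed.

Lemma gauss_wdom tau k0 B (g : R -> R) : 0 < tau -> 0 <= B -> (forall x, 0 <= x -> Rabs (g x) <= B) ->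
  forall x, 0 <= x -> Cmod (wt 1 tau x) * (exp (k0 * x) * Rabs (g x)) <= B * exp ((k0 + 1) ^ 2 * tau / 4) * exp (- (1) * x).
Proof.
intros Ht HB H x Hx; rewrite wt1_mod; assert (G := gauss_decay tau k0 x Ht); specialize (H x Hx).
replace (exp (- (x ^ 2 / tau)) * (exp (k0 * x) * Rabs (g x))) with ((exp (- (x ^ 2 / tau)) * exp (k0 * x)) * Rabs (g x)) by ring.
replace (B * exp ((k0 + 1) ^ 2 * tau / 4) * exp (- (1) * x)) with (exp ((k0 + 1) ^ 2 * tau / 4) * exp (- (1) * x) * B) by ring.
apply Rmult_le_compat; [left; apply Rmult_lt_0_compat; apply exp_pos|apply Rabs_pos|exact G|exact H].
Qed.

Lemma chk_cont i kap x : continuous (fun x => chk i (kap * x)) x.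
Proof.
apply (@ex_derive_continuous R_AbsRing R_NormedModule); eexists.
apply (is_derive_comp (chk i) (fun x => kap * x) x _ kap (is_derive_chk i (kap * x))); auto_derive; [easy|ring].
Qed.

Lemma gauss_isI tau B (g : R -> R) i kap : 0 < tau -> 0 <= B -> (forall x, continuous g x) -> (forall x, 0 <= x -> Rabs (g x) <= B) ->
  isI (fun x => wt 1 tau x * RtoC (chk i (kap * x) * g x))%C (II (fun x => wt 1 tau x * RtoC (chk i (kap * x) * g x))%C).
Proof.
intros Ht HB Hc H; apply (II_correct _ (B * exp ((Rabs kap + 1) ^ 2 * tau / 4)) 1 Rlt_0_1).
- apply Ccont_mult; [apply wt_cont, Ht|]; apply Ccont_RtoC; intros x.
  apply (continuous_mult (fun x => chk i (kap * x)) g x); [apply chk_cont|apply Hc].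
- intros x Hx; rewrite Cmod_mult, Cmod_R, Rabs_mult.
  eapply Rle_trans; [|apply (gauss_wdom tau (Rabs kap) B g Ht HB H x Hx)].
  apply Rmult_le_compat_l; [apply Cmod_ge_0|]; apply Rmult_le_compat_r; [apply Rabs_pos|].
  eapply Rle_trans; [apply chk_bound|]; rewrite Rabs_mult, (Rabs_pos_eq x) by exact Hx; lra.
Qed.

Lemma isI_le f (h : R -> R) J H : isI f J -> isI (fun x => RtoC (h x)) H -> (forall x, 0 <= x -> Cmod (f x) <= h x) -> Cmod J <= Re H.
Proof.
intros HJ HH Hle; apply le_epsilon; intros e He.
destruct (HJ (e / 2) ltac:(lra)) as [X1 H1], (HH (e / 2) ltac:(lra)) as [X2 H2].
set (X := Rmax 0 (Rmax X1 X2)).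
destruct (H1 X) as [l [L1 L2]]; [eapply Rle_trans; [apply Rmax_l|apply Rmax_r]|].
destruct (H2 X) as [m [M1 M2]]; [eapply Rle_trans; [apply Rmax_r|apply Rmax_r]|].
assert (A := isCI_bound f h 0 X l (Re m) (Rmax_l _ _) (fun x Hx => Hle x (proj1 Hx)) L1 (isCI_Re _ _ _ _ M1)).
assert (B := re_le_Cmod (m - H)%C); replace (Re (m - H)%C) with (Re m - Re H) in B by (destruct m, H; simpl; ring).
pose proof (Rle_abs (Re m - Re H)).
replace J with (l - (l - J))%C by ring; eapply Rle_trans; [apply Cmod_triangle|]; rewrite Cmod_opp; lra.
Qed.

(** The constant 1 with its derivatives, packaged so that [CD_Qk] also applies to the Gaussian
    without 1 / cosh. *)
Definition gau (k : nat) (x : R) : R := match k with O => 1 | S _ => 0 end.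

Definition GG (tau : R) : C := II (fun x => wt 1 tau x).

Lemma gau_der k x : is_derive (gau k) x (gau (S k) x).
Proof. destruct k; apply @is_derive_const. Qed.

Lemma gau_odd k : gau (2 * k + 1) 0 = 0.
Proof. rewrite Nat.add_1_r; easy. Qed.

Lemma gau_le k x : Rabs (gau k x) <= 1.
Proof. destruct k; simpl; [rewrite Rabs_R1|rewrite Rabs_R0]; lra. Qed.

(** By [CD_Qk] the derivative in kap is an integral against the derivative of the constant 1, hence
    0. This evaluates the Gaussian integral of cosh (kap x) in terms of the Gaussian mass. *)
Lemma gauss_const tau kap : 0 < tau -> 0 <= kap -> Qk 1 tau gau 0 kap = GG tau.
Proof.
intros Ht Hk; rewrite (CD_const_fun (Qk 1 tau gau 0) 0 kap Hk).
- unfold Qk, GG; replace (0 ^ 2 * tau / 4) with 0 by field; rewrite Cexp_opp, Cexp_div1, exp_0.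
  transitivity (1 * II (fun x => wt 1 tau x * RtoC (chk 0 (0 * x) * gau 0 x)))%C; [f_equal; field; apply C1_neq0|]; rewrite Cmult_1_l; f_equal.
  apply functional_extensionality; intros x; unfold chk; simpl; rewrite Rmult_0_l, cosh_0, Rmult_1_r; ring.
- intros x Hx; eapply CD_eq.
  + apply (CD_Qk 1 tau (kap + 1) 1 gau one_unit Ht Rlt_0_1 gau_der gau_odd); [|lra].
    intros k; exists (1 * exp ((kap + 1 + 1) ^ 2 * tau / 4)); split; [left; rewrite Rmult_1_l; apply exp_pos|].
    apply gauss_wdom; [exact Ht|lra|intros; apply gau_le].
  + unfold Qk; replace (II _) with (RtoC 0); [ring|]; symmetry; apply isI_II.
    apply (isI_ext (fun _ => RtoC 0)); [|exact isI_0]; intros y _; simpl; rewrite Rmult_0_r; ring.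
Qed.

Lemma gauss_cosh tau kap : 0 < tau -> 0 <= kap ->
  isI (fun x => wt 1 tau x * RtoC (cosh (kap * x)))%C (RtoC (exp (kap ^ 2 * tau / 4)) * GG tau)%C.
Proof.
intros Ht Hk.
assert (H := gauss_isI tau 1 (gau 0) 0 kap Ht Rle_0_1 (fun x => continuous_const 1 x) (fun x _ => gau_le 0 x)).
rewrite <- (gauss_const tau kap Ht Hk); unfold Qk.
rewrite Cexp_opp, Cexp_div1, Cmult_assoc, Cinv_r, Cmult_1_l by (apply RtoC_neq0, Rgt_not_eq, exp_pos).
eapply isI_ext; [|exact H]; intros x _; simpl; rewrite Rmult_1_r; easy.
Qed.

Lemma GG_eq K tau : (forall X, 0 < X -> Cmod (Phi 1 X - K)%C <= / X) -> 0 < tau -> GG tau = (RtoC (sqrt tau) * K)%C.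
Proof.
intros HK Ht; apply isI_II; intros e He; assert (S := sqrt_lt_R0 tau Ht).
exists (tau / e + 1); intros X HX; exists (CI (wt 1 tau) 0 X); split; [apply CI_correct, wt_cont, Ht|].
assert (T0 : 0 < tau / e) by (apply Rdiv_lt_0_compat; assumption).
rewrite wt_prim by exact Ht.
replace (RtoC (sqrt tau) * Phi 1 (X / sqrt tau) - RtoC (sqrt tau) * K)%C with (RtoC (sqrt tau) * (Phi 1 (X / sqrt tau) - K))%C by ring.
rewrite Cmod_mult, Cmod_R, Rabs_pos_eq by lra.
apply Rle_lt_trans with (sqrt tau * / (X / sqrt tau)); [apply Rmult_le_compat_l; [lra|apply HK, Rdiv_lt_0_compat; lra]|].
replace (sqrt tau * / (X / sqrt tau)) with (sqrt tau * sqrt tau / X) by (field; split; lra).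
rewrite sqrt_sqrt by lra; apply Rmult_lt_reg_r with X; [lra|]; replace (tau / X * X) with tau by (field; lra).
apply Rlt_le_trans with (e * (tau / e + 1)); [replace (e * (tau / e + 1)) with (tau + e) by (field; lra); lra|apply Rmult_le_compat_l; lra].
Qed.

Lemma sechd_bounded K : exists B, 0 <= B /\ forall k x, (k <= K)%nat -> 0 <= x -> Rabs (sechd k x) <= B.
Proof.
assert (G : forall k, exists B, 0 <= B /\ forall x, 0 <= x -> Rabs (sechd k x) <= B).
{ intros k; destruct (sechd_dom k) as [B HB]; assert (B0 := dominated_pos _ _ _ HB); exists B; split; [exact B0|]; intros x Hx.
  specialize (HB x Hx); cbv beta in HB; rewrite Cmod_R in HB; eapply Rle_trans; [exact HB|].
  assert (exp (- (1) * x) <= 1) by (replace (- (1) * x) with (- x) by ring; rewrite <- exp_0; apply exp_abs_le; lra); nra. }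
induction K as [|K [B [B0 HB]]].
- destruct (G 0%nat) as [B [B0 HB]]; exists B; split; [exact B0|]; intros k x Hk; replace k with 0%nat by lia; apply HB.
- destruct (G (S K)) as [B' [B0' HB']]; exists (B + B'); split; [lra|]; intros k x Hk Hx.
  destruct (Nat.eq_dec k (S K)) as [->|]; [specialize (HB' x Hx); lra|specialize (HB k x ltac:(lia) Hx); lra].
Qed.

Lemma sechd_cont k x : continuous (sechd k) x.
Proof. apply (@ex_derive_continuous R_AbsRing R_NormedModule); eexists; apply sechd_der. Qed.

Lemma chk_le_cosh k y : Rabs (chk k y) <= cosh y.
Proof.
pose proof (exp_pos y); pose proof (exp_pos (- y)); unfold chk, cosh, sinh; destruct (Nat.even k); apply Rabs_le; lra.
Qed.

Lemma cosh_abs y : cosh (Rabs y) = cosh y.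
Proof.
unfold Rabs; destruct (Rcase_abs y); [|easy]; unfold cosh; rewrite Ropp_involutive; field.
Qed.

(** Since |chk k| <= cosh, the integral is at most B exp (kap^2 tau / 4) times the Gaussian mass,
    and the prefactor of [Qk] removes exactly this exponential. The bound is therefore uniform in
    kap, as required: kap = 2 u / t + b / 6 grows without limit as t -> 0. *)
Lemma Qk_bound tau B k kap : 0 < tau -> 0 <= B -> (forall x, 0 <= x -> Rabs (sechd k x) <= B) ->
  Cmod (Qk 1 tau sechd k kap) <= B * Cmod (GG tau).
Proof.
intros Ht HB H.
assert (I1 := gauss_isI tau B (sechd k) k kap Ht HB (sechd_cont k) H).
assert (I2 := isI_scal (RtoC B) _ _ (gauss_cosh tau (Rabs kap) Ht (Rabs_pos kap))).
assert (I3 : isI (fun x => RtoC (B * (exp (- (x ^ 2 / tau)) * cosh (Rabs kap * x)))) (RtoC B * (RtoC (exp (Rabs kap ^ 2 * tau / 4)) * GG tau))%C).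
{ eapply isI_ext; [|exact I2]; intros x _; cbv beta; rewrite wt1_real, !RtoC_mult; easy. }
assert (A := isI_le _ _ _ _ I1 I3).
assert (A' : Cmod (II (fun x => wt 1 tau x * RtoC (chk k (kap * x) * sechd k x))%C) <= B * (exp (kap ^ 2 * tau / 4) * Cmod (GG tau))).
{ eapply Rle_trans; [apply A|].
  - intros x Hx; rewrite Cmod_mult, wt1_mod, Cmod_R, Rabs_mult.
    replace (cosh (Rabs kap * x)) with (cosh (kap * x)).
    2: { rewrite <- (cosh_abs (kap * x)), Rabs_mult, (Rabs_pos_eq x) by exact Hx; easy. }
    assert (C1 := chk_le_cosh k (kap * x)); specialize (H x Hx); pose proof (exp_pos (- (x ^ 2 / tau))).
    replace (B * (exp (- (x ^ 2 / tau)) * cosh (kap * x))) with (exp (- (x ^ 2 / tau)) * (cosh (kap * x) * B)) by ring.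
    apply Rmult_le_compat_l; [lra|]; apply Rmult_le_compat; try apply Rabs_pos; assumption.
  - eapply Rle_trans; [apply Rle_abs|]; eapply Rle_trans; [apply re_le_Cmod|].
    rewrite !Cmod_mult, !Cmod_R, pow2_abs, (Rabs_pos_eq B), (Rabs_pos_eq (exp _)) by (try (left; apply exp_pos); exact HB); lra. }
unfold Qk; rewrite Cmod_mult, Cexp_opp, Cexp_div1, <- RtoC_inv, Cmod_R by (apply Rgt_not_eq, exp_pos).
pose proof (exp_pos (kap ^ 2 * tau / 4)).
rewrite Rabs_pos_eq by (left; apply Rinv_0_lt_compat; lra).
apply Rmult_le_reg_l with (exp (kap ^ 2 * tau / 4)); [lra|].
rewrite <- Rmult_assoc, Rinv_r, Rmult_1_l by lra; lra.
Qed.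

Definition IC (tau kap : R) : C := II (fun x => wt 1 tau x * RtoC (cosh (kap * x) * sech x))%C.

Lemma IC_Qk tau kap : IC tau kap = (RtoC (exp (kap ^ 2 * tau / 4)) * Qk 1 tau sechd 0 kap)%C.
Proof. unfold IC; rewrite cosh_weight_Qk by apply C1_neq0; rewrite Cexp_div1; easy. Qed.

(** The sum of the two hyperbolic cosines is 2 cosh (kap x) cosh x, so 1 / cosh x cancels and a pure
    Gaussian integral is left. *)
Lemma IC_shift tau kap : 0 < tau -> 0 <= kap ->
  (IC tau (kap + 1) + IC tau (kap - 1) = 2 * RtoC (exp (kap ^ 2 * tau / 4)) * GG tau)%C.
Proof.
intros Ht Hk; destruct (sechd_bounded 0) as [B [B0 HB]].
assert (G : forall k, isI (fun x => wt 1 tau x * RtoC (cosh (k * x) * sech x))%C (IC tau k)).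
{ intros k; exact (gauss_isI tau B (sechd 0) 0 k Ht B0 (sechd_cont 0) (fun x Hx => HB 0%nat x (le_n _) Hx)). }
assert (I1 := isI_plus _ _ _ _ (G (kap + 1)) (G (kap - 1))).
assert (I2 := isI_scal 2%C _ _ (gauss_cosh tau kap Ht Hk)).
rewrite <- Cmult_assoc; apply (isI_unique _ _ _ I1); eapply isI_ext; [|exact I2].
intros x _; cbv beta; rewrite <- Cmult_plus_distr_l, <- RtoC_plus.
replace (cosh ((kap + 1) * x) * sech x + cosh ((kap - 1) * x) * sech x) with (2 * cosh (kap * x)); [rewrite RtoC_mult; ring|].
pose proof (cosh_pos x).
replace (2 * cosh (kap * x)) with (2 * cosh (kap * x) * cosh x * sech x) by (unfold sech; field; lra).
rewrite <- Rmult_plus_distr_r; f_equal; unfold cosh.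
replace ((kap + 1) * x) with (kap * x + x) by ring; replace ((kap - 1) * x) with (kap * x + - x) by ring.
replace (- (kap * x + x)) with (- (kap * x) + - x) by ring; replace (- (kap * x + - x)) with (- (kap * x) + x) by ring.
rewrite !exp_plus; field.
Qed.

(** At u = j t the frequency is 2 j + b / 6, and with width 6 t the term becomes exp (- (6 j^2 - j)
    t) [IC] / [GG], whose prefactor is up to sign the inverse of [nrm] at q = e^(-t). The idle
    factors 1 match the shape treated by [Bd_exp]. Division by the Gaussian mass normalises the
    integral. *)
Definition mterm (b t u : R) : C :=
  (RtoC (exp (b ^ 2 * t / 24)) * ((1 * (1 * RtoC (exp (- (- (1 + b)) * u)))) * (/ GG (6 * t) * Qk 1 (6 * t) sechd 0 (2 * u / t + b / 6))))%C.

(* At u = j t this satisfies the recurrence of [Ufun_rec], by the shift relation [IC_shift] of the integrals. *)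
Definition Mfun (t u : R) : C := (RtoC (exp (- t / 24)) / 2 * (mterm 5 t u + (mterm (-5) t u + (mterm 1 t u + mterm (-1) t u))))%C.

Section MordellSide.
Variable K0 : C.
Hypothesis HK : forall X, 0 < X -> Cmod (Phi 1 X - K0)%C <= / X.

(** [K0] cancels from the quotients by [GG] once it is known to be nonzero, which its square pi / 4
    shows. *)
Let K0nz : K0 <> RtoC 0.
Proof.
intros E; assert (S := Phi_lim_sq 1 one_unit K0 HK); rewrite E, Cmult_0_l in S.
assert (P := PI_RGT_0); apply (f_equal (fun z => z * 4)%C) in S.
replace (PI / (4 * 1) * 4)%C with (RtoC PI) in S by (field; intros F; injection F; lra).
rewrite Cmult_0_l in S; injection S; lra.
Qed.

Let GGnz tau : 0 < tau -> GG tau <> RtoC 0.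
Proof.
intros Ht; rewrite (GG_eq K0 tau HK Ht); apply Cmult_neq_0; [|exact K0nz].
apply RtoC_neq0, Rgt_not_eq, sqrt_lt_R0, Ht.
Qed.

Lemma mterm_IC b t j : 0 < t -> mterm b t (INR j * t) =
  (RtoC (exp (- (6 * INR j ^ 2 - INR j) * t)) * (/ GG (6 * t) * IC (6 * t) (2 * INR j + b / 6)))%C.
Proof.
intros Ht; unfold mterm; rewrite IC_Qk.
replace (2 * (INR j * t) / t + b / 6) with (2 * INR j + b / 6) by (field; lra).
rewrite !Cmult_1_l.
transitivity (RtoC (exp (b ^ 2 * t / 24) * exp (- (- (1 + b)) * (INR j * t))) * (/ GG (6 * t) * Qk 1 (6 * t) sechd 0 (2 * INR j + b / 6)))%C;
 [rewrite RtoC_mult; ring|].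
transitivity (RtoC (exp (- (6 * INR j ^ 2 - INR j) * t) * exp ((2 * INR j + b / 6) ^ 2 * (6 * t) / 4)) * (/ GG (6 * t) * Qk 1 (6 * t) sechd 0 (2 * INR j + b / 6)))%C;
 [|rewrite RtoC_mult; ring].
rewrite <- !exp_plus; do 3 f_equal; field.
Qed.

Lemma mterm_rec b t j : 0 < t -> -5 <= b -> mterm b t (INR (S j) * t) =
  (2 * RtoC (exp (- (6 * INR (S j) ^ 2 - INR (S j)) * t + (2 * INR j + 1 + b / 6) ^ 2 * (6 * t) / 4))
   - RtoC (exp (- (12 * INR j + 5) * t)) * mterm b t (INR j * t))%C.
Proof.
intros Ht Hb; rewrite !mterm_IC by exact Ht.
assert (t6 : 0 < 6 * t) by lra; pose proof (pos_INR j).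
assert (E := IC_shift (6 * t) (2 * INR j + 1 + b / 6) t6 ltac:(lra)).
replace (2 * INR j + 1 + b / 6 + 1) with (2 * INR (S j) + b / 6) in E by (rewrite S_INR; ring).
replace (2 * INR j + 1 + b / 6 - 1) with (2 * INR j + b / 6) in E by ring.
set (a := IC (6 * t) (2 * INR (S j) + b / 6)) in *; set (c := IC (6 * t) (2 * INR j + b / 6)) in *.
replace a with ((a + c) - c)%C by ring; rewrite E, exp_plus, RtoC_mult.
replace (exp (- (6 * INR (S j) ^ 2 - INR (S j)) * t)) with (exp (- (12 * INR j + 5) * t) * exp (- (6 * INR j ^ 2 - INR j) * t)).
2: { rewrite <- exp_plus; f_equal; rewrite S_INR; ring. }
rewrite RtoC_mult; assert (Z := GGnz (6 * t) t6); field; exact Z.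
Qed.

Lemma Mfun_rec t j : 0 < t -> let q := RtoC (exp (- t)) in Mfun t (INR (S j) * t) =
  (1 + q ^ (4 * j + 3) + q ^ (6 * j + 4) + q ^ (10 * j + 5) - q ^ (12 * j + 5) * Mfun t (INR j * t))%C.
Proof.
intros Ht q; unfold Mfun; rewrite !mterm_rec by lra; unfold q; rewrite !RtoC_exp_pow.
replace (- INR (12 * j + 5) * t) with (- (12 * INR j + 5) * t) by (rewrite plus_INR, mult_INR; simpl; ring).
assert (E : forall b m, - t / 24 + (- (6 * INR (S j) ^ 2 - INR (S j)) * t + (2 * INR j + 1 + b / 6) ^ 2 * (6 * t) / 4) = m ->
  (RtoC (exp (- t / 24)) * RtoC (exp (- (6 * INR (S j) ^ 2 - INR (S j)) * t + (2 * INR j + 1 + b / 6) ^ 2 * (6 * t) / 4)))%C = RtoC (exp m)).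
{ intros b m <-; rewrite <- RtoC_mult, <- exp_plus; easy. }
(* The values b = 5, 1, -1, -5 yield the four inhomogeneous terms 1, q^(4 j + 3), q^(6 j + 4), q^(10
   j + 5); this is why both signs of b are present in [Mfun]. *)
assert (E5 := E 5 0 ltac:(rewrite S_INR; field)).
assert (E1 := E 1 (- INR (4 * j + 3) * t) ltac:(rewrite S_INR, plus_INR, mult_INR; simpl; field)).
assert (Em1 := E (-1) (- INR (6 * j + 4) * t) ltac:(rewrite S_INR, plus_INR, mult_INR; simpl; field)).
assert (Em5 := E (-5) (- INR (10 * j + 5) * t) ltac:(rewrite S_INR, plus_INR, mult_INR; simpl; field)).
rewrite <- E1, <- Em1, <- Em5; replace (RtoC 1) with (RtoC (exp 0)) by (rewrite exp_0; easy); rewrite <- E5.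
generalize (mterm 5 t (INR j * t)) (mterm (-5) t (INR j * t)) (mterm 1 t (INR j * t)) (mterm (-1) t (INR j * t)); intros m1 m2 m3 m4.
field; apply two_neq0.
Qed.

Lemma Bd_seq T (F : nat -> R -> C) (c : C) (B : R) : (forall i u, 0 <= u <= T -> CD (F i) u (c * F (S i) u)%C) ->
  forall k i, (forall j u, (i <= j <= i + k)%nat -> 0 <= u <= T -> Cmod (F j u) <= B) -> Bd T k (fun _ => B) (Cmod c) (F i).
Proof.
intros D; induction k as [|k IH]; intros i H; (split; [intros u Hu; apply H; [lia|exact Hu]|]); [exact I|].
eexists; split; [apply D|]; apply (Bd_scal T k (fun _ => B)); [apply Cmod_ge_0|]; apply IH; intros; apply H; [lia|assumption].
Qed.

(** In the variable u the frequency moves with speed 2 / t, but [CD_Qk] supplies the factor 6 t / 2: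
    differentiation in u costs 6, whatever t is. The exponential costs at most |1 + b| <= 6, which
    makes the rate 12. *)
Lemma Mfun_fd K : exists M, forall t, 0 < t <= 1 -> INR K * t <= 1 -> Cmod (fd t K (Mfun t) 0) <= M * t ^ K.
Proof.
destruct (sechd_bounded K) as [B [B0 HB]].
set (A := exp 2 * (exp 6 * B)).
assert (A0 : 0 <= A) by (unfold A; apply Rmult_le_pos; [left; apply exp_pos|apply Rmult_le_pos; [left; apply exp_pos|exact B0]]).
assert (H1 : forall t b, 0 < t <= 1 -> -5 <= b <= 5 -> Bd 1 K (fun _ => A) 12 (mterm b t)).
{ intros t b Ht Hb; assert (t6 : 0 < 6 * t) by lra; assert (Z := GGnz (6 * t) t6).
  assert (t0 : RtoC t <> RtoC 0) by (apply RtoC_neq0; lra).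
  assert (BQ : Bd 1 K (fun _ => B) (Cmod 6) (fun u => / GG (6 * t) * Qk 1 (6 * t) sechd 0 (2 * u / t + b / 6))%C).
  { apply (Bd_seq 1 (fun i u => / GG (6 * t) * Qk 1 (6 * t) sechd i (2 * u / t + b / 6)%R)%C 6%C B).
    - intros i u Hu; eapply CD_eq.
      + apply CD_scal, (CD_comp (Qk 1 (6 * t) sechd i) (fun u => 2 * u / t + b / 6) u
          (RtoC (6 * t) / (2 * 1) * Qk 1 (6 * t) sechd (S i) (2 * u / t + b / 6)%R)%C (2 / t)); [|auto_derive; [lra|field; lra]].
        set (kap := 2 * u / t + b / 6).
        apply (CD_Qk 1 (6 * t) (Rabs kap + 1) 1 sechd one_unit t6 Rlt_0_1 sechd_der sechd_odd).
        * intros k; destruct (sechd_bounded k) as [B' [B0' HB']]; exists (B' * exp ((Rabs kap + 1 + 1) ^ 2 * (6 * t) / 4)); split.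
          -- apply Rmult_le_pos; [exact B0'|left; apply exp_pos].
          -- apply gauss_wdom; [exact t6|exact B0'|intros x Hx; apply HB'; [lia|exact Hx]].
        * pose proof (Rle_abs kap); pose proof (Rle_abs (- kap)); rewrite Rabs_Ropp in *; lra.
      + unfold Rdiv; rewrite !RtoC_mult, RtoC_inv by lra; field; split; assumption.
    - intros j u Hj Hu; rewrite Cmod_mult, Cmod_inv by exact Z.
      assert (G0 : 0 < Cmod (GG (6 * t))) by (apply Cmod_gt_0, Z).
      apply Rmult_le_reg_l with (Cmod (GG (6 * t))); [exact G0|]; rewrite <- Rmult_assoc, Rinv_r, Rmult_1_l by lra.
      eapply Rle_trans; [|right; apply Rmult_comm]; apply Qk_bound; [exact t6|exact B0|intros x Hx; apply HB; [lia|exact Hx]]. }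
  assert (BE := Bd_exp 1 K 1%C (- (1 + b)) 1%C).
  assert (B2 := Bd_scal 1 K _ _ (RtoC (exp (b ^ 2 * t / 24))) _ (Rplus_le_le_0_compat _ _ (Rabs_pos (- (1 + b))) (Cmod_ge_0 6%C))
     (Bd_mult 1 K _ _ _ _ _ _ (Rabs_pos (- (1 + b))) (Cmod_ge_0 6%C) BE BQ)).
  apply (Bd_weaken 1 K _ _ _ 12) with (3 := B2).
  - rewrite Cmod_R, (Rabs_pos_eq 6) by lra; pose proof (Rabs_pos (- (1 + b))).
    assert (Rabs (- (1 + b)) <= 6) by (apply Rabs_le; lra); lra.
  - intros u Hu; rewrite !Cmult_1_l, !Cmod_R, !Rabs_pos_eq by (left; apply exp_pos); unfold A.
    apply Rmult_le_compat; [left; apply exp_pos|apply Rmult_le_pos; [left; apply exp_pos|exact B0]| |].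
    + apply exp_abs_le; assert (b ^ 2 <= 25) by nra; assert (b ^ 2 * t <= 25 * 1) by (apply Rmult_le_compat; nra); lra.
    + apply Rmult_le_compat_r; [exact B0|apply exp_abs_le]; nra. }
exists (4 * A * (2 * 12) ^ K); intros t Ht HKt.
assert (L0 : 0 <= 12) by lra.
assert (B3 := Bd_scal 1 K _ _ (RtoC (exp (- t / 24)) / 2)%C _ L0 (Bd_plus 1 K _ _ _ _ _ (H1 t 5 Ht ltac:(lra)) (Bd_plus 1 K _ _ _ _ _ (H1 t (-5) Ht ltac:(lra))
   (Bd_plus 1 K _ _ _ _ _ (H1 t 1 Ht ltac:(lra)) (H1 t (-1) Ht ltac:(lra)) L0) L0) L0)).
assert (B4 : Bd 1 K (fun _ => 4 * A) 12 (Mfun t)).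
{ apply (Bd_weaken 1 K _ _ _ 12) with (3 := B3); [lra|]; intros u _; cbv beta.
  rewrite Cmod_div, !Cmod_R, !Rabs_pos_eq by (try apply two_neq0; try (left; apply exp_pos); lra).
  assert (exp (- t / 24) <= 1) by (rewrite <- exp_0; apply exp_abs_le; lra); pose proof (exp_pos (- t / 24)); nra. }
eapply Rle_trans; [apply (Bd_fd K 1 (4 * A) 12 (Mfun t) t 0); [lra|lra|lra|lra|exact B4]|].
rewrite Rpow_mult_distr; right; ring.
Qed.

Lemma Qk_even tau kap : Qk 1 tau sechd 0 (- kap) = Qk 1 tau sechd 0 kap.
Proof.
unfold Qk; f_equal; [do 4 f_equal; replace ((- kap) ^ 2) with (kap ^ 2) by ring; easy|].
f_equal; apply functional_extensionality; intros x; do 3 f_equal; unfold chk; simpl.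
rewrite <- (cosh_abs (- kap * x)), <- (cosh_abs (kap * x)); f_equal; rewrite Ropp_mult_distr_l_reverse; apply Rabs_Ropp.
Qed.

(** At u = 0 the terms for b and - b agree, because [Qk] of order 0 is even in kap; this accounts
    for the 1/2 in [Mfun]. The prefactors leave exp (25 t / 24 - t / 24) = e^t with the frequency
    5/6 and 1 with 1/6. *)
Lemma Mfun_0 t : 0 < t -> Mfun t 0 = (RtoC (exp t) * (/ GG (6 * t) * Qk 1 (6 * t) sechd 0 (5 / 6)) + / GG (6 * t) * Qk 1 (6 * t) sechd 0 (1 / 6))%C.
Proof.
intros Ht; unfold Mfun, mterm; rewrite !Rmult_0_r, exp_0.
replace (0 / t) with 0 by (field; lra); rewrite !Rplus_0_l.
replace (-5 / 6) with (- (5 / 6)) by field; replace (-1 / 6) with (- (1 / 6)) by field; rewrite !Qk_even.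
replace ((-5) ^ 2 * t / 24) with (25 * t / 24) by field; replace (5 ^ 2 * t / 24) with (25 * t / 24) by field.
replace ((-1) ^ 2 * t / 24) with (t / 24) by field; replace (1 ^ 2 * t / 24) with (t / 24) by field.
replace (exp t) with (exp (- t / 24) * exp (25 * t / 24)) by (rewrite <- exp_plus; f_equal; field).
assert (E : (RtoC (exp (- t / 24)) * RtoC (exp (t / 24)) = 1)%C).
{ rewrite <- RtoC_mult, <- exp_plus, <- exp_0; do 2 f_equal; field. }
rewrite RtoC_mult; set (a := RtoC (exp (- t / 24))) in *; set (b := RtoC (exp (t / 24))) in *.
set (X := (/ GG (6 * t) * Qk 1 (6 * t) sechd 0 (5 / 6))%C); set (Y := (/ GG (6 * t) * Qk 1 (6 * t) sechd 0 (1 / 6))%C).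
transitivity (a * RtoC (exp (25 * t / 24)) * X + (a * b) * Y)%C; [field; apply two_neq0|rewrite E; ring].
Qed.

Lemma phi_Mfun K : exists M, forall t, 0 < t <= 1 -> INR K * t <= 1 -> Cmod (phi (RtoC (exp (- t))) - Mfun t 0)%C <= M * t ^ K.
Proof.
destruct (Ufun_fd K) as [M1 H1], (Mfun_fd K) as [M2 H2]; exists (M1 + M2); intros t Ht HKt.
rewrite <- (Ufun_0 t ltac:(lra)).
eapply Rle_trans.
- apply (alternating_fd (fun u => Ufun t u - Mfun t u)%C t (fun j => exp (- INR (12 * j + 5) * t)) (fun j => Rlt_le _ _ (exp_pos _))) with (K := K).
  intros j; rewrite (Ufun_rec t ltac:(lra)), (Mfun_rec t j ltac:(lra)), !RtoC_exp_pow; ring.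
- rewrite fd_minus; eapply Rle_trans; [apply Cmod_triangle|]; rewrite Cmod_opp.
  specialize (H1 t ltac:(lra) HKt); specialize (H2 t Ht HKt); lra.
Qed.

(** Like [smallO], but the interval may shrink with N: the comparison of phi with [Mfun] to order N
    is only available for N t <= 1. *)
Definition sO (N : nat) (f : R -> C) : Prop :=
  exists M t0, 0 < t0 <= 1 /\ 0 <= M /\ forall t, 0 < t < t0 -> Cmod (f t) <= M * t ^ N.

Lemma sO_small N f : smallO N f -> sO N f.
Proof. intros [M [M0 H]]; exists M, 1; split; [lra|]; split; [exact M0|]; intros t Ht; apply H; lra. Qed.

Lemma sO_ext N f g : (forall t, 0 < t -> f t = g t) -> sO N f -> sO N g.
Proof. intros E [M [t0 [T [M0 H]]]]; exists M, t0; split; [exact T|]; split; [exact M0|]; intros t Ht; rewrite <- E by lra; apply H, Ht. Qed.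

Lemma sO_plus N f g : sO N f -> sO N g -> sO N (fun t => f t + g t)%C.
Proof.
intros [M [t0 [T [M0 H]]]] [M' [t1 [T' [M0' H']]]]; exists (M + M'), (Rmin t0 t1).
split; [split; [apply Rmin_glb_lt; lra|eapply Rle_trans; [apply Rmin_l|lra]]|]; split; [lra|]; intros t Ht.
assert (t < t0) by (eapply Rlt_le_trans; [apply Ht|apply Rmin_l]); assert (t < t1) by (eapply Rlt_le_trans; [apply Ht|apply Rmin_r]).
specialize (H t ltac:(lra)); specialize (H' t ltac:(lra)); eapply Rle_trans; [apply Cmod_triangle|lra].
Qed.

Lemma sO_mult N c f B : (forall t, 0 < t <= 1 -> Cmod (c t) <= B) -> sO N f -> sO N (fun t => c t * f t)%C.
Proof.
intros Hc [M [t0 [T [M0 H]]]]; assert (B0 : 0 <= B) by (eapply Rle_trans; [apply Cmod_ge_0|apply (Hc 1); lra]).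
exists (B * M), t0; split; [exact T|]; split; [apply Rmult_le_pos; assumption|]; intros t Ht.
rewrite Cmod_mult, Rmult_assoc; apply Rmult_le_compat; try apply Cmod_ge_0; [apply Hc; lra|apply H, Ht].
Qed.

Definition Xreal (c : R) (a b : nat) : C :=
  RtoC ((3 / 2) ^ a * c ^ (2 * b) / (INR (fact a) * INR (fact (2 * b))) * euler_number (2 * a + 2 * b)).

Definition Sreal (c : R) (N : nat) (t : R) : C := Csum (fun a => Csum (fun b => Xreal c a b * RtoC t ^ (a + 2 * b)) N)%C N.

(** For kap = c / 3 and tau = 6 t one has tau / 4 = 3 t / 2 and kap tau / 2 = c t, which are the
    powers of 3/2 and of c = 5/2, 1/2 in a_n. *)
Lemma asy_sum_Xreal (c t : R) (N : nat) : asy_sum 1 sechd (c / 3) (6 * t) N = Sreal c N t.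
Proof.
unfold asy_sum, Sreal; rewrite Csum_swap; apply Csum_ext; intros b _; rewrite <- Csum_scal; apply Csum_ext; intros a _.
assert (T2 := two_neq0); assert (T4 : RtoC 4 <> RtoC 0) by (apply RtoC_neq0; lra).
replace (RtoC (c / 3 * (6 * t)) / (2 * 1))%C with (RtoC (c * t)).
2: { replace (c / 3 * (6 * t)) with (2 * (c * t)) by field; rewrite (RtoC_mult 2); cfield. }
replace (RtoC (6 * t) / (4 * 1))%C with (RtoC (3 / 2 * t)).
2: { replace (6 * t) with (4 * (3 / 2 * t)) by field; rewrite (RtoC_mult 4); cfield. }
unfold Xreal; replace (2 * a + 2 * b)%nat with (2 * (b + a))%nat by lia.
change (euler_number (2 * (b + a))) with (sechd (2 * (b + a)) 0).
pose proof (INR_fact_neq_0 a); pose proof (INR_fact_neq_0 (2 * b)).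
rewrite <- !RtoC_pow, <- !RtoC_div, <- !RtoC_mult by assumption; f_equal.
rewrite !Rpow_mult_distr, pow_add; field; split; assumption.
Qed.

Lemma Qk_sO (c : R) (N : nat) : 0 <= c / 3 < 1 ->
  sO N (fun t => / GG (6 * t) * Qk 1 (6 * t) sechd 0 (c / 3) - Sreal c N t)%C.
Proof.
intros Hc; destruct (cosh_weight_expansion 1 K0 sechd one_unit HK sechd_der sechd_dom sechd_odd (c / 3) N Hc) as [M HM].
exists (Cmod (/ K0)%C * (Rabs M * 6 ^ N)), (/ 6); split; [lra|]; split.
{ apply Rmult_le_pos; [apply Cmod_ge_0|apply Rmult_le_pos; [apply Rabs_pos|apply pow_le; lra]]. }
intros t Ht; specialize (HM (6 * t) ltac:(lra) ltac:(lra)); rewrite asy_sum_Xreal in HM.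
assert (S0 : RtoC (sqrt (6 * t)) <> RtoC 0) by (apply RtoC_neq0, Rgt_not_eq, sqrt_lt_R0; lra).
rewrite (GG_eq K0 (6 * t) HK) by lra.
replace (/ (RtoC (sqrt (6 * t)) * K0) * Qk 1 (6 * t) sechd 0 (c / 3) - Sreal c N t)%C
  with (/ K0 * (/ RtoC (sqrt (6 * t)) * Qk 1 (6 * t) sechd 0 (c / 3) - K0 * Sreal c N t))%C by (field; split; assumption).
rewrite Cmod_mult, Rmult_assoc; apply Rmult_le_compat_l; [apply Cmod_ge_0|].
eapply Rle_trans; [exact HM|]; rewrite Rpow_mult_distr, Rmult_assoc; apply Rmult_le_compat_r; [|apply Rle_abs].
apply Rmult_le_pos; apply pow_le; lra.
Qed.

Definition Ereal (N : nat) (t : R) : C := Csum (fun c => RtoC (/ INR (fact c)) * RtoC t ^ c)%C N.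

Lemma exp_sO N : sO N (fun t => RtoC (exp t) - Ereal N t)%C.
Proof.
exists (exp 1 * 2 ^ N), 1; split; [lra|]; split; [apply Rmult_le_pos; [left; apply exp_pos|apply pow_le; lra]|]; intros t Ht.
assert (T := CTaylor_seq (fun _ x => RtoC (exp x)) 1%C 1 (exp 1) N 0).
rewrite Rmult_assoc, <- Rpow_mult_distr.
replace (2 * t) with (2 * Cmod 1 * t) by (rewrite Cmod_1; ring).
replace (Ereal N t) with (Csum (fun n => (1 * RtoC t) ^ n / RtoC (INR (fact n)) * RtoC (exp 0)) N)%C.
- apply T; [| |lra].
  + intros _ x _; eapply CD_eq; [apply CD_RtoC, is_derive_exp|ring].
  + intros x Hx; rewrite Cmod_R, Rabs_pos_eq by (left; apply exp_pos); apply exp_abs_le; lra.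
- unfold Ereal; apply Csum_ext; intros n _; rewrite exp_0, Cmult_1_l, RtoC_inv by apply INR_fact_neq_0; unfold Cdiv; ring.
Qed.

Lemma Sreal_bounded c N : exists B, forall t, 0 < t <= 1 -> Cmod (Sreal c N t) <= B.
Proof.
assert (H : smallO 0 (Sreal c N)).
{ apply smallO_Csum; intros a _; apply smallO_Csum; intros b _; apply smallO_pow; lia. }
destruct H as [M [M0 H]]; exists M; intros t Ht; specialize (H t Ht); simpl in H; lra.
Qed.

Lemma Sreal_Ereal c N t : (Ereal N t * Sreal c N t)%C =
  Csum (fun a => Csum (fun b => Csum (fun d => (Xreal c a b * RtoC (/ INR (fact d))) * RtoC t ^ (a + 2 * b + d)) N) N)%C N.
Proof.
unfold Sreal; rewrite <- Csum_scal; apply Csum_ext; intros a _; rewrite <- Csum_scal; apply Csum_ext; intros b _.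
rewrite (Cmult_comm (Ereal N t)); unfold Ereal; rewrite <- Csum_scal; apply Csum_ext; intros d _; rewrite (Cpow_add_r _ (a + 2 * b) d); ring.
Qed.

Lemma RtoC_sum_n (f : nat -> R) n : RtoC (sum_n f n) = Csum (fun i => RtoC (f i)) (S n).
Proof.
induction n as [|n IH]; [rewrite sum_O; simpl; ring|].
rewrite sum_Sn; change (plus (sum_n f n) (f (S n))) with (sum_n f n + f (S n)); rewrite RtoC_plus, IH; easy.
Qed.

Lemma coef_a_graded n : RtoC (coef_a n / INR (fact n)) =
  (graded3 (fun a b d => Xreal (5 / 2) a b * RtoC (/ INR (fact d))) n + graded2 (Xreal (1 / 2)) n)%C.
Proof.
pose proof (INR_fact_neq_0 n).
unfold coef_a, Rdiv at 1; rewrite Rmult_comm, Rmult_plus_distr_l, RtoC_plus, !RtoC_mult, !RtoC_sum_n; f_equal.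
- rewrite <- Csum_scal; apply Csum_ext; intros a _; rewrite RtoC_sum_n, <- Csum_scal; apply Csum_ext; intros b _.
  rewrite RtoC_sum_n, <- Csum_scal; apply Csum_ext; intros c _; destruct (Nat.eqb _ n); [|ring].
  unfold Xreal; rewrite <- !RtoC_mult; f_equal.
  pose proof (INR_fact_neq_0 a); pose proof (INR_fact_neq_0 (2 * b)); pose proof (INR_fact_neq_0 c); field; repeat split; assumption.
- rewrite <- Csum_scal; apply Csum_ext; intros a _; rewrite RtoC_sum_n, <- Csum_scal; apply Csum_ext; intros b _.
  destruct (Nat.eqb _ n); [|ring].
  unfold Xreal; rewrite <- !RtoC_mult; f_equal.
  pose proof (INR_fact_neq_0 a); pose proof (INR_fact_neq_0 (2 * b)); field; repeat split; assumption.
Qed.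

(** Of the two sums in a_n the first has a third index because the frequency 5/6 comes with the
    extra factor e^t of [Mfun_0], expanded in its own power series. *)
Lemma phi_expansion_sO N :
  sO N (fun t => phi (RtoC (exp (- t))) - Csum (fun n => RtoC (coef_a n / INR (fact n)) * RtoC t ^ n) N)%C.
Proof.
destruct (phi_Mfun N) as [M HM].
assert (H0 : sO N (fun t => phi (RtoC (exp (- t))) - Mfun t 0)%C).
{ pose proof (pos_INR N); exists (Rabs M), (/ (INR N + 1)); split.
  - split; [apply Rinv_0_lt_compat; lra|]; rewrite <- Rinv_1 at 2; apply Rinv_le_contravar; lra.
  - split; [apply Rabs_pos|]; intros t [Ht1 Ht2].
    assert (L1 : (INR N + 1) * t <= 1).
    { apply Rmult_le_reg_l with (/ (INR N + 1)); [apply Rinv_0_lt_compat; lra|]; rewrite <- Rmult_assoc, Rinv_l by lra; lra. }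
    assert (0 <= INR N * t) by (apply Rmult_le_pos; lra).
    eapply Rle_trans; [apply HM; lra|]; apply Rmult_le_compat_r; [apply pow_le; lra|apply Rle_abs]. }
assert (H5 := Qk_sO (5 / 2) N ltac:(lra)); assert (H1 := Qk_sO (1 / 2) N ltac:(lra)); assert (HE := exp_sO N).
destruct (Sreal_bounded (5 / 2) N) as [B HB].
assert (e3 : forall t, 0 < t <= 1 -> Cmod (RtoC (exp t)) <= exp 1).
{ intros t Ht; rewrite Cmod_R, Rabs_pos_eq by (left; apply exp_pos); apply exp_abs_le; lra. }
assert (G3 := sO_small _ _ (graded3_expansion (fun a b d => Xreal (5 / 2) a b * RtoC (/ INR (fact d)))%C N)).
assert (G2 := sO_small _ _ (graded2_expansion (Xreal (1 / 2)) N)).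
assert (A := sO_plus _ _ _ H0 (sO_plus _ _ _ (sO_mult _ _ _ _ e3 H5) (sO_plus _ _ _ (sO_mult _ _ _ _ HB HE) (sO_plus _ _ _ H1 (sO_plus _ _ _ G3 G2))))).
revert A; apply sO_ext; intros t Ht; cbv beta.
rewrite (Csum_ext (fun n => RtoC (coef_a n / INR (fact n)) * RtoC t ^ n)%C
  (fun n => graded3 (fun a b d => Xreal (5 / 2) a b * RtoC (/ INR (fact d))) n * RtoC t ^ n + graded2 (Xreal (1 / 2)) n * RtoC t ^ n)%C)
  by (intros n _; rewrite coef_a_graded; ring).
rewrite Csum_plus, <- Sreal_Ereal, Mfun_0 by exact Ht; fold (Sreal (1 / 2) N t).
replace (5 / 2 / 3) with (5 / 6) by field; replace (1 / 2 / 3) with (1 / 6) by field; ring.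
Qed.

End MordellSide.

Lemma phi_expansion_one :
  asymp_at_0 (fun t => phi (RtoC (exp (- t)))) (fun n => RtoC (coef_a n / INR (fact n))).
Proof.
destruct (Phi_lim_exists 1 one_unit) as [K0 HK]; intros N.
destruct (phi_expansion_sO K0 HK N) as [M [t0 [T [M0 H]]]]; exists M.
exists (mkposreal t0 (proj1 T)); intros t Ht Ht0; apply H; split; [exact Ht0|].
unfold ball in Ht; simpl in Ht; unfold AbsRing_ball, abs, minus, plus, opp in Ht; simpl in Ht.
rewrite Ropp_0, Rplus_0_r, Rabs_pos_eq in Ht by lra; exact Ht.
Qed.

Theorem theorem1p1 :
  ((forall k l : nat, (1 <= k)%nat -> (1 <= l)%nat ->
      Nat.gcd l (2 * k + 1) = 1%nat ->
      exists d : nat -> C,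
        asymp_at_0 (fun t => phi (exp (- t) * zeta (2 * k + 1) (INR l))%C) d)
   /\
   (forall k l : nat, (1 <= k)%nat -> (1 <= l)%nat ->
      Nat.gcd l (4 * k) = 1%nat ->
      exists d : nat -> C,
        asymp_at_0 (fun t => psi (exp (- t) * zeta (4 * k) (INR l))%C) d)
   /\
   asymp_at_0 (fun t => phi (RtoC (exp (- t))))
     (fun n => RtoC (coef_a n / INR (fact n))))
  /\
  ((forall k l : nat, (1 <= k)%nat -> (1 <= l)%nat ->
      Nat.gcd l (2 * k + 1) = 1%nat ->
      forall alpha : C,
      alpha = (- (2 * PI * Ci * INR l / INR (2 * k + 1)))%C ->
      exists J : C, is_mordell_integral alpha J /\
        (Cexp (alpha / 24) * phi (Cexp (- alpha)) =
         Csqrt (4 * PI / alpha)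
           * Cexp (PI ^ 2 / (24 * alpha)) * psi (Cexp (- (PI ^ 2 / alpha)))
         + Csqrt (2 * PI / (3 * alpha)) * J)%C)
   /\
   (forall k l : nat, (1 <= k)%nat -> (1 <= l)%nat ->
      Nat.gcd l (4 * k) = 1%nat ->
      forall alpha : C,
      alpha = (- (2 * PI * Ci * INR l / INR (4 * k)))%C ->
      exists J : C, is_mordell_integral alpha J /\
        (Cexp (alpha / 24) * psi (Cexp (- alpha)) =
         Csqrt (PI / (4 * alpha))
           * Cexp (PI ^ 2 / (24 * alpha)) * phi (Cexp (- (PI ^ 2 / alpha)))
         - Csqrt (PI / (6 * alpha)) * J)%C))
  /\
  (asymp_at_infty
     (fun k => zeta (24 * (2 * k + 1)) (-1) * phi (zeta (2 * k + 1) 1))%C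
     (fun k => Csqrt (2 * INR (2 * k + 1) * Ci)
               * zeta 96 (- (23 * INR (2 * k + 1))))%C
     (fun k => (2 * k + 1)%nat)
     (fun n k => zeta (24 * (2 * k + 1)) (-1) * coef_b n
                 + zeta (24 * (2 * k + 1)) (-25) * coef_c n)%C
   /\
   asymp_at_infty
     (fun k => zeta (96 * k) (-1) * psi (zeta (4 * k) 1))%C
     (fun k => Csqrt (2 * INR k * Ci) * zeta 24 (INR k))%C
     (fun k => (4 * k)%nat)
     (fun n k => - (1 / 2) * (zeta (96 * k) (-1) * coef_b n
                              + zeta (96 * k) (-25) * coef_c n))%C).
Proof.
(* Both parameters have the form - i x with x > 0; the radicands in the formulas then lie on the
   positive imaginary axis, where the principal root is explicit. *)
assert (HA : forall l N : nat, (0 < N)%nat -> (1 <= l)%nat ->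
  (- (2 * PI * Ci * INR l / INR N))%C = (- (Ci * RtoC (2 * PI * INR l / INR N)))%C /\ 0 < 2 * PI * INR l / INR N).
{ intros l N HN Hl; assert (N0 : 0 < INR N) by (apply lt_0_INR, HN).
  assert (l0 : 0 < INR l) by (apply lt_0_INR; lia); pose proof PI_RGT_0; split.
  - unfold Rdiv; rewrite !RtoC_mult, RtoC_inv by lra; unfold Cdiv; ring.
  - apply Rdiv_lt_0_compat; [apply Rmult_lt_0_compat|]; lra. }
split; [split; [|split]|split; [split|split]].
- intros k l _ _ Hg; apply phi_expansion_root, Hg.
- intros k l Hk _ Hg; apply psi_expansion_root; assumption.
- exact phi_expansion_one.
- intros k l _ Hl Hg alpha ->; destruct (HA l (2 * k + 1)%nat ltac:(lia) Hl) as [-> Hx].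
  eexists; split; [apply mordell_integral_exists, Hx|apply phi_transform; assumption].
- intros k l Hk Hl Hg alpha ->; destruct (HA l (4 * k)%nat ltac:(lia) Hl) as [-> Hx].
  eexists; split; [apply mordell_integral_exists, Hx|apply psi_transform; assumption].
- exact phi_expansion_infty.
- exact psi_expansion_infty.
Qed.
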